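(* Let $Q,V$ satisfy the standing hypotheses (Q) and (V) of the context, and let $0\le v\in W^{1,\infty}_{loc}(\mathbb{R}^d)$ satisfy $|\nabla v(x)|\le c\,v(x)$ for a.e. $x\in\mathbb{R}^d$ and some $c>0$. Let $\{\tilde S_p(t)\}_{t\ge0}$ be the contractive $C_0$-semigroup on $L^p(\mathbb{R}^d,\mathbb{C}^m)$ generated by $\tilde L_p$. Then: (1) The semigroups $\{\tilde S_p(t)\}_{t\ge0}$, $1<p<\infty$, are consistent. (2) $\{\tilde S_p(t)\}_{t\ge0}$ is positive if, and only if, the off-diagonal entries of $\tilde V=V-vI_m$ are nonnegative, i.e. $v_{ij}\ge0$ for all $i\ne j$.
   Context: Let $d,m\ge1$ be integers. Standing hypotheses. (Q): $Q=[q_{ij}]:\mathbb{R}^d\to\mathbb{R}^{d\times d}$ is Lipschitz, $Q(x)$ is symmetric for each $x$, and there are $\eta_1,\eta_2>0$ with $\eta_1|\xi|^2\le\langle Q(x)\xi,\xi\rangle\le\eta_2|\xi|^2$ for all $x,\xi\in\mathbb{R}^d$. (V): $V=[v_{ij}]:\mathbb{R}^d\to\mathbb{R}^{m\times m}$ is measurable, there is $\beta<0$ with $\mathrm{Re}\,\langle V(x)\xi,\xi\rangle\le\beta|\xi|^2$ for all $x\in\mathbb{R}^d$, $\xi\in\mathbb{C}^m$; moreover $v_{ij}\in W^{1,\infty}_{loc}(\mathbb{R}^d)$ and there is $\gamma\in[0,\frac12)$ with $\sup_{x\in\mathbb{R}^d}|\partial_jV(x)(-V(x))^{-\gamma}|<\infty$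 for all $j\in\{1,\dots,d\}$ (fractional power of the matrix $-V(x)$; supremum over a.e. $x$). For $1<p<\infty$, $L_p$ is the operator $L_pu=(\mathrm{div}(Q\nabla u_j))_{1\le j\le m}+Vu$ on $L^p(\mathbb{R}^d,\mathbb{C}^m)$ with domain $D(L_p)=\{u\in W^{2,p}(\mathbb{R}^d,\mathbb{C}^m):Vu\in L^p(\mathbb{R}^d,\mathbb{C}^m)\}$; $B_pu=vu$ with domain $D(B_p)=\{u\in L^p(\mathbb{R}^d,\mathbb{C}^m):vu\in L^p(\mathbb{R}^d,\mathbb{C}^m)\}$; $\tilde L_p:=L_p-B_p$ with domain $D(L_p)\cap D(B_p)$. It is known that under these hypotheses $\tilde L_p$ generates a contractive $C_0$-semigroup. Consistency means $\tilde S_p(t)f=\tilde S_q(t)f$ for all $t\ge0$, $f\in L^p\cap L^q$, $p,q\in(1,\infty)$. Positivity means that $\tilde S_p(t)$ maps (real-valued) functions with all components nonnegative a.e. to functions of the same kind, for all $t\ge0$. *)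

(* Defs.v *)
From HB Require Import structures.
From mathcomp Require Import all_boot all_order all_algebra.
From mathcomp Require Export complex.
From mathcomp Require Export all_classical all_reals all_analysis.

Set Implicit Arguments.
Unset Strict Implicit.
Unset Printing Implicit Defensive.

Import Order.TTheory GRing.Theory Num.Theory.
Import numFieldNormedType.Exports.

Local Open Scope classical_set_scope.
Local Open Scope ring_scope.
Local Open Scope complex_scope.

(** * Lebesgue measure on R^n, with R^n represented by ['rV[R]_n] *)

Definition rV_display : measure_display.
Proof. exact. Qed.

Section rV_measurable.
Context {R : realType} (n : nat).

Definition rV_coord (i : 'I_n) (x : 'rV[R]_n) : R := x 0 i.

Let rV_measurable0 : g_sigma_preimage rV_coord set0.
Proof. exact: sigma_algebra0. Qed.

Let rV_measurableC A :
  g_sigma_preimage rV_coord A -> g_sigma_preimage rV_coord (~` A).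
Proof. exact: sigma_algebraC. Qed.

Let rV_measurable_bigcup (F : _^nat) :
  (forall i, g_sigma_preimage rV_coord (F i)) ->
  g_sigma_preimage rV_coord (\bigcup_i (F i)).
Proof. exact: sigma_algebra_bigcup. Qed.

(* The sigma-algebra generated by the coordinates, i.e. the Borel one. *)
HB.instance Definition _ := @isMeasurable.Build rV_display 'rV[R]_n
  (g_sigma_preimage rV_coord)
  rV_measurable0 rV_measurableC rV_measurable_bigcup.

End rV_measurable.

Lemma measurable_rV_coord (R : realType) n (i : 'I_n) :
  measurable_fun [set: 'rV[R]_n] (fun x : 'rV[R]_n => x 0 i).
Proof.
move=> _ Y mY; rewrite setTI; apply: sub_sigma_algebra => /=.
rewrite -bigcup_seq/=; exists i => /=; first by rewrite mem_index_enum.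
by exists Y => //; rewrite setTI.
Qed.

Lemma measurable_fun_rV d (T : measurableType d) (R : realType) n
    (f : T -> 'rV[R]_n) :
  (forall i, measurable_fun [set: T] (fun t => f t 0 i)) ->
  measurable_fun [set: T] f.
Proof.
move=> mf.
suff : g_sigma_preimage (fun i => @rV_coord R n i \o f) `<=` measurable.
  rewrite g_sigma_preimage_comp => prefS _ A mA.
  by apply: prefS; exists A.
apply: smallest_sub; first exact: sigma_algebra_measurable.
case: n f mf => [|n] f mf; first by rewrite big_ord0.
rewrite -bigcup_mkord_ord; apply: bigcup_sub => i Ii.
by move=> A [B mB <-]; exact: mf.
Qed.

Section rV_cons.
Context (R : realType) (n : nat).

Definition rV_cons (z : measurableTypeR R * 'rV[R]_n) : 'rV[R]_n.+1 := row_mx z.1%:M z.2.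

Definition rV_uncons (x : 'rV[R]_n.+1) : measurableTypeR R * 'rV[R]_n :=
  (lsubmx (x : 'rV_(1 + n)) 0 0, rsubmx (x : 'rV_(1 + n))).

Lemma rV_consK : cancel rV_cons rV_uncons.
Proof.
by move=> [a v]; rewrite /rV_cons /rV_uncons row_mxKl row_mxKr mxE eqxx mulr1n.
Qed.

Lemma rV_cons0 z : rV_cons z 0 ord0 = z.1.
Proof.
by rewrite /rV_cons mxE; case: splitP => // j _; rewrite mxE ord1 mulr1n.
Qed.

Lemma rV_consS z i : rV_cons z 0 (lift ord0 i) = z.2 0 i.
Proof.
rewrite /rV_cons mxE; case: splitP => [j|j /=]; first by rewrite ord1.
by move=> /eqP; rewrite eqSS => /eqP/val_inj ->.
Qed.

Lemma measurable_rV_cons : measurable_fun [set: measurableTypeR R * 'rV[R]_n] rV_cons.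
Proof.
apply: (@measurable_fun_rV _ _ _ (1 + n)) => i.
rewrite -(splitK i); case: (fintype.split i) => j /=.
  rewrite ord1; under eq_fun do rewrite row_mxEl mxE eqxx mulr1n.
  exact: measurable_fst.
under eq_fun do rewrite row_mxEr.
by apply: (measurableT_comp (measurable_rV_coord j)); exact: measurable_snd.
Qed.

Lemma measurable_rV_uncons : measurable_fun [set: 'rV[R]_n.+1] rV_uncons.
Proof.
apply/measurable_fun_pairP; split => /=.
  rewrite /comp /=; under eq_fun do rewrite mxE.
  exact: measurable_rV_coord.
apply: measurable_fun_rV => i; rewrite /comp /=; under eq_fun do rewrite mxE.
exact: measurable_rV_coord.
Qed.

End rV_cons.

Section lebesgue_rV_succ.
Context (R : realType) (n : nat).
Variable mu : {sigma_finite_measure set 'rV[R]_n -> \bar R}.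

Definition lebesgue_rV_succ : set 'rV[R]_n.+1 -> \bar R :=
  pushforward (@lebesgue_measure R \x mu)%E (@rV_cons R n).

Let mpre (A : set 'rV[R]_n.+1) :
  measurable A -> measurable (@rV_cons R n @^-1` A).
Proof.
by move=> mA; rewrite -[X in measurable X]setTI; exact: measurable_rV_cons.
Qed.

Let lebesgue_rV_succ0 : lebesgue_rV_succ set0 = 0%E.
Proof. by rewrite /lebesgue_rV_succ /pushforward preimage_set0 measure0. Qed.

Let lebesgue_rV_succ_ge0 A : (0 <= lebesgue_rV_succ A)%E.
Proof. by rewrite /lebesgue_rV_succ /pushforward; exact: measure_ge0. Qed.

Let lebesgue_rV_succ_sigma_additive : semi_sigma_additive lebesgue_rV_succ.
Proof.
move=> F mF tF mUF; rewrite /lebesgue_rV_succ /pushforward preimage_bigcup.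
apply: measure_semi_sigma_additive.
- by move=> k; apply: mpre; exact: mF.
- apply/trivIsetP => /= i j _ _ ij; rewrite -preimage_setI.
  by move/trivIsetP : tF => /(_ _ _ _ _ ij) ->//; rewrite preimage_set0.
- by rewrite -preimage_bigcup; exact: mpre.
Qed.

HB.instance Definition _ := isMeasure.Build _ _ _ lebesgue_rV_succ
  lebesgue_rV_succ0 lebesgue_rV_succ_ge0 lebesgue_rV_succ_sigma_additive.

Let lebesgue_rV_succ_sigma_finite : sigma_finite setT lebesgue_rV_succ.
Proof.
have /sigma_finiteP[F [TF ndF Foo]] := sigma_finiteT (@lebesgue_measure R).
have /sigma_finiteP[G [TG ndG Goo]] := sigma_finiteT mu.
exists (fun k => @rV_uncons R n @^-1` (F k `*` G k)).
  apply/seteqP; split => // x _.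
  have : [set: measurableTypeR R] (rV_uncons x).1 by [].
  have : [set: 'rV[R]_n] (rV_uncons x).2 by [].
  rewrite TF TG => -[k _ Gk] [l _ Fl]; exists (maxn k l) => //; split => /=.
  - by move: Fl; exact/subsetPset/ndF/leq_maxr.
  - by move: Gk; exact/subsetPset/ndG/leq_maxl.
move=> k; have [mF Fk] := Foo k; have [mG Gk] := Goo k; split.
  rewrite -[X in measurable X]setTI; apply: measurable_rV_uncons => //.
  exact: measurableX.
rewrite /lebesgue_rV_succ /pushforward -comp_preimage.
rewrite (_ : _ \o _ = id); last by apply/funext => z; exact: rV_consK.
by rewrite preimage_id product_measure1E// lte_mul_pinfty// ge0_fin_numE.
Qed.

HB.instance Definition _ := Measure_isSigmaFinite.Build _ _ _ lebesgue_rV_succ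
  lebesgue_rV_succ_sigma_finite.

End lebesgue_rV_succ.

Fixpoint lebesgue_rV (R : realType) (n : nat) :
    {sigma_finite_measure set 'rV[R]_n -> \bar R} :=
  match n with
  | 0 => \d_ (0 : 'rV[R]_0)
  | n'.+1 => lebesgue_rV_succ (lebesgue_rV R n')
  end.

Lemma lebesgue_rV_box (R : realType) n (a b : 'rV[R]_n) :
  (forall i, a 0 i <= b 0 i) ->
  lebesgue_rV R n [set x : 'rV[R]_n | forall i, a 0 i <= x 0 i <= b 0 i] =
  (\prod_(i < n) (b 0 i - a 0 i))%:E.
Proof.
elim: n a b => [|n IH] a b ab.
  by rewrite big_ord0 /= diracE mem_set//= => -[].
pose tl (x : 'rV[R]_n.+1) : 'rV[R]_n := \row_i x 0 (lift ord0 i).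
pose tlbox := [set x : 'rV[R]_n | forall i, (tl a) 0 i <= x 0 i <= (tl b) 0 i].
have mtl : measurable tlbox.
  pose F (i : 'I_n) : set 'rV[R]_n :=
    (fun x : 'rV[R]_n => x 0 i) @^-1` `[(tl a) 0 i, (tl b) 0 i].
  have mF i : measurable (F i).
    by rewrite -[X in measurable X]setTI; exact: measurable_rV_coord.
  have fI : finite_set [set: 'I_n] by exact: finite_finset.
  have := @fin_bigcap_measurable _ _ _ _ F fI (fun i _ => mF i).
  congr (measurable _); apply/seteqP; split => x /= xab i.
    by have := xab i I; rewrite /F /= in_itv.
  by move=> _; rewrite /F /= in_itv/=; exact: xab.
rewrite /= /lebesgue_rV_succ /pushforward.
rewrite (_ : _ @^-1` _ = `[a 0 ord0, b 0 ord0]%classic `*` tlbox); last first.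
  apply/seteqP; split => -[y z] /=.
    move=> yzab; split => /=.
      by have := yzab ord0; rewrite rV_cons0 in_itv.
    by move=> i; have := yzab (lift ord0 i); rewrite rV_consS !mxE.
  rewrite in_itv/= => -[yab zab] i.
  case: (unliftP ord0 i) => [j ->|->]; last by rewrite rV_cons0.
  by have := zab j; rewrite rV_consS !mxE.
rewrite product_measure1E//= lebesgue_measure_itv/= IH => [|i]; last first.
  by rewrite !mxE.
rewrite big_ord_recl EFinM; congr (_ * _)%E.
  rewrite lte_fin; case: ltP => // ba.
  by rewrite (_ : b 0 ord0 = a 0 ord0) ?subrr//; apply/eqP; rewrite eq_le ba ab.
by congr EFin; apply: eq_bigr => i _; rewrite !mxE.
Qed.

(** * Weak derivatives and Sobolev spaces on R^d *)

Section sobolev.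
Context {R : realType} {d : nat}.
Local Notation mu := (lebesgue_rV R d).
Implicit Types (f g phi : 'rV[R]_d -> R) (k : 'I_d).

(* Lebesgue measurability: the sigma-algebra above being Borel, a function is
   Lebesgue measurable iff it agrees a.e. with a Borel function. *)
Definition lebesgue_measurable_fun f : Prop :=
  exists2 g, measurable_fun setT g & \forall x \ae mu, f x = g x.

Definition L1loc f : Prop :=
  lebesgue_measurable_fun f /\
  forall K : set 'rV[R]_d, compact K ->
    (\int[mu]_(x in K) `|f x|%:E < +oo)%E.

Definition Linftyloc f : Prop :=
  lebesgue_measurable_fun f /\
  forall K : set 'rV[R]_d, compact K ->
    exists C : R, \forall x \ae mu, K x -> `|f x| <= C.

Definition partial k phi : 'rV[R]_d -> R := fun x => 'D_(delta_mx 0 k) phi x.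

Definition iter_partial (s : seq 'I_d) phi : 'rV[R]_d -> R :=
  foldr partial phi s.

(* phi \in C_c^infty(R^d) *)
Definition test_function phi : Prop :=
  [/\ forall s k x, derivable (iter_partial s phi) x (delta_mx 0 k),
      forall s, continuous (iter_partial s phi) &
      compact (closure [set x | phi x != 0])].

Definition weak_partial k f g : Prop :=
  [/\ L1loc f, L1loc g &
    forall phi, test_function phi ->
      \int[mu]_x (f x * partial k phi x) = - \int[mu]_x (g x * phi x)].

Definition weak_div (F : 'I_d -> 'rV[R]_d -> R) g : Prop :=
  [/\ forall k, L1loc (F k), L1loc g &
    forall phi, test_function phi ->
      \int[mu]_x (\sum_k F k x * partial k phi x) = - \int[mu]_x (g x * phi x)].

Definition W1inftyloc f : Prop :=
  Linftyloc f /\ forall k, exists2 g, Linftyloc g & weak_partial k f g.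

End sobolev.

(** * Spaces of C^m-valued functions; elements of L^p are represented by
    functions, which are identified when they agree a.e. *)

Definition Cvec_norm (R : realType) (m : nat) (z : 'cV[R[i]]_m) : R :=
  Num.sqrt (\sum_j (complex.Re (z j 0) ^+ 2 + complex.Im (z j 0) ^+ 2)).

Definition Cvec_dot (R : realType) (m : nat) (z w : 'cV[R[i]]_m) : R[i] :=
  \sum_j z j 0 * conjc (w j 0).

Definition Rvec_dot (R : realType) (n : nat) (z w : 'cV[R]_n) : R :=
  \sum_j z j 0 * w j 0.

Definition vfun (R : realType) (d m : nat) := 'rV[R]_d -> 'cV[R[i]]_m.

Section vector_valued.
Context {R : realType} {d m : nat}.
Local Notation mu := (lebesgue_rV R d).
Local Notation vfun := (vfun R d m).
Implicit Types (u w f g : vfun) (p : R).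

Definition re_comp u (j : 'I_m) : 'rV[R]_d -> R := fun x => complex.Re (u x j 0).
Definition im_comp u (j : 'I_m) : 'rV[R]_d -> R := fun x => complex.Im (u x j 0).

Definition vae_eq u w : Prop := \forall x \ae mu, u x = w x.

Definition LpN p u : \bar R := Lnorm mu p%:E (fun x => (Cvec_norm (u x))%:E).

Definition Lp p u : Prop :=
  (forall j, lebesgue_measurable_fun (re_comp u j) /\
             lebesgue_measurable_fun (im_comp u j)) /\
  (LpN p u < +oo)%E.

Definition weak_partialv (k : 'I_d) u w : Prop :=
  forall j, weak_partial k (re_comp u j) (re_comp w j) /\
            weak_partial k (im_comp u j) (im_comp w j).

Definition W2p p u : Prop :=
  Lp p u /\
  exists Du : 'I_d -> vfun,
    (forall k, weak_partialv k u (Du k) /\ Lp p (Du k)) /\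
    forall h k, exists2 w, weak_partialv h (Du k) w & Lp p w.

(* w = (div (Q grad u_j))_j *)
Definition div_grad (Q : 'rV[R]_d -> 'M[R]_d) u w : Prop :=
  exists Du : 'I_d -> vfun,
    (forall k, weak_partialv k u (Du k)) /\
    forall j,
      weak_div (fun h x => \sum_k Q x h k * re_comp (Du k) j x) (re_comp w j) /\
      weak_div (fun h x => \sum_k Q x h k * im_comp (Du k) j x) (im_comp w j).

Definition mx_mul (V : 'rV[R]_d -> 'M[R]_m) u : vfun :=
  fun x => map_mx (real_complex R) (V x) *m u x.

Definition fun_mul (v : 'rV[R]_d -> R) u : vfun := fun x => (v x)%:C *: u x.

(** Unbounded operators are given by their graphs. *)

Definition vgraph := vfun -> vfun -> Prop.

Definition L_op (Q : 'rV[R]_d -> 'M[R]_d) (V : 'rV[R]_d -> 'M[R]_m) p : vgraph :=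
  fun u g => [/\ W2p p u, Lp p (mx_mul V u) &
    exists2 w, div_grad Q u w & vae_eq g (fun x => w x + mx_mul V u x)].

Definition B_op (v : 'rV[R]_d -> R) p : vgraph :=
  fun u g => [/\ Lp p u, Lp p (fun_mul v u) & vae_eq g (fun_mul v u)].

Definition op_sub (A B : vgraph) : vgraph :=
  fun u g => exists a b, [/\ A u a, B u b & vae_eq g (fun x => a x - b x)].

Definition Ltilde_op Q V v p : vgraph := op_sub (L_op Q V p) (B_op v p).

(** * Semigroups on L^p; only the values at times [0 <= t] are relevant *)

Record C0_semigroup p (S : R -> vfun -> vfun) : Prop := {
  semigroup_Lp : forall t f, 0 <= t -> Lp p f -> Lp p (S t f);
  semigroup_ae : forall t f g, 0 <= t -> Lp p f -> Lp p g ->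
    vae_eq f g -> vae_eq (S t f) (S t g);
  semigroup_linear : forall t (a : R[i]) f g, 0 <= t -> Lp p f -> Lp p g ->
    vae_eq (S t (fun x => a *: f x + g x)) (fun x => a *: S t f x + S t g x);
  semigroup_bounded : forall t, 0 <= t -> exists C : R,
    forall f, Lp p f -> (LpN p (S t f) <= C%:E * LpN p f)%E;
  semigroup0 : forall f, Lp p f -> vae_eq (S 0 f) f;
  semigroupD : forall s t f, 0 <= s -> 0 <= t -> Lp p f ->
    vae_eq (S (s + t) f) (S s (S t f));
  semigroup_continuous : forall f, Lp p f ->
    LpN p (fun x => S t f x - f x) @[t --> 0^'+] --> 0%E
}.

Definition contractive p (S : R -> vfun -> vfun) : Prop :=
  forall t f, 0 <= t -> Lp p f -> (LpN p (S t f) <= LpN p f)%E.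

Definition is_generator p (S : R -> vfun -> vfun) (A : vgraph) : Prop :=
  forall u g, Lp p u -> Lp p g ->
    (A u g <->
     LpN p (fun x => (t^-1)%:C *: (S t u x - u x) - g x) @[t --> 0^'+] --> 0%E).

Definition consistent p q (S T : R -> vfun -> vfun) : Prop :=
  forall t f, 0 <= t -> Lp p f -> Lp q f -> vae_eq (S t f) (T t f).

(* In [R[i]], [0 <= z] means that z is real and nonnegative. *)
Definition vnonneg u : Prop := \forall x \ae mu, forall j, 0 <= u x j 0.

Definition positive_semigroup p (S : R -> vfun -> vfun) : Prop :=
  forall t f, 0 <= t -> Lp p f -> vnonneg f -> vnonneg (S t f).

End vector_valued.

(** * Standing hypotheses on the coefficients *)

(* A^(-gamma), for A with Re <A xi, xi> > 0 (xi != 0) and 0 <= gamma < 1, by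
   the Balakrishnan formula
   A^(-gamma) = sin(pi gamma)/pi * \int_0^oo s^(-gamma) (s + A)^(-1) ds. *)
Definition mx_negpow (R : realType) (m : nat) (A : 'M[R]_m) (gamma : R) :
    'M[R]_m :=
  if gamma == 0 then 1%:M else
  (sin (pi * gamma) / pi) *: \matrix_(i, j)
    \int[lebesgue_measure]_(s in `]0, +oo[)
      (s `^ (- gamma) * invmx (s%:M + A) i j).

Section hypotheses.
Context {R : realType} {d m : nat}.
Local Notation mu := (lebesgue_rV R d).

(* The norms on ['rV_d] and ['M_d] are sup norms, which is immaterial for
   Lipschitz continuity. *)
Definition hypQ (Q : 'rV[R]_d -> 'M[R]_d) : Prop :=
  [/\ exists K : R, K.-lipschitz Q,
      forall x, (Q x)^T = Q x &
      exists eta1 eta2 : R, [/\ 0 < eta1, 0 < eta2 &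
        forall x (xi : 'cV[R]_d),
          eta1 * Rvec_dot xi xi <= Rvec_dot (Q x *m xi) xi <=
          eta2 * Rvec_dot xi xi]].

Definition hypV (V : 'rV[R]_d -> 'M[R]_m) : Prop :=
  [/\ forall i j, lebesgue_measurable_fun (fun x => V x i j),
      exists2 beta : R, beta < 0 &
        forall x (xi : 'cV[R[i]]_m),
          complex.Re (Cvec_dot (map_mx (real_complex R) (V x) *m xi) xi) <=
          beta * Cvec_norm xi ^+ 2,
      forall i j, W1inftyloc (fun x => V x i j) &
      exists2 gamma : R, 0 <= gamma < 2^-1 &
      exists2 DV : 'I_d -> 'rV[R]_d -> 'M[R]_m,
        forall k i j, weak_partial k (fun x => V x i j) (fun x => DV k x i j) &
        forall k, exists C : R, \forall x \ae mu,
          `|DV k x *m mx_negpow (- V x) gamma| <= C].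

Definition hypv (v : 'rV[R]_d -> R) : Prop :=
  [/\ W1inftyloc v,
      \forall x \ae mu, 0 <= v x &
      exists2 c : R, 0 < c &
      exists2 Dv : 'I_d -> 'rV[R]_d -> R,
        forall k, weak_partial k v (Dv k) &
        \forall x \ae mu, Num.sqrt (\sum_k Dv k x ^+ 2) <= c * v x].

Definition Vtilde (V : 'rV[R]_d -> 'M[R]_m) (v : 'rV[R]_d -> R) :
  'rV[R]_d -> 'M[R]_m := fun x => V x - (v x)%:M.

Definition offdiag_nonneg (V : 'rV[R]_d -> 'M[R]_m) : Prop :=
  forall i j, i != j -> \forall x \ae mu, 0 <= V x i j.

End hypotheses.

(* Main.v *)
(* Consistency.  By the exponential formula S(t) f = lim (1 - (t/n) A)^(-n) f it
   is enough that the resolvents on L^p and L^q agree on the intersection.  Let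
   u in L^p and w in L^q solve the two resolvent equations for the same f, with
   p <= q <= p + 1/(2d), and multiply both by a cut-off function at scale n.  The
   products are in the domain of the generator on L^p, up to commutators which are
   O(1/n) and supported in a ball of volume O(n^d); since q is so close to p, the
   loss from L^q to L^p on this ball is smaller than the gain 1/n.  Dissipativity
   on L^p then forces u = w, and a finite chain of exponents joins any p to any q.

   Positivity.  If the off-diagonal entries are nonnegative, the resolvent
   equation in L^2 is tested against the negative parts of the components of the
   solution: the second order part has a sign by ellipticity, the off-diagonal
   entries have the right sign, and V is dissipative, so these negative parts
   vanish.  The exponential formula carries this to the semigroup on L^2, and
   consistency carries it to L^p.  Conversely, for a test function phi >= 0 and
   i <> j, the i-th component of (S(t) (phi e_j) - phi e_j) / t is nonnegative and
   converges in L^p to v_ij phi.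

   The coefficients of Q are only Lipschitz; their bounded weak derivatives are
   obtained from the Riesz representation of a bounded functional on L^2, which
   replaces Rademacher's theorem. *)

Require Import Defs.
From HB Require Import structures.
From mathcomp Require Import all_boot all_order all_algebra.
From mathcomp Require Import all_classical all_reals all_analysis.
From mathcomp Require Import measurable_realfun ring lra.

Set Implicit Arguments.
Unset Strict Implicit.
Unset Printing Implicit Defensive.

Import Order.TTheory GRing.Theory Num.Theory.
Import numFieldNormedType.Exports.

Local Open Scope classical_set_scope.
Local Open Scope ring_scope.

(** * Borel sets and translation invariance *)

(** The order [p <= q] matters: a bounded multiplier of bounded support maps L^q into L^p, so the
    L^q solution is brought to L^p, never conversely. Its commutator with a cut-off at scale n is
    O(1/n) because [Q grad chi] has bounded weak derivatives in the matching coordinate directions,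
    which is where the Lipschitz bound on [Q] enters. The cut-offs tend not to 1 but to the constant
    [mbump 0 > 0], which divides out. Elements of L^p are determined and measurable only up to null
    sets, while integration and weak derivatives are handled on Borel functions. Arguments therefore
    begin with Borel representatives, and the abstract semigroup theory is run on a real vector
    space of chosen representatives. The semigroups are given, not constructed: dissipativity is
    read off from contractivity, and resolvents are recovered as limits of Riemann sums of the
    Laplace transform, so that no vector-valued integral is needed. Positivity starts in L^2 because
    the product of [div (Q grad s)] with the negative part of [s] is integrable there. Smooth
    nondecreasing functions replace [min t 0], since only they keep test functions smooth. *)

Section rV_borel.
Context {R : realType} {n : nat}.
Local Notation E := 'rV[R]_n.
Local Notation mu := (lebesgue_rV R n).

Lemma normrV_ltP (x : E) (e : R) : 0 < e ->
  reflect (forall i, `|x 0 i| < e) (`|x| < e).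
Proof.
move=> e0; apply: (iffP idP) => [xe i|xe].
  apply: le_lt_trans xe; rewrite [leRHS]mx_normrE.
  by apply: (le_bigmax _ (fun ij : 'I_1 * 'I_n => `|x ij.1 ij.2|) (0, i)).
rewrite [ltLHS]mx_normrE; apply/bigmax_ltP; split => // -[i j] _ /=.
by rewrite ord1.
Qed.

Lemma normrV_leP (x : E) (e : R) : 0 <= e ->
  reflect (forall i, `|x 0 i| <= e) (`|x| <= e).
Proof.
move=> e0; apply: (iffP idP) => [xe i|xe].
  apply: le_trans xe; rewrite [leRHS]mx_normrE.
  by apply: (le_bigmax _ (fun ij : 'I_1 * 'I_n => `|x ij.1 ij.2|) (0, i)).
rewrite [leLHS]mx_normrE; apply/bigmax_leP; split => // -[i j] _ /=.
by rewrite ord1.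
Qed.

Lemma coord_norm (x : E) i : `|x 0 i| <= `|x|.
Proof. by move: i; apply/normrV_leP. Qed.

Lemma measurable_box (a : 'I_n -> interval R) :
  measurable [set x : E | forall i, x 0 i \in a i].
Proof.
pose F i : set E := (fun x : E => x 0 i) @^-1` [set` a i].
rewrite (_ : [set _ | _] = \bigcap_(i in [set: 'I_n]) F i); last first.
  by apply/seteqP; split => x /= h i => [_|]; exact: h.
apply: fin_bigcap_measurable; first exact: finite_finset.
move=> i _; rewrite -[X in measurable X]setTI.
exact: measurable_rV_coord.
Qed.

(** Each point of [A] lies in a cube contained in [A] with rational centre and radius [1/(k+1)], and
    there are countably many such cubes. *)
Lemma open_measurable_rV (A : set E) : open A -> measurable A.
Proof.
move=> oA.
pose B (z : 'rV[rat]_n * nat) : set E :=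
  [set x | forall i, x 0 i \in `](ratr (z.1 0 i) - z.2.+1%:R^-1), (ratr (z.1 0 i) + z.2.+1%:R^-1)[].
have mB z : measurable (B z) by exact: measurable_box.
pose D := [set z | B z `<=` A].
rewrite (_ : A = \bigcup_(z in D) B z); last first.
  apply/seteqP; split => [x Ax|x [z Dz]]; last exact: Dz.
  have [e /= e0 xeA] : exists2 e : R, 0 < e & forall y, `|x - y| < e -> A y.
    have /nbhs_normP[e /= e0 xeA] : nbhs x A by exact: open_nbhs_nbhs.
    by exists e => // y; exact: xeA.
  (* Half of [e]: the point [x] and every point of the cube are within [1/(k+1)] of the rational
     centre. *)
  have [k ke] : exists k, k.+1%:R^-1 < e / 2.
    have e2 : 0 < e / 2 by rewrite divr_gt0.
    exists (Num.truncn (e / 2)^-1).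
    by rewrite invf_plt ?posrE//; exact: truncnS_gt.
  have k0 : 0 < k.+1%:R^-1 :> R by rewrite invr_gt0.
  have H (i : 'I_n) : exists q : rat, x 0 i - k.+1%:R^-1 < ratr q < x 0 i + k.+1%:R^-1.
    have [|q] := @rat_in_itvoo R (x 0 i - k.+1%:R^-1) (x 0 i + k.+1%:R^-1).
      by rewrite ltrBlDr -addrA ltrDl addr_gt0.
    by rewrite in_itv/=; exists q.
  have [q Hq] := choice H.
  exists (\row_i q i, k).
    move=> y By; apply: xeA.
    apply/normrV_ltP => // i; move: (By i); rewrite !mxE in_itv/= => /andP[h1 h2].
    have /andP[h3 h4] := Hq i.
    move: h1 h2 h3 h4 ke; set r := k.+1%:R^-1 => h1 h2 h3 h4 ke.
    by rewrite ltr_norml; apply/andP; split; lra.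
  move=> i; rewrite !mxE in_itv/=; have /andP[h3 h4] := Hq i.
  move: h3 h4 k0; set r := k.+1%:R^-1 => h3 h4 k0.
  by apply/andP; split; lra.
rewrite bigcup_mkcond; apply: countable_bigcupT_measurable; first exact: countableP.
by move=> z; case: ifPn => // _; exact: mB.
Qed.

Lemma continuous_measurable_rV (f : E -> R) : continuous f -> measurable_fun setT f.
Proof.
move=> cf; apply: (measurability _ (@RGenOpens.measurableE R)).
move=> _ [_ [a [b ->] <-]]; rewrite setTI; apply: open_measurable_rV.
by move/continuousP : cf; apply; exact: interval_open.
Qed.

(** Open sets are stable under intersection, so this lets a Dynkin induction start from them, as in
    [transl_cont_set]. *)
Lemma measurable_rV_openE : @measurable _ E = <<s open >>.
Proof.
apply/seteqP; split; last first.
  by apply: smallest_sub; [exact: sigma_algebra_measurable|exact: open_measurable_rV].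
apply: smallest_sub; first exact: smallest_sigma_algebra.
move=> A; rewrite -bigcup_seq => -[i /= _] [B mB <-]; rewrite setTI.
have -> : @rV_coord R n i @^-1` B = setT `&` @rV_coord R n i @^-1` B by rewrite setTI.
apply: (@measurability _ _ (g_sigma_algebraType (@open E)) _ setT (@rV_coord R n i) _ (@RGenOpens.measurableE R)) => //.
move=> _ [_ [a [b ->] <-]]; rewrite setTI.
apply: sub_sigma_algebra.
have /continuousP : continuous (@rV_coord R n i) by exact: coord_continuous.
by apply; exact: interval_open.
Qed.

Lemma measurable_rV_shift (a : E) : measurable_fun setT (fun x : E => x + a).
Proof.
apply: measurable_fun_rV => i; under eq_fun do rewrite mxE.
by apply: measurable_funD => //; exact: measurable_rV_coord.
Qed.

Lemma measurable_rV_add : measurable_fun setT (fun z : E * E => z.1 + z.2).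
Proof.
apply: measurable_fun_rV => i; under eq_fun do rewrite mxE.
apply: measurable_funD.
  by apply: (measurableT_comp (measurable_rV_coord i)); exact: measurable_fst.
by apply: (measurableT_comp (measurable_rV_coord i)); exact: measurable_snd.
Qed.

Definition cbox (a b : E) : set E := [set x | forall i, a 0 i <= x 0 i <= b 0 i].

Lemma measurable_cbox a b : measurable (cbox a b).
Proof.
rewrite (_ : cbox a b = [set x : E | forall i, x 0 i \in `[a 0 i, b 0 i]]).
  exact: measurable_box.
by apply/seteqP; split => x /= h i; have := h i; rewrite in_itv.
Qed.

Lemma lebesgue_rV_ball_lty (r : R) : (mu [set x : E | (`|x| < r)%R] < +oo)%E.
Proof.
pose a : E := const_mx (- `|r|); pose b : E := const_mx `|r|.
have ab i : a 0 i <= b 0 i by rewrite !mxE; have := normr_ge0 r; lra.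
apply: (@le_lt_trans _ _ (mu (cbox a b))).
  rewrite le_measure ?inE//.
  - apply: open_measurable_rV; apply: (@open_comp _ _ (fun x : E => `|x|) [set y | y < r]); last exact: open_lt.
    by move=> x _; exact: norm_continuous.
  - exact: measurable_cbox.
  - move=> x /= xr i; rewrite !mxE -ler_norml (le_trans (coord_norm _ _))//.
    exact: le_trans (ltW xr) (ler_norm r).
by rewrite lebesgue_rV_box// ltry.
Qed.

(** Both sides are measures in [A] that agree on closed boxes; boxes generate the Borel sets and are
    stable under intersection, so uniqueness of measures applies. *)
Lemma lebesgue_rV_shift (a : E) (A : set E) : measurable A ->
  mu ((fun x : E => x + a) @^-1` A) = mu A.
Proof.
move=> mA.
(* The empty set is adjoined because [lebesgue_rV_box] asks for ordered corners, while two boxes may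
   be disjoint. *)
pose G : set (set E) := [set B | B = set0 \/ exists2 ab : E * E, (forall i, ab.1 0 i <= ab.2 0 i) & B = cbox ab.1 ab.2].
pose g (k : nat) := cbox (const_mx (- k%:R)) (const_mx k%:R).
have Gg k : G (g k).
  right; exists (const_mx (- k%:R), const_mx k%:R) => //= i; rewrite !mxE.
  by have : 0 <= k%:R :> R by []; lra.
have mphi := measurable_rV_shift a.
pose nu0 := [the measure _ _ of pushforward mu (fun x : E => x + a)].
pose nu := nu0 mphi.
suff : mu A = nu A by move=> ->.
apply: (@measure_unique _ _ _ G g) => //.
- apply/seteqP; split; last first.
    apply: smallest_sub; first exact: sigma_algebra_measurable.
    by move=> B [->//|[ab _ ->]]; exact: measurable_cbox.
  apply: smallest_sub; first exact: smallest_sigma_algebra.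
  move=> B; rewrite -bigcup_seq => -[i /= _] [C mC <-].
  apply: (@measurability _ _ (g_sigma_algebraType G) _ setT (@rV_coord R n i) _ (@RGenCInfty.measurableE R)) => //.
  move=> _ [_ [x ->] <-]; rewrite setTI.
  (* A half-space is exhausted by growing boxes, which shows that boxes generate the Borel sets. *)
  have -> : @rV_coord R n i @^-1` `[x, +oo[%classic =
    \bigcup_k (cbox (\row_j (if j == i then x else - k%:R)) (\row_j (if j == i then x + k%:R else k%:R))).
    apply/seteqP; split => [y|y [k _]] /=; rewrite in_itv/= andbT; last first.
      by move/(_ i); rewrite !mxE eqxx => /andP[].
    rewrite /rV_coord => xy.
    exists (Num.truncn (`|y| + `|x|)).+1 => //= j; rewrite !mxE.
    have H := truncnS_gt (`|y| + `|x|).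
    have H1 := coord_norm y j.
    have H2 := ler_norm (- x).
    have H3 := normr_ge0 x.
    move: H1; rewrite ler_norml => /andP[H1 H4].
    rewrite normrN in H2.
    move: H; set r := _.+1%:R => H.
    by case: eqP => [ij|_]; [rewrite ij in H1 H4 *|]; apply/andP; split; lra.
  apply: bigcup_measurable => k _; apply: sub_sigma_algebra; right.
  exists (\row_j (if j == i then x else - k%:R), \row_j (if j == i then x + k%:R else k%:R)) => //= j.
  by rewrite !mxE; have : 0 <= k%:R :> R by []; case: eqP; lra.
- move=> B C [->|[ab _ ->]]; first by left; rewrite set0I.
  case=> [->|[cd _ ->]]; first by left; rewrite setI0.
  pose lo : E := \row_j Num.max (ab.1 0 j) (cd.1 0 j).
  pose hi : E := \row_j Num.min (ab.2 0 j) (cd.2 0 j).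
  have -> : cbox ab.1 ab.2 `&` cbox cd.1 cd.2 = cbox lo hi.
    apply/seteqP; split => x /=.
      move=> [h1 h2] j; rewrite !mxE ge_max le_min.
      by have /andP[-> ->] := h1 j; have /andP[-> ->] := h2 j.
    move=> h; split=> j; have := h j; rewrite !mxE ge_max le_min => /andP[/andP[h1 h2] /andP[h3 h4]].
      by rewrite h1 h3.
    by rewrite h2 h4.
  have [h|/existsNP[j /negP]] := pselect (forall j, lo 0 j <= hi 0 j).
    by right; exists (lo, hi).
  rewrite -ltNge => lohi; left; apply/seteqP; split => // x /= /(_ j) /andP[h1 h2].
  by have := le_lt_trans (le_trans h1 h2) lohi; rewrite ltxx.
- apply/seteqP; split => // x _; exists (Num.truncn `|x|).+1 => // j; rewrite !mxE -ler_norml.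
  by rewrite (le_trans (coord_norm x j))// ltW// truncnS_gt.
- move=> B [->|[ab h ->]]; first by rewrite !measure0.
  rewrite /= /pushforward.
  have -> : (fun x : E => x + a) @^-1` cbox ab.1 ab.2 = cbox (ab.1 - a) (ab.2 - a).
    by apply/seteqP; split => x /= H j; have := H j; rewrite !mxE lerBlDr lerBrDr.
  rewrite !lebesgue_rV_box//; last by move=> i; rewrite !mxE lerD2r.
  by congr EFin; apply: eq_bigr => i _; rewrite !mxE; ring.
- move=> k; have h i : (const_mx (- k%:R) : E) 0 i <= (const_mx k%:R : E) 0 i.
    by rewrite !mxE; have : 0 <= k%:R :> R by []; lra.
  by have H : mu (g k) = _ := lebesgue_rV_box h; apply: (eq_ind_r (fun z => (z < +oo)%E) _ H); rewrite ltry.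
Qed.

Lemma ge0_integral_rV_shift (a : E) (f : E -> \bar R) : measurable_fun setT f ->
  (forall x, 0 <= f x)%E -> (\int[mu]_x f (x + a)%R = \int[mu]_x f x)%E.
Proof.
move=> mf f0; have mphi := measurable_rV_shift a.
have := @ge0_integral_pushforward _ _ _ _ _ _ mphi mu setT f measurableT mf (fun x _ => f0 x).
rewrite preimage_setT => <-.
apply: eq_measure_integral => A mA _; exact: lebesgue_rV_shift.
Qed.

Lemma integral_rV_shift (a : E) (f : E -> \bar R) : measurable_fun setT f ->
  (\int[mu]_x f (x + a)%R = \int[mu]_x f x)%E.
Proof.
move=> mf; rewrite [LHS]integralE [RHS]integralE; congr (_ - _)%E.
  rewrite -[RHS](ge0_integral_rV_shift a (measurable_funepos mf))//.
  by apply: eq_integral => x _; rewrite !funeposE.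
rewrite -[RHS](ge0_integral_rV_shift a (measurable_funeneg mf))//.
by apply: eq_integral => x _; rewrite !funenegE.
Qed.

Lemma Rintegral_rV_shift (a : E) (f : E -> R) : measurable_fun setT f ->
  \int[mu]_x f (x + a) = \int[mu]_x f x.
Proof.
move=> mf; congr fine; apply: (@integral_rV_shift a (EFin \o f)).
exact/measurable_EFinP.
Qed.

Lemma measurable_fun_rV_shift d (U : measurableType d) (f : E -> U) (a : E) :
  measurable_fun setT f -> measurable_fun setT (fun x : E => f (x + a)).
Proof. by move=> mf; apply: (measurableT_comp mf); exact: measurable_rV_shift. Qed.

Lemma integrable_rV_shift (a : E) (f : E -> R) : mu.-integrable setT (EFin \o f) ->
  mu.-integrable setT (fun x => (f (x + a))%:E).
Proof.
move=> /integrableP[mf fi]; apply/integrableP; split.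
  exact: (@measurable_fun_rV_shift _ _ (EFin \o f)).
by rewrite (@ge0_integral_rV_shift a (fun x => `|(f x)%:E|%E))//; exact: measurableT_comp.
Qed.

End rV_borel.

(** * Integrals of powers *)

Section integral_without_measurability.
Context d (T : measurableType d) (R : realType).
Variable mu : {measure set T -> \bar R}.
Import HBNNSimple.
Local Open Scope ereal_scope.

(* The integral of a nonnegative function is a supremum over simple functions, so its monotonicity requires no measurability. *)
Lemma ae_ge0_le_integral_nm (D : set T) (f g : T -> \bar R) :
  (forall x, D x -> 0 <= f x) -> (forall x, D x -> 0 <= g x) ->
  {ae mu, forall x, D x -> f x <= g x} ->
  \int[mu]_(x in D) f x <= \int[mu]_(x in D) g x.
Proof.
move=> f0 g0 [N [mN N0 subN]].
rewrite [leLHS]integral_mkcond [leRHS]integral_mkcond.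
have f0' x : 0 <= (f \_ D) x by exact: erestrict_ge0.
have g0' x : 0 <= (g \_ D) x by exact: erestrict_ge0.
rewrite !ge0_integralTE//.
apply: ge_ereal_sup => _ [h /= hf <-].
pose h' := proj_nnsfun h (measurableC mN).
have hh' : sintegral mu h = sintegral mu h'.
  have sE (k : {nnsfun T >-> R}) : sintegral mu k = \int[mu]_x (k x)%:E.
    by rewrite integral_nnsfun// patch_setT.
  rewrite !sE; apply: ae_eq_integral => //.
  1,2: exact/measurable_EFinP.
  exists N; split => // x /= /not_implyP[_]; rewrite mindicE => hx.
  apply: contrapT => Nx; apply: hx.
  by rewrite mem_set ?mulr1.
rewrite hh'; apply: ereal_sup_ubound; exists h' => //= x.
rewrite mindicE; case: (pselect (N x)) => Nx.
  by rewrite memNset ?mulr0//= => /(_ Nx).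
rewrite mem_set// mulr1; apply: le_trans (hf x) _.
rewrite !patchE; case: ifPn => // xD; apply: contrapT => fg; apply: Nx.
by apply: subN => /=; apply/not_implyP; split => //; exact/set_mem.
Qed.

Lemma ge0_le_integral_nm (D : set T) (f g : T -> \bar R) :
  (forall x, D x -> 0 <= f x) -> (forall x, D x -> f x <= g x) ->
  \int[mu]_(x in D) f x <= \int[mu]_(x in D) g x.
Proof.
move=> f0 fg; apply: ae_ge0_le_integral_nm => //.
  by move=> x Dx; exact: le_trans (f0 _ Dx) (fg _ Dx).
exact: aeW.
Qed.

Lemma ae_eq_integral_nm (D : set T) (f g : T -> \bar R) :
  {ae mu, forall x, D x -> f x = g x} ->
  \int[mu]_(x in D) f x = \int[mu]_(x in D) g x.
Proof.
move=> fg.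
suff H (h k : T -> \bar R) (h0 : forall x, 0 <= h x) (k0 : forall x, 0 <= k x)  :
   {ae mu, forall x, D x -> h x = k x} -> \int[mu]_(x in D) h x = \int[mu]_(x in D) k x.
  rewrite [LHS]integralE [RHS]integralE; congr (_ - _).
  - apply: H => [x|x|]; [exact: funepos_ge0|exact: funepos_ge0|].
    by apply: filterS fg => x h Dx; rewrite !funeposE h.
  - apply: H => [x|x|]; [exact: funeneg_ge0|exact: funeneg_ge0|].
    by apply: filterS fg => x h Dx; rewrite !funenegE h.
move=> hk; apply/eqP; rewrite eq_le; apply/andP; split; apply: ae_ge0_le_integral_nm => //.
  by apply: filterS hk => x e Dx; rewrite e.
by apply: filterS hk => x e Dx; rewrite e.
Qed.

Lemma ae_eq_Rintegral_nm (D : set T) (f g : T -> R) :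
  {ae mu, forall x, D x -> f x = g x} ->
  (\int[mu]_(x in D) f x = \int[mu]_(x in D) g x)%R.
Proof.
by move=> fg; congr fine; apply: ae_eq_integral_nm; apply: filterS fg => x h Dx; rewrite h.
Qed.

End integral_without_measurability.

Section power_integral.
Context d (T : measurableType d) (R : realType).
Variable mu : {measure set T -> \bar R}.
Implicit Types f g h : T -> R.

(** No root is taken, which keeps all estimates linear in the integral. Weak derivatives are
    approximated with [r = 1], energies with [r = 2]; real exponents are left to [Ip]. *)
Definition Ipow (r : nat) (f : T -> R) : \bar R := (\int[mu]_x (`|f x| ^+ r)%:E)%E.

Lemma Ipow_ge0 r f : (0 <= Ipow r f)%E.
Proof. by apply: integral_ge0 => x _; rewrite lee_fin exprn_ge0. Qed.

Lemma le_Ipow r f g : (forall x, `|f x| <= `|g x|) -> (Ipow r f <= Ipow r g)%E.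
Proof.
move=> fg; apply: ge0_le_integral_nm => x _; rewrite lee_fin ?exprn_ge0//.
exact: lerXn2r (fg x).
Qed.

Lemma eq_Ipow r f g : f =1 g -> Ipow r f = Ipow r g.
Proof. by move=> /funext ->. Qed.

Lemma IpowN r f : Ipow r (fun x => - f x) = Ipow r f.
Proof. by congr integral; apply/funext => x; rewrite normrN. Qed.

Lemma measurable_Ipow r f : measurable_fun setT f ->
  measurable_fun setT (fun x => (`|f x| ^+ r)%:E).
Proof.
move=> mf; apply/measurable_EFinP; apply: measurable_funX.
exact: measurableT_comp.
Qed.

Lemma Ipow1P f : measurable_fun setT f ->
  mu.-integrable setT (EFin \o f) <-> (Ipow 1 f < +oo)%E.
Proof.
move=> mf; split=> [/integrableP[_]|h].
  by apply: le_lt_trans; rewrite le_eqVlt; apply/orP; left; apply/eqP; apply: eq_integral.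
apply/integrableP; split; first exact/measurable_EFinP.
by apply: le_lt_trans h; rewrite le_eqVlt; apply/orP; left; apply/eqP; apply: eq_integral.
Qed.

Lemma IpowZ r (c : R) f : measurable_fun setT f ->
  Ipow r (fun x => c * f x) = ((`|c| ^+ r)%:E * Ipow r f)%E.
Proof.
move=> mf; rewrite /Ipow -ge0_integralZl//.
- by apply: eq_integral => x _; rewrite normrM exprMn EFinM.
- exact: measurable_Ipow.
Qed.

Lemma normrD_exp_le r (a b : R) : `|a + b| ^+ r <= 2 ^+ r * (`|a| ^+ r + `|b| ^+ r).
Proof.
apply: (@le_trans _ _ ((2 * Num.max `|a| `|b|) ^+ r)).
  apply: lerXn2r; rewrite ?nnegrE// ?mulr_ge0//.
  apply: le_trans (ler_normD _ _) _.
  by rewrite mulr_natl mulr2n lerD// le_max lexx ?orbT.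
rewrite exprMn ler_wpM2l//.
by case: (leP `|a| `|b|) => _; rewrite ?lerDl ?lerDr exprn_ge0.
Qed.

Lemma IpowD_le r f g : measurable_fun setT f -> measurable_fun setT g ->
  (Ipow r (fun x => (f x + g x)%R) <= (2 ^+ r)%:E * (Ipow r f + Ipow r g))%E.
Proof.
move=> mf mg.
have mf' := measurable_Ipow r mf; have mg' := measurable_Ipow r mg.
have h0 (k : T -> R) x : [set: T] x -> (0 <= (`|k x| ^+ r)%:E)%E.
  by rewrite lee_fin exprn_ge0.
rewrite /Ipow -ge0_integralD// ?lee_fin//; try by move=> x _; exact: h0.
rewrite -ge0_integralZl//; try exact: emeasurable_funD.
  2: by move=> x _; rewrite adde_ge0// lee_fin exprn_ge0.
apply: ge0_le_integral_nm => x _; first by rewrite lee_fin exprn_ge0.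
by rewrite -EFinD -EFinM lee_fin normrD_exp_le.
Qed.

Lemma Ipow_fin_add r f g : measurable_fun setT f -> measurable_fun setT g ->
  (Ipow r f < +oo)%E -> (Ipow r g < +oo)%E -> (Ipow r (fun x => (f x + g x)%R) < +oo)%E.
Proof.
move=> mf mg f1 g1; apply: le_lt_trans (IpowD_le _ mf mg) _.
by rewrite lte_mul_pinfty ?lee_fin// lte_add_pinfty.
Qed.

Lemma Ipow_finZ r (c : R) f : measurable_fun setT f -> (Ipow r f < +oo)%E ->
  (Ipow r (fun x => (c * f x)%R) < +oo)%E.
Proof.
by move=> mf f1; rewrite IpowZ// lte_mul_pinfty ?lee_fin ?exprn_ge0.
Qed.

Lemma Ipow_fin_sum (I : Type) (s : seq I) r (f : I -> T -> R) : (0 < r)%N ->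
  (forall i, measurable_fun setT (f i)) -> (forall i, (Ipow r (f i) < +oo)%E) ->
  (Ipow r (fun x => (\sum_(i <- s) f i x)%R) < +oo)%E.
Proof.
move=> r0 mf f1; elim: s => [|i s IH].
  rewrite (_ : Ipow _ _ = 0%E) ?ltry//; rewrite /Ipow integral0_eq// => x _.
  by rewrite big_nil normr0 expr0n gtn_eqF.
under eq_fun do rewrite big_cons.
by apply: Ipow_fin_add => //; exact: measurable_sum.
Qed.

(** Only an upper bound is required. For nonnegative sequences this is convergence to 0; for a
    constant of unknown sign it says that the constant is at most 0, which is how [energy_compact]
    concludes. *)
Definition tends0 (u : nat -> \bar R) := forall e : R, 0 < e ->
  exists N, forall k, (N <= k)%N -> (u k <= e%:E)%E.

Lemma tends0_le (u v : nat -> \bar R) :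
  (forall k, u k <= v k)%E -> tends0 v -> tends0 u.
Proof.
by move=> uv v0 e /v0[N h]; exists N => k /h; apply: le_trans.
Qed.

Lemma tends0D (u v : nat -> \bar R) : tends0 u -> tends0 v ->
  tends0 (fun k => u k + v k)%E.
Proof.
move=> u0 v0 e e0; have e2 : 0 < e / 2 by rewrite divr_gt0.
have [N h] := u0 _ e2; have [M h'] := v0 _ e2; exists (maxn N M) => k.
rewrite geq_max => /andP[/h h1 /h' h2].
by rewrite (splitr e) EFinD leeD.
Qed.

Lemma tends0Z (c : R) (u : nat -> \bar R) : 0 <= c -> tends0 u ->
  tends0 (fun k => c%:E * u k)%E.
Proof.
move=> c0 u0 e e0.
have ec : 0 < e / (c + 1) by rewrite divr_gt0// ltr_wpDl.
have [N h] := u0 _ ec; exists N => k /h h1.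
apply: (@le_trans _ _ (c%:E * (e / (c + 1))%:E)%E); first by rewrite lee_wpmul2l ?lee_fin.
rewrite -EFinM lee_fin mulrCA ler_piMr ?(ltW e0)// ler_pdivrMr ?mul1r ?lerDl//.
by rewrite ltr_wpDl.
Qed.

Lemma tends0_sum (I : Type) (s : seq I) (u : I -> nat -> \bar R) :
  (forall i, tends0 (u i)) -> tends0 (fun k => \sum_(i <- s) u i k)%E.
Proof.
move=> u0; elim: s => [|i s IH].
  by move=> e e0; exists 0%N => k _; rewrite big_nil lee_fin ltW.
by under eq_fun do rewrite big_cons; exact: tends0D.
Qed.

Lemma cvg_tends0 (u : nat -> \bar R) : u k @[k --> \oo] --> 0%E -> tends0 u.
Proof.
move=> uc e e0.
have [|N _ h] := uc [set x | x < e%:E]%E _; last by exists N => k /h /ltW.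
exact: (@nbhs_open_ereal_lt _ 0 (fun=> e)).
Qed.

Lemma tends0_eq0 (c : \bar R) : (0 <= c)%E -> tends0 (fun=> c) -> c = 0%E.
Proof.
move=> c0 h; apply/eqP; rewrite eq_le c0 andbT; apply/lee_addgt0Pr => e e0.
by have [N /(_ N (leqnn _))] := h _ e0; rewrite add0e.
Qed.

Lemma tends0_IpowD r (f g : nat -> T -> R) :
  (forall k, measurable_fun setT (f k)) -> (forall k, measurable_fun setT (g k)) ->
  tends0 (fun k => Ipow r (f k)) -> tends0 (fun k => Ipow r (g k)) ->
  tends0 (fun k => Ipow r (fun x => f k x + g k x)).
Proof.
move=> mf mg f0 g0; apply: tends0_le (fun k => IpowD_le r (mf k) (mg k)) _.
by apply: tends0Z => //; exact: tends0D.
Qed.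

Lemma tends0_IpowZ r (c : R) (f : nat -> T -> R) : (forall k, measurable_fun setT (f k)) ->
  tends0 (fun k => Ipow r (f k)) -> tends0 (fun k => Ipow r (fun x => c * f k x)).
Proof.
move=> mf f0; under eq_fun do rewrite IpowZ//.
by apply: tends0Z => //; rewrite exprn_ge0.
Qed.

Lemma integrableDr f g : mu.-integrable setT (EFin \o f) -> mu.-integrable setT (EFin \o g) ->
  mu.-integrable setT (EFin \o (fun x => f x + g x)).
Proof.
move=> fi gi; rewrite (_ : EFin \o _ = (EFin \o f) \+ (EFin \o g))%E; last exact/funext.
exact: integrableD.
Qed.

Lemma integrableBr f g : mu.-integrable setT (EFin \o f) -> mu.-integrable setT (EFin \o g) ->
  mu.-integrable setT (EFin \o (fun x => f x - g x)).
Proof.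
move=> fi gi; rewrite (_ : EFin \o _ = (EFin \o f) \- (EFin \o g))%E; last exact/funext.
exact: integrableB.
Qed.

Lemma integrableZlr (c : R) f : mu.-integrable setT (EFin \o f) ->
  mu.-integrable setT (EFin \o (fun x => c * f x)).
Proof.
move=> fi; rewrite (_ : EFin \o _ = (fun x => c%:E * (f x)%:E)%E); last exact/funext.
exact: integrableZl.
Qed.

Lemma integrable_sumr (I : Type) (s : seq I) (f : I -> T -> R) :
  (forall i, mu.-integrable setT (EFin \o f i)) ->
  mu.-integrable setT (EFin \o (fun x => \sum_(i <- s) f i x)).
Proof.
move=> fi; elim: s => [|i s IH].
  rewrite (_ : EFin \o _ = cst 0%E); first exact: integrable0.
  by apply/funext => x /=; rewrite big_nil.
rewrite (_ : EFin \o _ = EFin \o (fun x => f i x + \sum_(i <- s) f i x)); first exact: integrableDr.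
by apply/funext => x /=; rewrite big_cons.
Qed.

Lemma Rintegral_sum (I : Type) (s : seq I) (f : I -> T -> R) :
  (forall i, mu.-integrable setT (EFin \o f i)) ->
  \int[mu]_x (\sum_(i <- s) f i x) = \sum_(i <- s) \int[mu]_x f i x.
Proof.
move=> fi; elim: s => [|i s IH].
  rewrite big_nil -[RHS](@Rintegral_set0 _ _ _ mu (fun=> 0)).
  rewrite /Rintegral !integral0_eq// => x _; by rewrite big_nil.
rewrite big_cons -IH -RintegralD//; last exact: integrable_sumr.
by apply: eq_Rintegral => x _; rewrite big_cons.
Qed.

Lemma dct_Ipow r (f_ : nat -> T -> R) (f g : T -> R) : (0 < r)%N ->
  (forall k, measurable_fun setT (f_ k)) -> measurable_fun setT f ->
  measurable_fun setT g -> (Ipow r g < +oo)%E ->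
  (forall k x, `|f_ k x - f x| <= g x) ->
  (forall x, f_ k x @[k --> \oo] --> f x) ->
  tends0 (fun k => Ipow r (fun x => f_ k x - f x)).
Proof.
move=> r0 mf_ mf mg gi fg fc.
have [] := @dominated_convergence _ _ _ mu setT measurableT
  (fun k x => (`|f_ k x - f x| ^+ r)%:E) (cst 0%E) (fun x => (`|g x| ^+ r)%:E).
- by move=> k; apply: measurable_Ipow; exact: measurable_funB.
- exact: measurable_cst.
- apply: aeW => x _ /=; apply: cvg_EFin; first exact: nearW.
  have -> : (0 : R) = `|f x - f x| ^+ r by rewrite subrr normr0 expr0n gtn_eqF.
  have H : continuous (fun y : R => `|y - f x| ^+ r).
    move=> y; apply: (@continuous_comp _ _ _ (fun y : R => `|y - f x|) (fun z => z ^+ r)).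
      apply: (@continuous_comp _ _ _ (fun y : R => y - f x) (fun z => `|z|)).
        by apply: cvgB; [exact: cvg_id|exact: cvg_cst].
      exact: norm_continuous.
    exact: exprn_continuous.
  exact: (cvg_comp _ _ (fc x) (H (f x))).
- apply/integrableP; split; first exact: measurable_Ipow.
  under eq_integral do rewrite gee0_abs ?lee_fin ?exprn_ge0//.
  exact: gi.
- apply: aeW => x k _; rewrite gee0_abs ?lee_fin ?exprn_ge0//.
  apply: lerXn2r; rewrite ?nnegrE//.
  exact: le_trans (fg k x) (ler_norm _).
by rewrite integral0 => _ _ h; apply: cvg_tends0.
Qed.

Lemma dct_Rintegral (f_ : nat -> T -> R) (f g : T -> R) :
  (forall k, measurable_fun setT (f_ k)) -> measurable_fun setT f ->
  mu.-integrable setT (EFin \o g) ->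
  (forall k x, `|f_ k x| <= g x) ->
  (forall x, f_ k x @[k --> \oo] --> f x) ->
  \int[mu]_x f_ k x @[k --> \oo] --> \int[mu]_x f x.
Proof.
move=> mf_ mf gi fg fc.
have [] := @dominated_convergence _ _ _ mu setT measurableT
  (fun k x => (f_ k x)%:E) (EFin \o f) (EFin \o g).
- by move=> k; exact/measurable_EFinP.
- exact/measurable_EFinP.
- by apply: aeW => x _ /=; apply: cvg_EFin; [exact: nearW|exact: fc].
- exact: gi.
- by apply: aeW => x k _; rewrite lee_fin; exact: fg.
move=> fi _ h; apply: fine_cvg; rewrite fineK; first exact: h.
exact: integrable_fin_num.
Qed.

Lemma integrable_le (f g : T -> R) : measurable_fun setT f ->
  mu.-integrable setT (EFin \o g) -> (forall x, `|f x| <= g x) ->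
  mu.-integrable setT (EFin \o f).
Proof.
move=> mf gi fg; apply: le_integrable gi => //; first exact/measurable_EFinP.
by move=> x _ /=; rewrite lee_fin (le_trans (fg x))// ler_norm.
Qed.

Lemma tends0_Rintegral (f_ : nat -> T -> R) (f : T -> R) :
  (forall k, mu.-integrable setT (EFin \o f_ k)) -> mu.-integrable setT (EFin \o f) ->
  tends0 (fun k => Ipow 1 (fun x => f_ k x - f x)) ->
  \int[mu]_x f_ k x @[k --> \oo] --> \int[mu]_x f x.
Proof.
move=> fi_ fi h; apply/cvgrPdist_le => /= e e0; have [N hN] := h _ e0.
exists N => // k /= /hN h1; rewrite distrC -RintegralB//.
have fk : mu.-integrable setT (EFin \o (fun x => f_ k x - f x)) by exact: integrableBr.
apply: le_trans (le_normr_Rintegral _ fk) _ => //.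
rewrite -lee_fin fineK; first by apply: le_trans h1; rewrite le_eqVlt; apply/orP; left; apply/eqP; apply: eq_integral.
by apply: integrable_fin_num => //; exact: integrable_norm.
Qed.

Lemma Ipow_eq0 r f : (0 < r)%N -> measurable_fun setT f -> Ipow r f = 0%E ->
  {ae mu, forall x, f x = 0}.
Proof.
move=> r0 mf h.
have /(ae_eq_integral_abs _ measurableT)/= H : measurable_fun setT (fun x => (`|f x| ^+ r)%:E).
  exact: measurable_Ipow.
have /H : (\int[mu]_x `|(`|f x| ^+ r)%:E| = 0)%E.
  by rewrite -[RHS]h; apply: eq_integral => x _; rewrite gee0_abs// lee_fin exprn_ge0.
apply: filterS => x /(_ I) /eqP; rewrite eqe expf_eq0 r0 normr_eq0 => /eqP.
by [].
Qed.

End power_integral.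

(** * Continuity of translations *)

Section translation_continuity.
Import HBNNSimple.
Context {R : realType} {n : nat}.
Local Notation E := 'rV[R]_n.
Local Notation mu := (lebesgue_rV R n).
Implicit Types f g : E -> R.

(** Sequential, because dominated convergence is; [transl_cont_eps] returns to a radius [del]. *)
Definition transl_cont (r : nat) (f : E -> R) := forall y : nat -> E,
  y k @[k --> \oo] --> (0 : E) ->
  tends0 (fun k => Ipow mu r (fun x => f (x + y k) - f x)).

Lemma Ipow_shift r f (a : E) : measurable_fun setT f ->
  Ipow mu r (fun x => f (x + a)) = Ipow mu r f.
Proof.
move=> mf; rewrite /Ipow.
apply: (@ge0_integral_rV_shift _ _ a (fun x => (`|f x| ^+ r)%:E)).
  exact: measurable_Ipow.
by move=> x; rewrite lee_fin exprn_ge0.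
Qed.

Lemma measurable_shift_sub f (a : E) : measurable_fun setT f ->
  measurable_fun setT (fun x : E => f (x + a) - f x).
Proof. by move=> mf; apply: measurable_funB => //; exact: measurable_fun_rV_shift. Qed.

Lemma transl_contD r f g : measurable_fun setT f -> measurable_fun setT g ->
  transl_cont r f -> transl_cont r g -> transl_cont r (fun x => f x + g x).
Proof.
move=> mf mg cf cg y y0.
rewrite (_ : (fun k => _) = (fun k => Ipow mu r (fun x => (f (x + y k) - f x) + (g (x + y k) - g x)))).
  by apply: tends0_IpowD => [k|k||]; [exact: measurable_shift_sub|exact: measurable_shift_sub|exact: cf|exact: cg].
by apply/funext => k; apply: eq_Ipow => x; ring.
Qed.

Lemma transl_contZ r (c : R) f : measurable_fun setT f ->
  transl_cont r f -> transl_cont r (fun x => c * f x).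
Proof.
move=> mf cf y y0.
rewrite (_ : (fun k => _) = (fun k => Ipow mu r (fun x => c * (f (x + y k) - f x)))).
  by apply: tends0_IpowZ => [k|]; [exact: measurable_shift_sub|exact: cf].
by apply/funext => k; apply: eq_Ipow => x; ring.
Qed.

Lemma transl_cont_sum (I : Type) (s : seq I) r (f : I -> E -> R) : (0 < r)%N ->
  (forall i, measurable_fun setT (f i)) -> (forall i, transl_cont r (f i)) ->
  transl_cont r (fun x => \sum_(i <- s) f i x).
Proof.
move=> r0 mf cf; elim: s => [|i s IH].
  move=> y _ e e0; exists 0%N => k _; rewrite (_ : Ipow _ _ _ = 0%E) ?lee_fin ?(ltW e0)//.
  by rewrite /Ipow integral0_eq// => x _; rewrite !big_nil subrr normr0 expr0n gtn_eqF.
under eq_fun do rewrite big_cons.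
by apply: transl_contD => //; exact: measurable_sum.
Qed.

Lemma transl_cont_lim r f : measurable_fun setT f ->
  (forall e : R, 0 < e -> exists g, [/\ measurable_fun setT g, transl_cont r g &
    (Ipow mu r (fun x => (f x - g x)%R) <= e%:E)%E]) ->
  transl_cont r f.
Proof.
move=> mf H y y0 e e0.
(* The total factor when [IpowD_le] is applied twice to the splitting of [f (x + y) - f x] through
   [g (x + y)] and [g x]. *)
pose C : R := 2 ^+ r * (1 + 2 ^+ r * 2).
have C0 : 0 < C by rewrite mulr_gt0 ?exprn_gt0// addr_gt0// mulr_gt0 ?exprn_gt0.
have [g [mg cg fg]] := H (e / C) (divr_gt0 e0 C0).
have [N hN] := cg y y0 (e / C) (divr_gt0 e0 C0).
exists N => k /hN h.
have mfg : measurable_fun setT (fun x => f x - g x) by exact: measurable_funB.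
have -> : Ipow mu r (fun x => f (x + y k) - f x) =
  Ipow mu r (fun x => (f (x + y k) - g (x + y k)) + ((g (x + y k) - g x) + (- (f x - g x)))).
  by apply: eq_Ipow => x; ring.
have m1 : measurable_fun setT (fun x : E => f (x + y k) - g (x + y k)) by exact: (measurable_fun_rV_shift _ mfg).
have m2 : measurable_fun setT (fun x : E => g (x + y k) - g x) by exact: measurable_shift_sub.
have m3 : measurable_fun setT (fun x => - (f x - g x)) by exact: measurable_funN.
have m23 : measurable_fun setT (fun x : E => (g (x + y k) - g x) + - (f x - g x)) by exact: measurable_funD.
apply: (le_trans (@IpowD_le _ _ _ mu r _ _ m1 m23)).
rewrite (Ipow_shift _ _ mfg).
apply: (@le_trans _ _ ((2 ^+ r)%:E * ((e / C)%:E + (2 ^+ r)%:E * ((e / C)%:E + (e / C)%:E)))%E).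
  apply: lee_wpmul2l; first by rewrite lee_fin exprn_ge0.
  apply: leeD => //; apply: (le_trans (@IpowD_le _ _ _ mu r _ _ m2 m3)).
  apply: lee_wpmul2l; first by rewrite lee_fin exprn_ge0.
  by apply: leeD => //; rewrite IpowN.
rewrite [X in (X <= _)%E](_ : _ = (2 ^+ r * (e / C + 2 ^+ r * (e / C + e / C)))%:E)// lee_fin.
rewrite (_ : 2 ^+ r * _ = e)//.
rewrite (_ : 2 ^+ r * _ = C * (e / C)) ; first by rewrite mulrC divfK// gt_eqF.
by rewrite /C; ring.
Qed.

Lemma measurable_ind (A : set E) : measurable A -> measurable_fun setT (\1_A : E -> R).
Proof. by move=> mA; exact: measurable_indic. Qed.

Lemma Ipow_ind r (A : set E) : (0 < r)%N -> measurable A -> Ipow mu r (\1_A) = mu A.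
Proof.
move=> r0 mA; transitivity (mu (A `&` setT)); last by rewrite setIT.
rewrite -integral_indic//.
apply: eq_integral => x _; rewrite indicE; case: (x \in A) => /=.
  by rewrite normr1 expr1n.
by rewrite normr0 expr0n gtn_eqF.
Qed.

(** At a point of [O], openness gives [\1_O (x + y k) = 1] for large [k], so dominated convergence
    settles the part of the difference inside [O] ([key]). The part outside is the same quantity for
    the translation by [- y k], by invariance of the measure. *)
Lemma transl_cont_open (O : set E) : open O -> (mu O < +oo)%E -> transl_cont 1 (\1_O).
Proof.
move=> oO O1.
have mO : measurable O by exact: open_measurable_rV.
have mb := measurable_ind mO.
have key y : y k @[k --> \oo] --> (0 : E) ->
    tends0 (fun k => Ipow mu 1 (fun x => \1_O x * \1_O (x + y k) - \1_O x)).
  move=> y0; apply: (@dct_Ipow _ _ _ mu 1 (fun k x => \1_O x * \1_O (x + y k)) (\1_O) (\1_O)) => //.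
  - move=> k; apply: measurable_funM => //.
    exact: (measurable_fun_rV_shift _ mb).
  - by rewrite Ipow_ind.
  - move=> k x; rewrite !indicE; case: (x \in O); rewrite ?mul1r ?mul0r ?subrr ?normr0//.
    by case: (_ \in O); rewrite ?subrr ?normr0 ?sub0r ?normrN ?normr1.
  - move=> x; rewrite /= [in X in _ --> X]indicE; case: (boolP (x \in O)) => xO; last first.
      under eq_fun do rewrite indicE (negbTE xO) mul0r.
      exact: cvg_cst.
    apply: cvg_near_cst.
    have Ox : nbhs x O by apply: open_nbhs_nbhs; split => //; exact: set_mem.
    have xy : x + y k @[k --> \oo] --> x + 0 by apply: cvgD => //; exact: cvg_cst.
    rewrite addr0 in xy; have [N _ hN] := xy _ Ox; exists N => // k /hN /= h.
    by rewrite !indicE xO mul1r mem_set.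
move=> y y0.
have yN0 : (- y k) @[k --> \oo] --> (0 : E) by rewrite -oppr0; exact: cvgN.
rewrite (_ : (fun k => _) = (fun k => Ipow mu 1 (fun x => (\1_O (x + y k) - \1_O (x + y k) * \1_O x) +
   (\1_O x * \1_O (x + y k) - \1_O x)))); last first.
  by apply/funext => k; apply: eq_Ipow => x; ring.
have mby k : measurable_fun setT (fun x : E => \1_O (x + y k) : R) by exact: (measurable_fun_rV_shift _ mb).
apply: tends0_IpowD; last exact: key.
- by move=> k; apply: measurable_funB => //; apply: measurable_funM.
- by move=> k; apply: measurable_funB => //; apply: measurable_funM.
have := key _ yN0; congr tends0; apply/funext => k.
pose F (x : E) : R := \1_O x * \1_O (x - y k) - \1_O x.
have mF : measurable_fun setT F.
  apply: measurable_funB => //; apply: measurable_funM => //.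
  exact: (measurable_fun_rV_shift _ mb).
rewrite -[LHS](Ipow_shift _ (y k) mF) -[RHS]IpowN; apply: eq_Ipow => x.
by rewrite /F addrK; ring.
Qed.

(** Dynkin induction from open sets. The intersection with a ball [O] keeps measures finite:
    complements are taken relative to [O], and countable disjoint unions are dominated by [\1_O]. *)
Lemma transl_cont_set (A : set E) (N : R) : measurable A ->
  transl_cont 1 (\1_(A `&` [set x : E | `|x| < N])).
Proof.
set O : set E := [set x : E | `|x| < N] => mA.
have oO : open O.
  apply: (@open_comp _ _ (fun x : E => `|x|) [set y | y < N]); last exact: open_lt.
  by move=> x _; exact: norm_continuous.
have mO : measurable O by exact: open_measurable_rV.
have O1 : (mu O < +oo)%E by exact: lebesgue_rV_ball_lty.
have sA : <<s @open E >> A by rewrite -measurable_rV_openE.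
move: A sA {mA}; apply: (@dynkin_induction _ E (@open E) (fun A => transl_cont 1 (\1_(A `&` O)))).
- exact: measurable_rV_openE.
- by move=> A B; exact: openI.
- by rewrite setTI; exact: transl_cont_open.
- move=> A oA; apply: transl_cont_open; first exact: openI.
  apply: le_lt_trans O1; rewrite le_measure ?inE//.
  by apply: measurableI => //; exact: open_measurable_rV.
- move=> A mA cA.
  rewrite (_ : \1_ _ = (fun x => \1_O x + (-1) * \1_(A `&` O) x)).
    apply: transl_contD; [exact: measurable_ind|..].
    + by apply: measurable_funM => //; apply: measurable_ind; exact: measurableI.
    + exact: transl_cont_open.
    + by apply: transl_contZ => //; apply: measurable_ind; exact: measurableI.
  apply/funext => x; rewrite !indicE !in_setI in_setC.
  by case: (x \in A); case: (x \in O) => /=; ring.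
- move=> F mF tF cF.
  have mFO k : measurable (F k `&` O) by exact: measurableI.
  have mUO : measurable (\bigcup_k F k `&` O).
    by apply: measurableI => //; exact: bigcup_measurable.
  pose f_ (k : nat) (x : E) : R := \sum_(0 <= i < k) \1_(F i `&` O) x.
  have mf_ k : measurable_fun setT (f_ k).
    by apply: measurable_sum => i; exact: measurable_ind.
  have fE k x : f_ k x = \1_(\bigcup_(i < k) F i `&` O) x.
    rewrite /f_; elim: k => [|k IH].
      by rewrite big_geq// bigcup_mkord big_ord0 set0I indic0.
    rewrite big_nat_recr//= IH !bigcup_mkord big_ord_recr/= setIUl indicE !indicE.
    rewrite in_setU.
    case: (boolP (x \in F k `&` O)) => h; last by rewrite orbF addr0.
    rewrite orbT (_ : (x \in _) = false) ?add0r//; apply/negbTE/negP => /set_mem[+ _].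
    rewrite -bigcup_mkord => -[i /= ik Fix]; have /set_mem[Fkx _] := h.
    have := tF i k I I (ex_intro _ x (conj Fix Fkx)).
    by move=> e; rewrite e ltnn in ik.
  have H : tends0 (fun k => Ipow mu 1 (fun x => f_ k x - \1_(\bigcup_k F k `&` O) x)).
    apply: (@dct_Ipow _ _ _ mu 1 f_ _ (\1_O)) => //; try exact: measurable_ind.
    + by rewrite Ipow_ind.
    + move=> k x; rewrite fE !indicE !in_setI.
      case: (x \in O); rewrite ?andbF ?subrr ?normr0// !andbT.
      case: (boolP (x \in \bigcup_(i < k) F i)) => h.
        rewrite (_ : (x \in _) = true) ?subrr ?normr0//.
        by apply/mem_set; have /set_mem[i _ Fix] := h; exists i.
      by case: (x \in _); rewrite ?subrr ?normr0// sub0r normrN normr1.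
    + move=> x; apply: cvg_near_cst.
      case: (pselect ((\bigcup_k F k) x)) => [[i _ Fix]|nF].
        exists i.+1 => // k /= ik; rewrite fE !indicE !in_setI; congr ((_ && _)%:R).
        by rewrite !mem_set//; exists i.
      apply: nearW => k; rewrite fE !indicE !in_setI; congr ((_ && _)%:R).
      rewrite !memNset// => -[i _ Fix]; apply: nF; by exists i.
  apply: transl_cont_lim; first exact: measurable_ind.
  move=> e e0; have [N' hN] := H _ e0; exists (f_ N'); split => //.
    by apply: transl_cont_sum => // i; exact: measurable_ind.
  by rewrite -IpowN; under eq_Ipow do rewrite opprB; exact: hN.
Qed.

(** By density: a nonnegative [f] is the limit, for the power [r], of simple functions cut to balls,
    and the general case follows from positive and negative parts. *)
Lemma transl_cont_Ipow r f : (0 < r)%N -> measurable_fun setT f ->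
  (Ipow mu r f < +oo)%E -> transl_cont r f.
Proof.
move=> r0.
pose O (N : nat) : set E := [set x : E | `|x| < N%:R].
have mO N : measurable (O N).
  apply: open_measurable_rV; apply: (@open_comp _ _ (fun x : E => `|x|) [set y | y < N%:R]); last exact: open_lt.
  by move=> x _; exact: norm_continuous.
(* Differences of indicators have modulus 0 or 1, so the power [r] is bounded by the power 1. *)
have cO N A : measurable A -> transl_cont r (\1_(A `&` O N)).
  move=> mA y y0; have := transl_cont_set N%:R mA y0; apply: tends0_le => k.
  apply: ge0_le_integral_nm => x _; rewrite lee_fin ?exprn_ge0// expr1.
  rewrite -[leRHS]expr1 ler_wiXn2l// !indicE.
  by do 2 case: (_ \in _); rewrite ?subrr ?normr0 ?subr0 ?sub0r ?normrN ?normr1.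
wlog f0 : f / forall x, 0 <= f x.
  move=> H mf f1.
  have mp : measurable_fun setT (fun x => Num.max (f x) 0) by exact: measurable_maxr.
  have mm : measurable_fun setT (fun x => Num.max (- f x) 0).
    by apply: measurable_maxr => //; exact: measurable_funN.
  rewrite (_ : f = (fun x => Num.max (f x) 0 + (-1) * Num.max (- f x) 0)); last first.
    by apply/funext => x; case: (leP (f x) 0) => h; case: (leP (- f x) 0) => h'; lra.
  apply: transl_contD => //; first exact: measurable_funM.
    apply: H => // [x|]; first by rewrite le_max lexx orbT.
    apply: le_lt_trans f1; apply: le_Ipow => x; case: (leP (f x) 0) => h //.
    by rewrite normr0.
  apply: transl_contZ => //; apply: H => // [x|]; first by rewrite le_max lexx orbT.
  apply: le_lt_trans f1; apply: le_Ipow => x; case: (leP (- f x) 0) => h //.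
    by rewrite normr0.
  by rewrite normrN.
move=> mf f1.
have mEf : measurable_fun setT (EFin \o f) by exact/measurable_EFinP.
pose h k := nnsfun_approx measurableT mEf k.
have h_f k x : h k x <= f x.
  by rewrite -lee_fin /h nnsfun_approxE; apply: (@le_approx _ _ _ setT (EFin \o f) k x) => //= y _; rewrite lee_fin.
have h0 k x : 0 <= h k x by exact: fun_ge0.
pose f_ k x := h k x * \1_(O k) x.
have mf_ k : measurable_fun setT (f_ k) by apply: measurable_funM => //; exact: measurable_ind.
have H : tends0 (fun k => Ipow mu r (fun x => f_ k x - f x)).
  apply: (@dct_Ipow _ _ _ mu r f_ _ f) => //.
  - move=> k x; rewrite /f_ indicE; case: (x \in _); rewrite ?mulr1 ?mulr0.
      by have := h_f k x; have := h0 k x; rewrite ler_norml => *; apply/andP; split; lra.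
    by rewrite sub0r normrN ger0_norm.
  - move=> x; have hx : h k x @[k --> \oo] --> f x.
      have /fine_fcvg : (h k x)%:E @[k --> \oo] --> (f x)%:E.
        by apply: (cvg_nnsfun_approx measurableT mEf) => // y _; rewrite lee_fin.
      by [].
    apply: cvg_trans hx; apply: near_eq_cvg; exists (Num.truncn `|x|).+1 => // k /= xk.
    rewrite /f_ indicE mem_set ?mulr1// /O /=.
    by apply: lt_le_trans (truncnS_gt _) _; rewrite ler_nat.
apply: transl_cont_lim => // e e0; have [N hN] := H _ e0; exists (f_ N); split => //; last first.
  by rewrite -IpowN; under eq_Ipow do rewrite opprB; exact: hN.
pose s : seq R := finmap.enum_fset (fset_set (range (h N))).
rewrite (_ : f_ N = (fun x => \sum_(y <- s) y * \1_(h N @^-1` [set y] `&` O N) x)).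
  apply: transl_cont_sum => // y.
    by apply: measurable_funM => //; apply: measurable_ind; exact: measurableI.
  by apply: transl_contZ; [apply: measurable_ind; exact: measurableI|exact: cO].
apply/funext => x; rewrite /f_ fimfunE fsbig_finite//= mulr_suml.
by apply: eq_bigr => y _; rewrite indicI -mulrA.
Qed.

Lemma transl_cont_eps r f : transl_cont r f -> forall e : R, 0 < e ->
  exists2 del : R, 0 < del & forall a : E, `|a| < del ->
    (Ipow mu r (fun x => (f (x + a) - f x)%R) <= e%:E)%E.
Proof.
move=> cf e e0; apply: contrapT => H.
have {}H k : exists a : E, `|a| < k.+1%:R^-1 /\
    ~ (Ipow mu r (fun x => (f (x + a) - f x)%R) <= e%:E)%E.
  apply: contrapT => h; apply: H; exists k.+1%:R^-1; first by rewrite invr_gt0.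
  by move=> a ak; apply: contrapT => h'; apply: h; exists a.
have [y hy] := choice H.
have y0 : y k @[k --> \oo] --> (0 : E).
  apply/cvgrPdist_lt => /= d d0; have := @cvg_harmonic R.
  move/cvgrPdist_lt => /(_ _ d0); apply: filterS => k.
  rewrite !sub0r !normrN ger0_norm ?invr_ge0// => h.
  by apply: lt_trans h; have [] := hy k.
have [N /(_ N (leqnn _)) h] := cf y y0 _ e0.
by have [_] := hy N.
Qed.

(** For exponent 1 this is the triangle inequality; for exponent 2 it is the nonnegativity of the
    variance of [h] under the probability density [rho]. *)
Lemma jensen_Rintegral r (h rho : E -> R) : (r = 1 \/ r = 2)%N ->
  measurable_fun setT h -> measurable_fun setT rho -> (forall y, 0 <= rho y) ->
  mu.-integrable setT (EFin \o rho) -> \int[mu]_y rho y = 1 ->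
  mu.-integrable setT (EFin \o (fun y => h y * rho y)) ->
  ((`|\int[mu]_y (h y * rho y)| ^+ r)%:E <= \int[mu]_y (`|h y| ^+ r * rho y)%:E)%E.
Proof.
move=> r12 mh mrho rho0 irho rho1 ih.
have [->|->] := r12.
  rewrite expr1; apply: (@le_trans _ _ (\int[mu]_y `|h y * rho y|)%:E).
    by rewrite lee_fin; apply: le_normr_Rintegral.
  rewrite fineK; last by apply: integrable_fin_num => //; exact: integrable_norm.
  by rewrite le_eqVlt; apply/orP; left; apply/eqP; apply: eq_integral => y _; rewrite normrM expr1 (ger0_norm (rho0 y)).
have mF : measurable_fun setT (fun y => `|h y| ^+ 2 * rho y).
  by apply: measurable_funM => //; apply: measurable_funX; exact: measurableT_comp.
have [fin|] := ltP (\int[mu]_y (`|h y| ^+ 2 * rho y)%:E)%E +oo%E; last first.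
  by rewrite leye_eq => /eqP ->; rewrite leey.
have i2 : mu.-integrable setT (EFin \o (fun y => `|h y| ^+ 2 * rho y)).
  apply/integrableP; split; first exact/measurable_EFinP.
  under eq_integral do rewrite gee0_abs ?lee_fin ?mulr_ge0 ?exprn_ge0//.
  exact: fin.
set c := \int[mu]_y (h y * rho y).
have -> : (\int[mu]_y (`|h y| ^+ 2 * rho y)%:E)%E = (\int[mu]_y (`|h y| ^+ 2 * rho y))%:E.
  by rewrite fineK//; exact: integrable_fin_num.
rewrite lee_fin real_normK ?num_real// -subr_ge0.
suff -> : \int[mu]_y (`|h y| ^+ 2 * rho y) - c ^+ 2 = \int[mu]_y ((h y - c) ^+ 2 * rho y).
  by apply: Rintegral_ge0 => y _; rewrite mulr_ge0 ?sqr_ge0.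
transitivity (\int[mu]_y ((`|h y| ^+ 2 * rho y - (2 * c) * (h y * rho y)) + c ^+ 2 * rho y)).
  rewrite RintegralD//; last 2 first.
  - by apply: integrableBr => //; exact: integrableZlr.
  - exact: integrableZlr.
  rewrite RintegralB//; last exact: integrableZlr.
  by rewrite !RintegralZl// rho1 -/c; ring.
by apply: eq_Rintegral => y _; rewrite real_normK ?num_real//; ring.
Qed.

(** A correlation rather than a convolution: the kernel is not reflected, hence the minus sign in
    [partial_moll]. *)
Definition moll (rho f : E -> R) (x : E) : R := \int[mu]_y (f (x + y) * rho y).

(** [moll rho f x - f x] is the [rho]-average of [f (x + y) - f x]. Jensen moves the power inside
    the average, and after Tonelli each translation in the support of [rho] contributes at most
    [e]. *)
Lemma Ipow_moll_le r (rho f : E -> R) (del e : R) : (r = 1 \/ r = 2)%N ->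
  measurable_fun setT f -> measurable_fun setT rho -> (forall y, 0 <= rho y) ->
  mu.-integrable setT (EFin \o rho) -> \int[mu]_y rho y = 1 ->
  (forall x : E, mu.-integrable setT (EFin \o (fun y : E => f (x + y) * rho y))) ->
  (forall y, del <= `|y| -> rho y = 0) -> 0 <= e ->
  (forall a : E, `|a| < del -> (Ipow mu r (fun x => (f (x + a) - f x)%R) <= e%:E)%E) ->
  (Ipow mu r (fun x => (moll rho f x - f x)%R) <= e%:E)%E.
Proof.
move=> r12 mf mrho rho0 irho rho1 ifr rhod e0 H.
have mfx (x : E) : measurable_fun setT (fun y : E => f (x + y) - f x).
  apply: measurable_funB => //; under eq_fun do rewrite addrC.
  exact: measurable_fun_rV_shift.
have ifx (x : E) : mu.-integrable setT (EFin \o (fun y : E => (f (x + y) - f x) * rho y)).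
  rewrite (_ : EFin \o _ = EFin \o (fun y : E => f (x + y) * rho y - f x * rho y)).
    by apply: integrableBr => //; exact: integrableZlr.
  by apply/funext => y /=; rewrite mulrBl.
pose F (z : E * E) := (`|f (z.1 + z.2) - f z.1| ^+ r * rho z.2)%:E.
have mF : measurable_fun setT F.
  apply/measurable_EFinP; apply: measurable_funM; last first.
    by apply: (measurableT_comp mrho); exact: measurable_snd.
  apply: measurable_funX; apply: measurableT_comp => //; apply: measurable_funB.
    by apply: (measurableT_comp mf); exact: measurable_rV_add.
  by apply: (measurableT_comp mf); exact: measurable_fst.
have F0 z : (0 <= F z)%E by rewrite lee_fin mulr_ge0 ?exprn_ge0.
apply: (@le_trans _ _ (\int[mu]_x \int[mu]_y F (x, y))%E).
  apply: ge0_le_integral_nm => x _; first by rewrite lee_fin exprn_ge0.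
  have -> : moll rho f x - f x = \int[mu]_y ((f (x + y) - f x) * rho y).
    rewrite -[X in _ - X]mulr1 -rho1 -RintegralZl// -RintegralB//; last exact: integrableZlr.
    by apply: eq_Rintegral => y _; rewrite mulrBl.
  exact: jensen_Rintegral.
rewrite fubini_tonelli//.
apply: (@le_trans _ _ (\int[mu]_y (e%:E * (rho y)%:E))%E); last first.
  rewrite integralZl//.
  have -> : (\int[mu]_y (rho y)%:E)%E = (\int[mu]_y rho y)%:E by rewrite fineK//; exact: integrable_fin_num.
  by rewrite rho1 mule1.
apply: ge0_le_integral_nm => y _; first by apply: integral_ge0.
have [yd|yd] := ltP `|y| del; last first.
  rewrite rhod// mule0 /F/= rhod// integral0_eq// => x _.
  by rewrite mulr0.
rewrite /F /=; under eq_integral do rewrite EFinM muleC.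
rewrite ge0_integralZl//.
- by rewrite muleC lee_wpmul2r ?lee_fin//; exact: H.
- exact: (measurable_Ipow r (measurable_shift_sub y mf)).
- by rewrite lee_fin.
Qed.

End translation_continuity.

(** * Smooth functions and test functions *)

Section smooth.
Context {R : realType} {V : normedModType R} {I : Type} (D : I -> V).
Implicit Types f g : V -> R.

Definition dpart (i : I) f : V -> R := fun x => 'D_(D i) f x.

(** Continuity is demanded at every order since directional derivability does not imply it. The
    family [D] of directions is a parameter, so that functions on R^n and on the line, the latter
    with the single direction 1, share one theory. *)
Fixpoint Ck (k : nat) f : Prop := continuous f /\
  (if k is k'.+1 then forall i, (forall x, derivable f x (D i)) /\ Ck k' (dpart i f)
   else True).

Definition smooth f := forall k, Ck k f.

Lemma Ck_cont k f : Ck k f -> continuous f.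
Proof. by case: k => [|k] []. Qed.

Lemma CkW k f : Ck k.+1 f -> Ck k f.
Proof.
elim: k f => [|k IH] f; first by case.
by case=> cf h; split=> // i; have [df hf] := h i; split=> //; exact: IH.
Qed.

Lemma eq_Ck k f g : f =1 g -> Ck k f -> Ck k g.
Proof. by move=> /funext ->. Qed.

Lemma is_derive_dpart i f x (df : R) : is_derive x (D i) f df -> dpart i f x = df.
Proof. by move=> h; rewrite /dpart derive_val. Qed.

Lemma Ck_cst k (c : R) : Ck k (fun=> c).
Proof.
elim: k c => [|k IH] c; first by split=> //; exact: cst_continuous.
split; [exact: cst_continuous|move=> i; split=> [x|]]; first exact: derivable_cst.
apply: eq_Ck (IH 0) => x; rewrite /dpart; by rewrite derive_cst.
Qed.

Lemma dpartD i f g : (forall x, derivable f x (D i)) -> (forall x, derivable g x (D i)) ->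
  dpart i (fun x => f x + g x) =1 (fun x => dpart i f x + dpart i g x).
Proof. by move=> df dg x; rewrite /dpart; exact: (deriveD (df x) (dg x)). Qed.

Lemma dpartM i f g : (forall x, derivable f x (D i)) -> (forall x, derivable g x (D i)) ->
  dpart i (fun x => f x * g x) =1 (fun x => f x * dpart i g x + g x * dpart i f x).
Proof. by move=> df dg x; rewrite /dpart; exact: (deriveM (df x) (dg x)). Qed.

Lemma Ck_derivable k f i x : Ck k.+1 f -> derivable f x (D i).
Proof. by case=> _ /(_ i)[]. Qed.

Lemma Ck_dpart k f i : Ck k.+1 f -> Ck k (dpart i f).
Proof. by case=> _ /(_ i)[]. Qed.

Lemma CkD k f g : Ck k f -> Ck k g -> Ck k (fun x => f x + g x).
Proof.
elim: k f g => [|k IH] f g cf cg.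
  split=> // x; apply: cvgD; [exact: (Ck_cont cf)|exact: (Ck_cont cg)].
split=> [x|i]; first by apply: cvgD; [exact: (Ck_cont cf)|exact: (Ck_cont cg)].
have df x : derivable f x (D i) := Ck_derivable cf.
have dg x : derivable g x (D i) := Ck_derivable cg.
split=> [x|]; first exact: derivableD.
apply: eq_Ck (fun x => esym (dpartD df dg x)) _.
by apply: IH; exact: Ck_dpart.
Qed.

Lemma CkM k f g : Ck k f -> Ck k g -> Ck k (fun x => f x * g x).
Proof.
elim: k f g => [|k IH] f g cf cg.
  split=> // x; apply: cvgM; [exact: (Ck_cont cf)|exact: (Ck_cont cg)].
split=> [x|i]; first by apply: cvgM; [exact: (Ck_cont cf)|exact: (Ck_cont cg)].
have df x : derivable f x (D i) := Ck_derivable cf.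
have dg x : derivable g x (D i) := Ck_derivable cg.
split=> [x|]; first exact: derivableM.
apply: eq_Ck (fun x => esym (dpartM df dg x)) _.
by apply: CkD; apply: IH; [exact: CkW|exact: Ck_dpart|exact: CkW|exact: Ck_dpart].
Qed.

Lemma smoothD f g : smooth f -> smooth g -> smooth (fun x => f x + g x).
Proof. by move=> sf sg k; exact: CkD. Qed.

Lemma smoothM f g : smooth f -> smooth g -> smooth (fun x => f x * g x).
Proof. by move=> sf sg k; exact: CkM. Qed.

Lemma smooth_cst (c : R) : smooth (fun=> c).
Proof. by move=> k; exact: Ck_cst. Qed.

Lemma smooth_prod (J : Type) (s : seq J) (F : J -> V -> R) :
  (forall j, smooth (F j)) -> smooth (fun x => \prod_(j <- s) F j x).
Proof.
move=> sF; elim: s => [|j s IH] k; first by apply: eq_Ck (Ck_cst k 1) => x; rewrite big_nil.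
by apply: eq_Ck (CkM (sF j k) (IH k)) => x; rewrite big_cons.
Qed.

Lemma smooth_cont f : smooth f -> continuous f.
Proof. by move=> /(_ 0%N) /Ck_cont. Qed.

Lemma smooth_derivable f i x : smooth f -> derivable f x (D i).
Proof. by move=> /(_ 1%N) /Ck_derivable. Qed.

Lemma smooth_dpart f i : smooth f -> smooth (dpart i f).
Proof. by move=> sf k; apply: Ck_dpart; exact: sf. Qed.

Lemma smooth_linear f (c : I -> R) : continuous f ->
  (forall x i, is_derive x (D i) f (c i)) -> smooth f.
Proof.
move=> cf df [|k]; first by split.
split=> // i; split=> [x|]; first by have [] := df x i.
apply: eq_Ck (Ck_cst k (c i)) => x; by rewrite (is_derive_dpart (df x i)).
Qed.

Lemma dpart_shift i f (a : V) : dpart i (fun x => f (x + a)) =1 (fun x => dpart i f (x + a)).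
Proof.
move=> x; rewrite /dpart /derive; set F := (X in lim (X @ _)).
by set G := (X in _ = lim (X @ _)); have -> : F = G by apply/funext => h; rewrite /F /G /= addrA.
Qed.

Lemma derivable_shift i f (a x : V) : derivable f (x + a) (D i) ->
  derivable (fun x => f (x + a)) x (D i).
Proof.
rewrite /derivable; set F := (X in cvg (X @ _)); set G := (X in _ -> cvg (X @ _)).
by have -> : F = G by apply/funext => h; rewrite /F /G /= addrA.
Qed.

Lemma smooth_shift f (a : V) : smooth f -> smooth (fun x => f (x + a)).
Proof.
move=> sf k; elim: k f sf => [|k IH] f sf.
  split=> // x; apply: (@continuous_comp _ _ _ (fun x => x + a) f).
    by apply: cvgD; [exact: cvg_id|exact: cvg_cst].
  exact: (smooth_cont sf).
split=> [x|i].
  apply: (@continuous_comp _ _ _ (fun x => x + a) f).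
    by apply: cvgD; [exact: cvg_id|exact: cvg_cst].
  exact: (smooth_cont sf).
split=> [x|]; first by apply: derivable_shift; exact: smooth_derivable.
apply: eq_Ck (fun x => esym (dpart_shift i f a x)) _.
by apply: IH; exact: smooth_dpart.
Qed.

Lemma is_derive_line f (x v : V) (t : R) (df : R) :
  is_derive (t *: v + x) v f df -> is_derive t 1 (fun s : R => f (s *: v + x)) df.
Proof.
move=> [h1 h2].
have E : (fun h : R => h^-1 *: (f (h *: v + (t *: v + x)) - f (t *: v + x))) =
  (fun h : R => h^-1 *: (f ((h *: (1 : R) + t) *: v + x) - f (t *: v + x))).
  by apply/funext => h; rewrite scalerDl [_%:A]mulr1 addrA.
by split; [move: h1; rewrite /derivable|move: h2; rewrite /derive] => /=; rewrite E.
Qed.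

(** Restriction to the line through [x] in direction [D i] reduces this to the one-variable chain
    rule. *)
Lemma dpart_comp_is_derive i (eta deta : R -> R) f (x : V) :
  derivable f x (D i) -> is_derive (f x) 1 eta (deta (f x)) ->
  is_derive x (D i) (fun y => eta (f y)) (deta (f x) * dpart i f x).
Proof.
move=> df de.
have H : is_derive (0 : R) 1 (fun s : R => f (s *: D i + x)) (dpart i f x).
  by apply: is_derive_line; rewrite scale0r add0r; exact: derivableP.
have e0 : f (0 *: D i + x) = f x by rewrite scale0r add0r.
have H' : is_derive (0 : R) 1 (eta \o (fun s : R => f (s *: D i + x))) (deta (f x) * dpart i f x).
  by apply: is_derive1_comp => //; rewrite e0.
have [h1 h2] := H'; split; first by apply/derivable1P.
rewrite -h2 /derive; set F := (X in lim (X @ _)); set G := (X in _ = lim (X @ _)).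
by have -> : F = G by apply/funext => h; rewrite /F /G /= addr0 scale0r add0r [_%:A]mulr1.
Qed.

End smooth.

Section smooth_comp.
Context {R : realType} {V : normedModType R} {I : Type} (D : I -> V).
Implicit Types f g : V -> R.

Definition smooth1 := smooth (fun _ : unit => (1 : R)).

Lemma smooth1_is_derive (eta : R -> R) (t : R) : smooth1 eta ->
  is_derive t 1 eta (dpart (fun _ : unit => (1 : R)) tt eta t).
Proof. by move=> se; apply/derivableP/(@smooth_derivable _ _ _ (fun _ : unit => (1 : R)) eta tt). Qed.

Lemma dpart_comp i (eta : R -> R) f x : smooth1 eta -> derivable f x (D i) ->
  dpart D i (fun y => eta (f y)) x = dpart (fun _ : unit => (1 : R)) tt eta (f x) * dpart D i f x.
Proof.
move=> se df; apply: is_derive_dpart.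
by apply: dpart_comp_is_derive => //; exact: (smooth1_is_derive (f x)).
Qed.

Lemma smooth_comp (eta : R -> R) f : smooth1 eta -> smooth D f ->
  smooth D (fun x => eta (f x)).
Proof.
move=> se sf k; elim: k eta se => [|k IH] eta se.
  split=> // x; apply: (@continuous_comp _ _ _ f eta); [exact: smooth_cont sf _|exact: smooth_cont se _].
split=> [x|i].
  apply: (@continuous_comp _ _ _ f eta); [exact: smooth_cont sf _|exact: smooth_cont se _].
split=> [x|].
  have [] := @dpart_comp_is_derive _ _ _ D i eta _ f x (smooth_derivable sf) (smooth1_is_derive (f x) se).
  by [].
apply: eq_Ck (fun x => esym (dpart_comp se (smooth_derivable (D := D) (i := i) (x := x) sf))) _.
apply: CkM; first by apply: IH; exact: smooth_dpart.
by apply: smooth_dpart.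
Qed.

Lemma dpart_bound i f (C : R) (x : V) (h : R) : (forall x, derivable f x (D i)) ->
  (forall x, `|dpart D i f x| <= C) ->
  `|f (h *: D i + x) - f x| <= C * `|h|.
Proof.
move=> df dC.
wlog h0 : h x / 0 <= h.
  move=> H; have [h0|h0] := leP 0 h; first exact: H.
  have := H (- h) (h *: D i + x); rewrite oppr_ge0 (ltW h0) normrN distrC.
  by rewrite addrA -scalerDl addNr scale0r add0r; apply.
pose g (t : R) := f (t *: D i + x).
have dg (t : R) : is_derive t 1 g (dpart D i f (t *: D i + x)).
  by apply: is_derive_line; exact: derivableP.
have cg : continuous g.
  by move=> t; apply/differentiable_continuous/derivable1_diffP; have [] := dg t.
have [c _] := @MVT_segment _ g _ 0 h h0 (fun t _ => dg t) (continuous_subspaceT cg).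
rewrite /g scale0r add0r subr0 => ->; rewrite normrM; exact: ler_wpM2r.
Qed.

End smooth_comp.

Section exp_bump.
Context {R : realType}.

(* The family is stable under derivation up to linear combinations, hence consists of smooth functions; [einv 0] is [exp (-1/t)] for [t > 0]. *)
Definition einv (k : nat) (t : R) : R := if 0 < t then t^-1 ^+ k * expR (- t^-1) else 0.

Lemma einv_ge0 k t : 0 <= einv k t.
Proof.
rewrite /einv; case: ltP => // t0; by rewrite mulr_ge0 ?expR_ge0// exprn_ge0// invr_ge0 ltW.
Qed.

Lemma einv_gt0 k t : 0 < t -> 0 < einv k t.
Proof. by move=> t0; rewrite /einv t0 mulr_gt0 ?expR_gt0// exprn_gt0// invr_gt0. Qed.

(** The Taylor lower bound of order [k + 1] for [expR] at [t^-1]; the order beyond [k] supplies the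
    factor that vanishes at 0. *)
Lemma einv_le k t : einv k t <= k.+1`!%:R * `|t|.
Proof.
rewrite /einv; case: ltP => t0; last by rewrite mulr_ge0.
rewrite (ger0_norm (ltW t0)) -ler_pdivrMr// mulrAC -exprSr expRN.
rewrite ler_pdivrMr ?expR_gt0//.
have := @expR_ge1Dxn R t^-1 k; rewrite invr_ge0 (ltW t0) => /(_ isT).
rewrite -ler_pdivrMl ?ltr0n ?fact_gt0// mulrC => h.
by apply: le_trans h; rewrite lerDr.
Qed.

Lemma einvS k t : t^-1 * einv k t = einv k.+1 t.
Proof. by rewrite /einv; case: ltP => t0; rewrite ?mulr0// mulrA exprS. Qed.

Lemma is_derive_einv k (t : R) :
  is_derive t 1 (einv k) (einv k.+2 t - k%:R * einv k.+1 t).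
Proof.
have [t0|t0|t0] := ltgtP 0 t.
- have t1 : t != 0 by rewrite gt_eqF.
  have d1 : is_derive t 1 (fun s : R => s^-1) (- t^-1 ^+ 2).
    apply: is_derive_eq; first exact: (is_deriveV t1 (is_derive_id t 1)).
    by rewrite /= [_ *: _]mulr1 exprVn.
  have d2 : is_derive t^-1 1 (fun y : R => y ^+ k) (k%:R * t^-1 ^+ k.-1).
    apply: DeriveDef; first exact: exprn_derivable.
    by rewrite exp_derive /= -[X in X = _]/(k%:R * t^-1 ^+ k.-1 * 1) mulr1.
  have d3 := is_derive1_comp d2 d1.
  have d4 := @is_derive1_comp R expR (fun s => - s^-1) t _ _ (is_derive_expR (- t^-1)) (is_deriveN d1).
  have d5 := is_deriveM d3 d4.
  apply: (@near_eq_is_derive _ _ _ _ _ t 1 _ _ (is_derive_eq d5 _)).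
    have : nbhs t [set s : R | 0 < s] by apply: open_nbhs_nbhs; split => //; exact: open_gt.
    by apply: filterS => s /= s0; rewrite /einv s0.
  rewrite /einv t0.
  transitivity (t^-1 ^+ k * (expR (- t^-1) * - - t^-1 ^+ 2) + expR (- t^-1) * (k%:R * t^-1 ^+ k.-1 * - t^-1 ^+ 2)); first by [].
  clear; move: t^-1 => {}t.
  by case: (k) => [|k'] /=; rewrite ?exprS; ring.
- have E s : s <= 0 -> einv k s = 0 by rewrite leNgt /einv => /negbTE ->.
  apply: (@near_eq_is_derive _ _ _ (cst 0) _ t 1).
    have : nbhs t [set s : R | s < 0] by apply: open_nbhs_nbhs; split => //; exact: open_lt.
    by apply: filterS => s /= s0; rewrite E// ltW.
  apply: (is_derive_eq (is_derive_cst (0 : R) t 1)).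
  by rewrite /einv ltNge (ltW t0)/= mulr0 subrr.
- rewrite -t0.
  (* At 0 the difference quotient of [einv k] is [einv k.+1] itself, which tends to 0 by
     [einv_le]. *)
  have E : (fun h : R => h^-1 *: (einv k (h *: (1 : R) + 0) - einv k 0)) = einv k.+1.
    apply/funext => h; rewrite addr0 [h *: _]mulr1 {2}/einv ltxx subr0.
    exact: einvS.
  have H : (fun h : R => h^-1 *: (einv k (h *: (1 : R) + 0) - einv k 0)) @ 0^' --> (0 : R).
    rewrite E; apply/cvgr0Pnorm_le => e e0.
    exists (e / k.+2`!%:R); first by rewrite /= divr_gt0.
    move=> h /=; rewrite sub0r normrN => /ltW he _.
    rewrite ger0_norm ?einv_ge0// (le_trans (einv_le _ _))//.
    by rewrite mulrC -ler_pdivlMr.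
  apply: DeriveDef; first by apply/cvg_ex; exists 0.
  by rewrite /einv !ltxx mulr0 subrr; apply: cvg_lim.
Qed.

Lemma smooth_einv k : smooth1 (einv k).
Proof.
move=> n; elim: n k => [|n IH] k.
  split=> // t; apply/differentiable_continuous/derivable1_diffP.
  by have [] := is_derive_einv k t.
split=> [t|[]].
  by apply/differentiable_continuous/derivable1_diffP; have [] := is_derive_einv k t.
split=> [t|]; first by have [] := is_derive_einv k t.
apply: (@eq_Ck _ _ _ _ _ (fun t => einv k.+2 t + (- k%:R) * einv k.+1 t)).
  move=> t; have [_] := is_derive_einv k t.
  by rewrite /dpart => ->; rewrite mulNr.
by apply: CkD => //; apply: CkM => //; exact: Ck_cst.
Qed.

End exp_bump.

(** * Test functions, the bump on the unit cube and mollifying kernels *)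

Section test_functions.
Context {R : realType} {n : nat}.
Local Notation E := 'rV[R]_n.
Local Notation mu := (lebesgue_rV R n).
Implicit Types phi psi : E -> R.

Definition unit_vec (k : 'I_n) : E := delta_mx 0 k.

Lemma partialE k phi : partial k phi = dpart unit_vec k phi.
Proof. by []. Qed.

Definition bdd_supp phi := exists M : R, forall x : E, M <= `|x| -> phi x = 0.

Lemma open_normlt M : open [set x : E | `|x| < M].
Proof.
apply: (@open_comp _ _ (fun x : E => `|x|) [set y | y < M]); last exact: open_lt.
by move=> x _; exact: norm_continuous.
Qed.

Lemma open_normgt M : open [set x : E | M < `|x|].
Proof.
apply: (@open_comp _ _ (fun x : E => `|x|) [set y | M < y]); last exact: open_gt.
by move=> x _; exact: norm_continuous.
Qed.

Lemma closed_normle M : closed [set x : E | `|x| <= M].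
Proof.
rewrite (_ : mkset _ = ~` [set x : E | M < `|x|]); first by apply: open_closedC; exact: open_normgt.
by apply/seteqP; split => x /=; rewrite leNgt => /negP.
Qed.

Lemma test_functionP phi : test_function phi <-> smooth unit_vec phi /\ bdd_supp phi.
Proof.
split=> [[dphi cphi cpt]|[sphi [M hM]]].
  split.
    move=> k; elim: k phi dphi cphi {cpt} => [|k IH] phi dphi cphi.
      by split => //; exact: (cphi [::]).
    split=> [|i]; first exact: (cphi [::]).
    split=> [x|]; first exact: (dphi [::]).
    have E s : iter_partial s (dpart unit_vec i phi) = iter_partial (rcons s i) phi.
      by rewrite /iter_partial foldr_rcons.
    by apply: IH => s; rewrite E.
  have [M [Mr hM]] := compact_bounded cpt.
  (* [compact_bounded] bounds the support by any number above [M]; it is used with [M + 1], and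
     [M + 2] exceeds that strictly. *)
  exists (M + 2) => x xM; apply: contrapT => /eqP phix.
  have cx : closure [set x | phi x != 0] x by apply: subset_closure.
  have /= := hM (M + 1) _ x; rewrite ltrDl => /(_ ltr01 cx).
  by move=> h; have := le_trans xM h; rewrite lerD2l leNgt ltr1n.
have sp s : smooth unit_vec (iter_partial s phi).
  by elim: s => //= i s IH; exact: smooth_dpart.
split=> [s k x|s|]; [exact: smooth_derivable|exact: smooth_cont|].
apply: bounded_closed_compact; last exact: closed_closure.
have h : closure [set x | phi x != 0] `<=` [set x : E | `|x| <= M].
  rewrite closureE; apply: smallest_sub.
    exact: closed_normle.
  move=> x /=; apply: contraNT; rewrite -ltNge => /ltW /hM ->.
  by rewrite eqxx.
exists M; split; first exact: num_real.
by move=> y My x /h /= xM; rewrite (le_trans xM)// ltW.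
Qed.

Lemma smooth_coord (i : 'I_n) : smooth unit_vec (fun x : E => x 0 i).
Proof.
apply: (@smooth_linear _ _ _ _ _ (fun k => (k == i)%:R)); first exact: coord_continuous.
move=> x k.
have H : (fun h : R => h^-1 *: (((h *: unit_vec k + x) 0 i) - x 0 i)) @ 0^' --> ((k == i)%:R : R).
  apply: cvg_near_cst; exists 1 => //= h _ h0.
  by rewrite !mxE eqxx /= addrK [_ *: _]mulKf// eq_sym.
by apply: DeriveDef; [apply/cvg_ex; exists (k == i)%:R|apply: cvg_lim].
Qed.

(** A product over coordinates is positive exactly on the open unit cube, which is the unit ball of
    the sup norm carried by row vectors. *)
Definition mbump (x : E) : R := \prod_i (einv 0 (1 - x 0 i) * einv 0 (1 + x 0 i)).

Lemma smooth_affine (a b : R) : smooth1 (fun t : R => a + b * t).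
Proof.
move=> k; apply: CkD; first exact: Ck_cst.
apply: CkM; first exact: Ck_cst.
apply: (@smooth_linear _ _ _ _ _ (fun=> 1)); first by move=> x; exact: cvg_id.
Qed.

Lemma smooth_mbump (c : R) : smooth unit_vec (fun x => mbump (c *: x)).
Proof.
rewrite /mbump; apply: smooth_prod => i k; apply: CkM.
  apply: (@eq_Ck _ _ _ _ _ (fun x : E => einv 0 (1 + (- c) * x 0 i))).
    by move=> x; rewrite !mxE mulNr.
  apply: smooth_comp; first exact: smooth_einv.
  exact: (smooth_comp (smooth_affine 1 (-c)) (smooth_coord i)).
apply: (@eq_Ck _ _ _ _ _ (fun x : E => einv 0 (1 + c * x 0 i))).
  by move=> x; rewrite !mxE.
apply: smooth_comp; first exact: smooth_einv.
exact: (smooth_comp (smooth_affine 1 c) (smooth_coord i)).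
Qed.

Lemma mbump_ge0 x : 0 <= mbump x.
Proof. by apply: prodr_ge0 => i _; rewrite mulr_ge0 ?einv_ge0. Qed.

Lemma mbump_gt0 (x : E) : `|x| < 1 -> 0 < mbump x.
Proof.
move=> x1; apply: prodr_gt0 => i _; have := le_lt_trans (coord_norm x i) x1.
by rewrite ltr_norml => /andP[h1 h2]; rewrite mulr_gt0 ?einv_gt0//; lra.
Qed.

Lemma mbump_eq0 (x : E) : 1 <= `|x| -> mbump x = 0.
Proof.
move=> x1; have [i xi] : exists i, 1 <= `|x 0 i|.
  apply: contrapT => h; move: x1; rewrite leNgt => /negP; apply.
  by apply/normrV_ltP => // i; rewrite ltNge; apply/negP => xi; apply: h; exists i.
rewrite /mbump (bigD1 i)//= (_ : _ * _ = 0) ?mul0r//.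
have [h|h] := lerP 1 (x 0 i).
  by rewrite {1}/einv (_ : (0 < 1 - x 0 i) = false) ?mul0r//; apply/negbTE; rewrite -leNgt; lra.
have {}xi : (0 < 1 + x 0 i) = false.
  by apply/negbTE; rewrite -leNgt; move: xi; rewrite ler_normr => /orP[h'|h']; lra.
by rewrite /einv xi mulr0 mul0r.
Qed.

Lemma test_smooth phi : test_function phi -> smooth unit_vec phi.
Proof. by move=> /test_functionP[]. Qed.

Lemma test_supp phi : test_function phi -> bdd_supp phi.
Proof. by move=> /test_functionP[]. Qed.

Lemma test_cont phi : test_function phi -> continuous phi.
Proof. by move=> /test_smooth /smooth_cont. Qed.

Lemma test_meas phi : test_function phi -> measurable_fun setT phi.
Proof. by move=> /test_cont; exact: continuous_measurable_rV. Qed.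

Lemma test_derivable phi k x : test_function phi -> derivable phi x (unit_vec k).
Proof. by move=> /test_smooth; exact: smooth_derivable. Qed.

Lemma bdd_supp_dpart phi k : bdd_supp phi -> bdd_supp (partial k phi).
Proof.
move=> [M hM]; exists (M + 1) => x xM.
rewrite /partial (@near_eq_derive _ _ _ phi (cst 0) x (delta_mx 0 k)); first by rewrite derive_cst.
have : nbhs x [set y : E | M < `|y|].
  apply: open_nbhs_nbhs; split; first exact: open_normgt.
  by apply: lt_le_trans xM; rewrite ltrDl.
by apply: filterS => y /= /ltW /hM ->.
Qed.

Lemma test_partial phi k : test_function phi -> test_function (partial k phi).
Proof.
move=> /test_functionP[s b]; apply/test_functionP; split; first exact: smooth_dpart.
exact: bdd_supp_dpart.
Qed.

Lemma test_mulS (g phi : E -> R) : smooth unit_vec g -> test_function phi ->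
  test_function (fun x => g x * phi x).
Proof.
move=> sg /test_functionP[s [M hM]]; apply/test_functionP; split; first exact: smoothM.
by exists M => x /hM ->; rewrite mulr0.
Qed.

Lemma test_add phi psi : test_function phi -> test_function psi ->
  test_function (fun x => phi x + psi x).
Proof.
move=> /test_functionP[s [M hM]] /test_functionP[s' [M' hM']]; apply/test_functionP; split.
  exact: smoothD.
exists (Num.max M M') => x; rewrite ge_max => /andP[/hM -> /hM' ->].
by rewrite addr0.
Qed.

Lemma test_scale c phi : test_function phi -> test_function (fun x => c * phi x).
Proof. by apply: test_mulS; exact: smooth_cst. Qed.

Lemma test_shift (a : E) phi : test_function phi -> test_function (fun x => phi (x + a)).
Proof.
move=> /test_functionP[s [M hM]]; apply/test_functionP; split; first exact: smooth_shift.
exists (M + `|a|) => x xM; apply: hM.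
have := ler_normB (x + a) a; rewrite addrK => h.
by rewrite -(lerD2r `|a|) (le_trans xM).
Qed.

Lemma test_comp (eta : R -> R) phi : smooth1 eta -> eta 0 = 0 -> test_function phi ->
  test_function (fun x => eta (phi x)).
Proof.
move=> se e0 /test_functionP[s [M hM]]; apply/test_functionP; split; first exact: smooth_comp.
by exists M => x /hM ->.
Qed.

Lemma cont_supp_bounded phi : continuous phi -> bdd_supp phi ->
  exists2 C, 0 <= C & forall x, `|phi x| <= C.
Proof.
move=> cphi [M hM].
have cA : compact [set x : E | `|x| <= `|M|].
  apply: bounded_closed_compact.
    exists `|M|; split; first exact: num_real.
    by move=> y My x /= xM; rewrite (le_trans xM)// ltW.
  exact: closed_normle.
have cn : continuous (fun x => `|phi x|).
  by move=> x; apply: (@continuous_comp _ _ _ phi (fun y => `|y|)); [exact: cphi|exact: norm_continuous].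
have [|c _ hc] := EVT_max_rV _ cA (continuous_subspaceT cn).
  by exists 0 => /=; rewrite normr0.
exists `|phi c| => // x; have [xM|xM] := leP `|x| `|M|; first by apply: hc; rewrite inE.
by rewrite hM ?normr0// (le_trans (ler_norm M))// ltW.
Qed.

Lemma test_bounded phi : test_function phi -> exists2 C, 0 <= C & forall x, `|phi x| <= C.
Proof. by move=> /test_functionP[/smooth_cont c b]; exact: cont_supp_bounded. Qed.

Lemma test_lipschitz phi k : test_function phi ->
  exists2 C, 0 <= C & forall (x : E) (h : R), `|phi (x + h *: unit_vec k) - phi x| <= C * `|h|.
Proof.
move=> tp; have [C C0 hC] := test_bounded (test_partial k tp); exists C => // x h.
rewrite [x + _]addrC; apply: (@dpart_bound R _ _ unit_vec k phi C x h _ hC) => y.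
exact: test_derivable.
Qed.

Lemma test_mbump (c b : R) : 0 < c -> test_function (fun x => b * mbump (c *: x)).
Proof.
move=> c0; apply: test_scale; apply/test_functionP; split; first exact: smooth_mbump.
exists c^-1 => x xc; apply: mbump_eq0; rewrite normrZ gtr0_norm//.
by rewrite -ler_pdivrMl ?mulr1.
Qed.

Definition kball (M : R) : set E := [set x : E | `|x| < M].

Lemma measurable_kball M : measurable (kball M).
Proof. by apply: open_measurable_rV; exact: open_normlt. Qed.

Lemma integrable_bdd_supp (f : E -> R) (C M : R) : measurable_fun setT f ->
  (forall x, `|f x| <= C) -> (forall x, M <= `|x| -> f x = 0) ->
  mu.-integrable setT (EFin \o f).
Proof.
move=> mf fC fM.
apply: (@integrable_le _ _ _ mu f (fun x => C * \1_(kball M) x)) => //.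
  apply: integrableZlr; apply/Ipow1P.
    by apply: measurable_ind; exact: measurable_kball.
  by rewrite Ipow_ind//; [exact: lebesgue_rV_ball_lty|exact: measurable_kball].
move=> x; rewrite indicE; case: (boolP (x \in kball M)) => h; first by rewrite mulr1.
rewrite fM ?normr0 ?mulr0// leNgt; apply/negP => xM; move/negP: h; apply.
exact: mem_set.
Qed.

Lemma test_integrable phi : test_function phi -> mu.-integrable setT (EFin \o phi).
Proof.
move=> tp; have [C _ hC] := test_bounded tp; have [M hM] := test_supp tp.
by apply: integrable_bdd_supp hC hM; exact: test_meas.
Qed.

Lemma kernel_exists (e : R) : 0 < e -> exists rho : E -> R, [/\ test_function rho,
  forall x, 0 <= rho x, forall x, e <= `|x| -> rho x = 0 & \int[mu]_x rho x = 1].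
Proof.
move=> e0; pose b (x : E) := mbump (e^-1 *: x).
have ei : 0 < e^-1 by rewrite invr_gt0.
have tb : test_function b.
  have := @test_mbump e^-1 1 ei; rewrite (_ : (fun x => _) = b)//.
  by apply/funext => x; rewrite mul1r.
have b0 x : 0 <= b x by exact: mbump_ge0.
have ib := test_integrable tb.
set I := \int[mu]_x b x.
have I0 : 0 < I.
  rewrite lt_neqAle Rintegral_ge0// andbT; apply/negP => /eqP h.
  have ib0 : Ipow mu 1 b = 0%E.
    rewrite /Ipow.
    transitivity (\int[mu]_x (b x)%:E)%E.
      by apply: eq_integral => x _; rewrite expr1 ger0_norm.
    by rewrite -[LHS]fineK ?(integrable_fin_num _ ib)//; congr EFin.
  have /(Ipow_eq0 (ltn0Sn 0) (test_meas tb)) [N [mN N0 hN]] := ib0.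
  (* If the integral were 0, [b] would vanish almost everywhere; but it is positive on this cube,
     whose measure is positive. *)
  pose c : E := const_mx (e / 2).
  have : (mu (cbox (- c) c) <= mu N)%E.
    rewrite le_measure ?inE//; first exact: measurable_cbox.
    move=> x /= xc; apply: hN => /= bx.
    have : 0 < b x.
      apply: mbump_gt0; rewrite normrZ gtr0_norm// mulrC ltr_pdivrMr// mul1r.
      apply/normrV_ltP => // i; have := xc i; rewrite !mxE -ler_norml => h'.
      by apply: le_lt_trans h' _; rewrite ltr_pdivrMr// ltr_pMr// ltr1n.
    by rewrite bx ltxx.
  rewrite N0 lebesgue_rV_box => [|i]; last by rewrite !mxE; lra.
  rewrite lee_fin leNgt => /negP; apply.
  by apply: prodr_gt0 => i _; rewrite !mxE; lra.
exists (fun x => I^-1 * b x); split.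
- exact: test_scale.
- by move=> x; rewrite mulr_ge0// invr_ge0 ltW.
- move=> x xe; rewrite /b mbump_eq0 ?mulr0// normrZ gtr0_norm// mulrC.
  by rewrite ler_pdivlMr// mul1r.
- by rewrite RintegralZl// -/I mulVf// gt_eqF.
Qed.

End test_functions.

(** * Mollification and weak derivatives *)

Section weak_derivatives.
Context {R : realType} {n : nat}.
Local Notation E := 'rV[R]_n.
Local Notation mu := (lebesgue_rV R n).
Local Notation uv := (@unit_vec R n).
Implicit Types f g phi psi : E -> R.

Definition dquot (k : 'I_n) (h : R) phi (x : E) : R := h^-1 * (phi (x + h *: uv k) - phi x).

Lemma dquot_cvg k phi x (h : nat -> R) : derivable phi x (uv k) ->
  (forall m, h m != 0) -> h m @[m --> \oo] --> 0 ->
  dquot k (h m) phi x @[m --> \oo] --> partial k phi x.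
Proof.
move=> dphi h0 hc; rewrite /dquot /partial /derive.
have /cvgr_dnbhsP/(_ h (conj h0 hc)) := dphi.
by under eq_fun do rewrite /= [_ + x]addrC.
Qed.

Lemma measurable_dquot k h phi : measurable_fun setT phi -> measurable_fun setT (dquot k h phi).
Proof. by move=> mphi; apply: measurable_funM => //; exact: measurable_shift_sub. Qed.

Lemma dquot_bound k phi (C : R) : (forall x h, `|phi (x + h *: uv k) - phi x| <= C * `|h|) ->
  forall x h, h != 0 -> `|dquot k h phi x| <= C.
Proof.
move=> H x h h0; rewrite normrM normfV ler_pdivrMl ?normr_gt0// mulrC.
exact: H.
Qed.

Lemma Rintegral_dquot k h phi : mu.-integrable setT (EFin \o phi) ->
  \int[mu]_x dquot k h phi x = 0.
Proof.
move=> iphi.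
have mphi : measurable_fun setT phi by apply/measurable_EFinP; exact: measurable_int iphi.
rewrite RintegralZl//; last by apply: integrableBr => //; exact: integrable_rV_shift.
rewrite RintegralB//; last exact: integrable_rV_shift.
by rewrite Rintegral_rV_shift// subrr mulr0.
Qed.

Definition hseq (m : nat) : R := m.+1%:R^-1.

Lemma hseq_gt0 m : 0 < hseq m. Proof. by rewrite invr_gt0. Qed.

Lemma hseq_cvg0 : hseq m @[m --> \oo] --> 0. Proof. exact: cvg_harmonic. Qed.

Lemma hseq_le1 m : hseq m <= 1. Proof. by rewrite invf_le1// ler1n. Qed.

Lemma norm_unit_vec k : `|uv k| <= 1.
Proof.
apply/normrV_leP => // i; rewrite !mxE; case: (_ && _) => /=; by rewrite ?normr1 ?normr0.
Qed.

Lemma dquot_supp k h phi M : `|h| <= 1 -> (forall x, M <= `|x| -> phi x = 0) ->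
  forall x, M + 1 <= `|x| -> dquot k h phi x = 0.
Proof.
move=> h1 hM x xM; rewrite /dquot !hM ?subrr ?mulr0//.
  by apply: le_trans xM; rewrite lerDl.
have := ler_normB (x + h *: uv k) (h *: uv k); rewrite addrK normrZ => h2.
have := norm_unit_vec k => h3.
have : `|h| * `|uv k| <= 1 by rewrite mulr_ile1.
lra.
Qed.

(** Difference quotients have integral 0 by translation invariance, and they converge dominatedly to
    the derivative. *)
Lemma Rintegral_partial0 k phi : test_function phi -> \int[mu]_x partial k phi x = 0.
Proof.
move=> tp; have [C C0 hC] := test_lipschitz k tp; have [M hM] := test_supp tp.
have h0 m : hseq m != 0 by rewrite gt_eqF// hseq_gt0.
have H : \int[mu]_x dquot k (hseq m) phi x @[m --> \oo] --> \int[mu]_x partial k phi x.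
  apply: (@dct_Rintegral _ _ _ mu _ _ (fun x => C * \1_(kball (M + 1)) x)).
  - by move=> m; apply: measurable_dquot; exact: test_meas.
  - by apply: test_meas; exact: test_partial.
  - apply: (@integrable_bdd_supp _ _ _ C (M + 1)).
    + by apply: measurable_funM => //; apply: measurable_ind; exact: measurable_kball.
    + move=> x; rewrite indicE; case: (_ \in _); rewrite ?mulr1 ?mulr0 ?normr0//.
      by rewrite ger0_norm.
    + move=> x xM; rewrite indicE memNset ?mulr0//= /kball /=; apply/negP.
      by rewrite -leNgt.
  - move=> m x; rewrite indicE; case: (boolP (x \in _)) => h.
      by rewrite mulr1; exact: dquot_bound.
    rewrite (dquot_supp k _ hM) ?normr0 ?mulr0//.
      by rewrite ger0_norm ?hseq_le1// ltW// hseq_gt0.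
    rewrite leNgt; apply/negP => xM; move/negP: h; apply; exact: mem_set.
  - move=> x; apply: dquot_cvg => //; [exact: test_derivable|exact: hseq_cvg0].
have -> : \int[mu]_x partial k phi x = lim (\int[mu]_x dquot k (hseq m) phi x @[m --> \oo]).
  by apply/esym/cvg_lim.
under eq_fun do rewrite Rintegral_dquot ?test_integrable//.
exact: lim_cst.
Qed.

Lemma partialM k phi psi x : smooth uv phi -> smooth uv psi ->
  partial k (fun x => phi x * psi x) x = phi x * partial k psi x + partial k phi x * psi x.
Proof.
move=> sf sg; rewrite [RHS]addrC [_ * psi x]mulrC addrC.
by apply: (@dpartM _ _ _ uv k phi psi _ _ x) => y; exact: smooth_derivable.
Qed.

Lemma seq_continuous (f : E -> R) : (forall (x : E) (u : nat -> E), u m @[m --> \oo] --> x ->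
  f (u m) @[m --> \oo] --> f x) -> continuous f.
Proof.
move=> H x A /nbhs_ballP[e e0 hA]; apply: contrapT => h.
have {}h m : exists y : E, `|x - y| < hseq m /\ e <= `|f x - f y|.
  apply: contrapT => h'; apply: h.
  apply/nbhs_ballP; exists (hseq m); first exact: hseq_gt0.
  move=> y; rewrite -ball_normE /= => xy; apply: contrapT => fxA.
  by apply: h'; exists y; split => //; rewrite leNgt; apply/negP => fe; apply: fxA; apply: hA.
have [u hu] := choice h.
have uc : u m @[m --> \oo] --> x.
  apply/cvgrPdist_lt => d d0; have /cvgrPdist_lt/(_ _ d0) := hseq_cvg0.
  apply: filterS => m; rewrite sub0r normrN gtr0_norm ?hseq_gt0// => h'.
  by apply: lt_trans h'; have [] := hu m.
have /cvgrPdist_lt/(_ _ e0)[N _ /(_ N (leqnn _)) /=] := H x u uc.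
by have [_] := hu N; rewrite leNgt => /negP.
Qed.

Lemma moll_shift (rho f : E -> R) (x : E) : measurable_fun setT f -> measurable_fun setT rho ->
  moll rho f x = \int[mu]_y (f y * rho (y - x)).
Proof.
move=> mf mrho; rewrite /moll -[RHS](Rintegral_rV_shift x).
  by apply: eq_Rintegral => y _; rewrite addrK addrC.
by apply: measurable_funM => //; exact: measurable_fun_rV_shift.
Qed.

Lemma integrableM_bdd f g (C : R) : mu.-integrable setT (EFin \o f) -> measurable_fun setT g ->
  (forall x, `|g x| <= C) -> mu.-integrable setT (EFin \o (fun x => f x * g x)).
Proof.
move=> fi mg gC.
have mf : measurable_fun setT f by apply/measurable_EFinP; exact: measurable_int fi.
apply: (@integrable_le _ _ _ mu _ (fun x => C * `|f x|)).
- exact: measurable_funM.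
- by apply: integrableZlr; exact: integrable_norm.
- by move=> x; rewrite normrM mulrC ler_wpM2r.
Qed.

Section moll_test.
Variables (f : E -> R) (M : R).
Hypotheses (fi : mu.-integrable setT (EFin \o f)) (fM : forall x, M <= `|x| -> f x = 0).

Let mf : measurable_fun setT f.
Proof. by apply/measurable_EFinP; exact: measurable_int fi. Qed.

Lemma moll_continuous rho : test_function rho -> continuous (moll rho f).
Proof.
move=> tr; apply: seq_continuous => x u ux.
have [C C0 hC] := test_bounded tr; have mr := test_meas tr.
under eq_fun do rewrite moll_shift//.
rewrite moll_shift//.
apply: (@dct_Rintegral _ _ _ mu _ _ (fun y => C * `|f y|)).
- by move=> m; apply: measurable_funM => //; exact: measurable_fun_rV_shift.
- by apply: measurable_funM => //; exact: measurable_fun_rV_shift.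
- by apply: integrableZlr; exact: integrable_norm.
- by move=> m y; rewrite normrM mulrC ler_wpM2r.
- move=> y; apply: cvgM; first exact: cvg_cst.
  have h : (y : E) - u m @[m --> \oo] --> (y : E) - x by apply: cvgB => //; exact: cvg_cst.
  have cr : continuous rho := test_cont tr.
  exact: (cvg_comp _ _ h (cr ((y : E) - x))).
Qed.

Lemma moll_is_derive rho k x : test_function rho ->
  is_derive x (uv k) (moll rho f) (- moll (partial k rho) f x).
Proof.
move=> tr; have [C C0 hC] := test_lipschitz k tr; have mr := test_meas tr.
have mpr := test_meas (test_partial k tr).
have [B B0 hB] := test_bounded tr.
have ir y : mu.-integrable setT (EFin \o (fun z => f z * rho (z - y))).
  by apply: integrableM_bdd => //; exact: measurable_fun_rV_shift.
have H : (fun h : R => h^-1 *: (moll rho f (h *: uv k + x) - moll rho f x)) @ 0^' -->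
    (- moll (partial k rho) f x).
  apply/cvgr_dnbhsP => h [h0 hc].
  (* An increment [h m] of [x] is an increment [- h m] of the argument [y - x] of the kernel. *)
  rewrite (_ : (fun m => _) = (fun m => - \int[mu]_y (f y * dquot k (- h m) rho (y - x)))).
    apply: cvgN; rewrite moll_shift//.
    apply: (@dct_Rintegral _ _ _ mu _ _ (fun y => C * `|f y|)).
    - move=> m; apply: measurable_funM => //.
      by apply: (@measurable_fun_rV_shift _ _ _ _ (dquot k (- h m) rho)); exact: measurable_dquot.
    - by apply: measurable_funM => //; exact: measurable_fun_rV_shift.
    - by apply: integrableZlr; exact: integrable_norm.
    - move=> m y; rewrite normrM mulrC ler_wpM2r//.
      by apply: dquot_bound => //; rewrite oppr_eq0.
    - move=> y; apply: cvgM; first exact: cvg_cst.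
      apply: dquot_cvg; [exact: test_derivable|by move=> m; rewrite oppr_eq0|].
      by rewrite -oppr0; exact: cvgN.
  apply/funext => m; transitivity ((h m)^-1 * (moll rho f (h m *: uv k + x) - moll rho f x)); first by [].
  rewrite !moll_shift// -RintegralB// -RintegralZl//; last exact: integrableBr.
  rewrite -mulN1r -RintegralZl//; last first.
    apply: (@integrableM_bdd _ _ C) => //.
      by apply: (@measurable_fun_rV_shift _ _ _ _ (dquot k (- h m) rho)); exact: measurable_dquot.
    by move=> y; apply: dquot_bound => //; rewrite oppr_eq0.
  apply: eq_Rintegral => y _; rewrite /dquot invrN scaleNr.
  rewrite (_ : y - x - h m *: uv k = y - (h m *: uv k + x)); first by ring.
  by rewrite opprD addrA addrAC.
by apply: DeriveDef; [apply/cvg_ex; exists (- moll (partial k rho) f x)|apply: cvg_lim].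
Qed.

Lemma test_moll rho : test_function rho -> test_function (moll rho f).
Proof.
move=> tr; apply/test_functionP; split.
  move=> j; elim: j rho tr => [|j IH] rho tr; first by split=> //; exact: moll_continuous.
  split=> [|k]; first exact: moll_continuous.
  split=> [x|]; first by have [] := moll_is_derive k x tr.
  apply: (@eq_Ck _ _ _ _ _ (fun x => (-1) * moll (partial k rho) f x)).
    by move=> x; rewrite mulN1r (is_derive_dpart (moll_is_derive k x tr)).
  by apply: CkM; [exact: Ck_cst|apply: IH; exact: test_partial].
have [M' hM'] := test_supp tr; exists (`|M| + `|M'|) => x xM.
rewrite /moll (_ : (fun _ => _) = fun=> 0) ; last first.
  apply/funext => y; have [yM|yM] := leP M' `|y|; first by rewrite hM' ?mulr0.
rewrite fM ?mul0r//.
have := ler_normB (x + y) y; rewrite addrK => h.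
  have h1 := ler_norm M; have h2 := ler_norm M'; lra.
by rewrite /Rintegral integral0.
Qed.

Lemma partial_moll rho k x : test_function rho ->
  partial k (moll rho f) x = - moll (partial k rho) f x.
Proof. by move=> tr; apply: (@is_derive_dpart _ _ _ uv); exact: moll_is_derive. Qed.

End moll_test.

(* Borel counterparts of [L1loc] and [weak_partial], with balls in place of compact sets. *)
Definition L1b f := measurable_fun setT f /\
  forall M : R, mu.-integrable setT (EFin \o (fun x => f x * \1_(kball M) x)).

Lemma L1bM f g : L1b f -> measurable_fun setT g ->
  (forall M, exists C, forall x, `|x| < M -> `|g x| <= C) -> L1b (fun x => g x * f x).
Proof.
move=> [mf fi] mg gb; split=> [|M]; first exact: measurable_funM.
have [C hC] := gb M.
have -> : (fun x => g x * f x * \1_(kball M) x) = (fun x => (f x * \1_(kball M) x) * (g x * \1_(kball M) x)).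
  by apply/funext => x; rewrite indicE; case: (_ \in _); rewrite /=; ring.
have mk : measurable_fun setT (\1_(kball M) : E -> R) by apply: measurable_ind; exact: measurable_kball.
apply: (@integrableM_bdd _ _ (Num.max C 0)) => //; first exact: measurable_funM.
move=> x; rewrite indicE; case: (boolP (x \in _)) => h; rewrite ?mulr1 ?mulr0 ?normr0 le_max.
  by rewrite hC//; exact: set_mem h.
by rewrite lexx orbT.
Qed.

Lemma cont_loc_bounded g : continuous g -> forall M : R, exists C, forall x : E, `|x| < M -> `|g x| <= C.
Proof.
move=> cg M.
have cA : compact [set x : E | `|x| <= M].
  apply: bounded_closed_compact; last exact: closed_normle.
  exists M; split; first exact: num_real.
  by move=> y My x /= xM; rewrite (le_trans xM)// ltW.
have cn : continuous (fun x => `|g x|).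
  by move=> x; apply: (@continuous_comp _ _ _ g (fun y => `|y|)); [exact: cg|exact: norm_continuous].
have [[y yM]|h] := pselect (exists y : E, `|y| < M).
  have [|c _ hc] := EVT_max_rV _ cA (continuous_subspaceT cn); first by exists y => /=; rewrite ltW.
  by exists `|g c| => x xM; apply: hc; rewrite inE /=; exact: ltW.
by exists 0 => x xM; exfalso; apply: h; exists x.
Qed.

Lemma L1b_smoothM f chi : L1b f -> smooth uv chi -> L1b (fun x => chi x * f x).
Proof.
move=> hf sc; apply: L1bM => //.
  by apply: continuous_measurable_rV; exact: smooth_cont sc.
by apply: cont_loc_bounded; exact: smooth_cont sc.
Qed.

Lemma L1bD f g : L1b f -> L1b g -> L1b (fun x => f x + g x).
Proof.
move=> [mf fi] [mg gi]; split=> [|M]; first exact: measurable_funD.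
under eq_fun do rewrite mulrDl.
exact: integrableDr.
Qed.

Lemma L1b_sum (J : Type) (s : seq J) (F : J -> E -> R) :
  (forall j, L1b (F j)) -> L1b (fun x => \sum_(j <- s) F j x).
Proof.
move=> hF; elim: s => [|j s IH].
  under eq_fun do rewrite big_nil.
  split=> // M; under eq_fun do rewrite mul0r.
  exact: (integrable0 mu setT).
by under eq_fun do rewrite big_cons; exact: L1bD.
Qed.

Lemma L1b_testM f phi : L1b f -> test_function phi -> mu.-integrable setT (EFin \o (fun x => f x * phi x)).
Proof.
move=> [mf fi] tp; have [C C0 hC] := test_bounded tp; have [M hM] := test_supp tp.
have -> : (fun x => f x * phi x) = (fun x => (f x * \1_(kball M) x) * phi x).
  apply/funext => x; rewrite indicE; case: (boolP (_ \in _)) => h; first by rewrite mulr1.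
  rewrite hM ?mulr0// leNgt; apply/negP => xM; move/negP: h; apply; exact: mem_set.
by apply: integrableM_bdd (fi M) _ hC; exact: test_meas.
Qed.

Lemma test_L1b phi : test_function phi -> L1b phi.
Proof.
move=> tp; split=> [|M]; first exact: test_meas.
apply: (@integrableM_bdd _ _ 1); first exact: test_integrable.
  by apply: measurable_ind; exact: measurable_kball.
by move=> x; rewrite indicE; case: (_ \in _); rewrite ?normr1 ?normr0.
Qed.

Definition wpB (k : 'I_n) f g := [/\ L1b f, L1b g & forall phi, test_function phi ->
  \int[mu]_x (f x * partial k phi x) = - \int[mu]_x (g x * phi x)].

Lemma wpB_smoothM k f g chi : wpB k f g -> smooth uv chi ->
  wpB k (fun x => chi x * f x) (fun x => chi x * g x + partial k chi x * f x).
Proof.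
move=> [hf hg H] sc; have spc : smooth uv (partial k chi) by exact: smooth_dpart.
split; first exact: L1b_smoothM.
  by apply: L1bD; exact: L1b_smoothM.
move=> phi tp; have tcp := test_mulS sc tp.
have tpcp := test_mulS spc tp.
transitivity (\int[mu]_x (f x * partial k (fun x => chi x * phi x) x) - \int[mu]_x (f x * (partial k chi x * phi x))).
  rewrite -RintegralB//; [|exact: L1b_testM (test_partial k tcp)|exact: L1b_testM].
  apply: eq_Rintegral => x _; rewrite partialM//; last exact: test_smooth.
  by ring.
rewrite H// -opprD -RintegralD//; [|exact: L1b_testM|exact: L1b_testM].
by congr (- _); apply: eq_Rintegral => x _; ring.
Qed.

Lemma wpB_test k phi : test_function phi -> wpB k phi (partial k phi).
Proof.
move=> tp; split; [exact: test_L1b|exact/test_L1b/test_partial|].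
move=> psi ts; apply/eqP; rewrite -addr_eq0 -RintegralD//.
- apply/eqP; rewrite -[RHS](Rintegral_partial0 k (test_mulS (test_smooth tp) ts)).
  by apply: eq_Rintegral => x _; rewrite partialM//; exact: test_smooth.
- by apply: L1b_testM; [exact: test_L1b|exact: test_partial].
- by apply: L1b_testM => //; apply: test_L1b; exact: test_partial.
Qed.

Lemma L1b_integrable_supp f M : L1b f -> (forall x, M <= `|x| -> f x = 0) ->
  mu.-integrable setT (EFin \o f).
Proof.
move=> [mf fi] fM; have -> : f = (fun x => f x * \1_(kball M) x); last exact: fi.
apply/funext => x; rewrite indicE; case: (boolP (_ \in _)) => h; first by rewrite mulr1.
rewrite fM ?mulr0// leNgt; apply/negP => xM; move/negP: h; apply; exact: mem_set.
Qed.

(** The weak derivative is tested against the translate of [rho] by [x]; its minus sign cancels the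
    one in [partial_moll]. *)
Lemma moll_partial rho k f g (M : R) x : wpB k f g -> test_function rho ->
  (forall x, M <= `|x| -> f x = 0) ->
  partial k (moll rho f) x = moll rho g x.
Proof.
move=> [hf hg H] tr fM; have [mf _] := hf; have [mg _] := hg.
have -> : partial k (moll rho f) x = - moll (partial k rho) f x.
  by apply: partial_moll => //; exact: L1b_integrable_supp hf fM.
rewrite !moll_shift//.
- have E1 : \int[mu]_y (f y * partial k rho (y - x)) = \int[mu]_y (f y * partial k (fun z => rho (z - x)) y).
    apply: eq_Rintegral => y _; congr (_ * _).
    exact: (esym (dpart_shift uv k rho (- x) y)).
  exact: (etrans (congr1 -%R (etrans E1 (H _ (test_shift (- x) tr)))) (opprK _)).
- exact: test_meas.
- by apply: test_meas; exact: test_partial.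
Qed.

(** Stated for all kernels of small support, so that one kernel can serve several functions at once:
    [f] with its derivatives in [sobolev_test_dense], the function and its bound in [weak_bound]. *)
Lemma moll_Ipow_small r f (M : R) : (r = 1 \/ r = 2)%N -> L1b f ->
  (forall x, M <= `|x| -> f x = 0) -> (Ipow mu r f < +oo)%E ->
  forall e : R, 0 < e -> exists2 del : R, 0 < del & forall rho, test_function rho ->
    (forall x, 0 <= rho x) -> (forall x, del <= `|x| -> rho x = 0) -> \int[mu]_x rho x = 1 ->
    (Ipow mu r (fun x => (moll rho f x - f x)%R) <= e%:E)%E.
Proof.
move=> r12 hf fM fr e e0; have [mf _] := hf.
have fi := L1b_integrable_supp hf fM.
have r0 : (0 < r)%N by case: r12 => ->.
have [del d0 hd] := transl_cont_eps (transl_cont_Ipow r0 mf fr) e0.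
exists del => // rho tr rho0 rhod rho1.
have [C C0 hC] := test_bounded tr; have mr := test_meas tr.
apply: (@Ipow_moll_le _ _ _ _ _ del) => //; last exact: ltW.
  exact: test_integrable.
move=> x; apply: (@integrableM_bdd _ _ C) => //.
have := integrable_rV_shift x fi; congr (mu.-integrable _ _).
by apply/funext => y /=; rewrite addrC.
Qed.

Lemma kernels_all (P : 'I_n -> R -> Prop) : (forall k, exists2 d : R, 0 < d & P k d) ->
  (forall k d d', 0 < d' <= d -> P k d -> P k d') -> exists2 d : R, 0 < d & forall k, P k d.
Proof.
move=> H Pm; have H' k : exists d, 0 < d /\ P k d by have [d d0 Pd] := H k; exists d.
have [d hd] := choice H'.
exists (\big[Num.min/1]_k d k).
  by elim/big_ind: _ => // [x y x0 y0|k _]; [rewrite lt_min x0|case: (hd k)].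
move=> k; apply: Pm (hd k).2; apply/andP; split; last exact: bigmin_le_cond.
by elim/big_ind: _ => // [x y x0 y0|k' _]; [rewrite lt_min x0|case: (hd k')].
Qed.

(** Mollification commutes with weak derivatives, so a kernel fine enough for [f] and all [g k] does
    it; bounded supports make the mollifications test functions. *)
Lemma sobolev_test_dense r f (g : 'I_n -> E -> R) (M : R) : (r = 1 \/ r = 2)%N ->
  (forall x, M <= `|x| -> f x = 0) -> (forall k x, M <= `|x| -> g k x = 0) ->
  (Ipow mu r f < +oo)%E -> (forall k, (Ipow mu r (g k) < +oo)%E) -> L1b f ->
  (forall k, wpB k f (g k)) -> forall e : R, 0 < e -> exists psi, [/\ test_function psi,
    (Ipow mu r (fun x => (psi x - f x)%R) <= e%:E)%E &
    forall k, (Ipow mu r (fun x => (partial k psi x - g k x)%R) <= e%:E)%E].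
Proof.
move=> r12 fM gM fr gr hf H e e0.
pose P k d := forall rho, test_function rho ->
    (forall x, 0 <= rho x) -> (forall x, d <= `|x| -> rho x = 0) -> \int[mu]_x rho x = 1 ->
    (Ipow mu r (fun x => (moll rho (g k) x - g k x)%R) <= e%:E)%E.
have [d1 d10 hd1] : exists2 d : R, 0 < d & forall k, P k d.
  apply: kernels_all => [k|k d d' /andP[_ dd] Pd rho tr r0 rd r1].
    by have [_ hg _] := H k; exact: moll_Ipow_small (gM k) (gr k) _ e0.
  by apply: Pd => // x xd; apply: rd; exact: le_trans dd xd.
have [d2 d20 hd2] := moll_Ipow_small r12 hf fM fr e0.
have [|rho [tr rho0 rhod rho1]] := @kernel_exists R n (Num.min d1 d2).
  by rewrite lt_min d10.
have fi := L1b_integrable_supp hf fM.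
exists (moll rho f); split; first exact: test_moll fi fM _ tr.
  by apply: hd2 => // x xd; apply: rhod; rewrite ge_min xd orbT.
move=> k; rewrite (_ : (fun x => _) = (fun x => moll rho (g k) x - g k x)).
  by apply: hd1 => // x xd; apply: rhod; rewrite ge_min xd.
by apply/funext => x; rewrite (moll_partial x (H k) tr fM).
Qed.

Lemma measurable_ind_kball (M : R) : measurable_fun setT (\1_(kball M) : E -> R).
Proof. by apply: measurable_ind; exact: measurable_kball. Qed.

Lemma L1b_cut f (M : R) : L1b f -> L1b (fun x => f x * \1_(kball M) x).
Proof.
move=> [mf fi]; have mk := measurable_ind_kball M.
split=> [|M']; first exact: measurable_funM.
apply: (@integrableM_bdd _ _ 1) => //; first exact: measurable_ind_kball.
by move=> x; rewrite indicE; case: (_ \in _); rewrite ?normr1 ?normr0.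
Qed.

Lemma cut_supp f (M : R) x : M <= `|x| -> f x * \1_(kball M) x = 0.
Proof.
by move=> xN; rewrite indicE memNset ?mulr0//= /kball /=; apply/negP; rewrite -leNgt.
Qed.

Lemma cut_in f (M : R) x : `|x| < M -> f x * \1_(kball M) x = f x.
Proof. by move=> xN; rewrite indicE mem_set ?mulr1. Qed.

Lemma moll_cut rho f (N : R) x : L1b f -> test_function rho ->
  (forall y, 1 <= `|y| -> rho y = 0) -> `|x| < N ->
  moll rho (fun y => f y * \1_(kball (N + 1)) y) x = \int[mu]_y (f y * rho (y - x)).
Proof.
move=> [mf _] tr rhod xN; have mr := test_meas tr.
have mc : measurable_fun setT (fun y => f y * \1_(kball (N + 1)) y).
  by apply: measurable_funM => //; exact: measurable_ind_kball.
rewrite (moll_shift x mc mr); apply: eq_Rintegral => y _.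
have [yN|yN] := ltP `|y| (N + 1); first by rewrite cut_in.
rewrite cut_supp// mul0r rhod ?mulr0//.
by have := ler_normB (y - x) (- x); rewrite opprK subrK normrN; lra.
Qed.

(* The two-sided bound is inherited by the mollifications of [g], which converge to [g] in L^1_loc. *)
Lemma weak_bound g (kap : E -> R) : L1b g -> L1b kap -> (forall phi, test_function phi ->
    (forall x, 0 <= phi x) -> \int[mu]_x phi x = 1 ->
    `|\int[mu]_x (g x * phi x)| <= \int[mu]_x (kap x * phi x)) ->
  {ae mu, forall x, `|g x| <= kap x}.
Proof.
move=> hg hkap H; have [mg gi] := hg; have [mkap kapi] := hkap.
have key (N : nat) : {ae mu, forall x, `|x| < N%:R -> `|g x| <= kap x}.
  pose f x := g x * \1_(kball (N%:R + 1)) x.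
  pose f' x := kap x * \1_(kball (N%:R + 1)) x.
  have hf : L1b f by exact: L1b_cut.
  have hf' : L1b f' by exact: L1b_cut.
  have f1 : (Ipow mu 1 f < +oo)%E by apply/Ipow1P; [case: hf|exact: gi].
  have f1' : (Ipow mu 1 f' < +oo)%E by apply/Ipow1P; [case: hf'|exact: kapi].
  pose s x := Num.max (`|g x| - kap x) 0 * \1_(kball N%:R) x.
  have ms : measurable_fun setT s.
    apply: measurable_funM; last exact: measurable_ind_kball.
    apply: measurable_maxr => //; apply: measurable_funB => //.
    exact: measurableT_comp.
  have s0 : Ipow mu 1 s = 0%E.
    apply: tends0_eq0; first exact: Ipow_ge0.
    move=> e e0; exists 0%N => _ _.
    have e4 : 0 < e / 4 by rewrite divr_gt0.
    have [d d0 hd] := moll_Ipow_small (or_introl erefl) hf (@cut_supp g (N%:R + 1)) f1 e4.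
    have [d' d0' hd'] := moll_Ipow_small (or_introl erefl) hf' (@cut_supp kap (N%:R + 1)) f1' e4.
    (* With support in the unit ball, mollifying the functions cut at radius [N + 1] gives, on the
       ball of radius [N], integrals of [g] and [kap] against translates of [rho], to which [H]
       applies. *)
    have [|rho [tr rho0 rhod rho1]] := @kernel_exists R n (Num.min (Num.min d d') 1).
      by rewrite !lt_min d0 d0' ltr01.
    have rd1 y : 1 <= `|y| -> rho y = 0 by move=> h; apply: rhod; rewrite ge_min h orbT.
    have h1 : (Ipow mu 1 (fun x => (moll rho f x - f x)%R) <= (e / 4)%:E)%E.
      by apply: hd => // x xd; apply: rhod; rewrite !ge_min xd.
    have h2 : (Ipow mu 1 (fun x => (moll rho f' x - f' x)%R) <= (e / 4)%:E)%E.
      by apply: hd' => // x xd; apply: rhod; rewrite !ge_min xd orbT.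
    have mm h : L1b h -> (forall x, N%:R + 1 <= `|x| -> h x = 0) -> measurable_fun setT (fun x => `|moll rho h x - h x|).
      move=> hh hM; apply: measurableT_comp => //; apply: measurable_funB; last by case: hh.
      by apply: test_meas; apply: (test_moll (L1b_integrable_supp hh hM) hM).
    have m1 := mm f hf (@cut_supp g _); have m2 := mm f' hf' (@cut_supp kap _).
    apply: (@le_trans _ _ (Ipow mu 1 (fun x => `|moll rho f x - f x| + `|moll rho f' x - f' x|))).
      apply: le_Ipow => x; rewrite [leRHS]ger0_norm ?addr_ge0//.
      have [xN|xN] := ltP `|x| N%:R; last by rewrite /s (cut_supp (fun x => Num.max (`|g x| - kap x) 0))// normr0 addr_ge0.
      rewrite /s (cut_in (fun x => Num.max (`|g x| - kap x) 0))// /f /f' (moll_cut hg tr rd1 xN) (moll_cut hkap tr rd1 xN).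
      have xN1 : `|x| < N%:R + 1 by lra.
      rewrite !cut_in//.
      have tsr : test_function (fun y => rho (y - x)) by exact: test_shift.
      have r1 : \int[mu]_y rho (y - x) = 1 by rewrite Rintegral_rV_shift//; exact: test_meas.
      have := H _ tsr (fun y => rho0 _) r1.
      set A := Rintegral _ _ _; set B := Rintegral _ _ _ => AB.
      have h3 := ler_normD A (g x - A); rewrite subrKC [`|g x - A|]distrC in h3.
      have h4 := ler_norm (B - kap x).
      rewrite ger0_norm ?le_max ?lexx ?orbT// ge_max addr_ge0// andbT; lra.
    apply: le_trans (@IpowD_le _ _ _ mu 1 _ _ m1 m2) _.
    apply: (@le_trans _ _ (2%:E * ((e / 4)%:E + (e / 4)%:E))%E).
      apply: lee_wpmul2l; first by rewrite lee_fin.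
      apply: leeD; [apply: le_trans h1|apply: le_trans h2]; apply: le_Ipow => x; by rewrite normr_id.
    by rewrite -EFinD -EFinM lee_fin; lra.
  have := Ipow_eq0 (ltn0Sn 0) ms s0; apply: filterS => x sx xN.
  move: sx; rewrite /s (cut_in (fun x => Num.max (`|g x| - kap x) 0))// => h.
  by rewrite -subr_le0 -h le_max lexx.
have [] : mu.-negligible (\bigcup_N ~` [set x : E | `|x| < N%:R -> `|g x| <= kap x]).
  by apply: negligible_bigcup => N; exact: key.
move=> A [mA A0 hA]; exists A; split => // x /= hx; apply: hA.
exists (Num.truncn `|x|).+1 => //= h; apply: hx; apply: h; exact: truncnS_gt.
Qed.

Lemma L1b0 : L1b (fun=> 0).
Proof.
split=> // M; under eq_fun do rewrite mul0r.
exact: (integrable0 mu setT).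
Qed.

Lemma fundamental_lemma g : L1b g -> (forall phi, test_function phi ->
    \int[mu]_x (g x * phi x) = 0) -> {ae mu, forall x, g x = 0}.
Proof.
move=> hg H; have : {ae mu, forall x, `|g x| <= 0}.
  apply: (weak_bound hg L1b0) => phi tp _ _; rewrite H// normr0.
  by apply: Rintegral_ge0 => x _; rewrite mul0r.
by apply: filterS => x; rewrite normr_le0 => /eqP.
Qed.

End weak_derivatives.

(** * Riesz representation *)

Lemma cvg_seq_norm_le (R : realType) (a : nat -> R) (l C : R) : a k @[k --> \oo] --> l ->
  (forall k, `|a k| <= C) -> `|l| <= C.
Proof.
move=> al aC; have cv : cvgn a by apply/cvg_ex; exists l.
rewrite -(cvg_lim _ al)// ler_norml; apply/andP; split; [apply: limr_ge => //|apply: limr_le => //];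
  by apply: nearW => k; have := aC k; rewrite ler_norml => /andP[].
Qed.

(** * Completeness for the p-th power integral, and products in L^2 *)

Section completeness.
Context d (T : measurableType d) (R : realType).
Variable mu : {measure set T -> \bar R}.
Implicit Types f g : T -> R.

Definition Ip (p : R) f : \bar R := (\int[mu]_x (`|f x| `^ p)%:E)%E.

Lemma measurable_Ip p f : measurable_fun setT f -> measurable_fun setT (fun x => (`|f x| `^ p)%:E).
Proof.
move=> mf; apply/measurable_EFinP.
apply: (measurableT_comp (measurable_powR p)); exact: measurableT_comp.
Qed.

Lemma powR_invK (p y : R) : 0 < p -> 0 <= y -> (y `^ p) `^ p^-1 = y.
Proof. by move=> p0 y0; rewrite -powRrM mulfV ?gt_eqF// powRr1. Qed.

Lemma powR_cvg_seq (p : R) (a : nat -> R) (l : R) : 0 < p -> (forall k, 0 <= a k) -> 0 <= l ->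
  a k @[k --> \oo] --> l -> a k `^ p @[k --> \oo] --> l `^ p.
Proof.
move=> p0 a0; rewrite le_eqVlt => /predU1P[<-|l0] al; last first.
  have c : {for l, continuous (fun y : R => y `^ p)}.
    apply/differentiable_continuous/derivable1_diffP.
    by have [] := is_derive1_powR p l0.
  exact: (cvg_comp _ _ al c).
rewrite powR0 ?gt_eqF//; apply/cvgrPdist_le => e e0.
have e1 : 0 < e `^ p^-1 by rewrite powR_gt0.
have /cvgrPdist_le/(_ _ e1)[N _ hN] := al; exists N => // k /hN /=.
rewrite !sub0r !normrN !ger0_norm ?powR_ge0// => h.
have -> : e = (e `^ p^-1) `^ p by rewrite -powRrM mulVf ?gt_eqF// powRr1// ltW.
by apply: ge0_ler_powR; rewrite ?nnegrE ?(ltW p0) ?(ltW e1).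
Qed.

Lemma geometric_cvg (w : nat -> R) (C : R) : (forall k, `|w k.+1 - w k| <= C * 2^-1 ^+ k) ->
  cvg (w k @[k --> \oo]).
Proof.
move=> H.
have h1 : cvgn (series (fun k => w k.+1 - w k)).
  apply: normed_cvg; apply: (@series_le_cvg _ _ (fun k => C * 2^-1 ^+ k)) => // [k|k|].
  - exact: normr_ge0.
  - exact: le_trans (normr_ge0 _) (H k).
  - by apply: is_cvg_geometric_series; rewrite ger0_norm ?invr_ge0// invf_lt1// ltr1n.
have -> : (fun k => w k) = (fun k => w 0%N + series (fun k => w k.+1 - w k) k).
  by apply/funext => k; rewrite /series /= telescope_sumr// addrC subrK.
by apply: is_cvgD => //; exact: is_cvg_cst.
Qed.

(** The Riesz-Fischer argument without the triangle inequality of L^p: along a fast subsequence the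
    increments, weighted by [2 ^+ k], have summable p-th power integrals, so almost everywhere they
    are bounded by a geometric sequence. Fatou then returns to the whole sequence. *)
Lemma Ip_complete (p : R) (u : nat -> T -> R) : 0 < p ->
  (forall k, measurable_fun setT (u k)) ->
  (forall e : R, 0 < e -> exists N, forall j k, (N <= j)%N -> (N <= k)%N ->
    (Ip p (fun x => (u j x - u k x)%R) <= e%:E)%E) ->
  exists2 v : T -> R, measurable_fun setT v & tends0 (fun k => Ip p (fun x => u k x - v x)).
Proof.
move=> p0 mu_ H.
(* The second factor compensates the weight in [D k], so that the integral of [D k] is at most
   [2^-1 ^+ k]. *)
pose eps (k : nat) : R := 2^-1 ^+ k * ((2 ^+ k) `^ p)^-1.
have eps0 k : 0 < eps k by rewrite mulr_gt0 ?exprn_gt0 ?invr_gt0 ?powR_gt0 ?exprn_gt0.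
have [Nf hN] := choice (fun k => H (eps k) (eps0 k)).
(* Summing the thresholds makes the indices nondecreasing; the summand [k] makes them tend to
   infinity. *)
pose m k := (\sum_(i < k.+1) Nf i + k)%N.
have mN k : (Nf k <= m k)%N by rewrite /m big_ord_recr /= -addnA addnC -addnA leq_addr.
have mS k : (m k <= m k.+1)%N by rewrite [leqRHS]/m big_ord_recr /= -addnA leq_add2l addnS ltnW// ltnS leq_addl.
have mN' k j : (k <= j)%N -> (Nf k <= m j)%N.
  move=> kj; apply: leq_trans (mN k) _; elim: j kj => [|j IH]; first by rewrite leqn0 => /eqP ->.
  rewrite leq_eqVlt => /predU1P[-> //|]; rewrite ltnS => /IH h; exact: leq_trans h (mS j).
pose w k := u (m k).
pose D k x := (2 ^+ k * `|w k.+1 x - w k x|) `^ p.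
have D0 k x : 0 <= D k x by exact: powR_ge0.
have mD k : measurable_fun setT (D k).
  apply: (measurableT_comp (measurable_powR p)); apply: measurable_funM => //.
  by apply: measurableT_comp => //; exact: (measurable_funB (mu_ _) (mu_ _)).
have DE k x : D k x = (2 ^+ k) `^ p * (`|w k.+1 x - w k x| `^ p).
  by rewrite /D powRM// exprn_ge0.
have iD k : (\int[mu]_x (D k x)%:E <= (2^-1 ^+ k)%:E)%E.
  under eq_integral do rewrite DE EFinM.
  rewrite ge0_integralZl//; last exact: (measurable_Ip p (measurable_funB (mu_ _) (mu_ _))).
  have := hN k (m k.+1) (m k) (mN' k k.+1 (leqnSn k)) (mN k).
  move=> h; apply: (@le_trans _ _ (((2 ^+ k) `^ p)%:E * (eps k)%:E)%E).
    by apply: lee_wpmul2l; rewrite ?lee_fin ?powR_ge0.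
  by rewrite -EFinM lee_fin /eps mulrCA divff ?mulr1// gt_eqF// powR_gt0 ?exprn_gt0.
pose S x := (\sum_(k <oo) (D k x)%:E)%E.
have mS' : measurable_fun setT S.
  apply: ge0_emeasurable_sum; first by move=> k x _ _; rewrite lee_fin.
  by move=> k _; exact/measurable_EFinP.
have iS : (\int[mu]_x S x < +oo)%E.
  rewrite integral_nneseries//; last 2 first.
  - by move=> k; exact/measurable_EFinP.
  - by move=> k x _; rewrite lee_fin.
  apply: (@le_lt_trans _ _ (\sum_(k <oo) (2^-1 ^+ k)%:E)%E).
    apply: lee_nneseries; last by move=> k _; exact: iD.
    by move=> k _ _; apply: integral_ge0 => x _; rewrite lee_fin.
  rewrite (_ : (\sum_(k <oo) (2^-1 ^+ k)%:E)%E = 2%:E) ?ltry//.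
  apply: cvg_lim => //.
  have := @cvg_geometric_eseries_half R 2 0; rewrite expr0 divr1.
  set F := eseries _; suff -> : (fun n => \sum_(0 <= k < n) (2^-1 ^+ k)%:E)%E = F by [].
  apply/funext => k; rewrite /F /eseries /=; apply: eq_bigr => i _.
  by rewrite addn1 natrX exprVn exprS invfM mulrA divff// mul1r.
have S0 x : (0 <= S x)%E by apply: nneseries_ge0 => k _ _; rewrite lee_fin.
pose A := [set x | (S x < +oo)%E].
have mA : measurable A.
  by rewrite -[A]setTI; exact: emeasurable_fun_infty_o.
have A1 : {ae mu, forall x, A x}.
  have : mu.-integrable setT S.
    apply/integrableP; split => //; by under eq_integral do rewrite gee0_abs//.
  by move=> /(integrable_ae measurableT); apply: filterS => x /(_ I); rewrite ge0_fin_numE.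
(* Setting the subsequence to 0 off the full set [A] makes it converge everywhere, so its limit is
   measurable. *)
pose wA k x := w k x * \1_A x.
have mwA k : measurable_fun setT (wA k) by apply: measurable_funM; [exact: mu_|exact: measurable_indic].
have cwA x : cvg (wA k x @[k --> \oo]).
  rewrite /wA indicE; case: (boolP (x \in A)) => xA; last first.
    by under eq_fun do rewrite mulr0; exact: is_cvg_cst.
  under eq_fun do rewrite mulr1.
  apply: (@geometric_cvg _ ((fine (S x)) `^ p^-1)) => k.
  have Sx : S x = (fine (S x))%:E by rewrite fineK// ge0_fin_numE//; exact: set_mem xA.
  have h : D k x <= fine (S x).
    rewrite -lee_fin -Sx; apply: le_trans (nneseries_lim_ge k.+1 _); last by move=> i _; rewrite lee_fin.
    rewrite big_nat_recr//= leeDr// sume_ge0// => i _; by rewrite lee_fin.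
  rewrite exprVn ler_pdivlMr ?exprn_gt0// mulrC.
  have y0 : 0 <= 2 ^+ k * `|w k.+1 x - w k x| by rewrite mulr_ge0 ?exprn_ge0.
  rewrite -[leLHS](powR_invK p0 y0).
  by apply: ge0_ler_powR; rewrite ?invr_ge0 ?nnegrE ?(ltW p0)// (le_trans _ h).
pose v x := lim (wA k x @[k --> \oo]).
have mv : measurable_fun setT v.
  apply: (measurable_fun_cvg (fun k => mwA k)) => x _; exact: cwA.
exists v => // e e0; have [N hN'] := H e e0; exists N => j Nj.
have -> : Ip p (fun x => u j x - v x) = (\int[mu]_x limn_einf (fun k => (`|u j x - w k x| `^ p)%:E))%E.
  apply: ae_eq_integral_nm; apply: filterS A1 => x Ax _.
  have wv : w k x @[k --> \oo] --> v x.
    have := cwA x; rewrite /v (_ : (fun k => wA k x) = (fun k => w k x))//.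
    by apply/funext => k; rewrite /wA indicE mem_set// mulr1.
  have h : (`|u j x - w k x| `^ p)%:E @[k --> \oo] --> (`|u j x - v x| `^ p)%:E.
    apply: cvg_EFin; first exact: nearW.
    apply: powR_cvg_seq => //.
    by apply: cvg_norm; apply: cvgB => //; exact: cvg_cst.
  by rewrite (cvg_limn_einf_sup h).1.
apply: le_trans (fatou mu measurableT _ _) _.
- by move=> k; apply: measurable_Ip; exact: (measurable_funB (mu_ _) (mu_ _)).
- by move=> k x _; rewrite lee_fin powR_ge0.
rewrite limn_einf_lim; apply: lime_le; first exact: is_cvg_einfs.
apply: nearW => k; apply: (@le_trans _ _ (Ip p (fun x => u j x - w (k + N)%N x))).
  by apply: ereal_inf_lbound; exists (k + N)%N => //=; exact: leq_addr.
by apply: hN' => //; rewrite /m (leq_trans (leq_addl k N))// leq_addl.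
Qed.

Lemma Ip2 f : Ip 2 f = Ipow mu 2 f.
Proof. by apply: eq_integral => x _; rewrite powR_mulrn. Qed.

Lemma Rintegral_sqr_Ipow f : measurable_fun setT f -> (Ipow mu 2 f < +oo)%E ->
  mu.-integrable setT (EFin \o (fun x => f x ^+ 2)) /\ (\int[mu]_x (f x ^+ 2))%:E = Ipow mu 2 f.
Proof.
move=> mf f2; have fi : mu.-integrable setT (EFin \o (fun x => f x ^+ 2)).
  apply/integrableP; split; first by apply/measurable_EFinP; exact: measurable_funX.
  apply: le_lt_trans f2; rewrite le_eqVlt; apply/orP; left; apply/eqP; apply: eq_integral => x _.
  by rewrite /= normrX.
split=> //; rewrite fineK; last exact: integrable_fin_num.
by apply: eq_integral => x _; rewrite real_normK ?num_real.
Qed.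

Lemma Ipow2_mul f g : measurable_fun setT f -> measurable_fun setT g ->
  (Ipow mu 2 f < +oo)%E -> (Ipow mu 2 g < +oo)%E -> mu.-integrable setT (EFin \o (fun x => f x * g x)).
Proof.
move=> mf mg f2 g2; apply: (@integrable_le _ _ _ mu _ (fun x => f x ^+ 2 + g x ^+ 2)).
- exact: measurable_funM.
- have [i1 _] := Rintegral_sqr_Ipow mf f2; have [i2 _] := Rintegral_sqr_Ipow mg g2.
  exact: integrableDr.
move=> x; rewrite normrM -[f x ^+ 2]real_normK ?num_real// -[g x ^+ 2]real_normK ?num_real//.
by have := sqr_ge0 (`|f x| - `|g x|); have := normr_ge0 (f x); have := normr_ge0 (g x); nra.
Qed.

(* AM-GM with a weight [a] replaces the Cauchy-Schwarz inequality *)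
Lemma tends0_mul (f : nat -> T -> R) g : (forall k, measurable_fun setT (f k)) ->
  measurable_fun setT g -> (Ipow mu 2 g < +oo)%E -> tends0 (fun k => Ipow mu 2 (f k)) ->
  tends0 (fun k => Ipow mu 1 (fun x => f k x * g x)).
Proof.
move=> mf mg g2 fs e e0.
have g20 := Ipow_ge0 mu 2 g.
have gE : Ipow mu 2 g = (fine (Ipow mu 2 g))%:E by rewrite fineK// ge0_fin_numE.
set G := fine _ in gE.
have G0 : 0 <= G by rewrite /G fine_ge0.
pose a := (2 * (G + 1)) / e.
have a0 : 0 < a by rewrite divr_gt0// mulr_gt0// ltr_wpDl.
have [N hN] := fs (e / (2 * a)) (divr_gt0 e0 (mulr_gt0 (ltr0Sn R 1) a0)).
exists N => k /hN hk.
apply: (@le_trans _ _ (\int[mu]_x (a%:E * (`|f k x| ^+ 2)%:E + (a^-1)%:E * (`|g x| ^+ 2)%:E))%E).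
  apply: ge0_le_integral_nm => x _; rewrite ?lee_fin ?exprn_ge0//.
  rewrite expr1 normrM.
  have := sqr_ge0 (a * `|f k x| - `|g x|) => h.
  have h2 : 0 <= a^-1 * (a * `|f k x| - `|g x|) ^+ 2 by rewrite mulr_ge0 ?invr_ge0 ?(ltW a0).
  have h3 : a^-1 * (a * `|f k x| - `|g x|) ^+ 2 = a * `|f k x| ^+ 2 - 2 * (`|f k x| * `|g x|) + a^-1 * `|g x| ^+ 2.
    by field; rewrite gt_eqF.
  have h4 : 0 <= `|f k x| * `|g x| by rewrite mulr_ge0.
  lra.
rewrite ge0_integralD//; last first.
- by apply: measurable_funeM; exact: measurable_Ipow.
- by move=> x _; rewrite mule_ge0 ?lee_fin ?exprn_ge0// invr_ge0 ltW.
- by apply: measurable_funeM; exact: measurable_Ipow.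
- by move=> x _; rewrite mule_ge0 ?lee_fin ?exprn_ge0// ltW.
have a1 : (0 <= (a^-1)%:E)%E by rewrite lee_fin invr_ge0 ltW.
have a2 : (0 <= a%:E)%E by rewrite lee_fin ltW.
rewrite (ge0_integralZl mu measurableT (measurable_Ipow 2 (mf k)) _ a2) ?(ge0_integralZl mu measurableT (measurable_Ipow 2 mg) _ a1)//.
apply: (@le_trans _ _ (a%:E * (e / (2 * a))%:E + (a^-1)%:E * G%:E)%E).
  by apply: leeD; [apply: lee_wpmul2l => //; rewrite lee_fin ltW|rewrite -gE].
rewrite -!EFinM -EFinD lee_fin.
have -> : a * (e / (2 * a)) = e / 2 by field; rewrite gt_eqF.
have : a^-1 * G <= e / 2.
  rewrite /a invf_div mulrAC ler_pdivrMr; last by rewrite mulr_gt0// ltr_wpDl.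
  by nra.
lra.
Qed.

End completeness.

Section riesz.
Context {R : realType} {n : nat}.
Local Notation E := 'rV[R]_n.
Local Notation mu := (lebesgue_rV R n).
Local Notation uv := (@unit_vec R n).

Lemma test_Ipow2 (phi : E -> R) : test_function phi -> (Ipow mu 2 phi < +oo)%E.
Proof.
move=> tp; have [C C0 hC] := test_bounded tp.
have : mu.-integrable setT (EFin \o (fun x => phi x * phi x)).
  by apply: integrableM_bdd hC; [exact: test_integrable|exact: test_meas].
move=> /integrableP[_]; apply: le_lt_trans; rewrite le_eqVlt; apply/orP; left; apply/eqP.
by apply: eq_integral => x _; rewrite /= normrM.
Qed.

Lemma partial_lin (k : 'I_n) (a : R) (phi psi : E -> R) x : test_function phi -> test_function psi ->
  partial k (fun x => phi x + a * psi x) x = partial k phi x + a * partial k psi x.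
Proof.
move=> tp ts; rewrite /partial.
have d1 : derivable phi x (delta_mx 0 k) by exact: test_derivable.
have d2 : derivable psi x (delta_mx 0 k) by exact: test_derivable.
rewrite (_ : (fun x => _) = phi + (a \*: psi)); last by apply/funext.
by rewrite deriveD//; [rewrite deriveZ|exact: derivableZ].
Qed.

(* Minimise the quadratic functional q - 2 L over the test functions. *)
Lemma riesz_test (L : (E -> R) -> R) (C : R) :
  (forall (a : R) phi psi, test_function phi -> test_function psi ->
     L (fun x => phi x + a * psi x) = L phi + a * L psi) ->
  (forall phi, test_function phi -> L phi ^+ 2 <= C * \int[mu]_x (phi x ^+ 2)) ->
  exists u : E -> R, [/\ measurable_fun setT u, (Ipow mu 2 u < +oo)%E &
    forall phi, test_function phi -> \int[mu]_x (u x * phi x) = L phi].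
Proof.
move=> linL bL.
pose q (phi : E -> R) := \int[mu]_x (phi x ^+ 2).
pose ip (phi psi : E -> R) := \int[mu]_x (phi x * psi x).
have t2 phi (tp : test_function phi) := Rintegral_sqr_Ipow (test_meas tp) (test_Ipow2 tp).
have iM phi psi : test_function phi -> test_function psi ->
    mu.-integrable setT (EFin \o (fun x => phi x * psi x)).
  by move=> tp ts; apply: L1b_testM => //; exact: test_L1b.
have q0 phi : 0 <= q phi by apply: Rintegral_ge0 => x _; exact: sqr_ge0.
have qD (a : R) phi psi : test_function phi -> test_function psi ->
    q (fun x => phi x + a * psi x) = q phi + 2 * a * ip phi psi + a ^+ 2 * q psi.
  move=> tp ts; have [i1 _] := t2 _ tp; have [i2 _] := t2 _ ts; have i3 := iM _ _ tp ts.
  have i4 := integrableZlr (2 * a) i3; have i5 := integrableZlr (a ^+ 2) i2.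
  have i6 := integrableDr i1 i4.
  rewrite /q /ip -!RintegralZl// -!RintegralD//.
  by apply: eq_Rintegral => x _; ring.
pose J phi := q phi - 2 * L phi.
have tadd (a : R) phi psi : test_function phi -> test_function psi -> test_function (fun x => phi x + a * psi x).
  by move=> tp ts; apply: test_add => //; exact: test_scale.
(* Since [(2 L)^2 <= 4 C q <= (q + |C|)^2], one has [2 L <= q + |C|]. *)
have C0J phi : test_function phi -> - `|C| <= J phi.
  move=> tp; have := bL _ tp; rewrite -/(q phi) /J => h.
  have h1 := q0 phi; have h2 := ler_norm C; have h3 := normr_ge0 C.
  have : (2 * L phi) ^+ 2 <= (q phi + `|C|) ^+ 2.
    by have h6 := sqr_ge0 (q phi - `|C|); rewrite -/(q phi) in h; nra.
  by rewrite -ler_sqrt ?sqr_ge0// ?exprn_even_gt0// !sqrtr_sqr => h4;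
     have := ler_norm (2 * L phi); rewrite [X in _ <= X]ger0_norm in h4; [lra|exact: addr_ge0].
pose Js := [set J phi | phi in [set phi : E -> R | test_function phi]].
have t0 : test_function (fun _ : E => 0 : R).
  by apply/test_functionP; split; [exact: smooth_cst|exists 0].
have hinf : has_inf Js.
  split; first by exists (J (fun=> 0)); exists (fun=> 0).
  by exists (- `|C|) => _ [phi tp <-]; exact: C0J.
pose m := inf Js.
have mJ phi : test_function phi -> m <= J phi.
  by move=> tp; apply: ge_inf; [case: hinf|exists phi].
have Hk (k : nat) : exists phi, test_function phi /\ J phi <= m + hseq k.
  have [_ [phi tp <-] h] := inf_adherent (hseq_gt0 k) hinf.
  by exists phi; split => //; exact: ltW.
have [phi hphi] := choice Hk.
have tphi k : test_function (phi k) by case: (hphi k).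
(* The parallelogram identity: [J] at the midpoint of two near-minimisers is still at least [m]. *)
have par j k : q (fun x => phi j x - phi k x) <= 2 * hseq j + 2 * hseq k.
  have E1 : (fun x => phi j x - phi k x) = (fun x => phi j x + (-1) * phi k x).
    by apply/funext => x; ring.
  rewrite E1 qD//.
  have tm : test_function (fun x => 2^-1 * (phi j x + 1 * phi k x)) by apply: test_scale; exact: tadd.
  have E2 : (fun x => 2^-1 * (phi j x + 1 * phi k x)) = (fun x => 0 + 2^-1 * (phi j x + 1 * phi k x)).
    by apply/funext => x; rewrite add0r.
  have := mJ _ tm; rewrite /J E2 qD//; last exact: tadd.
  rewrite linL//; last exact: tadd.
  rewrite linL// qD//.
  have q00 : q (fun=> 0) = 0.
    by rewrite /q /Rintegral integral0_eq// => x _; rewrite expr0n.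
  have ip0 psi : ip (fun=> 0) psi = 0.
    by rewrite /ip /Rintegral integral0_eq// => x _; rewrite mul0r.
  have L0 : L (fun=> 0) = 0.
    have := linL 1 _ _ t0 t0; rewrite mul1r (_ : (fun x => _) = fun=> 0); last first.
      by apply/funext => x; rewrite addr0.
    lra.
  rewrite q00 ip0 L0.
  have [_ ] := hphi j; have [_] := hphi k; rewrite /J; lra.
have [u mu_ uc] : exists2 v : E -> R, measurable_fun setT v & tends0 (fun k => Ip mu 2 (fun x => phi k x - v x)).
  apply: Ip_complete => [|k|e e0]; [by []|exact: test_meas|].
  have [N hN] : exists N : nat, forall k, (N <= k)%N -> hseq k <= e / 4.
    have e4 : 0 < e / 4 by rewrite divr_gt0.
    have /cvgrPdist_le/(_ _ e4)[N _ hN] := @hseq_cvg0 R.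
    by exists N => k /hN /=; rewrite sub0r normrN ger0_norm// ltW// hseq_gt0.
  exists N => j k /hN hj /hN hk; rewrite Ip2.
  have tjk : test_function (fun x => phi j x - phi k x).
    rewrite (_ : (fun x => _) = (fun x => phi j x + (-1) * phi k x)); first exact: tadd.
    by apply/funext => x; ring.
  have [_ <-] := t2 _ tjk; rewrite lee_fin; have := par j k; rewrite /q; lra.
have {}uc : tends0 (fun k => Ipow mu 2 (fun x => phi k x - u x)).
  by apply: tends0_le uc => k; rewrite Ip2.
have u2 : (Ipow mu 2 u < +oo)%E.
  have [N /(_ N (leqnn _)) h] := uc 1 ltr01.
  have E1 : Ipow mu 2 u = Ipow mu 2 (fun x => phi N x + - (phi N x - u x)).
    by apply: eq_Ipow => x; ring.
  rewrite E1; apply: Ipow_fin_add.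
  - exact: test_meas.
  - by apply: measurable_funN; apply: measurable_funB => //; exact: test_meas.
  - exact: test_Ipow2.
  - by rewrite IpowN (le_lt_trans h)// ltry.
exists u; split => // psi tpsi.
have ilim : ip (phi k) psi @[k --> \oo] --> \int[mu]_x (u x * psi x).
  apply: tends0_Rintegral.
  - by move=> k; exact: iM.
  - by apply: Ipow2_mul => //; [exact: test_meas|exact: test_Ipow2].
  have h : tends0 (fun k => Ipow mu 1 (fun x => (phi k x - u x) * psi x)).
    apply: tends0_mul => //; [|exact: test_meas|exact: test_Ipow2].
    by move=> k; apply: measurable_funB => //; exact: test_meas.
  by apply: tends0_le h => k; rewrite le_eqVlt; apply/orP; left; apply/eqP; apply: eq_Ipow => x; ring.
set I := \int[mu]_x (u x * psi x).
(* [J] at [phi k + t psi] is at least the infimum; the limit in [k] is a nonnegative polynomial in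
   [t] without constant term, so its linear coefficient vanishes. *)
have key t : 0 <= 2 * t * (I - L psi) + t ^+ 2 * q psi.
  have h k : 0 <= hseq k + (2 * t * (ip (phi k) psi - L psi) + t ^+ 2 * q psi).
    have := mJ _ (tadd n t _ _ (tphi k) tpsi); rewrite /J qD// linL//.
    have [_] := hphi k; rewrite /J; lra.
  have hc : hseq k + (2 * t * (ip (phi k) psi - L psi) + t ^+ 2 * q psi) @[k --> \oo] -->
     0 + (2 * t * (I - L psi) + t ^+ 2 * q psi).
    apply: cvgD; first exact: hseq_cvg0.
    apply: cvgD; last exact: cvg_cst.
    apply: cvgM; first exact: cvg_cst.
    by apply: cvgB => //; exact: cvg_cst.
  rewrite add0r in hc; rewrite -(cvg_lim _ hc)//.
  apply: limr_ge; first by apply/cvg_ex; eexists; exact: hc.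
  exact: nearW.
apply/eqP; rewrite -subr_eq0; apply/eqP.
have qp := q0 psi.
(* Close to the minimising [t]; the [+ 1] covers the case [q psi = 0]. *)
have := key (- (I - L psi) / (q psi + 1)).
set D := I - L psi; set Q := q psi.
have Q1 : 0 < Q + 1 by rewrite /Q; lra.
have -> : 2 * (- D / (Q + 1)) * D + (- D / (Q + 1)) ^+ 2 * Q = - (D ^+ 2 * (Q + 2) / (Q + 1) ^+ 2).
  by field; rewrite gt_eqF.
rewrite oppr_ge0 => h; apply/eqP; rewrite -sqrf_eq0; apply/eqP; apply/le_anti; rewrite sqr_ge0 andbT.
move: h; rewrite pmulr_lle0 ?invr_gt0 ?exprn_gt0// pmulr_lle0//.
by have := q0 psi; rewrite -/Q; lra.
Qed.

(** Moving difference quotients from [phi] to [l] gives [|L phi| <= K * \int |phi|] over a ball,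
    where [L] is the distributional derivative. Hence [L] is bounded in L^2 and is represented by a
    function, and [weak_bound] turns the same inequality into the pointwise bound by [K]. *)
Lemma lipschitz_weak_partial (l : E -> R) (k : 'I_n) (K M : R) : 0 <= K -> continuous l ->
  (forall x, M <= `|x| -> l x = 0) ->
  (forall x h, `|l (x + h *: uv k) - l x| <= K * `|h|) ->
  exists g, [/\ wpB k l g, forall x, `|g x| <= K & forall x, M + 1 <= `|x| -> g x = 0].
Proof.
move=> K0 cl lM lK.
have ml : measurable_fun setT l by exact: continuous_measurable_rV.
have [B B0 lB] : exists2 C, 0 <= C & forall x, `|l x| <= C.
  by apply: cont_supp_bounded => //; exists M.
have li : mu.-integrable setT (EFin \o l) by exact: integrable_bdd_supp lB lM.
have hl : L1b l.
  split=> // M'; apply: (@integrableM_bdd _ _ _ _ 1) => //; first exact: measurable_ind_kball.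
  by move=> x; rewrite indicE; case: (_ \in _); rewrite ?normr1 ?normr0.
pose L phi := - \int[mu]_x (l x * partial k phi x).
pose b : E -> R := \1_(kball (M + 1)).
have mb : measurable_fun setT b by exact: measurable_ind_kball.
have bi : mu.-integrable setT (EFin \o b).
  apply/Ipow1P => //; rewrite Ipow_ind//; [exact: lebesgue_rV_ball_lty|exact: measurable_kball].
have b1 x : 0 <= b x <= 1 by rewrite /b indicE; case: (_ \in _); rewrite ?lexx ?ler01.
have ib phi : test_function phi -> mu.-integrable setT (EFin \o (fun x => b x * `|phi x|)).
  move=> tp; have [D D0 hD] := test_bounded tp.
  apply: (@integrableM_bdd _ _ _ _ D) => //; last by move=> x; rewrite normr_id.
  by apply: measurableT_comp => //; exact: test_meas.
have LK phi : test_function phi -> `|L phi| <= K * \int[mu]_x (b x * `|phi x|).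
  move=> tp; rewrite normrN.
  have [D D0 hD] := test_bounded tp.
  have [D' D0' hD'] := test_lipschitz k tp.
  have h0 j : hseq j != 0 :> R by rewrite gt_eqF// hseq_gt0.
  have lim1 : \int[mu]_x (l x * dquot k (hseq j) phi x) @[j --> \oo] --> \int[mu]_x (l x * partial k phi x).
    apply: (@dct_Rintegral _ _ _ mu _ _ (fun x => D' * `|l x|)).
    - by move=> j; apply: measurable_funM => //; apply: measurable_dquot; exact: test_meas.
    - by apply: measurable_funM => //; apply: test_meas; exact: test_partial.
    - by apply: integrableZlr; exact: integrable_norm.
    - by move=> j x; rewrite normrM mulrC ler_wpM2r//; exact: dquot_bound.
    - move=> x; apply: cvgM; first exact: cvg_cst.
      by apply: dquot_cvg => //; [exact: test_derivable|exact: hseq_cvg0].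
  have bnd j : `|\int[mu]_x (l x * dquot k (hseq j) phi x)| <= K * \int[mu]_x (b x * `|phi x|).
    set h := hseq j.
    have i1 : mu.-integrable setT (EFin \o (fun x => l x * phi (x + h *: uv k))).
      by apply: (@integrableM_bdd _ _ _ _ D) => //; apply: measurable_fun_rV_shift; exact: test_meas.
    have i2 : mu.-integrable setT (EFin \o (fun x => l x * phi x)).
      by apply: (@integrableM_bdd _ _ _ _ D) => //; exact: test_meas.
    have i3 : mu.-integrable setT (EFin \o (fun x => l (x - h *: uv k) * phi x)).
      apply: (@integrableM_bdd _ _ _ _ D) => //; last exact: test_meas.
      exact: (@integrable_rV_shift _ _ (- (h *: uv k)) l li).
    (* Summation by parts for difference quotients, by translation invariance. *)
    have -> : \int[mu]_x (l x * dquot k h phi x) = \int[mu]_x (- (dquot k (- h) l x * phi x)).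
      transitivity (h^-1 * (\int[mu]_x (l x * phi (x + h *: uv k)) - \int[mu]_x (l x * phi x))).
        rewrite -RintegralB// -RintegralZl//; last exact: integrableBr.
        by apply: eq_Rintegral => x _; rewrite /dquot; ring.
      have -> : \int[mu]_x (l x * phi (x + h *: uv k)) = \int[mu]_x (l (x - h *: uv k) * phi x).
        rewrite -[RHS](Rintegral_rV_shift (h *: uv k)); last first.
          by apply: measurable_funM; [exact: (@measurable_fun_rV_shift _ _ _ _ l)|exact: test_meas].
        by apply: eq_Rintegral => x _; rewrite addrK.
      rewrite -RintegralB// -RintegralZl//; last exact: integrableBr.
      by apply: eq_Rintegral => x _; rewrite /dquot scaleNr invrN; ring.
    have mdl : measurable_fun setT (dquot k (- h) l) by exact: measurable_dquot.
    have dl x : `|dquot k (- h) l x| <= K * b x.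
      have hh : - h != 0 by rewrite oppr_eq0; exact: h0.
      have [xM|xM] := ltP `|x| (M + 1).
        rewrite /b indicE mem_set ?mulr1//; exact: dquot_bound.
      by rewrite (@dquot_supp _ _ k (- h) l M) ?normr0 ?normrN ?ger0_norm ?hseq_le1 ?(ltW (hseq_gt0 _))// mulr_ge0//; case/andP: (b1 x).
    have i4 : mu.-integrable setT (EFin \o (fun x => - (dquot k (- h) l x * phi x))).
      apply: (@integrable_le _ _ _ mu _ (fun x => K * (b x * `|phi x|))).
      - by apply: measurable_funN; apply: measurable_funM => //; exact: test_meas.
      - by apply: integrableZlr; exact: ib.
      - by move=> x; rewrite normrN normrM mulrA ler_wpM2r.
    apply: le_trans (le_normr_Rintegral _ i4) _ => //.
    rewrite -RintegralZl//; last exact: ib.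
    apply: le_Rintegral => //; [exact: integrable_norm|by apply: integrableZlr; exact: ib|].
    by move=> x _; rewrite normrN normrM mulrA ler_wpM2r.
  exact: cvg_seq_norm_le lim1 bnd.
have linL (a : R) phi psi : test_function phi -> test_function psi ->
     L (fun x => phi x + a * psi x) = L phi + a * L psi.
  move=> tp ts; rewrite /L mulrN -opprD; congr (- _).
  have ip f : test_function f -> mu.-integrable setT (EFin \o (fun x => l x * partial k f x)).
    by move=> tf; apply: L1b_testM => //; exact: test_partial.
  rewrite -RintegralZl ?ip// -RintegralD ?ip//; last by apply: integrableZlr; exact: ip.
  apply: eq_Rintegral => x _.
  rewrite partial_lin//; ring.
pose V := fine (mu (kball (M + 1))).
have bL phi : test_function phi -> L phi ^+ 2 <= (K ^+ 2 * (V + 1)) * \int[mu]_x (phi x ^+ 2).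
  move=> tp; set I := \int[mu]_x (b x * `|phi x|); set q := Rintegral _ _ _.
  have V0 : 0 <= V by exact: fine_ge0.
  have [iq _] := Rintegral_sqr_Ipow (test_meas tp) (test_Ipow2 tp).
  have bb : \int[mu]_x (b x) = V.
    rewrite /Rintegral /V; congr fine; rewrite integral_indic ?setIT//; exact: measurable_kball.
  (* This is the integral of [(|phi| - c b)^2], as [b] is an indicator. The value [c = I / (V + 1)]
     gives a Cauchy-Schwarz inequality that needs neither roots nor [V > 0]. *)
  have h c : 0 <= q - 2 * c * I + c ^+ 2 * V.
    rewrite -bb /q /I -!RintegralZl ?ib// -RintegralB//; last by apply: integrableZlr; exact: ib.
    rewrite -RintegralD//; last 2 first.
    - by apply: integrableBr => //; apply: integrableZlr; exact: ib.
    - exact: integrableZlr.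
    apply: Rintegral_ge0 => x _; rewrite -[phi x ^+ 2]real_normK ?num_real//.
    rewrite /b indicE; case: (_ \in _) => /=.
      by have := sqr_ge0 (`|phi x| - c); nra.
    by rewrite !mul0r !mulr0 subr0 addr0.
  have I2 : I ^+ 2 <= (V + 1) * q.
    have V1 : 0 < V + 1 by lra.
    have := h (I / (V + 1)).
    have -> : q - 2 * (I / (V + 1)) * I + (I / (V + 1)) ^+ 2 * V = q - I ^+ 2 * (V + 2) / (V + 1) ^+ 2.
      by field; rewrite gt_eqF.
    rewrite subr_ge0 ler_pdivrMr ?exprn_gt0// => h'.
    have : I ^+ 2 * (V + 2) <= ((V + 1) * q) * (V + 2).
      apply: le_trans h' _; have q0 : 0 <= q by apply: Rintegral_ge0 => x _; exact: sqr_ge0.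
      nra.
    by rewrite ler_pM2r//; lra.
  have I0 : 0 <= I by apply: Rintegral_ge0 => x _; rewrite mulr_ge0//; case/andP: (b1 x).
  have := LK _ tp; rewrite -/I => h1.
  rewrite -[L phi ^+ 2]real_normK ?num_real//.
  apply: (@le_trans _ _ ((K * I) ^+ 2)); first by rewrite lerXn2r ?nnegrE ?mulr_ge0.
  by rewrite exprMn -mulrA ler_wpM2l ?sqr_ge0.
have [u [mu_ u2 uL]] := riesz_test linL bL.
have hu : L1b u.
  split=> // M'; apply: Ipow2_mul => //; first exact: measurable_ind_kball.
  rewrite Ipow_ind//; [exact: lebesgue_rV_ball_lty|exact: measurable_kball].
have hKb : L1b (fun x => K * b x).
  split=> [|M']; first exact: measurable_funM.
  apply: (@integrableM_bdd _ _ _ _ 1); [exact: integrableZlr|exact: measurable_ind_kball|].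
  by move=> x; rewrite indicE; case: (_ \in _); rewrite ?normr1 ?normr0.
have uK : {ae mu, forall x, `|u x| <= K * b x}.
  apply: (weak_bound hu hKb) => phi tp phi0 phi1; rewrite uL//.
  have -> : \int[mu]_x (K * b x * phi x) = K * \int[mu]_x (b x * `|phi x|).
    rewrite -RintegralZl ?ib//; apply: eq_Rintegral => x _; rewrite ger0_norm//; by ring.
  exact: LK.
(* A modification on a null set, so that the bound and the support hold at every point and not only
   almost everywhere. *)
pose g x := if `|u x| <= K * b x then u x else 0.
have mg : measurable_fun setT g.
  apply: measurable_fun_ifT => //; apply: measurable_fun_ler; first exact: measurableT_comp.
  exact: measurable_funM.
have gb x : `|g x| <= K * b x.
  by rewrite /g; case: ifP => // _; rewrite normr0 mulr_ge0//; case/andP: (b1 x).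
have gu : {ae mu, forall x, setT x -> g x = u x}.
  by apply: filterS uK => x h _; rewrite /g h.
exists g; split.
- split=> //.
    split=> // M'; apply: (@integrable_le _ _ _ mu _ (fun x => K * b x)); last first.
    + move=> x; apply: le_trans (gb x); rewrite indicE; case: (_ \in _); rewrite ?mulr1// mulr0 normr0//.
    + exact: integrableZlr.
    + by apply: measurable_funM => //; exact: measurable_ind_kball.
  move=> phi tp.
  have -> : \int[mu]_x (g x * phi x) = \int[mu]_x (u x * phi x).
    by apply: ae_eq_Rintegral_nm; apply: filterS gu => x h _; rewrite h.
  by rewrite uL// /L opprK.
- by move=> x; apply: le_trans (gb x) _; rewrite ler_piMr//; case/andP: (b1 x).
- move=> x xM; apply/eqP; rewrite -normr_le0; apply: le_trans (gb x) _.
  by rewrite /b indicE memNset ?mulr0//= /kball /=; apply/negP; rewrite -leNgt.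
Qed.

End riesz.

(** * Elliptic operators and cut-off functions *)

Section borel_versions.
Context {R : realType} {n : nat}.
Local Notation E := 'rV[R]_n.
Local Notation mu := (lebesgue_rV R n).
Local Notation uv := (@unit_vec R n).
Implicit Types f g : E -> R.

Lemma L1loc_L1b f f' : L1loc f -> measurable_fun setT f' -> {ae mu, forall x, f x = f' x} -> L1b f'.
Proof.
move=> [_ h] mf ff'; split=> // M; have mk := @measurable_ind_kball R n M.
apply/Ipow1P; first exact: measurable_funM.
have cK : compact [set x : E | `|x| <= M].
  apply: bounded_closed_compact; last exact: closed_normle.
  exists M; split; first exact: num_real.
  by move=> y My x /= xM; rewrite (le_trans xM)// ltW.
apply: le_lt_trans (h _ cK); rewrite [leRHS]integral_mkcond.
apply: ae_ge0_le_integral_nm => //.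
- by move=> x _; rewrite erestrict_ge0.
apply: filterS ff' => x e _; rewrite expr1 normrM indicE patchE.
case: (boolP (x \in kball M)) => xM; last first.
  by rewrite /= normr0 mulr0; case: ifP => _; rewrite ?lee_fin.
rewrite /=; by rewrite mem_set ?normr1 ?mulr1 ?e//; have := set_mem xM; exact: ltW.
Qed.

Lemma L1b_L1loc f : L1b f -> L1loc f.
Proof.
move=> [mf fi]; split; first by exists f => //; exact: aeW.
move=> K /compact_bounded[M0 [_ hM]].
have KM : K `<=` kball (`|M0| + 2).
  move=> x Kx; rewrite /kball /=; apply: le_lt_trans (_ : _ <= `|M0| + 1) _; last by rewrite ltrD2l ltr1n.
  by apply: hM Kx; rewrite (le_lt_trans (ler_norm _))// ltrDl.
have := fi (`|M0| + 2) => /Ipow1P; move=> /(_ (measurable_funM mf (measurable_ind_kball _))).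
apply: le_lt_trans; rewrite integral_mkcond; apply: ge0_le_integral_nm => x _ //.
  by rewrite erestrict_ge0.
rewrite expr1 normrM patchE; case: ifP => [/set_mem/KM xK|_]; last by rewrite lee_fin mulr_ge0.
by rewrite indicE mem_set// normr1 mulr1.
Qed.

Lemma wpB_weak k f g : wpB k f g -> weak_partial k f g.
Proof. by move=> [hf hg H]; split => //; exact: L1b_L1loc. Qed.

Lemma weak_wpB k f g f' g' : weak_partial k f g -> measurable_fun setT f' -> measurable_fun setT g' ->
  {ae mu, forall x, f x = f' x} -> {ae mu, forall x, g x = g' x} -> wpB k f' g'.
Proof.
move=> [hf hg H] mf mg ff gg; split; [exact: L1loc_L1b hf mf ff|exact: L1loc_L1b hg mg gg|].
move=> phi tp; have := H _ tp.
rewrite (@ae_eq_Rintegral_nm _ _ _ mu setT _ (fun x => f' x * partial k phi x)); last first.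
  by apply: filterS ff => x -> _.
by rewrite (@ae_eq_Rintegral_nm _ _ _ mu setT (fun x => g x * phi x) (fun x => g' x * phi x))//; apply: filterS gg => x -> _.
Qed.

Definition wdivB (F : 'I_n -> E -> R) g := [/\ forall k, L1b (F k), L1b g & forall phi, test_function phi ->
  \int[mu]_x (\sum_k F k x * partial k phi x) = - \int[mu]_x (g x * phi x)].

Lemma wdivB_weak F g : wdivB F g -> weak_div F g.
Proof. by move=> [hF hg H]; split => // *; exact: L1b_L1loc. Qed.

Lemma ae_all_ord_R (P : 'I_n -> E -> Prop) : (forall j, {ae mu, forall x, P j x}) ->
  {ae mu, forall x, forall j, P j x}.
Proof.
move=> H; have : {ae mu, forall x, forall j, j \in index_enum 'I_n -> P j x}.
  elim: (index_enum _) => [|j s IH]; first exact: aeW.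
  apply: filterS2 (H j) IH => x Pj hs k; rewrite inE => /predU1P[-> //|]; exact: hs.
by apply: filterS => x h j; apply: h; rewrite mem_index_enum.
Qed.

Lemma weak_wdivB F F' g g' : weak_div F g -> (forall k, measurable_fun setT (F' k)) -> measurable_fun setT g' ->
  (forall k, {ae mu, forall x, F k x = F' k x}) -> {ae mu, forall x, g x = g' x} -> wdivB F' g'.
Proof.
move=> [hF hg H] mF mg FF gg; split; [by move=> k; exact: L1loc_L1b (hF k) (mF k) (FF k)|exact: L1loc_L1b hg mg gg|].
move=> phi tp; have := H _ tp.
rewrite (@ae_eq_Rintegral_nm _ _ _ mu setT _ (fun x => \sum_k F' k x * partial k phi x)); last first.
  by apply: filterS (ae_all_ord_R FF) => x e _; apply: eq_bigr => k _; rewrite e.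
by rewrite (@ae_eq_Rintegral_nm _ _ _ mu setT (fun x => g x * phi x) (fun x => g' x * phi x))//; apply: filterS gg => x -> _.
Qed.

Lemma L1bN f : L1b f -> L1b (fun x => - f x).
Proof.
move=> hf; rewrite (_ : (fun x => - f x) = (fun x => (fun=> -1) x * f x)).
  by apply: L1b_smoothM => //; exact: smooth_cst.
by apply/funext => x; rewrite mulN1r.
Qed.

Lemma wpB_uniq k f g h : wpB k f g -> wpB k f h -> {ae mu, forall x, g x = h x}.
Proof.
move=> [_ hg Hg] [_ hh Hh].
have hgh : L1b (fun x => g x + - h x) by apply: L1bD => //; exact: L1bN.
have := fundamental_lemma hgh; case=> [phi tp|A [mA A0 hA]]; last first.
  by exists A; split => //; apply: subset_trans hA => x /= nx hx; apply: nx; apply/eqP; rewrite -subr_eq0; exact/eqP.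
have e : \int[mu]_x (g x * phi x) = \int[mu]_x (h x * phi x) by apply: oppr_inj; rewrite -Hg// -Hh.
transitivity (\int[mu]_x (g x * phi x) - \int[mu]_x (h x * phi x)); last by rewrite e subrr.
rewrite -RintegralB//; [|exact: L1b_testM|exact: L1b_testM].
by apply: eq_Rintegral => x _; ring.
Qed.

Lemma L1b_bddM f (a : E -> R) (B : R) : L1b f -> measurable_fun setT a -> (forall x, `|a x| <= B) -> L1b (fun x => a x * f x).
Proof. by move=> hf ma aB; apply: L1bM => // M; exists B. Qed.

(* Test the weak derivative of [l] against mollifications of [phi * s]. *)
Lemma wpB_bddM k l g s (ds : 'I_n -> E -> R) (B : R) : wpB k l g -> (forall x, `|l x| <= B) -> (forall x, `|g x| <= B) ->
  (forall j, wpB j s (ds j)) -> wpB k (fun x => l x * s x) (fun x => g x * s x + l x * ds k x).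
Proof.
move=> [hl hg Hl] lB gB hs; have [ml _] := hl; have [mg _] := hg.
have [hs0 hdk _] := hs k.
have hls : L1b (fun x => l x * s x) by exact: L1b_bddM lB.
have hgs : L1b (fun x => g x * s x) by exact: L1b_bddM gB.
have hld : L1b (fun x => l x * ds k x) by exact: L1b_bddM lB.
split => //; first exact: L1bD.
move=> phi tp.
pose f x := phi x * s x; pose df j x := phi x * ds j x + partial j phi x * s x.
have hf j : wpB j f (df j) by apply: wpB_smoothM => //; exact: test_smooth.
have [M0 hM0] := test_supp tp.
have pM j x : M0 + 1 <= `|x| -> partial j phi x = 0.
  move=> xM; rewrite /partial (@near_eq_derive _ _ _ phi (cst 0) x (delta_mx 0 j)); first by rewrite derive_cst.
  have : nbhs x [set y : E | M0 < `|y|].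
    apply: open_nbhs_nbhs; split; first exact: open_normgt.
    by apply: lt_le_trans xM; rewrite ltrDl.
  by apply: filterS => y /= /ltW /hM0 ->.
have M01 x : M0 + 1 <= `|x| -> M0 <= `|x| by apply: le_trans; rewrite lerDl.
have f0 x : M0 + 1 <= `|x| -> f x = 0 by move=> /M01 h; rewrite /f hM0// mul0r.
have df0 j x : M0 + 1 <= `|x| -> df j x = 0 by move=> h; rewrite /df pM// hM0 ?M01// !mul0r addr0.
have [L1f _ _] := hf k; have L1df j : L1b (df j) by have [] := hf j.
have fin h : L1b h -> (forall x, M0 + 1 <= `|x| -> h x = 0) -> (Ipow mu 1 h < +oo)%E.
  by move=> hh h0; apply/Ipow1P; [by case: hh|exact: L1b_integrable_supp h0].
have Hpsi (i : nat) : exists psi, [/\ test_function psi,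
    (Ipow mu 1 (fun x => (psi x - f x)%R) <= (hseq i)%:E)%E &
    forall j, (Ipow mu 1 (fun x => (partial j psi x - df j x)%R) <= (hseq i)%:E)%E].
  apply: (sobolev_test_dense (or_introl erefl) f0 df0 (fin _ L1f f0)) => //.
  - by move=> j; exact: fin (df0 j).
  - exact: hseq_gt0.
have [psi hpsi] := choice Hpsi.
have h0 : tends0 (fun i => (hseq i : R)%:E).
  move=> e e0; have /cvgrPdist_le/(_ _ e0)[N _ hN] := @hseq_cvg0 R.
  by exists N => i /hN /=; rewrite sub0r normrN ger0_norm ?lee_fin// ltW// hseq_gt0.
have T1 : tends0 (fun i => Ipow mu 1 (fun x => psi i x - f x)).
  by apply: tends0_le h0 => i; have [] := hpsi i.
have T2 : tends0 (fun i => Ipow mu 1 (fun x => partial k (psi i) x - df k x)).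
  by apply: tends0_le h0 => i; have [_ _] := hpsi i.
have tpsi i : test_function (psi i) by case: (hpsi i).
have lim (a : E -> R) (h : nat -> E -> R) (h1 : E -> R) : L1b a -> (forall x, `|a x| <= B) ->
    (forall i, test_function (h i)) -> L1b h1 -> (forall x, M0 + 1 <= `|x| -> h1 x = 0) ->
    tends0 (fun i => Ipow mu 1 (fun x => h i x - h1 x)) ->
    \int[mu]_x (a x * h i x) @[i --> \oo] --> \int[mu]_x (a x * h1 x).
  move=> ha aB th hh1 h10 T; have [ma _] := ha; have [mh1 _] := hh1.
  apply: tends0_Rintegral.
  - by move=> i; exact: L1b_testM.
  - apply: (@L1b_integrable_supp _ _ _ (M0 + 1)); first exact: L1b_bddM aB.
    by move=> x /h10 ->; rewrite mulr0.
  have md i : measurable_fun setT (fun x => h i x - h1 x).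
    by apply: measurable_funB => //; exact: test_meas.
  have := tends0_IpowZ B md T; apply: tends0_le => i.
  apply: le_Ipow => x; rewrite -mulrBr !normrM ler_wpM2r// (le_trans (aB x))//.
  exact: ler_norm.
have E1 := lim l (fun i => partial k (psi i)) (df k) hl lB (fun i => test_partial k (tpsi i)) (L1df k) (df0 k) T2.
have E2 := lim g psi f hg gB tpsi L1f f0 T1.
have E3 : \int[mu]_x (l x * partial k (psi i) x) @[i --> \oo] --> - \int[mu]_x (g x * f x).
  under eq_fun do rewrite Hl//; exact: cvgN.
have e : \int[mu]_x (l x * df k x) = - \int[mu]_x (g x * f x) by exact: cvg_unique E1 E3.
have I1 : mu.-integrable setT (EFin \o (fun x => l x * s x * partial k phi x)).
  by apply: L1b_testM => //; exact: test_partial.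
have I2 := L1b_testM hgs tp; have I3 := L1b_testM hld tp.
have e1 : \int[mu]_x (l x * df k x) = \int[mu]_x (l x * ds k x * phi x) + \int[mu]_x (l x * s x * partial k phi x).
  by rewrite -RintegralD//; apply: eq_Rintegral => x _; rewrite /df; ring.
have e2 : \int[mu]_x ((g x * s x + l x * ds k x) * phi x) = \int[mu]_x (g x * f x) + \int[mu]_x (l x * ds k x * phi x).
  rewrite (_ : \int[mu]_x (g x * f x) = \int[mu]_x (g x * s x * phi x)).
    by rewrite -RintegralD//; apply: eq_Rintegral => x _; ring.
  by apply: eq_Rintegral => x _; rewrite /f; ring.
by rewrite e2; lra.
Qed.

Lemma partial_scale k f (c : R) x : c != 0 -> (forall y, derivable f y (uv k)) ->
  (forall y, derivable (fun y => f (c *: y)) y (uv k)) ->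
  partial k (fun y => f (c *: y)) x = c * partial k f (c *: x).
Proof.
move=> c0 df dF.
have h0 j : hseq j != 0 :> R by rewrite gt_eqF// hseq_gt0.
have L1 : dquot k (hseq j) (fun y => f (c *: y)) x @[j --> \oo] --> partial k (fun y => f (c *: y)) x.
  by apply: dquot_cvg => //; exact: hseq_cvg0.
have L2 : c * dquot k (c * hseq j) f (c *: x) @[j --> \oo] --> c * partial k f (c *: x).
  apply: cvgM; first exact: cvg_cst.
  have hc : c * hseq j @[j --> \oo] --> (0 : R).
    by rewrite -[X in _ --> X](mulr0 c); apply: cvgM; [exact: cvg_cst|exact: hseq_cvg0].
  have hn0 : forall j, (fun j => c * hseq j : R) j != 0 by move=> j; rewrite mulf_neq0.
  exact: dquot_cvg (df (c *: x)) hn0 hc.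
have EQ : (fun j => dquot k (hseq j) (fun y : E => f (c *: y)) x) = (fun j => c * dquot k (c * hseq j) f (c *: x)).
  by apply/funext => j; rewrite /dquot invfM scalerDr scalerA; field; rewrite c0 h0.
rewrite EQ in L1; exact: cvg_unique L1 L2.
Qed.

End borel_versions.

(** * Bounds on [Q], the vector field [Q grad chi], cut-offs and the product rule *)

Section coefficients.
Context {R : realType} {d : nat}.
Local Notation E := 'rV[R]_d.
Local Notation mu := (lebesgue_rV R d).
Local Notation uv := (@unit_vec R d).
Variable Q : E -> 'M[R]_d.
Hypothesis hQ : hypQ Q.

(** Entries are bounded by polarisation: the values of the form at [e_h + e_k] and [e_h - e_k]
    differ by [4 Q_hk], and both lie between 0 and [4 eta2], since these vectors have squared length
    at most 4 (equality for [h = k]). *)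
Lemma hypQ_bounds : exists2 B : R, 0 <= B & forall h k, (forall x, `|Q x h k| <= B) /\
  (forall x y, `|Q x h k - Q y h k| <= B * `|x - y|).
Proof.
have [[K hK] sym [eta1 [eta2 [e1 e2 H]]]] := hQ.
have dot x (xi : 'cV[R]_d) : Rvec_dot (Q x *m xi) xi <= eta2 * Rvec_dot xi xi by have /andP[] := H x xi.
have dot0 x (xi : 'cV[R]_d) : 0 <= Rvec_dot (Q x *m xi) xi.
  have /andP[h _] := H x xi; apply: le_trans h; rewrite mulr_ge0 ?(ltW e1)//.
  by apply: sumr_ge0 => j _; rewrite -expr2 sqr_ge0.
have quad x (h k : 'I_d) (a b : R) : Rvec_dot (Q x *m (a *: delta_mx h 0 + b *: delta_mx k 0)) (a *: delta_mx h 0 + b *: delta_mx k 0) =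
    a ^+ 2 * Q x h h + a * b * Q x h k + a * b * Q x k h + b ^+ 2 * Q x k k.
  rewrite mulmxDr -!scalemxAr /Rvec_dot.
  have D (c : 'I_d) (f : 'I_d -> R) (a0 : R) : \sum_j f j * (a0 *: (delta_mx c 0 : 'cV[R]_d)) j 0 = a0 * f c.
    rewrite (bigD1 c)//= big1 ?addr0 => [|j jc]; last by rewrite !mxE (negbTE jc) !mulr0.
    by rewrite !mxE !eqxx mulr1 mulrC.
  under eq_bigr do rewrite [X in _ * X]mxE mulrDr.
  rewrite big_split /= !D.
  have C (i c : 'I_d) : (Q x *m (delta_mx c 0 : 'cV[R]_d)) i 0 = Q x i c.
    by rewrite -colE mxE.
  have M i : (a *: (Q x *m (delta_mx h 0 : 'cV[R]_d)) + b *: (Q x *m (delta_mx k 0 : 'cV[R]_d))) i 0 = a * Q x i h + b * Q x i k.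
    have lin (X Y : 'cV[R]_d) j : (a *: X + b *: Y) j 0 = a * X j 0 + b * Y j 0 by rewrite !mxE.
    by rewrite lin !C.
  by rewrite !M; ring.
have dd (h k : 'I_d) : exists2 s : R, s <= 4 & forall (a b : R), a ^+ 2 = 1 -> b ^+ 2 = 1 ->
   Rvec_dot (a *: delta_mx h 0 + b *: delta_mx k 0 : 'cV[R]_d) (a *: delta_mx h 0 + b *: delta_mx k 0) <= 4.
  exists 4 => // a b a1 b1; rewrite /Rvec_dot.
  apply: (@le_trans _ _ (\sum_(j < d) (2 * (delta_mx h 0 : 'cV[R]_d) j 0 + 2 * (delta_mx k 0 : 'cV[R]_d) j 0))).
    apply: ler_sum => j _; rewrite !mxE.
    by do 2 case: (_ == _) => /=; nra.
  rewrite big_split /= -!mulr_sumr.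
  have S (c : 'I_d) : \sum_j (delta_mx c 0 : 'cV[R]_d) j 0 = 1.
    by rewrite (bigD1 c)//= big1 ?addr0 ?mxE ?eqxx// => j jc; rewrite mxE (negbTE jc).
  by rewrite !S; lra.
have Qb x h k : `|Q x h k| <= 2 * eta2.
  have sy : Q x k h = Q x h k by rewrite -{1}(sym x) mxE.
  have [_ _ d4] := dd h k.
  have q1 := quad x h k 1 1; have q2 := quad x h k 1 (-1).
  have l1 := dot x (1 *: delta_mx h 0 + 1 *: delta_mx k 0).
  have l2 := dot x (1 *: delta_mx h 0 + (-1) *: delta_mx k 0).
  have z1 := dot0 x (1 *: delta_mx h 0 + 1 *: delta_mx k 0).
  have z2 := dot0 x (1 *: delta_mx h 0 + (-1) *: delta_mx k 0).
  have d1 := d4 1 1 (expr1n _ _) (expr1n _ _).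
  have d2 : Rvec_dot (1 *: delta_mx h 0 + (-1) *: delta_mx k 0 : 'cV[R]_d) (1 *: delta_mx h 0 + (-1) *: delta_mx k 0) <= 4.
    by apply: d4; rewrite ?expr1n// sqrrN expr1n.
  rewrite q1 in l1 z1; rewrite q2 in l2 z2; rewrite sy in l1 z1 l2 z2.
  by rewrite ler_norml; apply/andP; split; nra.
exists (2 * eta2 + `|K|); first by rewrite addr_ge0// mulr_ge0// ltW.
move=> h k; split=> [x|x y].
  by apply: le_trans (Qb x h k) _; rewrite lerDl.
have hxy : `|Q x - Q y| <= K * `|x - y| by apply: (hK (x, y)).
apply: (@le_trans _ _ `|Q x - Q y|).
  apply: (@le_trans _ _ `|(Q x - Q y) h k|); first by rewrite !mxE.
  rewrite [leRHS]mx_normrE.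
  by apply: (le_bigmax _ (fun ij : 'I_d * 'I_d => `|(Q x - Q y) ij.1 ij.2|) (h, k)).
apply: le_trans hxy _; rewrite ler_wpM2r//; apply: le_trans (ler_norm _) _.
by rewrite lerDr mulr_ge0// ltW.
Qed.

(* The vector field [Q grad chi]. *)
Definition ell (chi : E -> R) (h : 'I_d) : E -> R := fun x => \sum_k Q x h k * partial k chi x.

Lemma Q_continuous h k : continuous (fun x : E => Q x h k : R).
Proof.
have [B B0 HB] := hypQ_bounds; have [_ lip] := HB h k.
apply: seq_continuous => x u ux; apply/cvgrPdist_le => /= e e0.
have B1 : 0 < B + 1 by rewrite ltr_wpDl.
have /cvgrPdist_le/(_ _ (divr_gt0 e0 B1))[N _ hN] := ux; exists N => // j /hN /= xy.
apply: le_trans (lip x (u j)) _.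
apply: (@le_trans _ _ ((B + 1) * (e / (B + 1)))); last by rewrite mulrC divfK ?gt_eqF.
by apply: ler_pM => //; rewrite lerDl.
Qed.

Lemma measurable_Q h k : measurable_fun setT (fun x : E => Q x h k : R).
Proof. by apply: continuous_measurable_rV; exact: Q_continuous. Qed.

(** [ell chi h] is a sum of products of bounded Lipschitz functions, hence Lipschitz in direction
    [h]. The constant depends on [Q] and [d] only, so any decay of the derivatives of [chi] is
    inherited. *)
Lemma ell_bounds : exists2 C : R, 0 <= C & forall (chi : E -> R) (c1 c2 M : R), test_function chi ->
  0 <= c1 -> 0 <= c2 -> (forall k x, `|partial k chi x| <= c1) ->
  (forall k h x (t : R), `|partial k chi (x + t *: uv h) - partial k chi x| <= c2 * `|t|) ->
  (forall k x, M <= `|x| -> partial k chi x = 0) ->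
  exists g : 'I_d -> E -> R, forall h, [/\ wpB h (ell chi h) (g h), forall x, `|ell chi h x| <= C * (c1 + c2),
    forall x, `|g h x| <= C * (c1 + c2) & forall x, M + 1 <= `|x| -> ell chi h x = 0 /\ g h x = 0].
Proof.
have [B B0 HB] := hypQ_bounds; exists (d%:R * B); first by rewrite mulr_ge0.
move=> chi c1 c2 M tchi c10 c20 hc1 hc2 hM.
have sum_le (F : 'I_d -> R) (c : R) : (forall k, `|F k| <= c) -> `|\sum_k F k| <= d%:R * c.
  move=> Fc; apply: le_trans (ler_norm_sum _ _ _) _.
  apply: (@le_trans _ _ (\sum_(k < d) c)); first exact: ler_sum.
  by rewrite sumr_const card_ord mulr_natl.
have lb h x : `|ell chi h x| <= d%:R * B * (c1 + c2).
  rewrite -mulrA; apply: sum_le => k; rewrite normrM; apply: ler_pM => //; first exact: (HB h k).1.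
  by apply: le_trans (hc1 k x) _; rewrite lerDl.
have l0 h x : M <= `|x| -> ell chi h x = 0.
  by move=> xM; apply: big1 => k _; rewrite hM// mulr0.
have lc h : continuous (ell chi h).
  have cF k : continuous (fun x : E => Q x h k * partial k chi x).
    have cq : continuous (fun x : E => Q x h k : R) := @Q_continuous h k.
    have ct : continuous (partial k chi) := test_cont (test_partial k tchi).
    by move=> x; exact: (continuousM (cq x) (ct x)).
  rewrite /ell; elim: (index_enum _) => [|k s IH].
    by under eq_fun do rewrite big_nil; exact: cst_continuous.
  rewrite (_ : (fun x : E => _) = (fun x => Q x h k * partial k chi x + \sum_(k <- s) Q x h k * partial k chi x)).
    by move=> x; exact: (continuousD (cF k x) (IH x)).
  by apply/funext => x; rewrite big_cons.
have ll h x t : `|ell chi h (x + t *: uv h) - ell chi h x| <= d%:R * B * (c1 + c2) * `|t|.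
  rewrite /ell -sumrB -!mulrA; apply: sum_le => k.
  have -> : Q (x + t *: uv h) h k * partial k chi (x + t *: uv h) - Q x h k * partial k chi x =
     (Q (x + t *: uv h) h k - Q x h k) * partial k chi (x + t *: uv h) +
     Q x h k * (partial k chi (x + t *: uv h) - partial k chi x) by ring.
  apply: le_trans (ler_normD _ _) _; rewrite !normrM.
  have -> : B * ((c1 + c2) * `|t|) = (B * `|t|) * c1 + B * (c2 * `|t|) by ring.
  have [HB1 HB2] := HB h k.
  apply: lerD; apply: ler_pM => //.
  apply: le_trans (HB2 _ _) _; rewrite ler_wpM2l// addrC addKr normrZ ler_piMr// norm_unit_vec //.
have C0 : 0 <= d%:R * B * (c1 + c2) by rewrite !mulr_ge0 ?addr_ge0.
have H h := lipschitz_weak_partial C0 (lc h) (l0 h) (ll h).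
have [g hg] := choice H; exists g => h; have [g1 g2 g3] := hg h; split => // x xM.
by rewrite g3// l0//; apply: le_trans xM; rewrite lerDl.
Qed.

Lemma ell_exists (chi : E -> R) : test_function chi -> exists (g : 'I_d -> E -> R) (C M : R), 0 <= C /\
  forall h, [/\ wpB h (ell chi h) (g h), forall x, `|ell chi h x| <= C,
    forall x, `|g h x| <= C & forall x, M <= `|x| -> ell chi h x = 0 /\ g h x = 0].
Proof.
move=> tchi; have [C C0 H] := ell_bounds.
have b1 k := test_bounded (test_partial k tchi).
have [c1 [c10 hc1]] : exists c1 : R, 0 <= c1 /\ forall k x, `|partial k chi x| <= c1.
  have H1 k : exists c, 0 <= c /\ forall x, `|partial k chi x| <= c by have [c ? ?] := b1 k; exists c.
  have [c hc] := choice H1; exists (\sum_k c k); split; first by apply: sumr_ge0 => k _; case: (hc k).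
  move=> k x; apply: le_trans ((hc k).2 x) _.
  by rewrite (bigD1 k)//= lerDl sumr_ge0// => i _; case: (hc i).
have [c2 [c20 hc2]] : exists c2 : R, 0 <= c2 /\ forall k h x (t : R),
    `|partial k chi (x + t *: uv h) - partial k chi x| <= c2 * `|t|.
  have H1 (kh : 'I_d * 'I_d) : exists c, 0 <= c /\ forall x (t : R),
      `|partial kh.1 chi (x + t *: uv kh.2) - partial kh.1 chi x| <= c * `|t|.
    by have [c ? ?] := test_lipschitz kh.2 (test_partial kh.1 tchi); exists c.
  have [c hc] := choice H1; exists (\sum_kh c kh); split; first by apply: sumr_ge0 => k _; case: (hc k).
  move=> k h x t; apply: le_trans ((hc (k, h)).2 x t) _; rewrite ler_wpM2r//.
  by rewrite (bigD1 (k, h))//= lerDl sumr_ge0// => i _; case: (hc i).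
have [M hM] : exists M : R, forall k x, M <= `|x| -> partial k chi x = 0.
  have [M0 hM0] := test_supp tchi; exists (M0 + 1) => k x xM.
  rewrite /partial (@near_eq_derive _ _ _ chi (cst 0) x (delta_mx 0 k)); first by rewrite derive_cst.
  have : nbhs x [set y : E | M0 < `|y|].
    apply: open_nbhs_nbhs; split; first exact: open_normgt.
    by apply: lt_le_trans xM; rewrite ltrDl.
  by apply: filterS => y /= /ltW /hM0 ->.
have [g hg] := H chi c1 c2 M tchi c10 c20 hc1 hc2 hM.
by exists g, (C * (c1 + c2)), (M + 1); split => //; rewrite mulr_ge0 ?addr_ge0.
Qed.

(** Not equal to 1 near the origin: a dilated bump that converges pointwise to the positive constant
    [mbump 0], which is enough to detect that a function vanishes. *)
Definition cutoff (n : nat) : E -> R := fun x => mbump (n.+1%:R^-1 *: x).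

Lemma test_mbump1 : test_function (@mbump R d).
Proof.
have := @test_mbump R d 1 1 ltr01; congr test_function.
by apply/funext => x; rewrite scale1r mul1r.
Qed.

Lemma test_cutoff n : test_function (cutoff n).
Proof.
have c0 : 0 < n.+1%:R^-1 :> R by rewrite invr_gt0.
have := @test_mbump R d _ 1 c0; congr test_function.
by apply/funext => x; rewrite mul1r.
Qed.

Lemma cutoff_cvg x : cutoff n x @[n --> \oo] --> mbump (0 : E).
Proof.
have cb : continuous (@mbump R d) := test_cont test_mbump1.
have h : (n.+1%:R^-1 *: x : E) @[n --> \oo] --> (0 : E).
  by rewrite -(scale0r x); apply: cvgZr_tmp; exact: hseq_cvg0.
exact: (cvg_comp _ _ h (cb 0)).
Qed.

(** First derivatives scale like [1/(n+1)], second ones like its square, which is smaller. The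
    radius grows by one unit twice: the cut-off lives in radius [n + 1], its partials are known to
    vanish from [n + 2], and the weak derivatives of [ell] from [n + 3]. *)
Lemma cutoff_bounds : exists2 C : R, 0 <= C & forall n, exists g : 'I_d -> E -> R, forall h,
  [/\ wpB h (ell (cutoff n) h) (g h), forall x, `|ell (cutoff n) h x| <= C / n.+1%:R,
      forall x, `|g h x| <= C / n.+1%:R &
      forall x, n.+3%:R <= `|x| -> ell (cutoff n) h x = 0 /\ g h x = 0].
Proof.
have [C C0 H] := ell_bounds; have tb := test_mbump1.
have [c1 [c10 hc1]] : exists c1 : R, 0 <= c1 /\ forall k (x : E), `|partial k mbump x| <= c1.
  have H1 k : exists c, 0 <= c /\ forall x : E, `|partial k mbump x| <= c by have [c ? ?] := test_bounded (test_partial k tb); exists c.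
  have [c hc] := choice H1; exists (\sum_k c k); split; first by apply: sumr_ge0 => k _; case: (hc k).
  move=> k x; apply: le_trans ((hc k).2 x) _.
  by rewrite (bigD1 k)//= lerDl sumr_ge0// => i _; case: (hc i).
have [c2 [c20 hc2]] : exists c2 : R, 0 <= c2 /\ forall k h (x : E) (t : R),
    `|partial k mbump (x + t *: uv h) - partial k mbump x| <= c2 * `|t|.
  have H1 (kh : 'I_d * 'I_d) : exists c, 0 <= c /\ forall (x : E) (t : R),
      `|partial kh.1 mbump (x + t *: uv kh.2) - partial kh.1 mbump x| <= c * `|t|.
    by have [c ? ?] := test_lipschitz kh.2 (test_partial kh.1 tb); exists c.
  have [c hc] := choice H1; exists (\sum_kh c kh); split; first by apply: sumr_ge0 => k _; case: (hc k).
  move=> k h x t; apply: le_trans ((hc (k, h)).2 x t) _; rewrite ler_wpM2r//.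
  by rewrite (bigD1 (k, h))//= lerDl sumr_ge0// => i _; case: (hc i).
exists (C * (c1 + c2)); first by rewrite mulr_ge0 ?addr_ge0.
move=> n; set N : R := n.+1%:R; have N0 : 0 < N by rewrite /N.
have N1 : 1 <= N by rewrite /N ler1n.
have iN0 : 0 < N^-1 by rewrite invr_gt0.
have pE k x : partial k (cutoff n) x = N^-1 * partial k mbump (N^-1 *: x).
  apply: partial_scale; first by rewrite gt_eqF.
    by move=> y; exact: test_derivable.
  by move=> y; apply: test_derivable; exact: test_cutoff.
have h1 k x : `|partial k (cutoff n) x| <= c1 / N.
  by rewrite pE normrM gtr0_norm// mulrC ler_wpM2r// ltW.
have h2 k h x t : `|partial k (cutoff n) (x + t *: uv h) - partial k (cutoff n) x| <= c2 / N * `|t|.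
  rewrite !pE -mulrBr normrM gtr0_norm// scalerDr scalerA.
  apply: le_trans (_ : N^-1 * (c2 * `|N^-1 * t|) <= _); first by rewrite ler_wpM2l// ltW.
  rewrite normrM gtr0_norm//; have -> : N^-1 * (c2 * (N^-1 * `|t|)) = (c2 / N * `|t|) * N^-1 by ring.
  by rewrite ler_piMr ?invf_le1// mulr_ge0 ?divr_ge0// ltW.
have h3 k x : n.+2%:R <= `|x| -> partial k (cutoff n) x = 0.
  move=> xM; rewrite /partial (@near_eq_derive _ _ _ (cutoff n) (cst 0) x (delta_mx 0 k)); first by rewrite derive_cst.
  have : nbhs x [set y : E | N < `|y|].
    apply: open_nbhs_nbhs; split; first exact: open_normgt.
    by apply: lt_le_trans xM; rewrite ltr_nat.
  apply: filterS => y /= yN; apply: mbump_eq0; rewrite normrZ gtr0_norm// ler_pdivlMl// mulr1; exact: ltW.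
have [g hg] := H _ _ _ _ (test_cutoff n) (divr_ge0 c10 (ltW N0)) (divr_ge0 c20 (ltW N0)) h1 h2 h3.
exists g => h; have [g1 g2 g3 g4] := hg h.
have e : C * (c1 / N + c2 / N) = C * (c1 + c2) / N by ring.
rewrite -e; split => // x; rewrite -natr1; exact: g4.
Qed.

Section cut.
Variables (chi : E -> R) (g : 'I_d -> E -> R) (B : R).
Hypothesis tchi : test_function chi.
Hypothesis hg : forall h, wpB h (ell chi h) (g h).
Hypothesis lB : forall h x, `|ell chi h x| <= B.
Hypothesis gB : forall h x, `|g h x| <= B.

Lemma wdivB_ell : wdivB (ell chi) (fun x => \sum_h g h x).
Proof.
have hl h : L1b (ell chi h) by have [] := hg h.
have hgh h : L1b (g h) by have [] := hg h.
split => //; first exact: L1b_sum.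
move=> phi tp; rewrite Rintegral_sum; last first.
  by move=> h; apply: L1b_testM => //; exact: test_partial.
have -> : \int[mu]_x ((\sum_h g h x) * phi x) = \int[mu]_x (\sum_h g h x * phi x).
  by apply: eq_Rintegral => x _; rewrite mulr_suml.
rewrite Rintegral_sum; last by move=> h; exact: L1b_testM.
by rewrite -sumrN; apply: eq_bigr => h _; have [_ _] := hg h; exact.
Qed.

(** The product rule [div (Q grad (chi s)) = chi w + div (s Q grad chi) + Q grad chi . grad s]. The
    first term comes from testing with [chi * phi], the second from the weak derivatives of
    [ell chi h * s]; expanded, it contains the third once more, whence the factor 2. *)
Lemma wdivB_cut (s : E -> R) (ds : 'I_d -> E -> R) (w : E -> R) :
  (forall k, wpB k s (ds k)) -> wdivB (fun h x => \sum_k Q x h k * ds k x) w ->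
  wdivB (fun h x => \sum_k Q x h k * (chi x * ds k x + partial k chi x * s x))
    (fun x => chi x * w x + \sum_h (g h x * s x + 2 * ell chi h x * ds h x)).
Proof.
move=> hs [hF hw HF]; have sc := test_smooth tchi.
pose F h x := \sum_k Q x h k * ds k x.
have {}hF h : L1b (F h) := hF h.
have FE h x : \sum_k Q x h k * (chi x * ds k x + partial k chi x * s x) = chi x * F h x + ell chi h x * s x.
  by rewrite /F /ell mulr_sumr mulr_suml -big_split /=; apply: eq_bigr => k _; ring.
have hls h : wpB h (fun x => ell chi h x * s x) (fun x => g h x * s x + ell chi h x * ds h x).
  exact: wpB_bddM (hg h) (lB h) (gB h) hs.
have hls1 h : L1b (fun x => ell chi h x * s x) by have [] := hls h.
have hls2 h : L1b (fun x => g h x * s x + ell chi h x * ds h x) by have [] := hls h.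
have hcF h : L1b (fun x => chi x * F h x) by exact: L1b_smoothM.
have hcw : L1b (fun x => chi x * w x) by exact: L1b_smoothM.
have hld h : L1b (fun x => ell chi h x * ds h x).
  by apply: L1b_bddM (lB h); [have [] := hs h|have [[]] := hg h].
have hS : L1b (fun x => \sum_h (g h x * s x + 2 * ell chi h x * ds h x)).
  apply: L1b_sum => h; have -> : (fun x => g h x * s x + 2 * ell chi h x * ds h x) =
    (fun x => (g h x * s x + ell chi h x * ds h x) + ell chi h x * ds h x) by apply/funext => x; ring.
  exact: L1bD.
split.
- by move=> h; under eq_fun do rewrite FE; exact: L1bD.
- exact: L1bD.
move=> phi tp; have tcp := test_mulS sc tp.
have iF h : mu.-integrable setT (EFin \o (fun x => F h x * partial h (fun x => chi x * phi x) x)).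
  by apply: L1b_testM => //; exact: test_partial.
have id_ h : mu.-integrable setT (EFin \o (fun x => ell chi h x * ds h x * phi x)) by exact: L1b_testM.
have il h : mu.-integrable setT (EFin \o (fun x => ell chi h x * s x * partial h phi x)).
  by apply: L1b_testM => //; exact: test_partial.
have il2 h : mu.-integrable setT (EFin \o (fun x => (g h x * s x + ell chi h x * ds h x) * phi x)).
  exact: L1b_testM.
have sym x h k : Q x h k = Q x k h by have [_ sy _] := hQ; rewrite -{1}(sy x) mxE.
(* Symmetry of [Q]: the two cross terms coincide. *)
have swap x : \sum_h F h x * partial h chi x = \sum_h ell chi h x * ds h x.
  rewrite /F /ell; under eq_bigr do rewrite mulr_suml; rewrite exchange_big /=.
  by apply: eq_bigr => k _; rewrite mulr_suml; apply: eq_bigr => h _; rewrite (sym x h k); ring.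
transitivity (\int[mu]_x (\sum_h F h x * partial h (fun x => chi x * phi x) x) -
    \int[mu]_x (\sum_h ell chi h x * ds h x * phi x) + \int[mu]_x (\sum_h ell chi h x * s x * partial h phi x)).
  rewrite -RintegralB//; [|exact: integrable_sumr|exact: integrable_sumr].
  rewrite -RintegralD//; [|by apply: integrableBr; exact: integrable_sumr|exact: integrable_sumr].
  apply: eq_Rintegral => x _.
  rewrite -mulr_suml -swap mulr_suml -sumrB -big_split /=; apply: eq_bigr => h _.
  by rewrite FE partialM//; [ring|exact: test_smooth].
rewrite HF// (Rintegral_sum _ il) (eq_bigr (fun h => - \int[mu]_x ((g h x * s x + ell chi h x * ds h x) * phi x))); last first.
  by move=> h _; have [_ _] := hls h; exact.
rewrite sumrN -(Rintegral_sum _ il2) -!opprD -RintegralD//; first last.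
- exact: integrable_sumr.
- exact: L1b_testM hw tcp.
rewrite -RintegralD//; first last.
- exact: integrable_sumr.
- by apply: integrableDr; [exact: L1b_testM hw tcp|exact: integrable_sumr].
congr (- _); apply: eq_Rintegral => x _; rewrite -!mulr_suml.
have -> : \sum_h (g h x * s x + 2 * ell chi h x * ds h x) =
    \sum_h ell chi h x * ds h x + \sum_h (g h x * s x + ell chi h x * ds h x).
  by rewrite -big_split /=; apply: eq_bigr => h _; ring.
by ring.
Qed.

End cut.
End coefficients.

(** * The spaces L^p *)

Lemma powR_sum_le (R : realType) (I : Type) (s : seq I) (a : I -> R) (p : R) : 0 < p ->
  (\sum_(i <- s) `|a i|) `^ p <= (size s)%:R `^ p * \sum_(i <- s) `|a i| `^ p.
Proof.
move=> p0; set S := \sum_(i <- s) `|a i| `^ p.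
have S0 : 0 <= S by apply: sumr_ge0 => i _; exact: powR_ge0.
have h : \sum_(i <- s) `|a i| <= (size s)%:R * S `^ p^-1.
  rewrite -sum1_size natr_sum mulr_suml mul1r.
  have : forall T, \sum_(i <- s) `|a i| `^ p <= T -> \sum_(i <- s) `|a i| <= \sum_(i <- s) T `^ p^-1.
    elim: s {S S0} => [|i s IH] T; first by rewrite !big_nil.
    rewrite !big_cons => hT; apply: lerD.
      rewrite -[leLHS](powR_invK p0 (normr_ge0 (a i))).
      have sp : 0 <= \sum_(j <- s) `|a j| `^ p by apply: sumr_ge0 => j _; exact: powR_ge0.
      have ap := powR_ge0 `|a i| p.
      by apply: ge0_ler_powR; rewrite ?invr_ge0 ?nnegrE ?(ltW p0)//; lra.
    by apply: IH; have := powR_ge0 `|a i| p; lra.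
  by move=> /(_ S (lexx _)).
apply: (@le_trans _ _ (((size s)%:R * S `^ p^-1) `^ p)).
  apply: ge0_ler_powR => //; rewrite ?nnegrE ?(ltW p0)//; first exact: sumr_ge0.
  by rewrite mulr_ge0 ?powR_ge0.
by rewrite powRM ?powR_ge0// -powRrM mulVf ?gt_eqF// powRr1.
Qed.

Section Cvec.
Context {R : realType} {m : nat}.
Implicit Types z w : 'cV[R[i]]_m.
Notation Re := complex.Re.
Notation Im := complex.Im.

Let sq z := \sum_j (Re (z j 0) ^+ 2 + Im (z j 0) ^+ 2).

Let sq_ge0 z : 0 <= sq z.
Proof. by apply: sumr_ge0 => j _; rewrite addr_ge0 ?sqr_ge0. Qed.

Lemma Cvec_norm_ge0 z : 0 <= Cvec_norm z.
Proof. exact: sqrtr_ge0. Qed.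

Lemma Cvec_norm_sqr z : Cvec_norm z ^+ 2 = \sum_j (Re (z j 0) ^+ 2 + Im (z j 0) ^+ 2).
Proof. by rewrite /Cvec_norm sqr_sqrtr//; exact: sq_ge0. Qed.

Lemma ReD (a b : R[i]) : Re (a + b) = Re a + Re b.
Proof. by case: a b => [? ?] [? ?]. Qed.

Lemma ImD (a b : R[i]) : Im (a + b) = Im a + Im b.
Proof. by case: a b => [? ?] [? ?]. Qed.

Lemma ReB (a b : R[i]) : Re (a - b) = Re a - Re b.
Proof. by case: a b => [? ?] [? ?]. Qed.

Lemma ImB (a b : R[i]) : Im (a - b) = Im a - Im b.
Proof. by case: a b => [? ?] [? ?]. Qed.

Lemma ReZ (a : R) (b : R[i]) : Re (a%:C%C * b) = a * Re b.
Proof. by case: b => [? ?] /=; rewrite mul0r subr0. Qed.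

Lemma ImZ (a : R) (b : R[i]) : Im (a%:C%C * b) = a * Im b.
Proof. by case: b => [? ?] /=; rewrite mul0r addr0. Qed.

Lemma Cvec_norm_comp z j : `|Re (z j 0)| <= Cvec_norm z /\ `|Im (z j 0)| <= Cvec_norm z.
Proof.
have h : Re (z j 0) ^+ 2 + Im (z j 0) ^+ 2 <= sq z.
  by rewrite /sq (bigD1 j)//= lerDl sumr_ge0// => i _; rewrite addr_ge0 ?sqr_ge0.
by split; rewrite -sqrtr_sqr /Cvec_norm ler_wsqrtr//; apply: le_trans h; rewrite ?lerDl ?lerDr sqr_ge0.
Qed.

Lemma Cvec_normZ (a : R) z : Cvec_norm (a%:C%C *: z) = `|a| * Cvec_norm z.
Proof.
rewrite /Cvec_norm -sqrtr_sqr -sqrtrM ?sqr_ge0//; congr Num.sqrt.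
by rewrite mulr_sumr; apply: eq_bigr => j _; rewrite mxE ReZ ImZ; ring.
Qed.

Lemma Cvec_normD z w : Cvec_norm (z + w) <= Cvec_norm z + Cvec_norm w.
Proof.
pose S := \sum_j (Re (z j 0) * Re (w j 0) + Im (z j 0) * Im (w j 0)).
have zw : sq (z + w) = sq z + 2 * S + sq w.
  rewrite /sq /S mulr_sumr -!big_split /=; apply: eq_bigr => j _.
  by rewrite mxE ReD ImD; ring.
have CS : S ^+ 2 <= sq z * sq w.
  (* At [A = sq w] and [B = S], the nonnegativity of this sum is Cauchy-Schwarz multiplied by
     [sq w]; the case [sq w = 0] is separate. *)
  have key (A B : R) : \sum_j ((A * Re (z j 0) - B * Re (w j 0)) ^+ 2 + (A * Im (z j 0) - B * Im (w j 0)) ^+ 2) =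
      A ^+ 2 * sq z - 2 * A * B * S + B ^+ 2 * sq w.
    by rewrite /sq /S !mulr_sumr -sumrB -big_split /=; apply: eq_bigr => j _; ring.
  have h : 0 <= sq w * (sq z * sq w - S ^+ 2).
    have := key (sq w) S => e; have -> : sq w * (sq z * sq w - S ^+ 2) = sq w ^+ 2 * sq z - 2 * sq w * S * S + S ^+ 2 * sq w by ring.
    by rewrite -e; apply: sumr_ge0 => j _; rewrite addr_ge0 ?sqr_ge0.
  move: (sq_ge0 w); rewrite le_eqVlt => /predU1P[w0|w0]; last by rewrite -subr_ge0 -(pmulr_rge0 _ w0).
  have wj j : Re (w j 0) = 0 /\ Im (w j 0) = 0.
    have := w0; rewrite /sq (bigD1 j)//=; set T := \sum_(i | _) _ => w0'.
    have T0 : 0 <= T by apply: sumr_ge0 => i _; rewrite addr_ge0 ?sqr_ge0.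
    have a0 := sqr_ge0 (Re (w j 0)); have b0 := sqr_ge0 (Im (w j 0)).
    by split; apply/eqP; rewrite -sqrf_eq0; apply/eqP; lra.
  have -> : S = 0 by rewrite /S big1// => j _; have [-> ->] := wj j; rewrite !mulr0 addr0.
  by rewrite expr0n mulr_ge0 ?sq_ge0.
have zn := Cvec_norm_ge0 z; have wn := Cvec_norm_ge0 w.
have z2 : Cvec_norm z ^+ 2 = sq z := Cvec_norm_sqr z.
have w2 : Cvec_norm w ^+ 2 = sq w := Cvec_norm_sqr w.
have Sle : S <= Cvec_norm z * Cvec_norm w.
  apply: le_trans (ler_norm _) _; rewrite -sqrtr_sqr -[leRHS]ger0_norm ?mulr_ge0//.
  by rewrite -[leRHS]sqrtr_sqr ler_wsqrtr// exprMn z2 w2.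
rewrite -[leRHS]ger0_norm ?addr_ge0// -sqrtr_sqr [Cvec_norm (z + w)]/Cvec_norm ler_wsqrtr//.
by rewrite -/(sq (z + w)) zw sqrrD z2 w2 -mulr_natl; lra.
Qed.

Lemma Cvec_norm_le z : Cvec_norm z <= \sum_j (`|Re (z j 0)| + `|Im (z j 0)|).
Proof.
have e : z = \sum_j ((Re (z j 0))%:C%C *: delta_mx j 0 + (Im (z j 0))%:C%C *: ('i%C *: delta_mx j 0)).
  apply/matrixP => i j; rewrite ord1 summxE (bigD1 i)//= big1 ?addr0 => [|k ki]; last first.
    by rewrite !mxE eq_sym (negbTE ki) /= !mulr0 addr0.
  by rewrite !mxE !eqxx /= !mulr1; case: (z i 0) => a b; congr (Complex _ _) => /=; ring.
have n1 j : Cvec_norm (delta_mx j 0 : 'cV[R[i]]_m) = 1.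
  rewrite /Cvec_norm (bigD1 j)//= big1 => [|k kj]; last by rewrite !mxE (negbTE kj) /= expr0n addr0.
  by rewrite !mxE !eqxx /= expr1n expr0n !addr0 sqrtr1.
have n2 j : Cvec_norm ('i%C *: delta_mx j 0 : 'cV[R[i]]_m) = 1.
  rewrite /Cvec_norm (bigD1 j)//= big1 => [|k kj]; last by rewrite !mxE (negbTE kj) /= !mulr0 !subr0 !addr0 expr0n addr0.
  by rewrite !mxE !eqxx /= !(mulr0, mulr1, mul0r, mul1r, subr0, addr0, add0r, sub0r, oppr0, subrr, expr1n, expr0n) /= ?add0r ?addr0 sqrtr1.
rewrite {1}e; elim/big_rec2: _ => [|j x y _ xy].
  by rewrite /Cvec_norm big1 ?sqrtr0// => j _; rewrite !mxE /= expr0n addr0.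
apply: le_trans (Cvec_normD _ _) _; apply: lerD => //.
by apply: le_trans (Cvec_normD _ _) _; rewrite !Cvec_normZ n1 n2 !mulr1.
Qed.

Lemma Cvec_norm_eq0 z : Cvec_norm z = 0 -> z = 0.
Proof.
move=> z0; apply/matrixP => j k; rewrite ord1 mxE.
have [] := Cvec_norm_comp z j; rewrite z0 !normr_le0 => /eqP a /eqP b.
by case: (z j 0) a b => /= ? ? -> ->.
Qed.

End Cvec.

Section Lp_space.
Context {R : realType} {d m : nat}.
Local Notation E := 'rV[R]_d.
Local Notation mu := (lebesgue_rV R d).
Local Notation vfun := (vfun R d m).
Implicit Types (u w f g : vfun) (p : R).

Definition borelv u := forall j, measurable_fun setT (re_comp u j) /\ measurable_fun setT (im_comp u j).

Definition vmeas u := forall j, lebesgue_measurable_fun (re_comp u j) /\ lebesgue_measurable_fun (im_comp u j).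

Definition vn u : E -> R := fun x => Cvec_norm (u x).

Lemma vae_eq_refl u : vae_eq u u.
Proof. exact: aeW. Qed.

Lemma vae_eq_sym u w : vae_eq u w -> vae_eq w u.
Proof. by apply: filterS => x ->. Qed.

Lemma vae_eq_trans u w f : vae_eq u w -> vae_eq w f -> vae_eq u f.
Proof. by apply: filterS2 => x -> ->. Qed.

Lemma ae_all_ord n (P : 'I_n -> E -> Prop) : (forall j, {ae mu, forall x, P j x}) ->
  {ae mu, forall x, forall j, P j x}.
Proof.
move=> H; have : {ae mu, forall x, forall j, j \in index_enum 'I_n -> P j x}.
  elim: (index_enum _) => [|j s IH]; first exact: aeW.
  apply: filterS2 (H j) IH => x Pj hs k; rewrite inE => /predU1P[-> //|]; exact: hs.
by apply: filterS => x h j; apply: h; rewrite mem_index_enum.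
Qed.

Lemma lebesgue_borel (f : E -> R) : measurable_fun setT f -> lebesgue_measurable_fun f.
Proof. by move=> mf; exists f => //; exact: aeW. Qed.

Lemma lebesgue_ae (f g : E -> R) : {ae mu, forall x, f x = g x} -> lebesgue_measurable_fun f -> lebesgue_measurable_fun g.
Proof. by move=> fg [h mh fh]; exists h => //; apply: filterS2 fg fh => x -> ->. Qed.

Lemma vmeas_borel u : vmeas u -> exists2 u', borelv u' & vae_eq u u'.
Proof.
move=> mu_.
have H1 j : exists h : E -> R, measurable_fun setT h /\ {ae mu, forall x, re_comp u j x = h x}.
  by have [[h mh e] _] := mu_ j; exists h.
have H2 j : exists h : E -> R, measurable_fun setT h /\ {ae mu, forall x, im_comp u j x = h x}.
  by have [_ [h mh e]] := mu_ j; exists h.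
have [a ha] := choice H1; have [b hb] := choice H2.
exists (fun x => \col_j (Complex (a j x) (b j x))).
  move=> j; have [[ma _] [mb _]] := (ha j, hb j); split.
    by apply: eq_measurable_fun ma => x _; rewrite /re_comp mxE.
  by apply: eq_measurable_fun mb => x _; rewrite /im_comp mxE.
apply: filterS2 (ae_all_ord (fun j => (ha j).2)) (ae_all_ord (fun j => (hb j).2)) => x xa xb.
apply/matrixP => j k; rewrite ord1 mxE -(xa j) -(xb j) /re_comp /im_comp.
by case: (u x j 0).
Qed.

Lemma borelv_meas u : borelv u -> vmeas u.
Proof. by move=> bu j; have [? ?] := bu j; split; exact: lebesgue_borel. Qed.

Lemma vmeas_ae u w : vae_eq u w -> vmeas u -> vmeas w.
Proof.
move=> uw mu_ j; have [h1 h2] := mu_ j; split.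
  by apply: lebesgue_ae h1; apply: filterS uw => x e; rewrite /re_comp e.
by apply: lebesgue_ae h2; apply: filterS uw => x e; rewrite /im_comp e.
Qed.

Lemma LpN_Ip p u : LpN p u = (Ip mu p (vn u) `^ p^-1)%E.
Proof. by rewrite /LpN unlock. Qed.

Lemma LpN_ae p u w : vae_eq u w -> LpN p u = LpN p w.
Proof.
move=> uw; rewrite !LpN_Ip; have -> // : Ip mu p (vn u) = Ip mu p (vn w).
by apply: ae_eq_integral_nm; apply: filterS uw => x e _; rewrite /vn e.
Qed.

Lemma Ip_ge0 p (f : E -> R) : (0 <= Ip mu p f)%E.
Proof. by apply: integral_ge0 => x _; rewrite lee_fin powR_ge0. Qed.

Lemma LpN_ge0 p u : (0 <= LpN p u)%E.
Proof. exact: Lnorm_ge0. Qed.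

Lemma LpN_lty p u : 0 < p -> (LpN p u < +oo)%E <-> (Ip mu p (vn u) < +oo)%E.
Proof.
move=> p0; rewrite LpN_Ip; have := Ip_ge0 p (vn u).
have np : p^-1 != 0 by rewrite invr_neq0// gt_eqF.
case: (Ip mu p (vn u)) => [r| |]// r0; rewrite ?poweRyr//.
by rewrite poweR_EFin !ltry.
Qed.

Lemma LpN_le p u (e : R) : 0 < p -> 0 <= e -> (LpN p u <= e%:E)%E <-> (Ip mu p (vn u) <= (e `^ p)%:E)%E.
Proof.
move=> p0 e0; rewrite LpN_Ip; have := Ip_ge0 p (vn u).
have np : p^-1 != 0 by rewrite invr_neq0// gt_eqF.
case: (Ip mu p (vn u)) => [r| |]// r0; rewrite ?poweRyr// poweR_EFin !lee_fin; rewrite lee_fin in r0.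
split=> h.
  rewrite -(powRr1 r0) -(mulVf (lt0r_neq0 p0)) powRrM.
  by apply: ge0_ler_powR; rewrite ?nnegrE ?(ltW p0) ?powR_ge0.
rewrite -(powR_invK p0 e0).
by apply: ge0_ler_powR; rewrite ?invr_ge0 ?nnegrE ?(ltW p0) ?powR_ge0.
Qed.

Lemma re_compB u w j : re_comp (fun x => u x - w x) j = (fun x => re_comp u j x - re_comp w j x).
Proof. by apply/funext => x; rewrite /re_comp !mxE ReB. Qed.

Lemma im_compB u w j : im_comp (fun x => u x - w x) j = (fun x => im_comp u j x - im_comp w j x).
Proof. by apply/funext => x; rewrite /im_comp !mxE ImB. Qed.

Lemma re_compD u w j : re_comp (fun x => u x + w x) j = (fun x => re_comp u j x + re_comp w j x).
Proof. by apply/funext => x; rewrite /re_comp !mxE ReD. Qed.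

Lemma im_compD u w j : im_comp (fun x => u x + w x) j = (fun x => im_comp u j x + im_comp w j x).
Proof. by apply/funext => x; rewrite /im_comp !mxE ImD. Qed.

Lemma re_compZ (a : E -> R) u j : re_comp (fun x => (a x)%:C%C *: u x) j = (fun x => a x * re_comp u j x).
Proof. by apply/funext => x; rewrite /re_comp mxE ReZ. Qed.

Lemma im_compZ (a : E -> R) u j : im_comp (fun x => (a x)%:C%C *: u x) j = (fun x => a x * im_comp u j x).
Proof. by apply/funext => x; rewrite /im_comp mxE ImZ. Qed.

Lemma borelvD u w : borelv u -> borelv w -> borelv (fun x => u x + w x).
Proof.
move=> bu bw j; rewrite re_compD im_compD; have [a b] := bu j; have [a' b'] := bw j.
by split; exact: measurable_funD.
Qed.

Lemma borelvM (a : E -> R) u : measurable_fun setT a -> borelv u -> borelv (fun x => (a x)%:C%C *: u x).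
Proof.
by move=> ma bu j; rewrite re_compZ im_compZ; have [? ?] := bu j; split; exact: measurable_funM.
Qed.

Lemma measurable_vn u : borelv u -> measurable_fun setT (vn u).
Proof.
move=> bu; pose g x := \sum_(j <- index_enum 'I_m) (re_comp u j x ^+ 2 + im_comp u j x ^+ 2).
have mg : measurable_fun setT g.
  by apply: measurable_sum => j; have [a b] := bu j; apply: measurable_funD; exact: measurable_funX.
rewrite (_ : vn u = (fun y => y `^ 2^-1) \o g).
  by apply: measurableT_comp => //; exact: measurable_powR.
apply/funext => x; rewrite /= powR12_sqrt//.
by apply: sumr_ge0 => j _; rewrite addr_ge0 ?sqr_ge0.
Qed.

Lemma Lp_meas p u : Lp p u -> vmeas u.
Proof. by case. Qed.

Lemma LpP p u : 0 < p -> Lp p u <-> vmeas u /\ (Ip mu p (vn u) < +oo)%E.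
Proof.
by move=> p0; split=> -[mu_ h]; split => //; [rewrite -LpN_lty|rewrite LpN_lty].
Qed.

Lemma Lp_ae p u w : vae_eq u w -> Lp p u -> Lp p w.
Proof. by move=> uw [mu_ h]; split; [exact: vmeas_ae uw mu_|rewrite -(LpN_ae p uw)]. Qed.

Lemma Lp_borel p u : Lp p u -> exists u', [/\ borelv u', vae_eq u u' & Lp p u'].
Proof.
by move=> h; have [u' bu uu'] := vmeas_borel (Lp_meas h); exists u'; split => //; exact: Lp_ae uu' h.
Qed.

Lemma vae_eqD u u' w w' : vae_eq u u' -> vae_eq w w' -> vae_eq (fun x => u x + w x) (fun x => u' x + w' x).
Proof. by apply: filterS2 => x -> ->. Qed.

Lemma vae_eqB u u' w w' : vae_eq u u' -> vae_eq w w' -> vae_eq (fun x => u x - w x) (fun x => u' x - w' x).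
Proof. by apply: filterS2 => x -> ->. Qed.

Lemma vae_eqZ (a : R[i]) u u' : vae_eq u u' -> vae_eq (fun x => a *: u x) (fun x => a *: u' x).
Proof. by apply: filterS => x ->. Qed.

Lemma LpN_D p u w : 1 <= p -> vmeas u -> vmeas w ->
  (LpN p (fun x => (u x + w x)%R) <= LpN p u + LpN p w)%E.
Proof.
move=> p1 mu_ mw; have [u' bu uu'] := vmeas_borel mu_; have [w' bw ww'] := vmeas_borel mw.
rewrite (LpN_ae p uu') (LpN_ae p ww') (LpN_ae p (vae_eqD uu' ww')).
have p0 : 0 < p by lra.
apply: le_trans (minkowski_EFin _ (measurable_vn bu) (measurable_vn bw) p1).
rewrite /LpN unlock; apply: gt0_ler_poweR; rewrite ?invr_ge0 ?(ltW p0) ?in_itv/= ?leey ?andbT ?integral_ge0//.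
apply: ge0_le_integral_nm => x _; rewrite ?lee_fin ?powR_ge0//.
apply: ge0_ler_powR; rewrite ?nnegrE ?(ltW p0)//= !ger0_norm ?addr_ge0 ?Cvec_norm_ge0//.
exact: Cvec_normD.
Qed.

Lemma LpN_Z p (a : R) u : 0 < p -> vmeas u -> LpN p (fun x => (a%:C)%C *: u x) = (`|a|%:E * LpN p u)%E.
Proof.
move=> p0 mu_; have [u' bu uu'] := vmeas_borel mu_.
rewrite (LpN_ae p uu') (LpN_ae p (vae_eqZ _ uu')) !LpN_Ip.
have -> : Ip mu p (vn (fun x => a%:C%C *: u' x)) = ((`|a| `^ p)%:E * Ip mu p (vn u'))%E.
  have cp : (0 <= (`|a| `^ p)%:E)%E by rewrite lee_fin powR_ge0.
  rewrite /Ip -(ge0_integralZl mu measurableT (measurable_Ip p (measurable_vn bu)) _ cp)//.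
  by apply: eq_integral => x _; rewrite /vn Cvec_normZ normrM normr_id powRM// EFinM.
rewrite poweRM ?lee_fin ?powR_ge0 ?Ip_ge0//; congr (_ * _)%E.
by rewrite poweR_EFin powR_invK.
Qed.

Lemma vmeasD u w : vmeas u -> vmeas w -> vmeas (fun x => u x + w x).
Proof.
move=> mu_ mw; have [u' bu uu'] := vmeas_borel mu_; have [w' bw ww'] := vmeas_borel mw.
by apply: vmeas_ae (vae_eq_sym (vae_eqD uu' ww')) _; apply: borelv_meas; exact: borelvD.
Qed.

Lemma vmeasZ (a : R) u : vmeas u -> vmeas (fun x => a%:C%C *: u x).
Proof.
move=> mu_; have [u' bu uu'] := vmeas_borel mu_.
by apply: vmeas_ae (vae_eq_sym (vae_eqZ _ uu')) _; apply: borelv_meas; exact: (@borelvM (fun=> a)).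
Qed.

Lemma LpD p u w : 1 <= p -> Lp p u -> Lp p w -> Lp p (fun x => u x + w x).
Proof.
move=> p1 [mu_ hu] [mw hw]; split; first exact: vmeasD.
by apply: le_lt_trans (LpN_D p1 mu_ mw) _; exact: lte_add_pinfty.
Qed.

Lemma LpZ p (a : R) u : 0 < p -> Lp p u -> Lp p (fun x => a%:C%C *: u x).
Proof.
move=> p0 [mu_ hu]; split; first exact: vmeasZ.
by rewrite LpN_Z// lte_mul_pinfty ?lee_fin.
Qed.

Lemma Lp0 p : 0 < p -> Lp p (fun _ : E => 0 : 'cV[R[i]]_m).
Proof.
move=> p0; apply/LpP => //; split.
  apply: borelv_meas => j; split.
    by rewrite (_ : re_comp _ j = cst 0)//; apply/funext => x; rewrite /re_comp mxE.
  by rewrite (_ : im_comp _ j = cst 0)//; apply/funext => x; rewrite /im_comp mxE.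
rewrite /Ip integral0_eq ?ltry// => x _; rewrite /vn.
have := Cvec_normZ 0 (0 : 'cV[R[i]]_m); rewrite scaler0 normr0 mul0r => ->.
by rewrite normr0 powR0 ?gt_eqF.
Qed.

Lemma scaleN1C (z : 'cV[R[i]]_m) : (-1)%:C%C *: z = - z.
Proof. by apply/matrixP => i j; rewrite !mxE; case: (z i j) => a b; congr (Complex _ _); ring. Qed.

Lemma LpB p u w : 1 <= p -> Lp p u -> Lp p w -> Lp p (fun x => u x - w x).
Proof.
move=> p1 hu hw; have p0 : 0 < p by lra.
have := LpD p1 hu (LpZ (-1) p0 hw); congr (Lp p _).
by apply/funext => x; rewrite scaleN1C.
Qed.

Lemma LpN_eq0 p u : 0 < p -> vmeas u -> LpN p u = 0%E -> vae_eq u (fun=> 0).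
Proof.
move=> p0 mu_ h; have [u' bu uu'] := vmeas_borel mu_.
rewrite (LpN_ae p uu') in h; apply: (vae_eq_trans uu').
have h0 : measurable_fun setT (fun x => (vn u' x)%:E) by apply/measurable_EFinP; exact: measurable_vn.
have := Lnorm_eq0_eq0 h0 _ h; rewrite lte_fin => /(_ p0)[].
move=> A [mA A0 hA]; exists A; split => //; apply: subset_trans hA => x /= nx hx; apply: nx.
by apply: Cvec_norm_eq0; have := hx I => -[].
Qed.

Lemma LpN_fin p u : Lp p u -> LpN p u = (fine (LpN p u))%:E.
Proof. by case=> _ h; rewrite fineK// ge0_fin_numE// LpN_ge0. Qed.

Lemma Ip_le p (f g : E -> R) : 0 <= p -> (forall x, `|f x| <= `|g x|) -> (Ip mu p f <= Ip mu p g)%E.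
Proof.
move=> p0 fg; apply: ge0_le_integral_nm => x _; rewrite ?lee_fin ?powR_ge0//.
by apply: ge0_ler_powR.
Qed.

Lemma Ip_comp p u j : 0 <= p -> (Ip mu p (re_comp u j) <= Ip mu p (vn u))%E /\
  (Ip mu p (im_comp u j) <= Ip mu p (vn u))%E.
Proof.
by move=> p0; split; apply: Ip_le => // x; rewrite [leRHS]ger0_norm ?Cvec_norm_ge0//;
  have [] := Cvec_norm_comp (u x) j.
Qed.

Lemma Ip_sum_le p (J : Type) (s : seq J) (f : J -> E -> R) (g : E -> R) : 0 < p ->
  (forall j, measurable_fun setT (f j)) -> (forall x, `|g x| <= \sum_(j <- s) `|f j x|) ->
  (Ip mu p g <= ((size s)%:R `^ p)%:E * \sum_(j <- s) Ip mu p (f j))%E.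
Proof.
move=> p0 mf fg.
have mI j : measurable_fun setT (fun x => (`|f j x| `^ p)%:E) by exact: measurable_Ip.
have cp : (0 <= ((size s)%:R `^ p)%:E :> \bar R)%E by rewrite lee_fin powR_ge0.
have pI j (x : E) : setT x -> (0 <= (`|f j x| `^ p)%:E)%E by rewrite lee_fin powR_ge0.
rewrite /Ip -(ge0_integral_sum mu measurableT mI pI).
rewrite -(ge0_integralZl mu measurableT (emeasurable_sum s (fun j => mI j)) _ cp)//; last first.
  by move=> x _; apply: sume_ge0 => j _; exact: pI.
apply: ge0_le_integral_nm => x _; rewrite ?lee_fin ?powR_ge0//.
rewrite sumEFin -EFinM lee_fin; apply: le_trans (powR_sum_le _ _ p0).
by apply: ge0_ler_powR; rewrite ?nnegrE ?(ltW p0)//; apply: sumr_ge0.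
Qed.

Lemma Ip_vn_le p u : 0 < p -> borelv u ->
  (Ip mu p (vn u) <= ((size (index_enum 'I_m) + size (index_enum 'I_m))%:R `^ p)%:E *
     (\sum_j Ip mu p (re_comp u j) + \sum_j Ip mu p (im_comp u j)))%E.
Proof.
move=> p0 bu; pose f (s : 'I_m + 'I_m) := match s with inl j => re_comp u j | inr j => im_comp u j end.
pose s := [seq inl j | j <- index_enum 'I_m] ++ [seq inr j | j <- index_enum 'I_m] : seq ('I_m + 'I_m).
have := @Ip_sum_le p _ s f (vn u) p0; rewrite size_cat !size_map big_cat /= !big_map; apply.
  by move=> [j|j]; have [] := bu j.
move=> x; rewrite big_cat /= !big_map /= -big_split /= ger0_norm ?Cvec_norm_ge0//.
exact: Cvec_norm_le.
Qed.

(** The real and imaginary components of Borel representatives are Cauchy; their limits are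
    reassembled, and [Ip_vn_le] bounds the error by those of the components. *)
Lemma Lp_complete p (u : nat -> vfun) : 1 <= p -> (forall k, Lp p (u k)) ->
  (forall e : R, 0 < e -> exists n0, forall j k, (n0 <= j)%N -> (n0 <= k)%N ->
     (LpN p (fun x => (u j x - u k x)%R) <= e%:E)%E) ->
  exists v, Lp p v /\ forall e : R, 0 < e -> exists n0, forall k, (n0 <= k)%N ->
     (LpN p (fun x => (u k x - v x)%R) <= e%:E)%E.
Proof.
move=> p1 hu Hc; have p0 : 0 < p by lra.
have [b hb] := choice (fun k => Lp_borel (hu k)).
have bb k : borelv (b k) by case: (hb k).
have ub k : vae_eq (u k) (b k) by case: (hb k).
have lb k : Lp p (b k) by case: (hb k).
have Hb e : 0 < e -> exists n0, forall j k, (n0 <= j)%N -> (n0 <= k)%N ->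
    (Ip mu p (vn (fun x => (b j x - b k x)%R)) <= e%:E)%E.
  move=> e0; have e1 : 0 < e `^ p^-1 by rewrite powR_gt0.
  have [n0 hn0] := Hc _ e1; exists n0 => j k nj nk; have := hn0 j k nj nk.
  rewrite (LpN_ae p (vae_eqB (ub j) (ub k))) LpN_le ?(ltW e1)//.
  by rewrite -powRrM mulVf ?gt_eqF// powRr1// ltW.
have cr j : exists v : E -> R, measurable_fun setT v /\ tends0 (fun k => Ip mu p (fun x => re_comp (b k) j x - v x)).
  suff [v mv hv] : exists2 v : E -> R, measurable_fun setT v & tends0 (fun k => Ip mu p (fun x => re_comp (b k) j x - v x)) by exists v.
  apply: Ip_complete => // [k|e e0]; first by have [] := bb k j.
  have [n0 hn0] := Hb e e0; exists n0 => i k ni nk; apply: le_trans (hn0 i k ni nk).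
  by have [h _] := Ip_comp (fun x => b i x - b k x) j (ltW p0); rewrite re_compB in h.
have ci j : exists v : E -> R, measurable_fun setT v /\ tends0 (fun k => Ip mu p (fun x => im_comp (b k) j x - v x)).
  suff [v mv hv] : exists2 v : E -> R, measurable_fun setT v & tends0 (fun k => Ip mu p (fun x => im_comp (b k) j x - v x)) by exists v.
  apply: Ip_complete => // [k|e e0]; first by have [] := bb k j.
  have [n0 hn0] := Hb e e0; exists n0 => i k ni nk; apply: le_trans (hn0 i k ni nk).
  by have [_ h] := Ip_comp (fun x => b i x - b k x) j (ltW p0); rewrite im_compB in h.
have [a ha] := choice cr; have [c hc] := choice ci.
pose v : vfun := fun x => \col_j (Complex (a j x) (c j x)).
have va j : re_comp v j = a j by apply/funext => x; rewrite /re_comp mxE.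
have vc j : im_comp v j = c j by apply/funext => x; rewrite /im_comp mxE.
have bv : borelv v by move=> j; rewrite va vc; have [? _] := ha j; have [? _] := hc j.
have bbv k : borelv (fun x => b k x - v x).
  move=> j; rewrite re_compB im_compB va vc; have [? _] := ha j; have [? _] := hc j.
  by have [? ?] := bb k j; split; exact: measurable_funB.
have T0 : tends0 (fun k => Ip mu p (vn (fun x => b k x - v x))).
  have := @tends0Z R ((size (index_enum 'I_m) + size (index_enum 'I_m))%:R `^ p) _ (powR_ge0 _ _)
    (tends0D (tends0_sum (index_enum 'I_m) (fun j => (ha j).2)) (tends0_sum (index_enum 'I_m) (fun j => (hc j).2))).
  apply: tends0_le => k; apply: le_trans (Ip_vn_le p0 (bbv k)) _.
  have E1 j : Ip mu p (re_comp (fun x => b k x - v x) j) = Ip mu p (fun x => re_comp (b k) j x - a j x).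
    by rewrite re_compB va.
  have E2 j : Ip mu p (im_comp (fun x => b k x - v x) j) = Ip mu p (fun x => im_comp (b k) j x - c j x).
    by rewrite im_compB vc.
  by rewrite (eq_bigr _ (fun j _ => E1 j)) (eq_bigr _ (fun j _ => E2 j)).
have L0 e : 0 < e -> exists n0, forall k, (n0 <= k)%N -> (LpN p (fun x => (b k x - v x)%R) <= e%:E)%E.
  move=> e0; have [n0 hn0] := T0 (e `^ p) (powR_gt0 _ e0).
  by exists n0 => k /hn0; rewrite LpN_le// ltW.
exists v; split; last first.
  move=> e e0; have [n0 hn0] := L0 e e0; exists n0 => k /hn0.
  by rewrite (LpN_ae p (vae_eqB (ub k) (vae_eq_refl v))).
have [n0 /(_ n0 (leqnn _)) h] := L0 1 ltr01.
have hl : Lp p (fun x => b n0 x - v x).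
  by split; [exact: borelv_meas|apply: le_lt_trans h _; exact: ltry].
have := LpB p1 (lb n0) hl; congr (Lp p _); apply/funext => x.
by rewrite subKr.
Qed.

End Lp_space.

(** * Contraction semigroups *)

Section contraction_semigroup.
Context {R : realType} {X : lmodType R}.
Variable N : X -> R.
Hypothesis N0 : forall x, N x = 0 -> x = 0.
Hypothesis ND : forall x y, N (x + y) <= N x + N y.
Hypothesis NZ : forall a x, N (a *: x) = `|a| * N x.
Hypothesis Ncomplete : forall u : nat -> X,
  (forall e : R, 0 < e -> exists n0, forall j k, (n0 <= j)%N -> (n0 <= k)%N -> N (u j - u k) <= e) ->
  exists v, forall e : R, 0 < e -> exists n0, forall k, (n0 <= k)%N -> N (u k - v) <= e.
Variable S : R -> X -> X.
Hypothesis S_add : forall t x y, 0 <= t -> S t (x + y) = S t x + S t y.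
Hypothesis S_scale : forall t a x, 0 <= t -> S t (a *: x) = a *: S t x.
Hypothesis S_contr : forall t x, 0 <= t -> N (S t x) <= N x.
Hypothesis S_0 : forall x, S 0 x = x.
Hypothesis S_D : forall s t x, 0 <= s -> 0 <= t -> S (s + t) x = S s (S t x).
Hypothesis S_cont : forall x (e : R), 0 < e -> exists2 d : R, 0 < d & forall t, 0 < t < d -> N (S t x - x) <= e.

Lemma NN x : N (- x) = N x.
Proof. by rewrite -scaleN1r NZ normrN1 mul1r. Qed.

Lemma N_0 : N 0 = 0.
Proof. by rewrite -(scale0r (0 : X)) NZ normr0 mul0r. Qed.

Lemma N_ge0 x : 0 <= N x.
Proof. by have := ND x (- x); rewrite subrr N_0 NN; lra. Qed.

Lemma NBC x y : N (x - y) = N (y - x).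
Proof. by rewrite -NN opprB. Qed.

Lemma NB x y : N (x - y) <= N x + N y.
Proof. by apply: le_trans (ND _ _) _; rewrite NN. Qed.

Lemma ND3 x y z : N (x - z) <= N (x - y) + N (y - z).
Proof. by rewrite -(subrK y x) -addrA addrK; exact: ND. Qed.

Lemma N_le_add x y : N x <= N (x - y) + N y.
Proof. by rewrite -{1}(subrK y x); exact: ND. Qed.

Lemma N_sum (J : Type) (r : seq J) (F : J -> X) (C : R) :
  (forall j, N (F j) <= C) -> N (\sum_(j <- r) F j) <= (size r)%:R * C.
Proof.
move=> FC; elim: r => [|j r IH]; first by rewrite big_nil N_0 mul0r.
rewrite big_cons; apply: le_trans (ND _ _) _.
by rewrite /= -natr1 mulrDl mul1r addrC; exact: lerD.
Qed.

Lemma S_opp t x : 0 <= t -> S t (- x) = - S t x.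
Proof. by move=> t0; rewrite -scaleN1r S_scale// scaleN1r. Qed.

Lemma S_sub t x y : 0 <= t -> S t (x - y) = S t x - S t y.
Proof. by move=> t0; rewrite S_add// S_opp. Qed.

Lemma zmod_rearr (a b c x y z : X) : a + b - (c + x) - (y + z) = (a - c - y) + (b - x - z).
Proof. by rewrite (opprD c) [in LHS]addrACA (opprD y) [LHS]addrACA. Qed.

(** The generator as a relation, with the right limit at 0 unfolded; no domain has to be singled
    out. *)
Definition gen u g := forall e : R, 0 < e -> exists2 d : R, 0 < d &
  forall t, 0 < t < d -> N (t^-1 *: (S t u - u) - g) <= e.

Lemma gen_lin a u g u' g' : gen u g -> gen u' g' -> gen (a *: u + u') (a *: g + g').
Proof.
move=> ug ug' e e0.
have a1 : 0 < `|a| + 1 by rewrite ltr_wpDl.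
have [d d0 hd] := ug (e / 2 / (`|a| + 1)) (divr_gt0 (divr_gt0 e0 (ltr0Sn _ 1)) a1).
have [d' d0' hd'] := ug' (e / 2) (divr_gt0 e0 (ltr0Sn _ 1)).
exists (Num.min d d'); first by rewrite lt_min d0.
move=> t /andP[t0]; rewrite lt_min => /andP[td td'].
have -> : t^-1 *: (S t (a *: u + u') - (a *: u + u')) - (a *: g + g') =
    a *: (t^-1 *: (S t u - u) - g) + (t^-1 *: (S t u' - u') - g').
  rewrite S_add ?ltW// S_scale ?ltW// !scalerBr !scalerDr !scalerA [t^-1 * a]mulrC.
  exact: zmod_rearr.
apply: le_trans (ND _ _) _; rewrite NZ.
have h1 := hd t; rewrite t0 td in h1; have h2 := hd' t; rewrite t0 td' in h2.
rewrite [leRHS](splitr e); apply: lerD; last exact: h2.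
apply: (@le_trans _ _ ((`|a| + 1) * (e / 2 / (`|a| + 1)))).
  by apply: ler_pM; rewrite ?N_ge0// ?lerDl// h1.
by rewrite mulrC divfK ?gt_eqF.
Qed.

Lemma gen_S s u g : 0 <= s -> gen u g -> gen (S s u) (S s g).
Proof.
move=> s0 ug e e0; have [d d0 hd] := ug _ e0; exists d => // t td.
have t0 : 0 <= t by case/andP: td => /ltW.
have -> : t^-1 *: (S t (S s u) - S s u) - S s g = S s (t^-1 *: (S t u - u) - g).
  by rewrite S_sub// S_scale// S_sub// -!S_D// [t + s]addrC.
by apply: le_trans (S_contr _ _) _ => //; exact: hd.
Qed.

(** With [y] the error of the difference quotient at a small time [t], [(1 + h/t) u = (u - h g) - h
    y + (h/t) S t u]. Contractivity lets the terms [(h/t) N u] cancel. *)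
Lemma gen_dissipative h u g : 0 < h -> gen u g -> N u <= N (u - h *: g).
Proof.
move=> h0 ug; apply/ler_addgt0Pl => e e0.
have [d d0 hd] := ug (e / h) (divr_gt0 e0 h0).
pose t := d / 2; have t0 : 0 < t by rewrite divr_gt0.
have {hd} : N (t^-1 *: (S t u - u) - g) <= e / h by apply: hd; rewrite t0 /t; lra.
set y := _ - g => hy.
have E : (1 + h / t) *: u = (u - h *: g) - h *: y + (h / t) *: S t u.
  rewrite /y scalerBr scalerA !scalerBr scalerDl scale1r.
  rewrite !opprD !opprK !addrA; set a := h *: g; set b := _ *: S t u; set c := _ *: u.
  by rewrite (ACl ((1*4)*(2*5)*(3*6)))/= !addNr !addr0.
have := NZ (1 + h / t) u; rewrite E => E'.
have h1 : 0 < h / t by rewrite divr_gt0.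
have : N (u - h *: g - h *: y + (h / t) *: S t u) <= N (u - h *: g) + h * (e / h) + (h / t) * N u.
  apply: le_trans (ND _ _) _; apply: lerD; last first.
    by rewrite NZ gtr0_norm// ler_wpM2l ?S_contr// ltW.
  apply: le_trans (NB _ _) _; apply: lerD => //.
  by rewrite NZ gtr0_norm// ler_pM2l.
rewrite E' ger0_norm; last by lra.
have -> : h * (e / h) = e by field; rewrite gt_eqF.
by rewrite mulrDl mul1r; lra.
Qed.

Section resolvent.
Variables (lam : R) (f : X).
Hypothesis lam0 : 0 < lam.

(** The damped semigroup: the integral of [T t f] over all positive times is the resolvent at [lam]
    applied to [f]. *)
Let T t x := expR (- lam * t) *: S t x.

Let T_sub t x y : 0 <= t -> T t (x - y) = T t x - T t y.
Proof. by move=> t0; rewrite /T S_sub// scalerBr. Qed.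

Let T_scale t a x : 0 <= t -> T t (a *: x) = a *: T t x.
Proof. by move=> t0; rewrite /T S_scale// !scalerA mulrC. Qed.

Let T_sum t (J : Type) (r : seq J) (F : J -> X) : 0 <= t ->
  T t (\sum_(j <- r) F j) = \sum_(j <- r) T t (F j).
Proof.
move=> t0; elim: r => [|j r IH]; last by rewrite !big_cons /T S_add// scalerDr -/(T t _) -IH.
by rewrite !big_nil -(scale0r f) T_scale// !scale0r.
Qed.

Let T_D s t x : 0 <= s -> 0 <= t -> T (s + t) x = T s (T t x).
Proof. by move=> s0 t0; rewrite /T S_scale// S_D// scalerA -expRD mulrDr. Qed.

Let T_0 x : T 0 x = x.
Proof. by rewrite /T mulr0 expR0 scale1r S_0. Qed.

Let T_norm t x : 0 <= t -> N (T t x) <= expR (- lam * t) * N x.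
Proof.
by move=> t0; rewrite /T NZ ger0_norm ?expR_ge0// ler_wpM2l ?expR_ge0// S_contr.
Qed.

Let T_contr t x : 0 <= t -> N (T t x) <= N x.
Proof.
move=> t0; apply: le_trans (T_norm x t0) _; rewrite ler_piMl ?N_ge0//.
by rewrite -expR0 ler_expR mulNr oppr_le0 mulr_ge0// ltW.
Qed.

Let exp_small e : 0 < e -> exists2 d : R, 0 < d & forall t, 0 <= t < d -> 1 - expR (- lam * t) <= e.
Proof.
move=> e0; exists (e / lam); first exact: divr_gt0.
move=> t /andP[t0 td]; have := expR_ge1Dx (- lam * t).
by move: td; rewrite ltr_pdivlMr// mulrC; lra.
Qed.

Let T_cont x (e : R) : 0 < e -> exists2 d : R, 0 < d & forall t, 0 <= t < d -> N (T t x - x) <= e.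
Proof.
move=> e0; have e2 : 0 < e / 2 by rewrite divr_gt0.
have [d d0 hd] := S_cont x e2.
have x1 : 0 < N x + 1 by rewrite ltr_wpDl ?N_ge0.
have [d' d0' hd'] := exp_small (divr_gt0 e2 x1).
exists (Num.min d d'); first by rewrite lt_min d0.
move=> t /andP[]; rewrite le_eqVlt => /predU1P[<- _|t0]; first by rewrite T_0 subrr N_0 ltW.
rewrite lt_min => /andP[td td'].
have h1 : N (S t x - x) <= e / 2 by apply: hd; rewrite t0.
have h2 : 1 - expR (- lam * t) <= e / 2 / (N x + 1) by apply: hd'; rewrite ltW.
apply: le_trans (ND3 _ (S t x) _) _; rewrite (splitr e); apply: lerD => //.
rewrite /T -[X in _ - X]scale1r -scalerBl NZ distrC ger0_norm; last first.
  by rewrite subr_ge0 -expR0 ler_expR mulNr oppr_le0 mulr_ge0// ltW.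
apply: (@le_trans _ _ (e / 2 / (N x + 1) * (N x + 1))); last by rewrite divfK ?gt_eqF.
apply: ler_pM; rewrite ?N_ge0//; last by apply: le_trans (S_contr _ (ltW t0)) _; rewrite lerDl.
by rewrite subr_ge0 -expR0 ler_expR mulNr oppr_le0 mulr_ge0// ltW.
Qed.

Let telescope h j x : 0 <= h ->
  x - T (j%:R * h) x = \sum_(i < j) T (i%:R * h) (x - T h x).
Proof.
move=> h0; elim: j => [|j IH]; first by rewrite big_ord0 mul0r T_0 subrr.
rewrite big_ord_recr /= -IH T_sub ?mulr_ge0// -T_D ?mulr_ge0//.
by rewrite -natr1 mulrDl mul1r addrA subrK.
Qed.

Let hn n : R := 2^-1 ^+ n.
Let hn0 n : 0 < hn n. Proof. by rewrite exprn_gt0. Qed.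
(** The number of steps of length [hn n] that reach time [n]. *)
Let K n := (n * 2 ^ n)%N.
(* Riemann sums, along dyadic subdivisions, of the Laplace transform defining the resolvent. *)
Let U n := \sum_(k < K n) hn n *: T (k%:R * hn n) f.

Let hnK n : (2 ^ n)%:R * hn n = 1 :> R.
Proof. by rewrite /hn natrX -exprMn divff// expr1n. Qed.

(** A discrete form of [(lam - A) U = f]: shifting the Riemann sum by one step leaves only the two
    end terms, the far one being exponentially small. *)
Let U_step n : U n - T (hn n) (U n) = hn n *: (f - T n%:R f).
Proof.
have h0 := ltW (hn0 n).
rewrite /U T_sum// -sumrB.
have -> : n%:R = (K n)%:R * hn n :> R by rewrite /K natrM -mulrA hnK mulr1.
rewrite (telescope (K n) f h0) scaler_sumr; apply: eq_bigr => i _.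
by rewrite T_scale// -scalerBr T_sub ?mulr_ge0// -!T_D ?mulr_ge0// [hn n + _]addrC.
Qed.

(** Iterating the one-step identity gives [hn n] times a sum of [T r f] over small [r], each within
    [e] of [f], plus the far ends. *)
Let U_est n j e : (forall r, 0 <= r <= j%:R * hn n -> N (T r f - f) <= e) ->
  N (U n - T (j%:R * hn n) (U n) - (j%:R * hn n) *: f) <= (j%:R * hn n) * (e + expR (- lam * n%:R) * N f).
Proof.
move=> he; have h0 := ltW (hn0 n).
rewrite telescope// U_step.
have -> : (j%:R * hn n) *: f = \sum_(i < j) hn n *: f.
  by rewrite sumr_const card_ord -[RHS]scaler_nat scalerA.
rewrite -sumrB.
have -> : (j%:R * hn n) * (e + expR (- lam * n%:R) * N f) =
    (size (index_enum 'I_j))%:R * (hn n * (e + expR (- lam * n%:R) * N f)).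
  by rewrite -mulrA; congr (_%:R * _); rewrite -[LHS]card_ord cardT enumT.
apply: N_sum => i; rewrite T_scale ?mulr_ge0// -scalerBr NZ ger0_norm//.
apply: ler_wpM2l => //; rewrite T_sub ?mulr_ge0// -addrA addrCA addrC.
apply: le_trans (ND _ _) _; apply: lerD; last first.
  rewrite NN; apply: le_trans (T_contr _ _) _; rewrite ?mulr_ge0//.
  exact: T_norm.
by apply: he; rewrite mulr_ge0//= ler_wpM2r// ler_nat ltnW.
Qed.

Let hnD n m : (n <= m)%N -> hn n = (2 ^ (m - n))%:R * hn m.
Proof.
move=> nm; by rewrite /hn natrX -[X in _ = _ * _ ^+ X](subnK nm) exprD mulrA -exprMn divff// expr1n mul1r.
Qed.

(** Both sums nearly satisfy the same equation over one step of the coarser grid, so [D - T D] is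
    small compared with [hn n]. As [T] contracts by [expR (- lam * hn n)], this bounds [N D]. *)
Let U_cauchy n m e : (n <= m)%N -> (forall r, 0 <= r <= hn n -> N (T r f - f) <= e) ->
  N (U m - U n) <= (1 + lam) / lam * (2 * e + 2 * expR (- lam * n%:R) * N f).
Proof.
move=> nm he; have h0 := hn0 n; have e0 : 0 <= e by apply: le_trans (N_ge0 _) (he 0 _); rewrite lexx ltW.
have := @U_est m (2 ^ (m - n)) e; rewrite -hnD// => /(_ he) h1.
have := @U_est n 1%N 
   e; rewrite mul1r => /(_ he) h2.
set D := U m - U n.
have emn : expR (- lam * m%:R) <= expR (- lam * n%:R).
  by rewrite ler_expR; have : n%:R <= m%:R :> R by [rewrite ler_nat]; have := lam0; nra.
have fp := N_ge0 f; have Ep := expR_ge0 (- lam * n%:R).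
have h3 : N (D - T (hn n) D) <= hn n * (2 * e + 2 * expR (- lam * n%:R) * N f).
  have -> : D - T (hn n) D = (U m - T (hn n) (U m) - hn n *: f) - (U n - T (hn n) (U n) - hn n *: f).
    rewrite /D T_sub ?ltW// [in RHS]opprB addrA subrK opprD opprK addrACA.
    by congr (_ + _); rewrite opprB addrC.
  apply: le_trans (NB _ _) _; have := ler_wpM2l (ltW h0) (ler_wpM2r fp emn); lra.
have h4 : N D - expR (- lam * hn n) * N D <= N (D - T (hn n) D).
  have := N_le_add D (T (hn n) D); have := T_norm D (ltW h0); lra.
have h1n : hn n <= 1 by rewrite /hn exprn_ile1// invf_le1// ler1n.
have h5 : (1 + lam * hn n) * expR (- lam * hn n) <= 1.
  have := expR_ge1Dx (lam * hn n) => h; rewrite mulNr expRN.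
  by rewrite ler_pdivrMr ?expR_gt0// mul1r.
(* The source of [(1 + lam) / lam]: [1 - expR (- x) >= x / (1 + x)] with [x = lam * hn n <= lam]. *)
have h6 : lam * hn n <= (1 + lam) * (1 - expR (- lam * hn n)).
  have E1 : 0 <= 1 - expR (- lam * hn n).
    have : 0 <= lam * hn n * expR (- lam * hn n) by rewrite !mulr_ge0// ltW.
    lra.
  have : 0 <= lam * (1 - hn n) * (1 - expR (- lam * hn n)).
    by apply: mulr_ge0 E1; apply: mulr_ge0; [exact: ltW|rewrite subr_ge0].
  lra.
have ND0 := N_ge0 D.
have h7 : lam * hn n * N D <= (1 + lam) * (hn n * (2 * e + 2 * expR (- lam * n%:R) * N f)).
  apply: (@le_trans _ _ ((1 + lam) * (1 - expR (- lam * hn n)) * N D)); first exact: ler_wpM2r.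
  rewrite -mulrA ler_wpM2l ?addr_ge0 ?(ltW lam0)//; lra.
rewrite mulrAC ler_pdivlMr// -(ler_pM2l h0); lra.
Qed.

Let small (e : R) : 0 < e -> exists n0, forall n, (n0 <= n)%N -> hn n <= e /\ expR (- lam * n%:R) <= e.
Proof.
move=> e0; have c0 : 0 < Num.min 1 lam by rewrite lt_min ltr01.
have a0 : 0 < Num.min 1 lam * e by rewrite mulr_gt0.
exists (Num.truncn (Num.min 1 lam * e)^-1) => n.
move=> h; have hn' : (Num.min 1 lam * e)^-1 < n.+1%:R.
  apply: lt_le_trans (_ : (Num.truncn (Num.min 1 lam * e)^-1).+1%:R <= _).
    by rewrite truncnS_gt.
  by rewrite ler_nat.
move: hn'; rewrite invf_plt ?posrE// => /ltW hn'.
have c1 : Num.min 1 lam <= 1 by rewrite ge_min lexx.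
have c2 : Num.min 1 lam <= lam by rewrite ge_min lexx orbT.
have key x : Num.min 1 lam * n.+1%:R * x <= 1 -> x <= e.
  move=> hx; rewrite -(ler_pM2l c0); apply: le_trans hn'.
  by rewrite -[leRHS]mul1r ler_pdivlMr// mulrAC.
have nS : n.+1%:R = n%:R + 1 :> R by rewrite -natr1.
have n0 : 0 <= n%:R :> R by [].
split; apply: key.
  apply: (@le_trans _ _ (n.+1%:R * hn n)).
    by rewrite -mulrA ler_piMl// mulr_ge0// ltW.
  rewrite -[leRHS](hnK n) ler_wpM2r ?(ltW (hn0 n))// ler_nat; exact: ltn_expl.
have h5 : (1 + lam * n%:R) * expR (- lam * n%:R) <= 1.
  have := expR_ge1Dx (lam * n%:R) => h'; rewrite mulNr expRN.
  by rewrite ler_pdivrMr ?expR_gt0// mul1r.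
apply: le_trans h5; rewrite ler_wpM2r// nS; nra.
Qed.

Let N_eps x y : (forall e : R, 0 < e -> N x <= y + e) -> N x <= y.
Proof. by move=> h; apply/ler_addgt0Pr. Qed.

Let U_limit : exists V, forall e : R, 0 < e -> exists n0, forall k, (n0 <= k)%N -> N (U k - V) <= e.
Proof.
apply: Ncomplete => e e0.
have f0 := N_ge0 f.
pose C := (1 + lam) / lam * (2 + 2 * N f) + 1.
have C0 : 0 < C by rewrite /C; have : 0 <= (1 + lam) / lam * (2 + 2 * N f); [rewrite mulr_ge0 ?divr_ge0 ?addr_ge0 ?mulr_ge0// ltW|lra].
have [d d0 hd] := T_cont f (divr_gt0 e0 C0).
have m0 : 0 < Num.min (d / 2) (e / C) by rewrite lt_min !divr_gt0.
have [n0 hn0'] := small m0; exists n0.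
have key j k : (n0 <= j)%N -> (j <= k)%N -> N (U k - U j) <= e.
  move=> nj jk; have [h1 h2] := hn0' _ nj.
  move: h1 h2; rewrite !le_min => /andP[h1 _] /andP[_ h2].
  have h3 : forall r, 0 <= r <= hn j -> N (T r f - f) <= e / C.
    by move=> r /andP[r0 rh]; apply: hd; rewrite r0 /=; lra.
  apply: le_trans (U_cauchy jk h3) _.
  apply: (@le_trans _ _ ((1 + lam) / lam * ((2 + 2 * N f) * (e / C)))).
    rewrite ler_wpM2l ?divr_ge0 ?addr_ge0 ?(ltW lam0)//.
    have := ler_wpM2r f0 h2; lra.
  have eC : 0 < e / C by rewrite divr_gt0.
  rewrite mulrA -[leRHS](divfK (lt0r_neq0 C0)) [leLHS]mulrC ler_pM2l// /C; lra.
move=> j k nj nk; case: (leqP j k) => [jk|/ltnW kj]; last exact: key.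
by rewrite NBC; exact: key.
Qed.

(** The estimate of [U_est] passes to the limit for dyadic [s], where the exponential tail
    disappears, and then to every [s] by rounding down to a dyadic number and continuity. *)
Let V_est : exists2 V, True & forall s e, 0 <= s -> (forall r, 0 <= r <= s -> N (T r f - f) <= e) ->
  N (V - T s V - s *: f) <= s * e.
Proof.
have [V hV] := U_limit; exists V => //.
have dyadic n j e : (forall r, 0 <= r <= j%:R * hn n -> N (T r f - f) <= e) ->
    N (V - T (j%:R * hn n) V - (j%:R * hn n) *: f) <= j%:R * hn n * e.
  move=> he; apply: N_eps => eps eps0.
  set s := j%:R * hn n in he *.
  have s0 : 0 <= s by rewrite mulr_ge0// ltW.
  have f0 := N_ge0 f.
  have [n1 hn1] := hV (eps / 4) (divr_gt0 eps0 (ltr0Sn _ 3)).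
  have c0 : 0 < s * N f + 1 by have := mulr_ge0 s0 f0; lra.
  have c1 : 0 < eps / 4 / (s * N f + 1) by rewrite !divr_gt0.
  have [n2 hn2] := small c1.
  pose m := maxn n (maxn n1 n2).
  have nm : (n <= m)%N by rewrite leq_maxl.
  have h1 : N (U m - V) <= eps / 4 by apply: hn1; rewrite /m !leq_max leqnn orbT.
  have [_ h2] : hn m <= eps / 4 / (s * N f + 1) /\ expR (- lam * m%:R) <= eps / 4 / (s * N f + 1).
    by apply: hn2; rewrite /m !leq_max leqnn !orbT.
  have sE : s = (j * 2 ^ (m - n))%:R * hn m by rewrite natrM -mulrA -hnD.
  have := @U_est m (j * 2 ^ (m - n))%N e; rewrite -sE => /(_ he) h3.
  have h4 : s * (expR (- lam * m%:R) * N f) <= eps / 4.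
    rewrite mulrCA; apply: (@le_trans _ _ (eps / 4 / (s * N f + 1) * (s * N f + 1))); last first.
      by rewrite divfK ?gt_eqF.
    by apply: ler_pM; rewrite ?expR_ge0 ?(mulr_ge0 s0 f0) ?lerDl.
  have -> : V - T s V - s *: f = (U m - T s (U m) - s *: f) - ((U m - V) - T s (U m - V)).
    rewrite T_sub// [in RHS]opprB.
    by rewrite !opprB !addrA [RHS](ACl ((6*5*3)*(1*7)*(4*2)))/= !subrr !addr0.
  apply: le_trans (NB _ _) _.
  have := NB (U m - V) (T s (U m - V)); have := T_contr (U m - V) s0; lra.
move=> s e s0 he; apply: N_eps => eps eps0.
have f0 := N_ge0 f.
have e0 : 0 <= e by apply: le_trans (N_ge0 _) (he 0 _); rewrite lexx.
have [d d0 hd] := T_cont V (divr_gt0 eps0 (ltr0Sn _ 1)).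
have f1 : 0 < N f + 1 by rewrite ltr_wpDl.
have m0 : 0 < Num.min (d / 2) (eps / 2 / (N f + 1)) by rewrite lt_min !divr_gt0.
have [n /(_ n (leqnn n))[]] := small m0; rewrite !le_min => /andP[hd1 hd2] _.
pose j := Num.truncn (s / hn n); pose s' := j%:R * hn n.
have /andP[j1 j2] : (j%:R <= s / hn n < j.+1%:R) by rewrite truncn_itv// divr_ge0// ltW.
have s1 : s' <= s by rewrite /s' -ler_pdivlMr.
have s2 : s < s' + hn n by rewrite /s' -{2}[hn n]mul1r -mulrDl natr1 -ltr_pdivrMr.
have s'0 : 0 <= s' by rewrite mulr_ge0// ltW.
have h1 : N (V - T s' V - s' *: f) <= s' * e.
  by apply: dyadic => r /andP[r0 rs]; apply: he; rewrite r0 (le_trans rs).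
have h2 : N (T (s - s') V - V) <= eps / 2 by apply: hd; lra.
have -> : V - T s V - s *: f = (V - T s' V - s' *: f) - (T s' (T (s - s') V - V) + (s - s') *: f).
  rewrite T_sub// -T_D// ?subr_ge0// [s' + _]addrC subrK scalerBl opprD !opprB !addrA.
  by rewrite [RHS](ACl ((1*5*7)*(2*4)*(3*6)))/= !addNr !addr0.
apply: le_trans (NB _ _) _.
have := ND (T s' (T (s - s') V - V)) ((s - s') *: f); rewrite (NZ (s - s') f) ger0_norm ?subr_ge0//.
have := T_contr (T (s - s') V - V) s'0.
have : (s - s') * N f <= eps / 2.
  apply: (@le_trans _ _ (eps / 2 / (N f + 1) * (N f + 1))); last by rewrite divfK ?gt_eqF.
  apply: ler_pM; rewrite ?subr_ge0 ?lerDl//; lra.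
have := ler_wpM2r e0 s1; lra.
Qed.

(** The first clause says [(lam - A) V = f]. The second approximates [f] by combinations of [V] and
    [S t V], which lie in the domain; [gen_dense] rests on it. *)
Lemma resolvent_exists : exists V, gen V (lam *: V - f) /\
  forall e, 0 < e -> exists2 t, 0 < t & N (t^-1 *: (V - expR (- lam * t) *: S t V) - f) <= e.
Proof.
have [V _ hV] := V_est; exists V.
have step e : 0 < e -> exists2 d : R, 0 < d & forall t, 0 < t < d -> N (V - T t V - t *: f) <= t * e.
  move=> e0; have [d d0 hd] := T_cont f e0; exists d => // t /andP[t0 td].
  apply: hV; first exact: ltW.
  by move=> r /andP[r0 rt]; apply: hd; rewrite r0 (le_lt_trans rt).
split; last first.
  move=> e e0; have [d d0 hd] := step e e0.
  have d2 : 0 < d / 2 by rewrite divr_gt0.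
  exists (d / 2) => //; set t := d / 2 in d2 *.
  have := hd t; rewrite d2 /= (_ : t < d); last by rewrite /t; lra.
  move=> /(_ isT) h; have -> : t^-1 *: (V - expR (- lam * t) *: S t V) - f = t^-1 *: (V - T t V - t *: f).
    by rewrite [in RHS]scalerBr scalerA mulVf ?gt_eqF// scale1r.
  by rewrite NZ ger0_norm ?invr_ge0 ?(ltW d2)// ler_pdivrMl.
move=> e e0; have f0 := N_ge0 f; have V0 := N_ge0 V.
have [d d0 hd] := step (e / 4) (divr_gt0 e0 (ltr0Sn _ 3)).
(* The error is at most [t * M + e / 2]; the bound [t < (2 lam)^-1] keeps [expR (lam * t)] below 2,
   which gives the factors 2. *)
pose M := 2 * lam ^+ 2 * N V + 2 * lam * N f + 1.
have M0 : 0 < M.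
  by rewrite ltr_wpDl// addr_ge0// !mulr_ge0// ltW.
pose d' := Num.min (Num.min d (e / 2 / M)) ((2 * lam)^-1).
exists d'; first by rewrite !lt_min d0 !divr_gt0// invr_gt0 mulr_gt0.
move=> t /andP[t0]; rewrite !lt_min => /andP[/andP[td tM] tl].
have := hd t; rewrite t0 td => /(_ isT).
set w := V - T t V - t *: f => hw.
pose E := expR (lam * t).
have x2 : lam * t <= 2^-1.
  by move: tl; rewrite invfM -[_ * lam^-1]/(_ / lam) ltr_pdivlMr// mulrC => /ltW.
have x0 : 0 < lam * t by rewrite mulr_gt0.
have E1 : 1 + lam * t <= E by exact: expR_ge1Dx.
have E2 : E * (1 - lam * t) <= 1.
  have := expR_ge1Dx (- (lam * t)); rewrite expRN -/E => h.
  have E0 : 0 < E by exact: expR_gt0.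
  by rewrite -[leRHS](mulfV (lt0r_neq0 E0)) ler_pM2l.
have ET : S t V = E *: T t V by rewrite /T scalerA /E -expRD mulNr subrr expR0 scale1r.
have TV : T t V = V - t *: f - w by rewrite /w [V - T t V - _]addrAC subKr.
(* Undo the damping: [S t V = E T t V] and [T t V = V - t f - w], with [w] of size [t * e / 4]. *)
have -> : t^-1 *: (S t V - V) - (lam *: V - f) =
    ((E - 1) / t - lam) *: V - ((E - 1) *: f + (E / t) *: w).
  rewrite ET TV; clearbody w E; rewrite !scalerBr !scalerA scalerBl [(E - 1) / t]mulrBl scalerBl scalerBl div1r scale1r.
  have -> : t^-1 * E * t = E by field; rewrite gt_eqF.
  rewrite [t^-1 * E]mulrC !opprD !opprK !addrA.
  by rewrite (ACl (1*4*5*2*6*3))/=.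
apply: le_trans (NB _ _) _; rewrite NZ.
have := ND ((E - 1) *: f) ((E / t) *: w); rewrite !NZ.
rewrite (ger0_norm (_ : 0 <= E - 1)); last by lra.
rewrite (ger0_norm (_ : 0 <= E / t)); last by rewrite divr_ge0 ?expR_ge0 ?ltW.
have h1 : E - 1 <= 2 * (lam * t) by nra.
have h2 : 0 <= (E - 1) / t - lam.
  by rewrite subr_ge0 ler_pdivlMr//; lra.
have h3 : (E - 1) / t - lam <= 2 * lam ^+ 2 * t.
  by rewrite lerBlDr ler_pdivrMr// expr2; nra.
rewrite (ger0_norm h2).
have h4 : E / t * N w <= e / 2.
  have : E / t * N w <= E / t * (t * (e / 4)) by rewrite ler_wpM2l// divr_ge0 ?expR_ge0 ?ltW.
  rewrite mulrA divfK ?gt_eqF//; nra.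
have h5 : t * M <= e / 2 by rewrite -ler_pdivlMr// ltW.
move: h5; rewrite /M; nra.
Qed.

End resolvent.

(** With the resolvent [V] of [f] at 1, the vector [t^-1 (V - expR (- t) S t V)] is in the domain
    and close to [f]. *)
Lemma gen_dense f e : 0 < e -> exists u g, gen u g /\ N (u - f) <= e.
Proof.
move=> e0; have [V [gV hV]] := resolvent_exists f ltr01.
have [t t0 ht] := hV e e0.
pose c := expR (- 1 * t).
have h : gen (t^-1 *: (V - c *: S t V)) (t^-1 *: ((1 *: V - f) - c *: S t (1 *: V - f))).
  have h1 := gen_lin (- c) (gen_S (ltW t0) gV) gV.
  have h2 : gen 0 0.
    move=> e' e'0; exists 1 => // s /andP[s0 _].
    have S0 := S_scale 0 V (ltW s0); rewrite !scale0r in S0.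
    by rewrite S0 !subrr scaler0 subrr N_0 ltW.
  have := gen_lin t^-1 h1 h2.
  by rewrite !addr0 !scaleNr [- _ + V]addrC [- _ + (1 *: V - f)]addrC.
by eexists; eexists; split; first exact: h.
Qed.

Section yosida.
(** [J h] stands for the resolvent [(1 - h A)^(-1)]; its linearity and contractivity follow from
    dissipativity. *)
Variable J : R -> X -> X.
Hypothesis J_gen : forall h f, 0 < h -> gen (J h f) (h^-1 *: (J h f - f)).

(** The difference of two solutions of [z - h A z = f] solves the equation with source 0, so
    dissipativity makes its norm 0. *)
Lemma J_uniq h u g : 0 < h -> gen u g -> J h (u - h *: g) = u.
Proof.
move=> h0 ug; set f := u - _.
have fE : f + h *: g = u by rewrite /f subrK.
have h1 := gen_lin (-1) ug (J_gen f h0); clearbody f.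
have := gen_dissipative h0 h1; rewrite scalerDr !scalerA mulfV ?gt_eqF// scale1r !scaleN1r mulrN1 scaleNr.
have -> : - u + J h f - (- (h *: g) + (J h f - f)) = 0.
  rewrite opprD opprK opprB !addrA (ACl ((4*3)*1*(2*5)))/= fE.
  by rewrite !subrr addr0.
rewrite N_0 => h2; apply/eqP; rewrite -subr_eq0; apply/eqP/N0/le_anti.
by rewrite N_ge0 andbT; move: h2; rewrite [- u + _]addrC.
Qed.

Lemma J_contr h f : 0 < h -> N (J h f) <= N f.
Proof.
move=> h0; have := gen_dissipative h0 (J_gen f h0).
by rewrite scalerA mulfV ?gt_eqF// scale1r opprB addrC subrK.
Qed.

Lemma J_lin h a x y : 0 < h -> J h (a *: x + y) = a *: J h x + J h y.
Proof.
move=> h0; have g := gen_lin a (J_gen x h0) (J_gen y h0).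
rewrite -[RHS](J_uniq h0 g); congr (J h _).
have Z z : h *: (h^-1 *: z) = z by rewrite scalerA mulfV ?gt_eqF// scale1r.
by rewrite scalerDr scalerA mulrC -scalerA !Z opprD addrACA -scalerBr !subKr.
Qed.

Lemma J_sub h x y : 0 < h -> J h (x - y) = J h x - J h y.
Proof. by move=> h0; rewrite addrC -scaleN1r J_lin// scaleN1r addrC. Qed.

Lemma J_S h s f : 0 < h -> 0 <= s -> J h (S s f) = S s (J h f).
Proof.
move=> h0 s0; have := J_uniq h0 (gen_S s0 (J_gen f h0)).
by rewrite S_scale// scalerA mulfV ?gt_eqF// scale1r S_sub// opprB addrC subrK.
Qed.

Lemma J_gen_sub h u g : 0 < h -> gen u g -> J h u - u = h *: J h g.
Proof.
move=> h0 ug; have := gen_lin h (J_gen g h0) ug.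
rewrite scalerA mulfV ?gt_eqF// scale1r subrK => h1.
have := J_uniq h0 h1; rewrite addrC addKr => ->.
by rewrite addrK.
Qed.

Lemma J_cvg f e : 0 < e -> exists2 d : R, 0 < d & forall h, 0 < h < d -> N (J h f - f) <= e.
Proof.
move=> e0; have e4 : 0 < e / 4 by rewrite divr_gt0.
have [u [g [ug uf]]] := gen_dense f e4; have g0 := N_ge0 g.
have g1 : 0 < N g + 1 by rewrite ltr_wpDl.
exists (e / 2 / (N g + 1)); first by rewrite !divr_gt0.
move=> h /andP[h0 hd].
apply: le_trans (ND3 _ (J h u) _) _; rewrite -J_sub//.
have h1 := J_contr (f - u) h0; rewrite NBC in uf.
have h2 : N (J h u - f) <= N (J h u - u) + N (u - f) by exact: ND3.
rewrite (J_gen_sub h0 ug) NZ gtr0_norm// in h2.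
have h3 : h * N (J h g) <= e / 2.
  apply: (@le_trans _ _ (e / 2 / (N g + 1) * (N g + 1))); last by rewrite divfK ?gt_eqF.
  apply: ler_pM; rewrite ?N_ge0 ?(ltW h0) ?(ltW hd)//.
  by apply: le_trans (J_contr _ h0) _; rewrite lerDl.
rewrite (NBC u f) in h2; lra.
Qed.

Lemma iterJ_contr h n x y : 0 < h -> N (iter n (J h) x - iter n (J h) y) <= N (x - y).
Proof.
move=> h0; elim: n => [//|n IH]; apply: le_trans IH.
by rewrite !iterS -J_sub//; exact: J_contr.
Qed.

(** Telescoping a difference of n-th powers of two commuting contractions. *)
Lemma S_iterJ h n f : 0 < h -> N (S (n%:R * h) f - iter n (J h) f) <= n%:R * N (S h f - J h f).
Proof.
move=> h0; elim: n => [|n IH]; first by rewrite !mul0r S_0 subrr N_0.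
have nh : 0 <= n%:R * h by rewrite mulr_ge0// ltW.
rewrite -natr1 !mulrDl !mul1r S_D ?(ltW h0)//.
apply: le_trans (ND3 _ (S (n%:R * h) (J h f)) _) _; rewrite addrC; apply: lerD.
  by rewrite iterS -J_S// -J_sub//; exact: le_trans (J_contr _ h0) IH.
by rewrite -S_sub//; exact: S_contr.
Qed.

(* For [f] in the domain, [n |S(t/n) f - J(t/n) f| -> 0]; the general case follows by density. *)
Lemma exponential_formula t f e : 0 < t -> 0 < e -> exists n0, forall n, (n0 <= n)%N ->
  N (S t f - iter n.+1 (J (t / n.+1%:R)) f) <= e.
Proof.
move=> t0 e0; have e4 : 0 < e / 4 by rewrite divr_gt0.
have [u [g [ug uf]]] := gen_dense f e4.
have e1 : 0 < e / 4 / t by rewrite divr_gt0.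
have [d d0 hd] := ug _ e1; have [d' d0' hd'] := J_cvg g e1.
have m0 : 0 < Num.min d d' by rewrite lt_min d0.
exists (Num.truncn (t / Num.min d d')) => n hn.
set h := t / n.+1%:R.
have h0 : 0 < h by rewrite divr_gt0.
have : h < Num.min d d'.
  rewrite /h ltr_pdivrMr// mulrC -ltr_pdivrMr//.
  apply: lt_le_trans (_ : (Num.truncn (t / Num.min d d')).+1%:R <= _); first by rewrite truncnS_gt.
  by rewrite ler_nat.
rewrite lt_min => /andP[hd1 hd2].
have h1 := hd h; rewrite h0 hd1 in h1; have {}h1 := h1 isT.
have h2 := hd' h; rewrite h0 hd2 in h2; have {}h2 := h2 isT.
have tE : t = n.+1%:R * h by rewrite /h mulrC divfK.
have h3 : N (S h u - J h u) <= h * (e / 4 / t + e / 4 / t).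
  (* Since [J h u - u = h J h g], the difference is [h] times the difference of two approximations
     of [g]. *)
  have -> : S h u - J h u = h *: ((h^-1 *: (S h u - u) - g) - (J h g - g)).
    rewrite scalerBr scalerBr scalerA mulfV ?gt_eqF// scale1r scalerBr -(J_gen_sub h0 ug).
    by rewrite [in RHS]opprB addrA subrK opprB addrA subrK.
  rewrite NZ gtr0_norm// ler_pM2l//; apply: le_trans (NB _ _) _; exact: lerD.
have h4 : N (S t u - iter n.+1 (J h) u) <= e / 2.
  rewrite tE; apply: le_trans (S_iterJ _ _ h0) _.
  apply: (@le_trans _ _ (n.+1%:R * (h * (e / 4 / t + e / 4 / t)))); first by rewrite ler_wpM2l.
  rewrite mulrA -tE; have -> : t * (e / 4 / t + e / 4 / t) = e / 2 by field; rewrite gt_eqF.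
  by [].
have h5 := iterJ_contr n.+1 u f h0.
apply: le_trans (ND3 _ (S t u) _) _; rewrite -S_sub ?(ltW t0)//.
have h6 := S_contr (f - u) (ltW t0); rewrite (NBC f u) in h6.
have h7 := ND3 (S t u) (iter n.+1 (J h) u) (iter n.+1 (J h) f).
apply: le_trans (lerD h6 (le_trans h7 (lerD h4 h5))) _; lra.
Qed.

End yosida.
End contraction_semigroup.

Lemma cvg_at_right0P (R : realType) (F : R -> \bar R) : (forall t, 0 <= F t)%E ->
  (F t @[t --> 0^'+] --> 0%E) <->
  (forall e : R, 0 < e -> exists2 d : R, 0 < d & forall t, 0 < t < d -> (F t <= e%:E)%E).
Proof.
move=> F0; split=> [h e e0|h].
  have hn : nbhs (0%E : \bar R) [set x | (x < e%:E)%E] by exact: (@nbhs_open_ereal_lt _ 0 (fun=> e)).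
  have [del /= d0 hd] := h _ hn; exists del => // t /andP[t0 td].
  by apply/ltW/hd => //=; rewrite sub0r normrN gtr0_norm.
have near_ (P : R -> Prop) del : 0 < del -> (forall t, 0 < t < del -> P t) -> \forall t \near 0^'+, P t.
  move=> d0 hP; exists del => //= t /= td t0.
  by apply: hP; move: td; rewrite sub0r normrN gtr0_norm// t0.
apply/fine_cvgP; split.
  have [del d0 hd] := h _ ltr01; apply: near_ d0 _ => t /hd h1.
  by rewrite ge0_fin_numE// (le_lt_trans h1)// ltry.
apply/cvgrPdist_le => /= e e0; have [del d0 hd] := h _ e0; apply: near_ d0 _ => t /hd h1.
rewrite sub0r normrN ger0_norm ?fine_ge0// -lee_fin fineK// ge0_fin_numE//.
by rewrite (le_lt_trans h1)// ltry.
Qed.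

(** * L^p as a real vector space of representatives, and transfer of the abstract theory *)

Section Lq.
Context {R : realType} {d m : nat} {p : R}.
Local Notation E := 'rV[R]_d.
Local Notation mu := (lebesgue_rV R d).
Local Notation vfun := (vfun R d m).
Implicit Types (f g u w : vfun).

(** The choice depends only on the set of admissible functions, so functions equal almost everywhere
    receive literally the same representative. *)
Definition vrep f : vfun := xget (fun=> 0) [set g | Lp p g /\ vae_eq f g].

Lemma vrepP f : Lp p f -> Lp p (vrep f) /\ vae_eq f (vrep f).
Proof.
move=> hf; have : exists g, [set g | Lp p g /\ vae_eq f g] g by exists f; split => //; exact: vae_eq_refl.
exact: xgetPex.
Qed.

Lemma eq_vrep f g : vae_eq f g -> vrep f = vrep g.
Proof.
move=> fg; congr xget; apply/funext => h; apply/propext; split => -[hh e]; split => //.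
  exact: vae_eq_trans (vae_eq_sym fg) e.
exact: vae_eq_trans fg e.
Qed.

(* The space L^p, each class of functions being represented by a chosen member. *)
Record Lq_rec := LqRec { lqv : vfun; lq_mem : Lp p lqv; lq_can : vrep lqv = lqv }.

(** The proof of [1 < p] is a parameter of the type, so that the structures declared on it can use
    the stability of L^p under sums. *)
Definition Lq (p1 : 1 < p) : Type := Lq_rec.

Lemma Lq_eq (x y : Lq_rec) : lqv x = lqv y -> x = y.
Proof.
case: x => x x1 x2; case: y => y y1 y2 /= e; case: _ / e y1 y2 => y1 y2.
by rewrite (Prop_irrelevance x1 y1) (Prop_irrelevance x2 y2).
Qed.

Hypothesis p1 : 1 < p.
Let p0 : 0 < p. Proof. exact: lt_trans ltr01 p1. Qed.
Let p1' : 1 <= p. Proof. exact: ltW. Qed.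

Fact vrepK f : Lp p f -> vrep (vrep f) = vrep f.
Proof. by move=> /vrepP[_ /eq_vrep]. Qed.

Definition lq0 : Lq p1 := LqRec (vrepP (Lp0 p0)).1 (vrepK (Lp0 p0)).

Definition lqpi f : Lq p1 :=
  match pselect (Lp p f) with left h => LqRec (vrepP h).1 (vrepK h) | right _ => lq0 end.

Lemma lqv_pi f : Lp p f -> lqv (lqpi f) = vrep f.
Proof. by move=> h; rewrite /lqpi; case: pselect. Qed.

Lemma lqpiE f : Lp p f -> vae_eq (lqv (lqpi f)) f.
Proof. by move=> h; rewrite lqv_pi//; apply: vae_eq_sym; exact: (vrepP h).2. Qed.

Lemma lqpi_eq f g : Lp p f -> vae_eq f g -> lqpi f = lqpi g.
Proof.
move=> h fg; apply: Lq_eq; rewrite !lqv_pi//; first exact: eq_vrep.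
exact: Lp_ae fg h.
Qed.

Lemma lqpiK (x : Lq p1) : lqpi (lqv x) = x.
Proof. by apply: Lq_eq; rewrite lqv_pi; [exact: lq_can|exact: lq_mem]. Qed.

Definition lq_add (x y : Lq p1) : Lq p1 := lqpi (fun t => lqv x t + lqv y t).
Definition lq_opp (x : Lq p1) : Lq p1 := lqpi (fun t => (-1)%:C%C *: lqv x t).
(** Real scalars are enough: resolvents and the exponential formula involve real parameters only. *)
Definition lq_scale (a : R) (x : Lq p1) : Lq p1 := lqpi (fun t => a%:C%C *: lqv x t).

Lemma lqpiD f g : Lp p f -> Lp p g -> lqpi (fun t => f t + g t) = lq_add (lqpi f) (lqpi g).
Proof.
by move=> hf hg; apply: lqpi_eq; [exact: LpD|apply: vae_eqD; apply: vae_eq_sym; exact: lqpiE].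
Qed.

Lemma lqpiZ (a : R) f : Lp p f -> lqpi (fun t => a%:C%C *: f t) = lq_scale a (lqpi f).
Proof.
by move=> hf; apply: lqpi_eq; [exact: LpZ|apply: vae_eqZ; apply: vae_eq_sym; exact: lqpiE].
Qed.

Lemma lqpi0 : lqpi (fun=> 0) = lq0.
Proof. by apply: Lq_eq; rewrite lqv_pi//; exact: Lp0. Qed.

Let mem (x : Lq p1) : Lp p (lqv x) := lq_mem x.

Lemma lq_addA : associative lq_add.
Proof.
move=> x y z; rewrite -[x in LHS]lqpiK -[z in RHS]lqpiK /lq_add -!/(lq_add _ _) -!lqpiD//; try exact: LpD.
by congr lqpi; apply/funext => t; rewrite addrA.
Qed.

Lemma lq_addC : commutative lq_add.
Proof. by move=> x y; congr lqpi; apply/funext => t; rewrite addrC. Qed.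

Lemma lq_add0 : left_id lq0 lq_add.
Proof.
move=> x; rewrite -lqpi0 -[x in LHS]lqpiK -lqpiD//; last exact: Lp0.
by rewrite -[RHS]lqpiK; congr lqpi; apply/funext => t; rewrite add0r.
Qed.

Lemma lq_addN : left_inverse lq0 lq_opp lq_add.
Proof.
move=> x; rewrite -[x in X in lq_add _ X]lqpiK -lqpiD//; last exact: LpZ.
by rewrite -lqpi0; congr lqpi; apply/funext => t; rewrite scaleN1C addNr.
Qed.

HB.instance Definition _ := gen_eqMixin (Lq p1).
HB.instance Definition _ := gen_choiceMixin (Lq p1).
HB.instance Definition _ := GRing.isZmodule.Build (Lq p1) lq_addA lq_addC lq_add0 lq_addN.

Lemma lq_scaleA (a b : R) (x : Lq p1) : lq_scale a (lq_scale b x) = lq_scale (a * b) x.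
Proof.
rewrite -lqpiZ; last exact: LpZ.
by congr lqpi; apply/funext => t; rewrite scalerA; congr (_ *: _); congr (Complex _ _); ring.
Qed.

Lemma lq_scale1 : left_id 1 lq_scale.
Proof. by move=> x; rewrite -[RHS]lqpiK; congr lqpi; apply/funext => t; rewrite scale1r. Qed.

Lemma lq_scaleDr : right_distributive lq_scale +%R.
Proof.
move=> a x y; rewrite /GRing.add /= -lqpiZ ?lqpiK; last exact: LpD.
rewrite -lqpiD; try exact: LpZ.
by congr lqpi; apply/funext => t; rewrite scalerDr.
Qed.

Lemma lq_scaleDl (x : Lq p1) : {morph lq_scale^~ x : a b / a + b}.
Proof.
move=> a b; rewrite [RHS]/GRing.add /= -lqpiD; try exact: LpZ.
by congr lqpi; apply/funext => t; rewrite -scalerDl; congr (_ *: _); congr (Complex _ _); ring.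
Qed.

HB.instance Definition _ := GRing.Zmodule_isLmodule.Build R (Lq p1) lq_scaleA lq_scale1 lq_scaleDr lq_scaleDl.

#[local] Opaque lqpi.

Definition lqn (x : Lq p1) : R := fine (LpN p (lqv x)).

Lemma lqnE (x : Lq p1) : LpN p (lqv x) = (lqn x)%:E.
Proof. by rewrite [LHS]LpN_fin. Qed.

Lemma LpN_lqpi f : Lp p f -> LpN p f = (lqn (lqpi f))%:E.
Proof. by move=> h; rewrite -lqnE; apply: LpN_ae; apply: vae_eq_sym; exact: lqpiE. Qed.

Lemma lqpi_add f g : Lp p f -> Lp p g -> lqpi (fun t => f t + g t) = lqpi f + lqpi g.
Proof. exact: lqpiD. Qed.

Lemma lqpi_scale (a : R) f : Lp p f -> lqpi (fun t => a%:C%C *: f t) = a *: lqpi f.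
Proof. exact: lqpiZ. Qed.

Lemma lqpi_zero : lqpi (fun=> 0) = 0.
Proof. exact: lqpi0. Qed.

Lemma lqpi_sub f g : Lp p f -> Lp p g -> lqpi (fun t => f t - g t) = lqpi f - lqpi g.
Proof.
move=> hf hg; rewrite -scaleN1r -lqpi_scale// -lqpi_add//; last exact: LpZ.
by congr lqpi; apply/funext => t; rewrite scaleN1C.
Qed.

Lemma lqn0 (x : Lq p1) : lqn x = 0 -> x = 0.
Proof.
move=> h; have := lqnE x; rewrite h => h'.
rewrite -(lqpiK x) -lqpi_zero; apply: lqpi_eq => //; apply: LpN_eq0 h' => //.
exact: Lp_meas (mem x).
Qed.

Lemma lqnD (x y : Lq p1) : lqn (x + y) <= lqn x + lqn y.
Proof.
rewrite -lee_fin EFinD -!lqnE; have := LpN_D p1' (Lp_meas (mem x)) (Lp_meas (mem y)).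
by rewrite (LpN_ae p (vae_eq_sym (lqpiE (LpD p1' (mem x) (mem y))))).
Qed.

Lemma lqnZ (a : R) (x : Lq p1) : lqn (a *: x) = `|a| * lqn x.
Proof.
apply/EFin_inj; rewrite EFinM -!lqnE -(LpN_Z a p0 (Lp_meas (mem x))).
by apply: LpN_ae; apply: lqpiE; exact: LpZ.
Qed.

Lemma lqn_complete (u : nat -> Lq p1) :
  (forall e : R, 0 < e -> exists n0, forall j k, (n0 <= j)%N -> (n0 <= k)%N -> lqn (u j - u k) <= e) ->
  exists v, forall e : R, 0 < e -> exists n0, forall k, (n0 <= k)%N -> lqn (u k - v) <= e.
Proof.
move=> H; have [e e0|v [hv lim]] := Lp_complete p1' (fun k => mem (u k)).
  have [n0 hn0] := H e e0; exists n0 => j k nj nk; have := hn0 j k nj nk.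
  rewrite -lee_fin -[X in lqn X](_ : lqpi (fun x => lqv (u j) x - lqv (u k) x) = _).
    by rewrite -LpN_lqpi//; exact: LpB.
  by rewrite (lqpi_sub (mem _) (mem _)) !lqpiK.
exists (lqpi v) => e e0; have [n0 hn0] := lim e e0; exists n0 => k /hn0.
rewrite -(lqpiK (u k)) -lqpi_sub// -lee_fin -LpN_lqpi//; last exact: LpB.
by rewrite lqpiK.
Qed.

Variables (S : R -> vfun -> vfun) (A : @vgraph R d m).
Hypotheses (C0S : C0_semigroup p S) (conS : contractive p S) (genS : is_generator p S A).

Let T t (x : Lq p1) : Lq p1 := lqpi (S t (lqv x)).

Let LpS t f : 0 <= t -> Lp p f -> Lp p (S t f) := @semigroup_Lp _ _ _ _ _ C0S t f.

Let T_pi t f : 0 <= t -> Lp p f -> T t (lqpi f) = lqpi (S t f).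
Proof.
move=> t0 hf; apply: lqpi_eq; first exact: LpS.
by apply: (semigroup_ae C0S) => //; exact: lqpiE.
Qed.

Let T_lin t (a : R) x y : 0 <= t -> T t (a *: x + y) = a *: T t x + T t y.
Proof.
move=> t0; have hax := LpZ a p0 (mem x).
have -> : a *: x + y = lqpi (fun s => a%:C%C *: lqv x s + lqv y s).
  by rewrite lqpi_add// lqpi_scale// !lqpiK.
rewrite T_pi//; last exact: LpD.
rewrite (lqpi_eq _ (semigroup_linear C0S a%:C%C t0 (mem x) (mem y))); last by apply: LpS => //; exact: LpD.
have hx := LpS t0 (mem x); have hy := LpS t0 (mem y).
by rewrite (lqpi_add (LpZ a p0 hx) hy) (lqpi_scale a hx).
Qed.

Let T_add t x y : 0 <= t -> T t (x + y) = T t x + T t y.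
Proof. by move=> t0; have := T_lin 1 x y t0; rewrite !scale1r. Qed.

Let T_scale t (a : R) x : 0 <= t -> T t (a *: x) = a *: T t x.
Proof.
move=> t0; have T0 : T t 0 = 0.
  by apply: (@addrI _ (T t 0)); rewrite -T_add// !addr0.
by have := T_lin a x 0 t0; rewrite T0 !addr0.
Qed.

Let T_contr t x : 0 <= t -> lqn (T t x) <= lqn x.
Proof. by move=> t0; rewrite -lee_fin -LpN_lqpi -?lqnE; [exact: conS|exact: LpS]. Qed.

Let T_0 x : T 0 x = x.
Proof. by rewrite -[RHS]lqpiK; apply: lqpi_eq; [exact: LpS|exact: (semigroup0 C0S)]. Qed.

Let T_D s t x : 0 <= s -> 0 <= t -> T (s + t) x = T s (T t x).
Proof.
move=> s0 t0; rewrite T_pi//; last exact: LpS.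
by apply: lqpi_eq; [apply: LpS => //; exact: addr_ge0|exact: (semigroupD C0S)].
Qed.

Let T_cont x (e : R) : 0 < e -> exists2 d : R, 0 < d & forall t, 0 < t < d -> lqn (T t x - x) <= e.
Proof.
move=> e0; have [H _] := cvg_at_right0P (fun t => LpN_ge0 p (fun y => S t (lqv x) y - lqv x y)).
have [del d0 hd] := H (semigroup_continuous C0S (mem x)) e e0.
exists del => // t td; have t0 : 0 <= t by case/andP: td => /ltW.
rewrite -lee_fin -{2}(lqpiK x) -lqpi_sub//; last exact: LpS.
by rewrite -LpN_lqpi; [exact: hd|apply: LpB => //; exact: LpS].
Qed.

Local Notation gen' := (gen lqn T).

Lemma gen_piP u g : Lp p u -> Lp p g -> A u g <-> gen' (lqpi u) (lqpi g).
Proof.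
move=> hu hg; have Lt t : 0 <= t -> Lp p (fun x => (t^-1)%:C%C *: (S t u x - u x) - g x).
  by move=> t0; apply: LpB => //; apply: LpZ => //; apply: LpB => //; exact: LpS.
have E t : 0 <= t -> LpN p (fun x => (t^-1)%:C%C *: (S t u x - u x) - g x) =
    (lqn (t^-1 *: (T t (lqpi u) - lqpi u) - lqpi g))%:E.
  move=> t0; have hSu := LpS t0 hu; have h1 := LpB p1' hSu hu; have h2 := LpZ t^-1 p0 h1.
  by rewrite (LpN_lqpi (Lt t t0)) (lqpi_sub h2 hg) (lqpi_scale t^-1 h1) (lqpi_sub hSu hu) T_pi.
rewrite genS// cvg_at_right0P; last by move=> t; exact: LpN_ge0.
split=> H e e0; have [del d0 hd] := H e e0; exists del => // t td; have := hd t td;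
  have t0 : 0 <= t by case/andP: td => /ltW.
  by rewrite E// lee_fin.
by rewrite E// lee_fin.
Qed.

(** [resolvent_exists] at [h^-1], applied to [h^-1] times [f]. *)
Lemma resolvent_Lp (h : R) f : 0 < h -> Lp p f -> exists u, Lp p u /\
  A u (fun x => (h^-1)%:C%C *: (u x - f x)).
Proof.
move=> h0 hf; have h1 : 0 < h^-1 by rewrite invr_gt0.
have [V [gV _]] := @resolvent_exists _ _ lqn lqnD lqnZ lqn_complete T T_add T_scale T_contr T_0 T_D T_cont
   h^-1 (h^-1 *: lqpi f) h1.
exists (lqv V); split; first exact: mem.
have hL := LpB p1' (mem V) hf.
have hZ := LpZ h^-1 p0 hL; apply/(gen_piP (mem V) hZ).
by rewrite (lqpi_scale _ hL) (lqpi_sub (mem V) hf) lqpiK scalerBr.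
Qed.

Lemma dissipative_Lp (h : R) u g : 0 < h -> Lp p u -> Lp p g -> A u g ->
  (LpN p u <= LpN p (fun x => (u x - h%:C%C *: g x)%R))%E.
Proof.
move=> h0 hu hg /(gen_piP hu hg) ug.
have hL := LpZ h p0 hg.
rewrite (LpN_lqpi hu) (LpN_lqpi (LpB p1' hu hL)) (lqpi_sub hu hL) (lqpi_scale h hg) lee_fin.
exact: (@gen_dissipative _ _ lqn lqnD lqnZ T T_contr).
Qed.

Lemma generator_sub u g u' g' : Lp p u -> Lp p g -> Lp p u' -> Lp p g' -> A u g -> A u' g' ->
  A (fun x => u x - u' x) (fun x => g x - g' x).
Proof.
move=> hu hg hu' hg' /(gen_piP hu hg) a /(gen_piP hu' hg') b.
apply/(gen_piP (LpB p1' hu hu') (LpB p1' hg hg')).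
have h := @gen_lin _ _ lqn lqnD lqnZ T T_add T_scale (-1) _ _ _ _ b a.
have e1 : -1 *: lqpi u' + lqpi u = lqpi (fun x => u x - u' x).
  by rewrite (lqpi_sub hu hu') scaleN1r addrC.
have e2 : -1 *: lqpi g' + lqpi g = lqpi (fun x => g x - g' x).
  by rewrite (lqpi_sub hg hg') scaleN1r addrC.
by rewrite e1 e2 in h.
Qed.

Lemma exponential_Lp (J : R -> vfun -> vfun) (t : R) f (e : R) :
  (forall h g, 0 < h -> Lp p g -> Lp p (J h g) /\ A (J h g) (fun x => (h^-1)%:C%C *: (J h g x - g x))) ->
  0 < t -> 0 < e -> Lp p f -> exists n0, forall n, (n0 <= n)%N ->
    Lp p (iter n.+1 (J (t / n.+1%:R)) f) /\
    (LpN p (fun x => (S t f x - iter n.+1 (J (t / n.+1%:R)) f x)%R) <= e%:E)%E.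
Proof.
move=> HJ t0 e0 hf.
pose J' h (x : Lq p1) : Lq p1 := lqpi (J h (lqv x)).
have gJ h g : 0 < h -> Lp p g -> gen' (lqpi (J h g)) (h^-1 *: (lqpi (J h g) - lqpi g)).
  move=> h0 hg; have [hJ AJ] := HJ h g h0 hg; have hB := LpB p1' hJ hg.
  have /(gen_piP hJ (LpZ h^-1 p0 hB)) := AJ.
  by rewrite (lqpi_scale h^-1 hB) (lqpi_sub hJ hg).
have gJ' h x : 0 < h -> gen' (J' h x) (h^-1 *: (J' h x - x)).
  by move=> h0; have := gJ h _ h0 (mem x); rewrite lqpiK.
have JE h g : 0 < h -> Lp p g -> J' h (lqpi g) = lqpi (J h g).
  move=> h0 hg; rewrite -[RHS](@J_uniq _ _ lqn lqn0 lqnD lqnZ T T_add T_scale T_contr J' gJ' h _ _ h0 (gJ h g h0 hg)).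
  by congr (J' h _); rewrite scalerA mulfV ?gt_eqF// scale1r subKr.
have Jit h n g : 0 < h -> Lp p g -> Lp p (iter n (J h) g) /\ iter n (J' h) (lqpi g) = lqpi (iter n (J h) g).
  move=> h0 hg; elim: n => [//|n [IH1 IH2]]; split; first exact: (HJ h _ h0 IH1).1.
  by rewrite !iterS IH2 JE.
have [n0 hn0] := @exponential_formula _ _ lqn lqn0 lqnD lqnZ lqn_complete T T_add T_scale T_contr T_0 T_D T_cont
   J' gJ' t (lqpi f) e t0 e0.
exists n0 => n /hn0 h.
have h0 : 0 < t / n.+1%:R by rewrite divr_gt0.
have [h1 h2] := Jit _ n.+1 f h0 hf; split => //.
have hS := LpS (ltW t0) hf.
rewrite h2 (T_pi (ltW t0) hf) -(lqpi_sub hS h1) in h.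
by rewrite (LpN_lqpi (LpB p1' hS h1)) lee_fin.
Qed.

End Lq.

(** * Consistency *)

Section scalar_estimates.
Context {R : realType} {d : nat}.
Local Notation E := 'rV[R]_d.
Local Notation mu := (lebesgue_rV R d).
Implicit Types f : E -> R.

Lemma powR_threshold (p q t y : R) : 0 < p -> p <= q -> 0 < t -> 0 <= y ->
  y `^ p <= t `^ p + t `^ (p - q) * y `^ q.
Proof.
move=> p0 pq t0 y0; have [yt|ty] := leP y t.
  have h : y `^ p <= t `^ p by apply: ge0_ler_powR; rewrite ?nnegrE ?(ltW p0) ?(ltW t0).
  by apply: le_trans h _; rewrite lerDl mulr_ge0 ?powR_ge0.
have yp : 0 < y by exact: lt_trans ty.
apply: (@le_trans _ _ (t `^ (p - q) * y `^ q)); last by rewrite lerDr powR_ge0.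
have -> : t `^ (p - q) = (t `^ (q - p))^-1 by rewrite -powRN opprB.
rewrite ler_pdivlMl ?powR_gt0//.
have -> : y `^ q = y `^ (q - p) * y `^ p by rewrite -powRD ?subrK// (gt_eqF yp) implybT.
rewrite ler_wpM2r ?powR_ge0//.
by apply: ge0_ler_powR; rewrite ?nnegrE ?subr_ge0 ?(ltW t0) ?(ltW yp)// ltW.
Qed.

Lemma IpZ (p c : R) f : measurable_fun setT f ->
  Ip mu p (fun x => (c * f x)%R) = ((`|c| `^ p)%:E * Ip mu p f)%E.
Proof.
move=> mf; have cq : (0 <= (`|c| `^ p)%:E)%E by rewrite lee_fin powR_ge0.
rewrite /Ip -(ge0_integralZl mu measurableT (measurable_Ip p mf) _ cq); last first.
  by move=> x _; rewrite lee_fin powR_ge0.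
by apply: eq_integral => x _; rewrite normrM (powRM _ (normr_ge0 c) (normr_ge0 _)) EFinM.
Qed.

Lemma Ip_cut (p q t M : R) f : 0 < p -> p <= q -> 0 < t -> measurable_fun setT f ->
  (Ip mu p (fun x => (\1_(kball M) x * f x)%R) <= (t `^ p)%:E * mu (kball M) + (t `^ (p - q))%:E * Ip mu q f)%E.
Proof.
move=> p0 pq t0 mf.
have -> : mu (kball M) = (\int[mu]_x (\1_(kball M) x)%:E)%E.
  by rewrite integral_indic ?setIT//; exact: measurable_kball.
have mi : measurable_fun setT (fun x : E => (\1_(kball M) x)%:E : \bar R).
  by apply/measurable_EFinP; exact: measurable_ind_kball.
have t1 : (0 <= (t `^ p)%:E)%E by rewrite lee_fin powR_ge0.
have t2 : (0 <= (t `^ (p - q))%:E)%E by rewrite lee_fin powR_ge0.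
have i0 (x : E) : setT x -> (0 <= (\1_(kball M) x)%:E :> \bar R)%E by rewrite lee_fin indicE.
have f0 (x : E) : setT x -> (0 <= (`|f x| `^ q)%:E)%E by rewrite lee_fin powR_ge0.
rewrite -(ge0_integralZl mu measurableT mi i0 t1) /Ip.
rewrite -(ge0_integralZl mu measurableT (measurable_Ip q mf) f0 t2).
rewrite -ge0_integralD//; first last.
- by apply: measurable_funeM; exact: measurable_Ip.
- by move=> x h; rewrite mule_ge0// f0.
- exact: measurable_funeM.
- by move=> x h; rewrite mule_ge0// i0.
apply: ge0_le_integral_nm => x _; rewrite ?lee_fin ?powR_ge0//.
rewrite indicE; case: (x \in _) => /=; rewrite ?mul1r ?mulr1.
  exact: powR_threshold.
by rewrite mul0r normr0 powR0 ?gt_eqF// mulr0 add0r mulr_ge0 ?powR_ge0.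
Qed.

Lemma mu_kball_le (M : R) : 0 <= M -> (mu (kball M) <= ((2 * M) ^+ d)%:E)%E.
Proof.
move=> M0; pose a : E := const_mx (- M); pose b : E := const_mx M.
have ab i : a 0 i <= b 0 i by rewrite !mxE; lra.
apply: (@le_trans _ _ (mu (cbox a b))).
  apply: le_measure; rewrite ?inE; [exact: measurable_kball|exact: measurable_cbox|].
  move=> x /= xr i; rewrite !mxE -ler_norml (le_trans (coord_norm _ _))//; exact: ltW.
rewrite lebesgue_rV_box// lee_fin (eq_bigr (fun=> 2 * M)) => [|i _]; last by rewrite !mxE; ring.
by rewrite prodr_const card_ord.
Qed.

Lemma Ip_fin_cut (p q B M : R) (a f : E -> R) : 0 < p -> p <= q -> measurable_fun setT f -> measurable_fun setT a ->
  (forall x, `|a x| <= B) -> (forall x, M <= `|x| -> a x = 0) -> (Ip mu q f < +oo)%E ->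
  (Ip mu p (fun x => a x * f x)%R < +oo)%E.
Proof.
move=> p0 pq mf ma aB aM fq; have B0 : 0 <= B by apply: le_trans (aB 0).
have h := @Ip_cut p q 1 M (fun x => B * f x) p0 pq ltr01 (measurable_funM (measurable_cst _) mf).
apply: le_lt_trans (le_lt_trans h _).
  apply: Ip_le; first exact: ltW.
  move=> x; rewrite indicE; case: (boolP (x \in _)) => xM.
    by rewrite mul1r !normrM ler_wpM2r// (le_trans (aB x))// ler_norm.
  rewrite aM ?mul0r ?normr0// leNgt; apply/negP => hx; move/negP: xM; apply; exact: mem_set.
apply: lte_add_pinfty; first by rewrite lte_mul_pinfty ?lee_fin ?powR_ge0// lebesgue_rV_ball_lty.
rewrite (IpZ q B mf) !powR1 mul1e.
by apply: lte_mul_pinfty; rewrite ?lee_fin ?powR_ge0.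
Qed.

Lemma powRN_small (e s : R) : 0 < e -> 0 < s -> exists n0, forall n, (n0 <= n)%N -> n.+1%:R `^ (- s) <= e.
Proof.
move=> e0 s0; have a0 : 0 < (e^-1) `^ s^-1 by rewrite powR_gt0// invr_gt0.
exists (Num.truncn ((e^-1) `^ s^-1)) => n h.
have h1 : (e^-1) `^ s^-1 <= n.+1%:R.
  apply: le_trans (ltW (truncnS_gt _)) _; by rewrite ler_nat.
rewrite powRN; rewrite -[leRHS]invrK lef_pV2 ?posrE ?invr_gt0 ?powR_gt0//.
have i0 : 0 <= e^-1 by rewrite invr_ge0 ltW.
have -> : e^-1 = ((e^-1) `^ s^-1) `^ s by rewrite -powRrM mulVf ?gt_eqF// powRr1.
by apply: ge0_ler_powR; rewrite ?nnegrE ?(ltW s0) ?(ltW a0).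
Qed.

(* Cut [f] at the height [(n + 1)^(-d)]: the small values cost the volume of the ball, the large ones the power [d (q - p) <= 1/2] of [n + 1]. *)
Lemma Ip_decay (p q c : R) f : (0 < d)%N -> 1 < p -> p <= q -> q <= p + (2 * d%:R)^-1 -> 0 <= c ->
  measurable_fun setT f -> (Ip mu q f < +oo)%E ->
  tends0 (fun n => Ip mu p (fun x => c / n.+1%:R * (\1_(kball n.+3%:R) x * f x))).
Proof.
move=> d0 p1 pq qp c0 mf fq.
have p0 : 0 < p by exact: lt_trans p1.
have dR : 0 < d%:R :> R by rewrite ltr0n.
have If0 : (0 <= Ip mu q f)%E by exact: Ip_ge0.
have IfE : Ip mu q f = (fine (Ip mu q f))%:E by rewrite fineK// ge0_fin_numE.
set I := fine _ in IfE; have I0 : 0 <= I by exact: fine_ge0.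
have key (n : nat) : (Ip mu p (fun x => (c / n.+1%:R * (\1_(kball n.+3%:R) x * f x))%R) <=
    ((c `^ p * (6 ^+ d + I)) * n.+1%:R `^ (- 2^-1))%:E)%E.
  set N : R := n.+1%:R; have N0 : 0 < N by rewrite /N. have N1 : 1 <= N by rewrite /N ler1n.
  pose t := N `^ (- d%:R); have t0 : 0 < t by rewrite powR_gt0.
  have mk : measurable_fun setT (fun x => \1_(kball n.+3%:R) x * f x) by apply: measurable_funM => //; exact: measurable_ind_kball.
  have cN : 0 <= c / N by rewrite divr_ge0// ltW.
  have -> : Ip mu p (fun x => c / N * (\1_(kball n.+3%:R) x * f x)) =
      (((c / N) `^ p)%:E * Ip mu p (fun x => (\1_(kball n.+3%:R) x * f x)%R))%E.
    by rewrite (IpZ _ (c / N) mk) (ger0_norm cN).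
  have h := @Ip_cut p q t n.+3%:R f p0 pq t0 mf.
  (* The radius [n + 3] is at most [3 N], so the ball sits in a cube of side [6 N]. *)
  have mk6 : (mu (kball n.+3%:R) <= (6 ^+ d * N `^ d%:R)%:E)%E.
    apply: le_trans (mu_kball_le _) _; first by [].
    rewrite lee_fin powR_mulrn ?(ltW N0)// -exprMn lerXn2r ?nnegrE ?mulr_ge0 ?(ltW N0)//.
    have -> : 6 * N = 2 * (3 * N) by ring.
    by rewrite ler_pM2l// /N -natrM ler_nat mulnS; case: (n) => // k; rewrite mulSn addnA leq_addr.
  apply: (@le_trans _ _ (((c / N) `^ p)%:E * ((t `^ p)%:E * (6 ^+ d * N `^ d%:R)%:E + (t `^ (p - q))%:E * I%:E))%E).
    apply: lee_wpmul2l; first by rewrite lee_fin powR_ge0.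
    apply: le_trans h _; rewrite -IfE; apply: leeD => //.
    by apply: lee_wpmul2l; rewrite ?lee_fin ?powR_ge0.
  rewrite -[leLHS]/(((c / N) `^ p * (t `^ p * (6 ^+ d * N `^ d%:R) + t `^ (p - q) * I))%:E) lee_fin.
  have mono (a b : R) : a <= b -> N `^ a <= N `^ b by move=> ab; rewrite ler_powR.
  (* Here the exponent is [- p - d p + d <= - p], in [e2] it is [- p + d (q - p) <= - p + 1/2]; as
     [p > 1], both are at most [- 1/2]. *)
  have e1 : N `^ (- p) * (t `^ p * N `^ d%:R) <= N `^ (- 2^-1).
    rewrite /t -powRrM -!powRD ?(gt_eqF N0) ?implybT//; apply: mono.
    have : d%:R * 1 <= d%:R * p by rewrite ler_pM2l// ltW.
    have : (2^-1 : R) <= 1 by rewrite invf_le1// ler1n.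
    lra.
  have e2 : N `^ (- p) * t `^ (p - q) <= N `^ (- 2^-1).
    rewrite /t -powRrM -!powRD ?(gt_eqF N0) ?implybT//; apply: mono.
    have h1 : d%:R * (q - p) <= 2^-1.
      have : d%:R * (q - p) <= d%:R * (2 * d%:R)^-1 by rewrite ler_pM2l//; lra.
      have -> : d%:R * (2 * d%:R)^-1 = 2^-1 :> R by field; rewrite gt_eqF.
      by [].
    rewrite mulNr -mulrN opprB; set y := d%:R * (q - p) in h1 *; lra.
  have -> : (c / N) `^ p = c `^ p * N `^ (- p).
    by rewrite powRM ?invr_ge0 ?(ltW N0)// -powR_inv1 ?(ltW N0)// -powRrM mulN1r.
  have -> : c `^ p * N `^ (- p) * (t `^ p * (6 ^+ d * N `^ d%:R) + t `^ (p - q) * I) =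
     c `^ p * (6 ^+ d * (N `^ (- p) * (t `^ p * N `^ d%:R)) + I * (N `^ (- p) * t `^ (p - q))) by ring.
  rewrite -mulrA ler_wpM2l ?powR_ge0// mulrDl; apply: lerD; rewrite ler_wpM2l// exprn_ge0//.
move=> e e0; have C0 : 0 < c `^ p * (6 ^+ d + I) + 1.
  by rewrite ltr_wpDl// mulr_ge0 ?powR_ge0// addr_ge0// exprn_ge0.
have h2 : 0 < 2^-1 :> R by rewrite invr_gt0.
have [n0 hn0] := powRN_small (divr_gt0 e0 C0) h2.
exists n0 => n /hn0 h; apply: le_trans (key n) _; rewrite lee_fin.
apply: (@le_trans _ _ ((c `^ p * (6 ^+ d + I) + 1) * (e / (c `^ p * (6 ^+ d + I) + 1)))); last by rewrite mulrC divfK ?gt_eqF.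
apply: ler_pM; rewrite ?powR_ge0 ?lerDl// mulr_ge0 ?powR_ge0// addr_ge0// exprn_ge0//.
Qed.

Lemma Ip_lim0 (p : R) (f_ : nat -> E -> R) f : 0 < p -> (forall n, measurable_fun setT (f_ n)) ->
  (forall x, f_ n x @[n --> \oo] --> f x) -> tends0 (fun n => Ip mu p (f_ n)) -> Ip mu p f = 0%E.
Proof.
move=> p0 mf fc T; apply: tends0_eq0; first exact: Ip_ge0.
move=> e e0; exists 0%N => _ _; have [N hN] := T e e0.
have -> : Ip mu p f = (\int[mu]_x limn_einf (fun n => (`|f_ n x| `^ p)%:E))%E.
  apply: eq_integral => x _.
  have h : (`|f_ n x| `^ p)%:E @[n --> \oo] --> (`|f x| `^ p)%:E.
    apply: cvg_EFin; first exact: nearW.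
    apply: powR_cvg_seq => //.
    by apply: cvg_norm; exact: fc.
  by rewrite (cvg_limn_einf_sup h).1.
apply: le_trans (fatou mu measurableT _ _) _.
- by move=> n; exact: measurable_Ip.
- by move=> n x _; rewrite lee_fin powR_ge0.
rewrite limn_einf_lim; apply: lime_le; first exact: is_cvg_einfs.
apply: nearW => n; apply: (@le_trans _ _ (Ip mu p (f_ (n + N)%N))).
  by apply: ereal_inf_lbound; exists (n + N)%N => //=; exact: leq_addr.
by apply: hN; exact: leq_addl.
Qed.

Lemma Ip_eq0 (p : R) f : 0 < p -> measurable_fun setT f -> Ip mu p f = 0%E -> {ae mu, forall x, f x = 0}.
Proof.
move=> p0 mf h.
have /(ae_eq_integral_abs _ measurableT)/= H : measurable_fun setT (fun x => (`|f x| `^ p)%:E) by exact: measurable_Ip.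
have /H : (\int[mu]_x `|(`|f x| `^ p)%:E| = 0)%E.
  by rewrite -[RHS]h; apply: eq_integral => x _; rewrite gee0_abs// lee_fin powR_ge0.
case=> A [mA A0 hA]; exists A; split => //; apply: subset_trans hA => x /= nx hx; apply: nx.
have := hx I => -[] /eqP; rewrite powR_eq0 => /andP[/eqP/normr0_eq0 -> _] //.
Qed.

Lemma Ip_fin_add (p : R) f (g : E -> R) : 0 < p -> measurable_fun setT f -> measurable_fun setT g ->
  (Ip mu p (fun x => (f x + g x)%R) <= (2 `^ p)%:E * (Ip mu p f + Ip mu p g))%E.
Proof.
move=> p0 mf mg; pose F (b : bool) := if b then f else g.
have := @Ip_sum_le R d p _ [:: true; false] F (fun x => f x + g x) p0; rewrite /= !big_cons !big_nil /= adde0.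
apply; first by case.
by move=> x; rewrite !big_cons big_nil addr0; exact: ler_normD.
Qed.

End scalar_estimates.

Section wpB_linear.
Context {R : realType} {d : nat}.
Local Notation E := 'rV[R]_d.
Local Notation mu := (lebesgue_rV R d).

Lemma wpB_add (k : 'I_d) (f g f' g' : E -> R) : wpB k f g -> wpB k f' g' ->
  wpB k (fun x => f x + f' x) (fun x => g x + g' x).
Proof.
move=> [hf hg H] [hf' hg' H']; split; [exact: L1bD|exact: L1bD|].
move=> phi tp; have tk := test_partial k tp.
transitivity (\int[mu]_x (f x * partial k phi x) + \int[mu]_x (f' x * partial k phi x)).
  rewrite -RintegralD//; [|exact: L1b_testM|exact: L1b_testM].
  by apply: eq_Rintegral => x _; ring.
rewrite H// H'// -opprD -RintegralD//; [|exact: L1b_testM|exact: L1b_testM].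
by congr (- _); apply: eq_Rintegral => x _; ring.
Qed.

End wpB_linear.

(** * The graph of the operator in Borel terms, and its behaviour under cut-offs *)

Section graph.
Context {R : realType} {d m : nat}.
Local Notation E := 'rV[R]_d.
Local Notation mu := (lebesgue_rV R d).
Local Notation vfun := (vfun R d m).
Implicit Types (u w f g : vfun) (p q : R).

Definition vsc (a : E -> R) u : vfun := fun x => (a x)%:C%C *: u x.

Definition wpv k u w := forall j, wpB k (re_comp u j) (re_comp w j) /\ wpB k (im_comp u j) (im_comp w j).

Lemma re_ae u w j : vae_eq u w -> {ae mu, forall x, re_comp u j x = re_comp w j x}.
Proof. by apply: filterS => x e; rewrite /re_comp e. Qed.

Lemma im_ae u w j : vae_eq u w -> {ae mu, forall x, im_comp u j x = im_comp w j x}.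
Proof. by apply: filterS => x e; rewrite /im_comp e. Qed.

Lemma weak_wpv k u w u' w' : weak_partialv k u w -> borelv u' -> borelv w' -> vae_eq u u' -> vae_eq w w' ->
  wpv k u' w'.
Proof.
move=> H bu bw uu ww j; have [H1 H2] := H j; have [b1 b2] := bu j; have [c1 c2] := bw j; split.
  exact: weak_wpB H1 b1 c1 (re_ae j uu) (re_ae j ww).
exact: weak_wpB H2 b2 c2 (im_ae j uu) (im_ae j ww).
Qed.

Lemma wpv_weak k u w : wpv k u w -> weak_partialv k u w.
Proof. by move=> H j; have [H1 H2] := H j; split; exact: wpB_weak. Qed.

Lemma wpv_add k u w u' w' : wpv k u w -> wpv k u' w' -> wpv k (fun x => u x + u' x) (fun x => w x + w' x).
Proof.
move=> H H' j; have [a b] := H j; have [a' b'] := H' j.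
by rewrite !re_compD !im_compD; split; exact: wpB_add.
Qed.

Lemma wpv_smoothM k u w (chi : E -> R) : smooth (@unit_vec R d) chi -> wpv k u w ->
  wpv k (vsc chi u) (fun x => vsc chi w x + vsc (partial k chi) u x).
Proof.
move=> sc H j; have [a b] := H j; rewrite re_compD im_compD /vsc !re_compZ !im_compZ.
by split; exact: wpB_smoothM.
Qed.

Variables (Q : E -> 'M[R]_d) (V : E -> 'M[R]_m) (v : E -> R).
Hypothesis hQ : hypQ Q.

Definition wdv (Du : 'I_d -> vfun) w := forall j,
  wdivB (fun h x => \sum_k Q x h k * re_comp (Du k) j x) (re_comp w j) /\
  wdivB (fun h x => \sum_k Q x h k * im_comp (Du k) j x) (im_comp w j).

(* Borel data witnessing that [u] is in the domain of the operator; [w] is [div (Q grad u)]. *)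
Record gdata p u (Du : 'I_d -> vfun) (D2 : 'I_d -> 'I_d -> vfun) w : Prop := GData {
  gd_b : borelv u; gd_b1 : forall k, borelv (Du k); gd_b2 : forall h k, borelv (D2 h k); gd_bw : borelv w;
  gd_L : Lp p u; gd_L1 : forall k, Lp p (Du k); gd_L2 : forall h k, Lp p (D2 h k);
  gd_wp : forall k, wpv k u (Du k); gd_wp2 : forall h k, wpv h (Du k) (D2 h k);
  gd_wd : wdv Du w; gd_V : Lp p (mx_mul V u); gd_v : Lp p (fun_mul v u) }.

Lemma weak_partialv_vmeas k u w : weak_partialv k u w -> vmeas w.
Proof. by move=> H j; have [[_ [? _] _] [_ [? _] _]] := H j. Qed.

Lemma div_grad_vmeas u w : div_grad Q u w -> vmeas w.
Proof. by move=> [Du [_ H]] j; have [[_ [? _] _] [_ [? _] _]] := H j. Qed.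

Lemma measurable_QD (h : 'I_d) (F : 'I_d -> E -> R) : (forall k, measurable_fun setT (F k)) ->
  measurable_fun setT (fun x : E => \sum_k Q x h k * F k x).
Proof.
move=> mF; apply: measurable_sum => k; apply: measurable_funM => //; exact: measurable_Q.
Qed.

(** All witnesses hidden in the definition of the operator are replaced by Borel versions attached
    to one common gradient. *)
Lemma graph_data p u g : Ltilde_op Q V v p u g -> exists u' Du D2 w, [/\ gdata p u' Du D2 w, vae_eq u u' &
  vae_eq g (fun x => w x + mx_mul V u' x - fun_mul v u' x)].
Proof.
move=> [a [b [[[hu [Du0 [HD HD2]]] hV [w0 hw aE]] [_ hv bE] gE]]].
have [u' [bu uu hu']] := Lp_borel hu.
have [Du hDu] := choice (fun k => Lp_borel (HD k).2).
have H2 (hk : 'I_d * 'I_d) : exists z, weak_partialv hk.1 (Du0 hk.2) z /\ Lp p z.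
  by have [z ? ?] := HD2 hk.1 hk.2; exists z.
have [D20 hD20] := choice H2.
have [D2 hD2] := choice (fun hk => Lp_borel (hD20 hk).2).
have [w bw ww] := vmeas_borel (div_grad_vmeas hw).
have bD k : borelv (Du k) by case: (hDu k).
have eD k : vae_eq (Du0 k) (Du k) by case: (hDu k).
have wp k : wpv k u' (Du k) := weak_wpv (HD k).1 bu (bD k) uu (eD k).
have [Du1 [HD1 Hw]] := hw.
have [Db hDb] := choice (fun k => (let: ex_intro2 z a b := vmeas_borel (weak_partialv_vmeas (HD1 k)) in
  ex_intro (fun z => borelv z /\ vae_eq (Du1 k) z) z (conj a b))).
(* The gradients provided by [W2p] and by [div_grad] are unrelated witnesses; uniqueness of weak
   derivatives identifies them. *)
have e1 k j : {ae mu, forall x, re_comp (Du1 k) j x = re_comp (Du k) j x} /\ {ae mu, forall x, im_comp (Du1 k) j x = im_comp (Du k) j x}.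
  have [bb eb] := hDb k; have h1 := weak_wpv (HD1 k) bu bb uu eb.
  have [a1 a2] := h1 j; have [c1 c2] := wp k j; split.
    by apply: filterS2 (re_ae j eb) (wpB_uniq a1 c1) => x -> ->.
  by apply: filterS2 (im_ae j eb) (wpB_uniq a2 c2) => x -> ->.
exists u', Du, (fun h k => D2 (h, k)), w; split => //.
- split => //.
  + by move=> h k; case: (hD2 (h, k)).
  + by move=> k; case: (hDu k).
  + by move=> h k; case: (hD2 (h, k)).
  + move=> h k; have [h1 h2 _] := hD2 (h, k).
    exact: weak_wpv (hD20 (h, k)).1 (bD k) h1 (eD k) h2.
  + move=> j; have [w1 w2] := Hw j; have [b1 b2] := bw j; split.
      apply: (weak_wdivB w1 _ b1 _ (re_ae j ww)) => h.
        by apply: measurable_QD => k; have [] := bD k j.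
      by apply: filterS (ae_all_ord_R (fun k => (e1 k j).1)) => x e; apply: eq_bigr => k _; rewrite e.
    apply: (weak_wdivB w2 _ b2 _ (im_ae j ww)) => h.
      by apply: measurable_QD => k; have [] := bD k j.
    by apply: filterS (ae_all_ord_R (fun k => (e1 k j).2)) => x e; apply: eq_bigr => k _; rewrite e.
  + by apply: Lp_ae hV; apply: filterS uu => x e; rewrite /mx_mul e.
  + by apply: Lp_ae hv; apply: filterS uu => x e; rewrite /fun_mul e.
have c1 : vae_eq g (fun x => w0 x + mx_mul V u x - b x) by apply: filterS2 gE aE => x -> ->.
have c2 : vae_eq g (fun x => w0 x + mx_mul V u x - fun_mul v u x) by apply: filterS2 c1 bE => x -> ->.
by apply: filterS3 c2 uu ww => x -> e ->; rewrite /mx_mul /fun_mul e.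
Qed.

Lemma graph_intro p u Du D2 w g : gdata p u Du D2 w ->
  vae_eq g (fun x => w x + mx_mul V u x - fun_mul v u x) -> Ltilde_op Q V v p u g.
Proof.
move=> D gE; exists (fun x => w x + mx_mul V u x), (fun_mul v u); split => //; last first.
  by split; [exact: gd_L D|exact: gd_v D|exact: vae_eq_refl].
split; last 2 first.
- exact: gd_V D.
- exists w; last exact: vae_eq_refl.
  exists Du; split => [k|j]; first exact: wpv_weak (gd_wp D k).
  by have [h1 h2] := gd_wd D j; split; exact: wdivB_weak.
split; first exact: gd_L D.
exists Du; split => [k|h k]; first by split; [exact: wpv_weak (gd_wp D k)|exact: gd_L1 D k].
by exists (D2 h k); [exact: wpv_weak (gd_wp2 D h k)|exact: gd_L2 D h k].
Qed.

Lemma Lp_vsc p q (a : E -> R) (B M : R) u : 0 < p -> p <= q -> measurable_fun setT a ->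
  (forall x, `|a x| <= B) -> (forall x, M <= `|x| -> a x = 0) -> borelv u -> Lp q u -> Lp p (vsc a u).
Proof.
move=> p0 pq ma aB aM bu hu; have q0 : 0 < q by exact: lt_le_trans pq.
apply/LpP => //; split; first by apply: borelv_meas; exact: borelvM.
have [_ fq] := (LpP u q0).1 hu.
have := Ip_fin_cut p0 pq (measurable_vn bu) ma aB aM fq; apply: le_lt_trans.
apply: Ip_le; first exact: ltW.
by move=> x; rewrite /vn /vsc Cvec_normZ !normrM normr_id.
Qed.

Lemma Lp_test p q (a : E -> R) u : 0 < p -> p <= q -> test_function a -> borelv u -> Lp q u -> Lp p (vsc a u).
Proof.
move=> p0 pq ta; have [B _ hB] := test_bounded ta; have [M hM] := test_supp ta.
exact: (Lp_vsc p0 pq (test_meas ta) hB hM).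
Qed.

Lemma Lp_sum p (J : Type) (s : seq J) (F : J -> vfun) : 1 <= p -> (forall k, Lp p (F k)) -> Lp p (fun x => \sum_(k <- s) F k x).
Proof.
move=> p1 hF; elim: s => [|k s IH].
  rewrite (_ : (fun x => _) = (fun _ : E => 0 : 'cV[R[i]]_m)); first by apply: Lp0; exact: lt_le_trans p1.
  by apply/funext => x; rewrite big_nil.
rewrite (_ : (fun x => _) = (fun x => F k x + \sum_(k <- s) F k x)); first exact: LpD.
by apply/funext => x; rewrite big_cons.
Qed.

Lemma borelv_sum (s : seq 'I_d) (F : 'I_d -> vfun) : (forall k, borelv (F k)) -> borelv (fun x => \sum_(k <- s) F k x).
Proof.
move=> hF; elim: s => [|k s IH].
  rewrite (_ : (fun x => _) = (fun _ : E => 0 : 'cV[R[i]]_m)); last by apply/funext => x; rewrite big_nil.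
  move=> j; split.
    by rewrite (_ : re_comp _ j = cst 0)//; apply/funext => x; rewrite /re_comp mxE.
  by rewrite (_ : im_comp _ j = cst 0)//; apply/funext => x; rewrite /im_comp mxE.
rewrite (_ : (fun x => _) = (fun x => F k x + \sum_(k <- s) F k x)); first exact: borelvD.
by apply/funext => x; rewrite big_cons.
Qed.

Lemma re_comp_sum (s : seq 'I_d) (F : 'I_d -> vfun) j :
  re_comp (fun x => \sum_(k <- s) F k x) j = (fun x => \sum_(k <- s) re_comp (F k) j x).
Proof.
apply/funext => x; rewrite /re_comp summxE; elim: s => [|k s IH]; first by rewrite !big_nil.
by rewrite !big_cons ReD IH.
Qed.

Lemma im_comp_sum (s : seq 'I_d) (F : 'I_d -> vfun) j :
  im_comp (fun x => \sum_(k <- s) F k x) j = (fun x => \sum_(k <- s) im_comp (F k) j x).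
Proof.
apply/funext => x; rewrite /im_comp summxE; elim: s => [|k s IH]; first by rewrite !big_nil.
by rewrite !big_cons ImD IH.
Qed.

(* The commutator of the divergence-form operator with multiplication by [chi]. *)
Definition comm (chi : E -> R) (g : 'I_d -> E -> R) u (Du : 'I_d -> vfun) : vfun :=
  fun x => \sum_h (vsc (g h) u x + vsc (fun y => 2 * ell Q chi h y) (Du h) x).

(** Every term of the Leibniz formulas carries a bounded factor of bounded support, which lowers the
    exponent from [q] to [p]; the divergence part is [wdivB_cut], component by component. The case
    [p = q] treats the L^p solution. *)
Lemma gdata_cut p q u Du D2 w (chi : E -> R) (g : 'I_d -> E -> R) (B M : R) :
  1 <= p -> p <= q -> gdata q u Du D2 w -> test_function chi ->
  (forall h, [/\ wpB h (ell Q chi h) (g h), forall x, `|ell Q chi h x| <= B,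
     forall x, `|g h x| <= B & forall x, M <= `|x| -> ell Q chi h x = 0 /\ g h x = 0]) ->
  gdata p (vsc chi u) (fun k x => vsc chi (Du k) x + vsc (partial k chi) u x)
    (fun h k x => (vsc chi (D2 h k) x + vsc (partial h chi) (Du k) x) +
       (vsc (partial k chi) (Du h) x + vsc (partial h (partial k chi)) u x))
    (fun x => vsc chi w x + comm chi g u Du x) /\ Lp p (comm chi g u Du).
Proof.
move=> p1 pq D tchi hg; have p0 : 0 < p by exact: lt_le_trans p1.
have sc := test_smooth tchi; have mc := test_meas tchi.
have tp k := test_partial k tchi; have mp k := test_meas (tp k).
have tpp h k := test_partial h (tp k); have mpp h k := test_meas (tpp h k).
have bu := gd_b D; have b1 := gd_b1 D; have b2 := gd_b2 D; have bw := gd_bw D.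
have mg h : measurable_fun setT (g h) by have [[_ []]] := hg h.
have ml h : measurable_fun setT (fun y => 2 * ell Q chi h y).
  by apply: measurable_funM => //; have [[[]]] := hg h.
have hC : Lp p (comm chi g u Du).
  apply: Lp_sum => // h; have [_ lB gB gM] := hg h; apply: LpD => //.
    by apply: (Lp_vsc p0 pq (mg h) gB (fun x xM => (gM x xM).2)) => //; exact: gd_L D.
  apply: (@Lp_vsc p q _ (2 * B) M) => //.
  - by move=> x; rewrite normrM (gtr0_norm (ltr0Sn _ 1)) ler_pM2l.
  - by move=> x /gM[-> _]; rewrite mulr0.
  - exact: gd_L1 D h.
split => //; split.
- exact: borelvM.
- by move=> k; apply: borelvD; exact: borelvM.
- by move=> h k; apply: borelvD; apply: borelvD; exact: borelvM.
- apply: borelvD; first exact: borelvM.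
  by apply: borelv_sum => h; apply: borelvD; exact: borelvM.
- exact: Lp_test pq tchi bu (gd_L D).
- by move=> k; apply: LpD => //; [exact: Lp_test pq tchi (b1 k) (gd_L1 D k)|exact: Lp_test pq (tp k) bu (gd_L D)].
- move=> h k; apply: LpD => //; apply: LpD => //.
  + exact: Lp_test pq tchi (b2 h k) (gd_L2 D h k).
  + exact: Lp_test pq (tp h) (b1 k) (gd_L1 D k).
  + exact: Lp_test pq (tp k) (b1 h) (gd_L1 D h).
  + exact: Lp_test pq (tpp h k) bu (gd_L D).
- by move=> k; apply: wpv_smoothM => //; exact: gd_wp D k.
- move=> h k; apply: wpv_add; apply: wpv_smoothM => //; [exact: gd_wp2 D h k|exact: test_smooth|exact: gd_wp D h].
- have hwp h : wpB h (ell Q chi h) (g h) by have [] := hg h.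
  have lB h x : `|ell Q chi h x| <= B by have [] := hg h.
  have gB h x : `|g h x| <= B by have [] := hg h.
  move=> j; have [w1 w2] := gd_wd D j.
  have r1 := wdivB_cut hQ tchi hwp lB gB (fun k => (gd_wp D k j).1) w1.
  have r2 := wdivB_cut hQ tchi hwp lB gB (fun k => (gd_wp D k j).2) w2.
  split.
    move: r1; congr wdivB.
      by apply/funext => h; apply/funext => x; apply: eq_bigr => k _; rewrite re_compD /vsc !re_compZ.
    rewrite re_compD /comm re_comp_sum /vsc re_compZ; apply/funext => x; congr (_ + _).
    by apply: eq_bigr => h _; rewrite re_compD !re_compZ.
  move: r2; congr wdivB.
    by apply/funext => h; apply/funext => x; apply: eq_bigr => k _; rewrite im_compD /vsc !im_compZ.
  rewrite im_compD /comm im_comp_sum /vsc im_compZ; apply/funext => x; congr (_ + _).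
  by apply: eq_bigr => h _; rewrite im_compD !im_compZ.
- have [Vb bV VV] := vmeas_borel (Lp_meas (gd_V D)).
  have h1 := Lp_test p0 pq tchi bV (Lp_ae VV (gd_V D)).
  apply: Lp_ae h1; apply: filterS VV => x e; rewrite /vsc -e /mx_mul -scalemxAr //.
- have [Vb bV VV] := vmeas_borel (Lp_meas (gd_v D)).
  have h1 := Lp_test p0 pq tchi bV (Lp_ae VV (gd_v D)).
  by apply: Lp_ae h1; apply: filterS VV => x e; rewrite /vsc -e /fun_mul !scalerA mulrC.
Qed.

Lemma vn_comm_le (chi : E -> R) (g : 'I_d -> E -> R) u Du (B M : R) x : 0 <= B ->
  (forall h x, `|ell Q chi h x| <= B) -> (forall h x, `|g h x| <= B) ->
  (forall h x, M <= `|x| -> ell Q chi h x = 0 /\ g h x = 0) ->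
  vn (comm chi g u Du) x <= B * (\1_(kball M) x * \sum_h (vn u x + 2 * vn (Du h) x)).
Proof.
move=> B0 lB gB gM; rewrite indicE; case: (boolP (x \in _)) => xM; last first.
  rewrite mul0r mulr0 /vn /comm.
  have xM' : M <= `|x| by rewrite leNgt; apply/negP => h; move/negP: xM; apply; exact: mem_set.
  rewrite big1 => [|h _]; last by rewrite /vsc; have [-> ->] := gM h x xM'; rewrite ?mulr0 !scale0r addr0.
  by have := Cvec_normZ 0 (0 : 'cV[R[i]]_m); rewrite scaler0 normr0 mul0r => ->.
rewrite mul1r mulr_sumr /vn /comm.
elim: (index_enum _) => [|h s IH].
  by rewrite !big_nil; have := Cvec_normZ 0 (0 : 'cV[R[i]]_m); rewrite scaler0 normr0 mul0r => ->.
rewrite !big_cons; apply: le_trans (Cvec_normD _ _) _; apply: lerD => //.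
apply: le_trans (Cvec_normD _ _) _; rewrite /vsc !Cvec_normZ mulrDr; apply: lerD.
  by rewrite ler_wpM2r ?Cvec_norm_ge0.
by rewrite normrM (gtr0_norm (ltr0Sn _ 1)) mulrA [B * 2]mulrC ler_wpM2r ?Cvec_norm_ge0// ler_pM2l.
Qed.

End graph.

Section lp_limits.
Context {R : realType} {d m : nat}.
Local Notation E := 'rV[R]_d.
Local Notation mu := (lebesgue_rV R d).
Local Notation vfun := (vfun R d m).
Implicit Types (u w f g : vfun) (p q : R).

Lemma tends0_LpN p (z : nat -> vfun) : 0 < p ->
  tends0 (fun n => Ip mu p (vn (z n))) <-> tends0 (fun n => LpN p (z n)).
Proof.
move=> p0; split=> H e e0.
  have [n0 hn0] := H (e `^ p) (powR_gt0 _ e0); exists n0 => n /hn0.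
  by rewrite -LpN_le// ltW.
have e1 : 0 < e `^ p^-1 by rewrite powR_gt0.
have [n0 hn0] := H _ e1; exists n0 => n /hn0; rewrite LpN_le ?(ltW e1)//.
by rewrite -powRrM mulVf ?gt_eqF// powRr1// ltW.
Qed.

Lemma Ip_fin_sum p (J : Type) (s : seq J) (f : J -> E -> R) : 0 < p -> (forall j, measurable_fun setT (f j)) ->
  (forall j, (Ip mu p (f j) < +oo)%E) -> (Ip mu p (fun x => (\sum_(j <- s) f j x)%R) < +oo)%E.
Proof.
move=> p0 mf ff; elim: s => [|j s IH].
  rewrite /Ip integral0_eq ?ltry// => x _; by rewrite big_nil normr0 powR0 ?gt_eqF.
rewrite (_ : (fun x => _) = (fun x => f j x + \sum_(j <- s) f j x)); last by apply/funext => x; rewrite big_cons.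
apply: le_lt_trans (Ip_fin_add p0 (mf j) (measurable_sum s mf)) _.
by apply: lte_mul_pinfty; rewrite ?lee_fin ?powR_ge0//; apply: lte_add_pinfty.
Qed.

(** [Ip_cut] at a fixed height [t], chosen so that the volume term is below [e / 2]; the other term
    then tends to 0. *)
Lemma tends0_Ip_cut p q (M : R) (f : nat -> E -> R) : 0 < p -> p <= q -> (forall n, measurable_fun setT (f n)) ->
  tends0 (fun n => Ip mu q (f n)) -> tends0 (fun n => Ip mu p (fun x => \1_(kball M) x * f n x)).
Proof.
move=> p0 pq mf H e e0.
have mE : mu (kball M) = (fine (mu (kball M)))%:E by rewrite fineK// ge0_fin_numE ?measure_ge0// lebesgue_rV_ball_lty.
set K := fine _ in mE; have K0 : 0 <= K by exact: fine_ge0.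
have K1 : 0 < K + 1 by rewrite ltr_wpDl.
have e2 : 0 < e / 2 by rewrite divr_gt0.
pose t := (e / 2 / (K + 1)) `^ p^-1.
have c0 : 0 < e / 2 / (K + 1) by rewrite divr_gt0.
have t0 : 0 < t by rewrite powR_gt0.
have tp : t `^ p = e / 2 / (K + 1) by rewrite /t -powRrM mulVf ?gt_eqF// powRr1// ltW.
have tq : 0 < t `^ (p - q) by rewrite powR_gt0.
have [n0 hn0] := H (e / 2 / t `^ (p - q)) (divr_gt0 e2 tq); exists n0 => n /hn0 hn.
apply: le_trans (Ip_cut M p0 pq t0 (mf n)) _; rewrite (splitr e) EFinD; apply: leeD.
  rewrite mE -EFinM lee_fin tp; apply: (@le_trans _ _ (e / 2 / (K + 1) * (K + 1))); last by rewrite divfK ?gt_eqF.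
  by rewrite ler_wpM2l ?(ltW c0)// lerDl.
have tq' : (0 <= (t `^ (p - q))%:E)%E by rewrite lee_fin ltW.
apply: le_trans (lee_wpmul2l tq' hn) _.
by rewrite -EFinM lee_fin mulrC divfK ?gt_eqF.
Qed.

Lemma Lp_interp p q (r : R) f : 0 < p -> p <= r -> r <= q -> Lp p f -> Lp q f -> Lp r f.
Proof.
move=> p0 pr rq hp hq; have r0 : 0 < r by exact: lt_le_trans pr.
have q0 : 0 < q by exact: lt_le_trans rq.
have [f' bf ff] := vmeas_borel (Lp_meas hp).
apply: Lp_ae (vae_eq_sym ff) _.
have /(LpP f' p0)[_ h1] := Lp_ae ff hp; have /(LpP f' q0)[_ h2] := Lp_ae ff hq.
apply/(LpP f' r0); split; first exact: borelv_meas.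
have mvn := measurable_vn bf.
apply: (@le_lt_trans _ _ (Ip mu p (vn f') + Ip mu q (vn f'))%E); last exact: lte_add_pinfty.
have i0 r' : forall x, setT x -> (0 <= (`|vn f' x| `^ r')%:E)%E by move=> x _; rewrite lee_fin powR_ge0.
rewrite /Ip -(ge0_integralD mu measurableT (i0 p) (measurable_Ip p mvn) (i0 q) (measurable_Ip q mvn)).
apply: ge0_le_integral_nm => x _; rewrite ?lee_fin ?powR_ge0//.
set y := `|vn f' x|; have y0 : 0 <= y by exact: normr_ge0.
have [y1|y1] := leP y 1; last first.
  apply: (@le_trans _ _ (y `^ q)); last by rewrite lerDr powR_ge0.
  by apply: ler_powR => //; exact: ltW.
apply: (@le_trans _ _ (y `^ p)); last by rewrite lerDl powR_ge0.
move: y0; rewrite le_eqVlt => /predU1P[<-|y0]; first by rewrite !powR0 ?gt_eqF.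
by apply: ger_powR => //; rewrite y0.
Qed.

Lemma Lp_test_nb p q (a : E -> R) u : 0 < p -> p <= q -> test_function a -> Lp q u -> Lp p (vsc a u).
Proof.
move=> p0 pq ta hu; have [u' [bu uu hu']] := Lp_borel hu.
by apply: Lp_ae (Lp_test p0 pq ta bu hu'); apply: filterS uu => x e; rewrite /vsc e.
Qed.

End lp_limits.

Section consistency.
Context {R : realType} {d m : nat}.
Local Notation E := 'rV[R]_d.
Local Notation mu := (lebesgue_rV R d).
Local Notation vfun := (vfun R d m).
Implicit Types (u w f g : vfun) (p q : R).
Variables (Q : E -> 'M[R]_d) (V : E -> 'M[R]_m) (v : E -> R) (T : R -> R -> vfun -> vfun).
Hypotheses (d0 : (0 < d)%N) (hQ : hypQ Q).
Hypothesis HT : forall p : R, 1 < p -> [/\ C0_semigroup p (T p), contractive p (T p) &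
  is_generator p (T p) (Ltilde_op Q V v p)].

Let C0T p (p1 : 1 < p) : C0_semigroup p (T p). Proof. by case: (HT p1). Qed.
Let conT p (p1 : 1 < p) : contractive p (T p). Proof. by case: (HT p1). Qed.
Let genT p (p1 : 1 < p) : is_generator p (T p) (Ltilde_op Q V v p). Proof. by case: (HT p1). Qed.

Lemma tends0_comm p q u Du D2 w (g : nat -> 'I_d -> E -> R) (C : R) : 1 < p -> p <= q -> q <= p + (2 * d%:R)^-1 -> 0 <= C ->
  gdata Q V v q u Du D2 w ->
  (forall n h, [/\ wpB h (ell Q (cutoff n) h) (g n h), forall x, `|ell Q (cutoff n) h x| <= C / n.+1%:R,
      forall x, `|g n h x| <= C / n.+1%:R &
      forall x, n.+3%:R <= `|x| -> ell Q (cutoff n) h x = 0 /\ g n h x = 0]) ->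
  tends0 (fun n => LpN p (comm Q (cutoff n) (g n) u Du)).
Proof.
move=> p1 pq qp CC0 D hg; have p0 : 0 < p by exact: lt_trans p1.
have q0 : 0 < q by exact: lt_le_trans pq.
apply/tends0_LpN => //.
pose f x := \sum_h (vn u x + 2 * vn (Du h) x).
have mu_ := measurable_vn (gd_b D); have mD h := measurable_vn (gd_b1 D h).
have m1 h : measurable_fun setT (fun x => vn u x + 2 * vn (Du h) x).
  by apply: measurable_funD => //; exact: measurable_funM.
have mf : measurable_fun setT f by exact: measurable_sum.
have fq : (Ip mu q f < +oo)%E.
  apply: Ip_fin_sum => // h; have [_ f1] := (LpP u q0).1 (gd_L D); have [_ f2] := (LpP (Du h) q0).1 (gd_L1 D h).
  have m2 : measurable_fun setT (fun x => 2 * vn (Du h) x) by exact: measurable_funM.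
  apply: le_lt_trans (Ip_fin_add q0 mu_ m2) _.
  have z0 (c : R) : (0 <= (c `^ q)%:E)%E by rewrite lee_fin powR_ge0.
  have f3 : (Ip mu q (fun x => (2 * vn (Du h) x)%R) < +oo)%E.
    by rewrite (IpZ q 2 (mD h)); exact: (lte_mul_pinfty (z0 _)).
  exact: (lte_mul_pinfty (z0 2) _ (lte_add_pinfty f1 f3)).
apply: tends0_le (Ip_decay d0 p1 pq qp CC0 mf fq) => n.
apply: Ip_le; first exact: ltW.
have n0 : 0 <= C / n.+1%:R by rewrite divr_ge0.
move=> x; have h1 := @vn_comm_le R d m Q (cutoff n) (g n) u Du (C / n.+1%:R) n.+3%:R x n0.
rewrite ger0_norm ?Cvec_norm_ge0//.
apply: le_trans (h1 _ _ _) (ler_norm _); by [move=> h; case: (hg n h)|move=> h y; case: (hg n h)].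
Qed.

(** The sources may differ on a null set so that the lemma can be iterated along powers of the two
    resolvents. *)
Lemma resolvent_consistent p q (h : R) f1 f2 u w : 1 < p -> p <= q -> q <= p + (2 * d%:R)^-1 -> 0 < h ->
  Lp p f1 -> Lp q f2 -> vae_eq f1 f2 -> Lp p u -> Lp q w ->
  Ltilde_op Q V v p u (fun x => (h^-1)%:C%C *: (u x - f1 x)) ->
  Ltilde_op Q V v q w (fun x => (h^-1)%:C%C *: (w x - f2 x)) -> vae_eq u w.
Proof.
move=> p1 pq qp h0 hf1 hf2 ff hu hw Gu Gw.
have p0 : 0 < p by exact: lt_trans p1.
have p1' : 1 <= p by exact: ltW.
have [u' [Du [D2u [wu [Dp uu gu]]]]] := graph_data hQ Gu.
have [w' [Dw [D2w [ww [Dq wE gw]]]]] := graph_data hQ Gw.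
have [C CC0 HC] := cutoff_bounds hQ; have [g hg] := choice HC.
pose chi (n : nat) : E -> R := cutoff n.
have tchi n : test_function (chi n) by exact: test_cutoff.
pose Cu n := comm Q (chi n) (g n) u' Du; pose Cw n := comm Q (chi n) (g n) w' Dw.
have cutu n := gdata_cut hQ p1' (lexx p) Dp (tchi n) (hg n).
have cutw n := gdata_cut hQ p1' pq Dq (tchi n) (hg n).
pose gX n x := vsc (chi n) (fun y => (h^-1)%:C%C *: (u' y - f1 y)) x + Cu n x.
pose gY n x := vsc (chi n) (fun y => (h^-1)%:C%C *: (w' y - f2 y)) x + Cw n x.
have hu' := gd_L Dp; have hw' := gd_L Dq; have q1' : 1 <= q by exact: le_trans pq.
have q0 : 0 < q by exact: lt_le_trans pq.
have LgX n : Lp p (gX n).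
  apply: LpD => //; last exact: (cutu n).2.
  by apply: (Lp_test_nb p0 (lexx p) (tchi n)); apply: LpZ => //; exact: LpB.
have LgY n : Lp p (gY n).
  apply: LpD => //; last exact: (cutw n).2.
  by apply: (Lp_test_nb p0 pq (tchi n)); apply: LpZ => //; exact: LpB.
have GX n : Ltilde_op Q V v p (vsc (chi n) u') (gX n).
  apply: (graph_intro (cutu n).1); apply: filterS2 gu uu => x gx ux.
  rewrite ux in gx; rewrite /gX {1}/vsc gx /vsc /mx_mul /fun_mul -scalemxAr scalerBr scalerDr !scalerA.
  by rewrite [(v x)%:C%C * _]mulrC addrAC; congr (_ - _); rewrite addrAC.
have GY n : Ltilde_op Q V v p (vsc (chi n) w') (gY n).
  apply: (graph_intro (cutw n).1); apply: filterS2 gw wE => x gx ux.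
  rewrite ux in gx; rewrite /gY {1}/vsc gx /vsc /mx_mul /fun_mul -scalemxAr scalerBr scalerDr !scalerA.
  by rewrite [(v x)%:C%C * _]mulrC addrAC; congr (_ - _); rewrite addrAC.
have LX n : Lp p (vsc (chi n) u') := gd_L (cutu n).1.
have LY n : Lp p (vsc (chi n) w') := gd_L (cutw n).1.
pose Z n : vfun := fun x => vsc (chi n) u' x - vsc (chi n) w' x.
have key n : (LpN p (Z n) <= h%:E * (LpN p (Cu n) + LpN p (Cw n)))%E.
  have G := generator_sub p1 (C0T p1) (genT p1) (LX n) (LgX n) (LY n) (LgY n) (GX n) (GY n).
  have := dissipative_Lp p1 (C0T p1) (conT p1) (genT p1) h0 (LpB p1' (LX n) (LY n)) (LpB p1' (LgX n) (LgY n)) G.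
  move=> le; apply: (le_trans le).
  have hCu := (cutu n).2; have hCw := (cutw n).2.
  (* In [Z - h (gX - gY)] the solutions cancel and so do the sources, equal almost everywhere; only
     the commutators remain. *)
  rewrite (@LpN_ae _ _ _ p _ (fun x => h%:C%C *: (Cw n x - Cu n x))); last first.
    apply: filterS ff => x fx; rewrite /gX /gY /vsc fx.
    have hz (z : 'cV[R[i]]_m) : h%:C%C *: ((h^-1)%:C%C *: z) = z.
      rewrite scalerA -[RHS]scale1r; congr (_ *: _).
      by rewrite -rmorphM mulfV ?gt_eqF.
    rewrite ![(chi n x)%:C%C *: ((h^-1)%:C%C *: _)]scalerA ![(chi n x)%:C%C * _]mulrC -!scalerA.
    rewrite opprD addrACA scalerDr -!scalerBr hz opprB addrA subrK.
    by rewrite opprD addrA subrr add0r -scalerN opprB.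
  rewrite LpN_Z//; last exact: Lp_meas (LpB p1' hCw hCu).
  rewrite ger0_norm ?(ltW h0)//; apply: lee_wpmul2l; first by rewrite lee_fin ltW.
  rewrite addeC; have h1 := LpN_D p1' (Lp_meas hCw) (Lp_meas (LpZ (-1) p0 hCu)).
  rewrite LpN_Z ?normrN1 ?mul1e// in h1; last exact: Lp_meas hCu.
  by apply: le_trans h1; rewrite le_eqVlt; apply/orP; left; apply/eqP; apply: LpN_ae; apply: aeW => x; rewrite scaleN1C.
have T1 : tends0 (fun n => LpN p (Cu n)).
  by apply: (tends0_comm p1 (lexx p) _ CC0 Dp hg); rewrite lerDl invr_ge0 mulr_ge0.
have T2 : tends0 (fun n => LpN p (Cw n)) by exact: (tends0_comm p1 pq qp CC0 Dq hg).
have TZ : tends0 (fun n => Ip mu p (vn (Z n))).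
  by apply/tends0_LpN => //; apply: tends0_le (tends0Z (ltW h0) (tends0D T1 T2)); exact: key.
have bz : borelv (fun x => u' x + (-1)%:C%C *: w' x).
  by apply: borelvD; [exact: gd_b Dp|apply: (@borelvM _ _ _ (fun=> -1)) => //; exact: gd_b Dq].
pose z : vfun := fun x => u' x + (-1)%:C%C *: w' x.
have mz : measurable_fun setT (vn z) := measurable_vn bz.
have ZE n x : vn (Z n) x = `|chi n x| * vn z x.
  by rewrite /vn /Z /vsc -scalerBr Cvec_normZ /z scaleN1C.
(* The limit of the cut-off difference is [mbump 0] times the difference, and Fatou gives it norm
   0. *)
have lim0 := @Ip_lim0 R d p (fun n => vn (Z n)) (fun x => `|mbump (0 : E)| * vn z x) p0.
have {}lim0 : Ip mu p (fun x => (`|mbump (0 : E)| * vn z x)%R) = 0%E.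
  apply: lim0 => // [n|x].
    rewrite (_ : vn (Z n) = (fun x => `|chi n x| * vn z x)); last by apply/funext => x; exact: ZE.
    by apply: measurable_funM => //; apply: measurableT_comp => //; exact: test_meas.
  rewrite (_ : (fun n => vn (Z n) x) = (fun n => `|chi n x| * vn z x)); last by apply/funext => n; exact: ZE.
  by apply: cvgM; [apply: cvg_norm; exact: cutoff_cvg|exact: cvg_cst].
have b0 : 0 < mbump (0 : E) by apply: mbump_gt0; rewrite normr0.
have m2 : measurable_fun setT (fun x => `|mbump (0 : E)| * vn z x) by exact: measurable_funM.
have /= ae0 := Ip_eq0 p0 m2 lim0.
apply: filterS3 uu wE ae0 => x -> -> /eqP; rewrite mulf_eq0 normr_eq0 (gt_eqF b0) /= => /eqP/Cvec_norm_eq0.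
by rewrite /z scaleN1C => /eqP; rewrite subr_eq0 => /eqP.
Qed.

Lemma J_ex p : 1 < p -> exists J : R -> vfun -> vfun, forall h f, 0 < h -> Lp p f ->
  Lp p (J h f) /\ Ltilde_op Q V v p (J h f) (fun x => (h^-1)%:C%C *: (J h f x - f x)).
Proof.
move=> p1; have H (hf : R * vfun) : exists u, 0 < hf.1 -> Lp p hf.2 ->
    Lp p u /\ Ltilde_op Q V v p u (fun x => (hf.1^-1)%:C%C *: (u x - hf.2 x)).
  have [[h0 hp]|n] := pselect (0 < hf.1 /\ Lp p hf.2); last by exists hf.2 => h0 hp; exfalso; exact: n.
  by have [u hu] := resolvent_Lp p1 (C0T p1) (conT p1) (genT p1) h0 hp; exists u.
by have [J hJ] := choice H; exists (fun h f => J (h, f)) => h f; exact: hJ (h, f).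
Qed.

Lemma consistent_near p q : 1 < p -> p <= q -> q <= p + (2 * d%:R)^-1 -> consistent p q (T p) (T q).
Proof.
move=> p1 pq qp t f; rewrite le_eqVlt => /predU1P[<-|t0] hp hq.
  have q1 : 1 < q by exact: lt_le_trans pq.
  exact: vae_eq_trans (semigroup0 (C0T p1) hp) (vae_eq_sym (semigroup0 (C0T q1) hq)).
have q1 : 1 < q by exact: lt_le_trans pq.
have p0 : 0 < p by exact: lt_trans p1.
have q0 : 0 < q by exact: lt_trans q1.
have p1' : 1 <= p by exact: ltW. have q1' : 1 <= q by exact: ltW.
have [Jp hJp] := J_ex p1; have [Jq hJq] := J_ex q1.
have it (h : R) n : 0 < h -> [/\ Lp p (iter n (Jp h) f), Lp q (iter n (Jq h) f) & vae_eq (iter n (Jp h) f) (iter n (Jq h) f)].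
  move=> h0; elim: n => [|n [IH1 IH2 IH3]]; first by split => //; exact: vae_eq_refl.
  have [a1 a2] := hJp _ _ h0 IH1; have [b1 b2] := hJq _ _ h0 IH2.
  rewrite !iterS; split => //; exact: resolvent_consistent IH3 a1 b1 a2 b2.

have th n : 0 < t / n.+1%:R by rewrite divr_gt0.
have hSp : Lp p (T p t f) := semigroup_Lp (C0T p1) (ltW t0) hp.
have hSq : Lp q (T q t f) := semigroup_Lp (C0T q1) (ltW t0) hq.
have [a ha] := choice (fun n => Lp_borel (LpB p1' hSp (let: And3 x _ _ := it _ n.+1 (th n) in x))).
have [b hb] := choice (fun n => Lp_borel (LpB q1' (let: And3 _ x _ := it _ n.+1 (th n) in x) hSq)).
have Ta : tends0 (fun n => Ip mu p (vn (a n))).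
  apply/tends0_LpN => // e e0.
  have [n0 hn0] := exponential_Lp p1 (C0T p1) (conT p1) (genT p1) hJp t0 e0 hp.
  by exists n0 => n /hn0[_]; have [_ e1 _] := ha n; rewrite (LpN_ae p e1).
have Tb : tends0 (fun n => Ip mu q (vn (b n))).
  apply/tends0_LpN => // e e0.
  have [n0 hn0] := exponential_Lp q1 (C0T q1) (conT q1) (genT q1) hJq t0 e0 hq.
  exists n0 => n /hn0[h1 h2]; have [_ e1 _] := hb n; rewrite -(LpN_ae q e1).
  apply: le_trans h2; rewrite le_eqVlt; apply/orP; left; apply/eqP.
  have := LpN_Z (-1) q0 (Lp_meas (LpB q1' hSq h1)); rewrite normrN1 mul1e => <-.
  by apply: LpN_ae; apply: aeW => x; rewrite scaleN1C opprB.
have [z1 [bz1 ez1 _]] := Lp_borel hSp; have [z2 [bz2 ez2 _]] := Lp_borel hSq.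
pose z : vfun := fun x => z1 x + (-1)%:C%C *: z2 x.
have bz : borelv z by apply: borelvD => //; exact: (@borelvM _ _ _ (fun=> -1)).
have mz := measurable_vn bz.
have ba n : borelv (a n) by case: (ha n).
have bb n : borelv (b n) by case: (hb n).
have zle n : {ae mu, forall x, vn z x <= vn (a n) x + vn (b n) x}.
  have [_ e1 _] := ha n; have [_ e2 _] := hb n; have [_ _ e3] := it _ n.+1 (th n).
  have c : vae_eq (fun x => T p t f x - T q t f x) (fun x => a n x + b n x).
    by apply: filterS3 e1 e2 e3 => x <- <- <-; rewrite addrA subrK.
  apply: filterS3 ez1 ez2 c => x e4 e5 e6.
  by rewrite /vn /z scaleN1C -e4 -e5 e6; exact: Cvec_normD.
(* One approximation converges in L^p, the other in L^q; on a ball both converge in L^p, so the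
   limits are compared ball by ball. *)
have z0 (M : nat) : {ae mu, forall x, \1_(kball M%:R) x * vn z x = 0}.
  have mk : measurable_fun setT (fun x : E => \1_(kball M%:R) x : R) := measurable_ind_kball _.
  apply: (@Ip_eq0 R d p _ p0); first exact: measurable_funM.
  have T1 : tends0 (fun n => Ip mu p (fun x => \1_(kball M%:R) x * vn (a n) x)).
    apply: tends0_le Ta => n; apply: Ip_le; first exact: ltW.
    move=> x; rewrite normrM ler_piMl// indicE; case: (_ \in _); rewrite ?normr1 ?normr0//.
  have T2 := tends0_Ip_cut M%:R p0 pq (fun n => measurable_vn (bb n)) Tb.
  apply: tends0_eq0; first exact: Ip_ge0.
  apply: tends0_le (tends0Z (powR_ge0 2 p) (tends0D T1 T2)) => n.
  have ma n' : measurable_fun setT (fun x => \1_(kball M%:R) x * vn (a n') x) by apply: measurable_funM => //; exact: measurable_vn.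
  have mb n' : measurable_fun setT (fun x => \1_(kball M%:R) x * vn (b n') x) by apply: measurable_funM => //; exact: measurable_vn.
  apply: le_trans (Ip_fin_add p0 (ma n) (mb n)).
  apply: ae_ge0_le_integral_nm => //; try by move=> x _; rewrite lee_fin powR_ge0.
  apply: filterS (zle n) => x zx _; rewrite lee_fin; apply: ge0_ler_powR; rewrite ?nnegrE ?(ltW p0)//.
  have v0 (y : vfun) : 0 <= vn y x by exact: Cvec_norm_ge0.
  rewrite -mulrDr !normrM ler_wpM2l// !ger0_norm ?addr_ge0//.
have zz : {ae mu, forall x, forall M : nat, \1_(kball M%:R) x * vn z x = 0} by exact/ae_foralln.
apply: filterS3 ez1 ez2 zz => x -> -> /(_ (Num.truncn `|x|).+1).
rewrite indicE mem_set ?mul1r; last by rewrite /kball /=; exact: truncnS_gt.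
by move=> /Cvec_norm_eq0; rewrite /z scaleN1C => /eqP; rewrite subr_eq0 => /eqP.
Qed.

(** The overlap interval has the same length [1/(2d)] at every exponent, so [n] counts the steps of
    the chain. *)
Lemma consistent_le (n : nat) p q : 1 < p -> p <= q -> q <= p + n%:R * (2 * d%:R)^-1 -> consistent p q (T p) (T q).
Proof.
pose del : R := (2 * d%:R)^-1; rewrite -/del; have del0 : 0 < del by rewrite invr_gt0 mulr_gt0// ltr0n.
elim: n p => [|n IH] p p1 pq qp.
  have -> : q = p by apply/le_anti; rewrite pq andbT; move: qp; rewrite mul0r addr0.
  by move=> t f *; exact: vae_eq_refl.
have [qd|qd] := leP q (p + del); first exact: consistent_near.
have pr : p <= p + del by rewrite lerDl ltW.
have rq : p + del <= q by exact: ltW.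
move=> t f t0 hp hq.
have hr := Lp_interp (lt_trans ltr01 p1) pr rq hp hq.
apply: vae_eq_trans (consistent_near p1 pr (lexx _) t0 hp hr) _.
apply: IH => //; move: qp; rewrite -natr1 mulrDl mul1r; lra.
Qed.

Lemma semigroups_consistent p q : 1 < p -> 1 < q -> consistent p q (T p) (T q).
Proof.
have H p' q' : 1 < p' -> p' <= q' -> consistent p' q' (T p') (T q').
  move=> p1 pq; pose del : R := (2 * d%:R)^-1; have del0 : 0 < del by rewrite invr_gt0 mulr_gt0// ltr0n.
  apply: (consistent_le (n := (Num.truncn ((q' - p') / del)).+1)) => //.
  rewrite -lerBlDl -ler_pdivrMr//; exact/ltW/truncnS_gt.
move=> p1 q1; have [pq|/ltW qp] := leP p q; first exact: H.
by move=> t f t0 hp hq; apply: vae_eq_sym; exact: H.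
Qed.

End consistency.

(** * Positivity *)

Section negative_part.
Context {R : realType}.
Local Notation D1 := (fun _ : unit => (1 : R)).

(* Smooth approximations from above of [t |-> min t 0] that are nondecreasing: for [t < 0] this is [t exp (1 / ((n + 1) t))]. *)
Definition negcut (n : nat) (t : R) : R := t * einv 0 (- n.+1%:R * t).

Lemma smooth_negcut n : smooth1 (negcut n).
Proof.
have h1 : smooth1 (fun t : R => - n.+1%:R * t).
  by move=> k; apply: eq_Ck (smooth_affine 0 (- n.+1%:R) k) => t; rewrite add0r.
have h2 : smooth1 (fun t : R => t) by move=> k; apply: eq_Ck (smooth_affine 0 1 k) => t; rewrite add0r mul1r.
by apply: smoothM => //; apply: smooth_comp => //; exact: smooth_einv.
Qed.

Lemma negcut_ge0 n t : 0 <= t -> negcut n t = 0.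
Proof.
by move=> t0; rewrite /negcut /einv mulNr oppr_gt0 ltNge mulr_ge0// mulr0.
Qed.

Lemma einv0_le1 (t : R) : einv 0 t <= 1.
Proof.
rewrite /einv; case: ifPn => // t0; rewrite expr0 mul1r -[leRHS]expR0 ler_expR oppr_le0 invr_ge0 ltW//.
Qed.

Lemma negcut_bound n t : `|negcut n t| <= `|t|.
Proof. by rewrite /negcut normrM ler_piMr// ger0_norm ?einv_ge0// einv0_le1. Qed.

Lemma negcut_cvg t : negcut n t @[n --> \oo] --> Num.min t 0.
Proof.
have [t0|t0] := leP 0 t.
  by rewrite (_ : (fun n => _) = cst 0); [exact: cvg_cst|apply/funext => n; exact: negcut_ge0].
rewrite (_ : (fun n => _) = (fun n => t * expR (t^-1 * n.+1%:R^-1))); last first.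
  apply/funext => n; rewrite /negcut /einv mulNr oppr_gt0 pmulr_rlt0// t0 expr0 mul1r.
  by rewrite -invrN opprK invfM [X in expR X]mulrC.
have h : (t^-1 * n.+1%:R^-1 : R) @[n --> \oo] --> (t^-1 * 0 : R).
  by apply: cvgM; [exact: cvg_cst|exact: cvg_harmonic].
have h2 : expR (t^-1 * n.+1%:R^-1) @[n --> \oo] --> expR (t^-1 * 0) by exact: (cvg_comp _ _ h (@continuous_expR R _)).
by rewrite -[X in _ --> X]mulr1; apply: cvgM; [exact: cvg_cst|move: h2; rewrite mulr0 expR0].
Qed.

(** With [y = - (n + 1) t > 0] the derivative is [(1 + 1/y) expR (- 1/y)], and [1 + a <= expR a]. *)
Lemma dpart_negcut n t : 0 <= dpart D1 tt (negcut n) t <= 1.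
Proof.
have d1 : is_derive t 1 (fun s : R => - n.+1%:R * s) (- n.+1%:R).
  apply: is_derive_eq (is_deriveM (is_derive_cst (- n.+1%:R : R) t 1) (is_derive_id t 1)) _.
  by rewrite scaler0 addr0 [_ *: _]mulr1.
have d2 := is_derive1_comp (is_derive_einv 0 (- n.+1%:R * t)) d1.
have d3 := is_deriveM (is_derive_id t 1) d2.
have e : t * (einv 2 (- n.+1%:R * t) * - n.+1%:R) = einv 1 (- n.+1%:R * t).
  rewrite mulrCA mulrC [t * _]mulrC; move: (- n.+1%:R * t) => y.
  have [y0|y0] := ltP 0 y; last by rewrite /einv ltNge y0 mulr0.
  by rewrite -(einvS 1) mulrA mulfV ?gt_eqF// mul1r.
have -> : dpart D1 tt (negcut n) t = einv 1 (- n.+1%:R * t) + einv 0 (- n.+1%:R * t).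
  have -> := @is_derive_dpart _ _ _ D1 tt (negcut n) t _ d3.
  by rewrite mul0r subr0 /= [X in _ + X]mulr1; congr (_ + _).
set y := - n.+1%:R * t; rewrite addr_ge0 ?einv_ge0//=.
rewrite /einv; case: ifPn => y0; last by rewrite addr0 ler01.
rewrite expr1 expr0 -mulrDl mulrC expRN ler_pdivrMl ?expR_gt0// mulr1 addrC.
exact: expR_ge1Dx.
Qed.

End negative_part.

(** * Testing [div (Q grad s)] against a nondecreasing function of [s] *)

Section energy.
Context {R : realType} {d : nat}.
Local Notation E := 'rV[R]_d.
Local Notation mu := (lebesgue_rV R d).
Local Notation D1 := (fun _ : unit => (1 : R)).

Lemma Rintegral_norm_Ipow1 (f : E -> R) : mu.-integrable setT (EFin \o f) ->
  (\int[mu]_x `|f x|)%:E = Ipow mu 1 f.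
Proof.
move=> fi; have mf : measurable_fun setT f by apply/measurable_EFinP; case/integrableP: fi.
have f1 := (Ipow1P mu mf).1 fi.
have e : (\int[mu]_x `|f x|%:E)%E = Ipow mu 1 f by apply: eq_integral => x _; rewrite expr1.
by rewrite /Rintegral e fineK// ge0_fin_numE ?Ipow_ge0.
Qed.

Lemma Ipow2_bddM (a f : E -> R) (B : R) : measurable_fun setT f -> (forall x, `|a x| <= B) ->
  (Ipow mu 2 f < +oo)%E -> (Ipow mu 2 (fun x => a x * f x)%R < +oo)%E.
Proof.
move=> mf aB ff; apply: le_lt_trans (Ipow_finZ B mf ff); apply: le_Ipow => x.
by rewrite !normrM ler_wpM2r// (le_trans (aB x))// ler_norm.
Qed.

Variables (eta : R -> R) (C : R).
Hypotheses (se : smooth1 eta) (eta0 : eta 0 = 0).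
Hypothesis etaC : forall t, 0 <= dpart D1 tt eta t <= C.

Lemma eta_lip a b : `|eta a - eta b| <= C * `|a - b|.
Proof.
have := @dpart_bound R R unit D1 tt eta C b (a - b).
rewrite [(a - b) *: _]mulr1 subrK; apply.
  by move=> x; exact: (@smooth_derivable _ _ _ D1 eta tt x se).
by move=> x; have /andP[h1 h2] := etaC x; rewrite ger0_norm.
Qed.

Lemma measurable_eta (s : E -> R) : measurable_fun setT s -> measurable_fun setT (fun x => eta (s x)).
Proof.
move=> ms; apply: (measurableT_comp (f := eta)) => //.
by apply: continuous_measurable_fun; exact: smooth_cont se.
Qed.

(** No chain rule is used for [s] itself: [s] is approximated with its gradient in L^2 by test
    functions [psi n], and [eta (psi n)] is again a test function because [eta 0 = 0]. The errors
    are products of an L^2-small factor with [w] or [F]. *)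
Lemma energy_compact (s w : E -> R) (ds F : 'I_d -> E -> R) (M : R) :
  (forall x, M <= `|x| -> s x = 0) -> (forall k x, M <= `|x| -> ds k x = 0) ->
  (Ipow mu 2 s < +oo)%E -> (forall k, (Ipow mu 2 (ds k) < +oo)%E) ->
  (forall k, (Ipow mu 2 (F k) < +oo)%E) -> (Ipow mu 2 w < +oo)%E ->
  L1b s -> (forall k, wpB k s (ds k)) -> wdivB F w -> (forall x, 0 <= \sum_h F h x * ds h x) ->
  \int[mu]_x (w x * eta (s x)) <= 0.
Proof.
move=> sM dsM s2 ds2 F2 w2 Ls wp [LF [mw Lw] wd] ell0.
have C0 : 0 <= C by have /andP[] := etaC 0; exact: le_trans.
have e0 n : 0 < n.+1%:R^-1 :> R by rewrite invr_gt0.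
have [psi hpsi] := choice (fun n => sobolev_test_dense (or_intror erefl) sM dsM s2 ds2 Ls wp (e0 n)).
have tp n : test_function (psi n) by case: (hpsi n).
have ms : measurable_fun setT s by case: Ls.
have mds k : measurable_fun setT (ds k) by have [_ []] := wp k.
have mF k : measurable_fun setT (F k) by have [] := LF k.
have harm (u : nat -> \bar R) : (forall n, u n <= (n.+1%:R^-1)%:E)%E -> tends0 u.
  move=> hu; apply: tends0_le hu _; apply: cvg_tends0.
  by apply: cvg_EFin; [exact: nearW|exact: cvg_harmonic].
have md k : measurable_fun setT (fun x => psi k x - s x) by apply: measurable_funB => //; exact: test_meas.
have mdk h k : measurable_fun setT (fun x => partial h (psi k) x - ds h x).
  by apply: measurable_funB => //; apply: test_meas; exact: test_partial.
have T1 : tends0 (fun n => Ipow mu 1 (fun x => (psi n x - s x) * w x)).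
  by apply: tends0_mul => //; apply: harm => n; case: (hpsi n).
have T2 h : tends0 (fun n => Ipow mu 1 (fun x => (partial h (psi n) x - ds h x) * F h x)).
  by apply: tends0_mul => //; apply: harm => n; case: (hpsi n).
have ip2 n : (Ipow mu 2 (fun x => psi n x - s x)%R < +oo)%E.
  by case: (hpsi n) => _ h _; apply: le_lt_trans h (ltry _).
have ipk n h : (Ipow mu 2 (fun x => partial h (psi n) x - ds h x)%R < +oo)%E.
  by case: (hpsi n) => _ _ hh; apply: le_lt_trans (hh h) (ltry _).
have i1 n : mu.-integrable setT (EFin \o (fun x => (psi n x - s x) * w x)) by exact: Ipow2_mul.
have i2 n h : mu.-integrable setT (EFin \o (fun x => (partial h (psi n) x - ds h x) * F h x)) by exact: Ipow2_mul.
have te n : test_function (fun x => eta (psi n x)) by exact: test_comp.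
have i3 : mu.-integrable setT (EFin \o (fun x => w x * eta (s x))).
  apply: Ipow2_mul => //; first exact: measurable_eta.
  apply: le_lt_trans (Ipow_finZ C ms s2); apply: le_Ipow => x.
  by have := eta_lip (s x) 0; rewrite eta0 !subr0 normrM (ger0_norm C0).
have i4 n : mu.-integrable setT (EFin \o (fun x => w x * eta (psi n x))) by exact: L1b_testM.
have i5 n : mu.-integrable setT (EFin \o (fun x => \sum_h F h x * partial h (fun y => eta (psi n y)) x)).
  by apply: integrable_sumr => h; apply: L1b_testM => //; exact: test_partial.
have in1 n : mu.-integrable setT (EFin \o (fun x => `|(psi n x - s x) * w x|)) by exact: integrable_norm.
have in2 n h : mu.-integrable setT (EFin \o (fun x => `|(partial h (psi n) x - ds h x) * F h x|)) by exact: integrable_norm.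
have key n : ((\int[mu]_x (w x * eta (s x)))%:E <= C%:E * (Ipow mu 1 (fun x => ((psi n x - s x) * w x)%R) +
    \sum_h Ipow mu 1 (fun x => ((partial h (psi n) x - ds h x) * F h x)%R)))%E.
  under eq_bigr do rewrite -Rintegral_norm_Ipow1//.
  rewrite -Rintegral_norm_Ipow1// sumEFin lee_fin -Rintegral_sum// -RintegralD//; last exact: integrable_sumr.
  rewrite -RintegralZl//; last by apply: integrableDr => //; exact: integrable_sumr.
  have -> : \int[mu]_x (w x * eta (s x)) = \int[mu]_x (w x * eta (s x) - w x * eta (psi n x)
      - \sum_h F h x * partial h (fun y => eta (psi n y)) x).
    by rewrite RintegralB//; [rewrite RintegralB// wd// opprK subrK|exact: integrableBr].
  apply: le_Rintegral => //.
  - by apply: integrableBr => //; exact: integrableBr.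
  - by apply: integrableZlr; apply: integrableDr => //; exact: integrable_sumr.
  move=> x _; rewrite mulrDr; apply: lerD.
    rewrite -mulrBr; apply: le_trans (ler_norm _) _; rewrite normrM normrM mulrA [leLHS]mulrC ler_wpM2r//.
    by rewrite [`|psi n x - _|]distrC; exact: eta_lip.
  have /andP[a0 a1] := etaC (psi n x); set a := dpart _ _ _ _ in a0 a1.
  (* The derivative of [eta] factors out as a number [a] in [[0, C]]; the part with the true
     gradient is nonnegative and is discarded. *)
  have -> : \sum_h F h x * partial h (fun y => eta (psi n y)) x = a * (\sum_h F h x * ds h x + \sum_h (partial h (psi n) x - ds h x) * F h x).
    rewrite -big_split/= mulr_sumr; apply: eq_bigr => h _.
    rewrite partialE (dpart_comp se (@test_derivable R d (psi n) h x (tp n))) -partialE -/a; ring.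
  rewrite mulrDr opprD; apply: (@le_trans _ _ (- (a * \sum_h (partial h (psi n) x - ds h x) * F h x))).
    by rewrite gerDr oppr_le0 mulr_ge0.
  apply: le_trans (ler_norm _) _; rewrite normrN normrM (ger0_norm a0).
  apply: ler_pM => //; exact: ler_norm_sum.
have T : tends0 (fun=> (\int[mu]_x (w x * eta (s x)))%:E).
  by apply: tends0_le key _; apply: tends0Z => //; apply: tends0D => //; exact: tends0_sum.
apply/ler_addgt0Pr => e e1; rewrite add0r -lee_fin.
by have [n0 hn0] := T e e1; exact: hn0 n0 (leqnn _).
Qed.

Lemma supp_partials (chi : E -> R) : test_function chi ->
  exists M : R, (forall x, M <= `|x| -> chi x = 0) /\ forall k x, M <= `|x| -> partial k chi x = 0.
Proof.
move=> tchi; have [M0 h0] := test_supp tchi.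
have [M hM] := choice (fun k => test_supp (test_partial k tchi)).
have s0 k : 0 <= \sum_(i < d | i != k) `|M i| by exact: sumr_ge0.
exists (`|M0| + \sum_k `|M k|); split => [x xM|k x xM].
  apply: h0; apply: le_trans xM; apply: le_trans (ler_norm _) _; rewrite lerDl; exact: sumr_ge0.
apply: hM; apply: le_trans xM; apply: le_trans (ler_norm _) _.
by rewrite (bigD1 k)//= addrCA lerDl addr_ge0.
Qed.

Lemma cvg_harmonic0 (C' : R) (a : nat -> R) : (forall n, `|a n| <= C' / n.+1%:R) -> a n @[n --> \oo] --> 0.
Proof.
move=> h; apply: norm_cvg0.
apply: (@squeeze_cvgr _ _ _ _ (fun=> 0) (fun n => C' * n.+1%:R^-1)).
- by apply: nearW => n; rewrite normr_ge0 h.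
- exact: cvg_cst.
- by rewrite -(mulr0 C'); apply: cvgM; [exact: cvg_cst|exact: cvg_harmonic].
Qed.

Variable Q : E -> 'M[R]_d.
Hypotheses (d0 : (0 < d)%N) (hQ : hypQ Q).

Lemma Q_form_ge0 x (xi : 'I_d -> R) : 0 <= \sum_h (\sum_k Q x h k * xi k) * xi h.
Proof.
have [_ _ [e1 [e2 [e10 _ He]]]] := hQ.
have /andP[h _] := He x (\col_k xi k).
have -> : \sum_h (\sum_k Q x h k * xi k) * xi h = Rvec_dot (Q x *m \col_k xi k) (\col_k xi k).
  by apply: eq_bigr => i _; rewrite !mxE; congr (_ * _); apply: eq_bigr => k _; rewrite mxE.
apply: le_trans h; rewrite mulr_ge0 ?(ltW e10)// sumr_ge0// => i _; exact: sqr_ge0.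
Qed.

(** [energy_compact] for [cutoff n * s], then [n] to infinity: the commutators vanish pointwise and
    the cut-offs leave their limit [mbump 0] inside [eta]. *)
Lemma energy (s w : E -> R) (ds : 'I_d -> E -> R) :
  (Ipow mu 2 s < +oo)%E -> (forall k, (Ipow mu 2 (ds k) < +oo)%E) -> (Ipow mu 2 w < +oo)%E ->
  (forall k, wpB k s (ds k)) -> wdivB (fun h x => \sum_k Q x h k * ds k x) w ->
  \int[mu]_x (w x * eta (mbump (0 : E) * s x)) <= 0.
Proof.
move=> s2 ds2 w2 wp wd; have C0 : 0 <= C by have /andP[] := etaC 0; exact: le_trans.
have ms : measurable_fun setT s by have [[]] := wp (Ordinal d0).
have mds k : measurable_fun setT (ds k) by have [_ []] := wp k.
have mw : measurable_fun setT w by have [_ []] := wd.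
have [K K0 HK] := cutoff_bounds hQ; have [g hg] := choice HK.
pose chi (n : nat) : E -> R := cutoff n.
have tchi n : test_function (chi n) by exact: test_cutoff.
have mchi n := test_meas (tchi n).
have [B B0 hB] := test_bounded (@test_mbump1 R d).
have chiB n x : `|chi n x| <= B by exact: hB.
have hwp n h : wpB h (ell Q (chi n) h) (g n h) by have [] := hg n h.
have lB n h x : `|ell Q (chi n) h x| <= K / n.+1%:R by have [] := hg n h.
have gB n h x : `|g n h x| <= K / n.+1%:R by have [] := hg n h.
have ml n h : measurable_fun setT (ell Q (chi n) h) by have [[]] := hwp n h.
have mg n h : measurable_fun setT (g n h) by have [_ []] := hwp n h.
have Kn n : K / n.+1%:R <= K by rewrite ler_pdivrMr// ler_peMr// ler1n.
pose wn n x := chi n x * w x + \sum_h (g n h x * s x + 2 * ell Q (chi n) h x * ds h x).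
have wdn n := wdivB_cut hQ (tchi n) (hwp n) (lB n) (gB n) wp wd.
have mwn n : measurable_fun setT (wn n) by have [_ [? _] _] := wdn n.
have mt n h : measurable_fun setT (fun x => g n h x * s x + 2 * ell Q (chi n) h x * ds h x).
  by apply: measurable_funD; apply: measurable_funM => //; exact: measurable_funM.
have wn2 n : (Ipow mu 2 (wn n) < +oo)%E.
  apply: Ipow_fin_add.
  - exact: measurable_funM.
  - exact: measurable_sum.
  - exact: Ipow2_bddM (chiB n) w2.
  apply: Ipow_fin_sum => // h; apply: Ipow_fin_add.
  - exact: measurable_funM.
  - by apply: measurable_funM => //; exact: measurable_funM.
  - exact: Ipow2_bddM (gB n h) s2.
  apply: (@Ipow2_bddM _ _ (2 * (K / n.+1%:R))) => // x.
  by rewrite normrM (gtr0_norm (ltr0Sn _ 1)) ler_pM2l.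
have neg n : \int[mu]_x (wn n x * eta (chi n x * s x)) <= 0.
  have [M [M1 M2]] := supp_partials (tchi n).
  have mdsn k : measurable_fun setT (fun x => chi n x * ds k x + partial k (chi n) x * s x).
    by apply: measurable_funD; apply: measurable_funM => //; exact: test_meas (test_partial k (tchi n)).
  have dsn2 k : (Ipow mu 2 (fun x => chi n x * ds k x + partial k (chi n) x * s x)%R < +oo)%E.
    have [B' _ hB'] := test_bounded (test_partial k (tchi n)).
    apply: Ipow_fin_add.
    - exact: measurable_funM.
    - by apply: measurable_funM => //; exact: test_meas (test_partial k (tchi n)).
    - exact: Ipow2_bddM (chiB n) (ds2 k).
    - exact: Ipow2_bddM hB' s2.
  have [BQ BQ0 hBQ] := hypQ_bounds hQ.
  apply: (@energy_compact _ _ (fun k x => chi n x * ds k x + partial k (chi n) x * s x)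
    (fun h x => \sum_k Q x h k * (chi n x * ds k x + partial k (chi n) x * s x)) M) => //.
  - by move=> x xM; rewrite M1 ?mul0r.
  - by move=> k x xM; rewrite M1 ?M2 ?mul0r ?addr0.
  - exact: Ipow2_bddM (chiB n) s2.
  - move=> h; apply: Ipow_fin_sum => // k.
      by apply: measurable_funM => //; exact: measurable_Q.
    by apply: Ipow2_bddM (dsn2 k) => // x; exact: (hBQ h k).1.
  - by have [L _ _] := wp (Ordinal d0); apply: L1b_smoothM => //; exact: test_smooth.
  - by move=> k; apply: wpB_smoothM => //; exact: test_smooth.
  - by move=> x; exact: Q_form_ge0.
(* A majorant of all [wn n], in L^2; its product with the Lipschitz bound of [eta (chi n * s)] is
   integrable. *)
pose W x := B * `|w x| + \sum_h (K * `|s x| + 2 * K * `|ds h x|).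
have mW : measurable_fun setT W.
  apply: measurable_funD; first by apply: measurable_funM => //; exact: measurableT_comp.
  apply: measurable_sum => h; apply: measurable_funD; apply: measurable_funM => //; exact: measurableT_comp.
have nI f : Ipow mu 2 (fun x : E => `|f x|) = Ipow mu 2 f by apply: eq_integral => x _; rewrite normr_id.
have mn (f : E -> R) : measurable_fun setT f -> measurable_fun setT (fun x => `|f x|) by move=> mf; exact: measurableT_comp.
have W2 : (Ipow mu 2 W < +oo)%E.
  apply: Ipow_fin_add.
  - by apply: measurable_funM => //; exact: mn.
  - apply: measurable_sum => h; apply: measurable_funD; apply: measurable_funM => //; exact: mn.
  - by apply: Ipow_finZ; [exact: mn|rewrite nI].
  apply: Ipow_fin_sum => // [h|h].
    by apply: measurable_funD; apply: measurable_funM => //; exact: mn.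
  by apply: Ipow_fin_add; [apply: measurable_funM => //; exact: mn|apply: measurable_funM => //; exact: mn| |]; (apply: Ipow_finZ; [exact: mn|rewrite nI]).
have WI : mu.-integrable setT (EFin \o (fun x => W x * (C * B * `|s x|))).
  apply: Ipow2_mul => //; first by apply: measurable_funM => //; exact: mn.
  by apply: Ipow_finZ; [exact: mn|rewrite nI].
have wnW n x : `|wn n x| <= W x.
  apply: le_trans (ler_normD _ _) _; apply: lerD; first by rewrite normrM ler_wpM2r.
  apply: le_trans (ler_norm_sum _ _ _) _; apply: ler_sum => h _.
  apply: le_trans (ler_normD _ _) _; rewrite !normrM (gtr0_norm (ltr0Sn _ 1)).
  by apply: lerD; rewrite ler_wpM2r// ?ler_pM2l//; apply: le_trans (Kn n).
have etale n x : `|eta (chi n x * s x)| <= C * B * `|s x|.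
  have := eta_lip (chi n x * s x) 0; rewrite eta0 !subr0 => h; apply: le_trans h _.
  by rewrite -mulrA ler_wpM2l// normrM ler_wpM2r.
have lim := @dct_Rintegral _ _ _ mu (fun n x => wn n x * eta (chi n x * s x))
  (fun x => mbump (0 : E) * w x * eta (mbump (0 : E) * s x)) _ _ _ WI.
have {}lim : \int[mu]_x (wn n x * eta (chi n x * s x)) @[n --> \oo] --> \int[mu]_x (mbump (0 : E) * w x * eta (mbump (0 : E) * s x)).
  apply: lim.
  - by move=> n; apply: measurable_funM => //; apply: measurable_eta; exact: measurable_funM.
  - by apply: measurable_funM; [exact: measurable_funM|apply: measurable_eta; exact: measurable_funM].
  - by move=> n x; rewrite normrM ler_pM.
  move=> x; apply: cvgM; last first.
    have h : chi n x * s x @[n --> \oo] --> mbump (0 : E) * s x by apply: cvgM; [exact: cutoff_cvg|exact: cvg_cst].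
    exact: (cvg_comp _ _ h (@smooth_cont _ _ _ _ _ se _)).
  rewrite -[X in _ --> X]addr0; apply: cvgD.
    by apply: cvgM; [exact: cutoff_cvg|exact: cvg_cst].
  rewrite [X in _ --> X](_ : 0 = \sum_(h < d) (0 * s x + 2 * 0 * ds h x)); last first.
    by rewrite big1// => h _; rewrite mulr0 !mul0r addr0.
  apply: cvg_big => [|h _]; first exact: add_continuous.
  apply: cvgD; apply: cvgM; try exact: cvg_cst.
    exact: cvg_harmonic0 (fun n => gB n h x).
  by apply: cvgM; [exact: cvg_cst|exact: cvg_harmonic0 (fun n => lB n h x)].
have b0 : 0 < mbump (0 : E) by apply: mbump_gt0; rewrite normr0.
have L : \int[mu]_x (mbump (0 : E) * w x * eta (mbump (0 : E) * s x)) <= 0.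
  rewrite -(cvg_lim _ lim)//; apply: limr_le; first by apply/cvg_ex; eexists; exact: lim.
  exact: nearW.
have i3 : mu.-integrable setT (EFin \o (fun x => w x * eta (mbump (0 : E) * s x))).
  apply: Ipow2_mul => //; first by apply: measurable_eta; exact: measurable_funM.
  apply: le_lt_trans (Ipow_finZ (C * mbump (0 : E)) ms s2); apply: le_Ipow => x.
  have := eta_lip (mbump (0 : E) * s x) 0; rewrite eta0 !subr0 => h; apply: le_trans h _.
  by rewrite -mulrA [leRHS]normrM (ger0_norm C0).
move: L; under eq_Rintegral do rewrite -mulrA.
by rewrite RintegralZl// pmulr_rle0.
Qed.

End energy.

Section maximum_principle.
Context {R : realType} {d m : nat}.
Local Notation E := 'rV[R]_d.
Local Notation mu := (lebesgue_rV R d).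
Variables (Q : E -> 'M[R]_d).
Hypotheses (d0 : (0 < d)%N) (hQ : hypQ Q).

Lemma normr_min0 (t : R) : `|Num.min t 0| <= `|t|.
Proof. by rewrite /Num.min; case: ifPn => // _; rewrite normr0. Qed.

Lemma measurable_min0 (s : E -> R) : measurable_fun setT s -> measurable_fun setT (fun x => Num.min (s x) 0).
Proof. by move=> ms; apply: measurable_minr. Qed.

Lemma Ipow2_min0 (s : E -> R) : (Ipow mu 2 s < +oo)%E -> (Ipow mu 2 (fun x => Num.min (s x) 0%R) < +oo)%E.
Proof. by move=> s2; apply: le_lt_trans s2; apply: le_Ipow => x; exact: normr_min0. Qed.

(** The limit of [energy] for [eta = negcut n]. The function [min t 0] is positively homogeneous, so
    the constant [mbump 0] comes out and is divided away. *)
Lemma energy_min0 (s w : E -> R) (ds : 'I_d -> E -> R) :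
  (Ipow mu 2 s < +oo)%E -> (forall k, (Ipow mu 2 (ds k) < +oo)%E) -> (Ipow mu 2 w < +oo)%E ->
  (forall k, wpB k s (ds k)) -> wdivB (fun h x => \sum_k Q x h k * ds k x) w ->
  \int[mu]_x (w x * Num.min (s x) 0) <= 0.
Proof.
move=> s2 ds2 w2 wp wd.
have ms : measurable_fun setT s by have [[]] := wp (Ordinal d0).
have mw : measurable_fun setT w by have [_ []] := wd.
have b0 : 0 < mbump (0 : E) by apply: mbump_gt0; rewrite normr0.
set b := mbump (0 : E) in b0.
have neg n : \int[mu]_x (w x * negcut n (b * s x)) <= 0.
  exact: (energy (smooth_negcut n) (negcut_ge0 n (lexx 0)) (dpart_negcut n) d0 hQ s2 ds2 w2 wp wd).
have mn (f : E -> R) : measurable_fun setT f -> measurable_fun setT (fun x => `|f x|) by move=> mf; exact: measurableT_comp.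
have nI f : Ipow mu 2 (fun x : E => `|f x|) = Ipow mu 2 f by apply: eq_integral => x _; rewrite normr_id.
have WI : mu.-integrable setT (EFin \o (fun x => `|w x| * (b * `|s x|))).
  apply: Ipow2_mul; [exact: mn|by apply: measurable_funM => //; exact: mn|by rewrite nI|].
  by apply: Ipow_finZ; [exact: mn|rewrite nI].
have lim := @dct_Rintegral _ _ _ mu (fun n x => w x * negcut n (b * s x)) (fun x => w x * Num.min (b * s x) 0) _ _ _ WI.
have {}lim : \int[mu]_x (w x * negcut n (b * s x)) @[n --> \oo] --> \int[mu]_x (w x * Num.min (b * s x) 0).
  apply: lim.
  - by move=> n; apply: measurable_funM => //; apply: (measurable_eta (smooth_negcut n)); exact: measurable_funM.
  - by apply: measurable_funM => //; apply: measurable_min0; exact: measurable_funM.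
  - move=> n x; rewrite normrM ler_wpM2l//; apply: le_trans (negcut_bound _ _) _.
    by rewrite normrM gtr0_norm.
  - by move=> x; apply: cvgM; [exact: cvg_cst|exact: negcut_cvg].
have : \int[mu]_x (w x * Num.min (b * s x) 0) <= 0.
  rewrite -(cvg_lim _ lim)//; apply: limr_le; first by apply/cvg_ex; eexists; exact: lim.
  exact: nearW.
have i3 : mu.-integrable setT (EFin \o (fun x => w x * Num.min (s x) 0)).
  by apply: Ipow2_mul => //; [exact: measurable_min0|exact: Ipow2_min0].
under eq_Rintegral do rewrite -(mulr0 b) -minr_pMr ?(ltW b0)// mulrCA.
by rewrite RintegralZl// pmulr_rle0.
Qed.

Variables (V : E -> 'M[R]_m) (v : E -> R).
Hypothesis Vdiss : forall x (xi : 'I_m -> R), \sum_j (\sum_k V x j k * xi k) * xi j <= 0.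
Hypothesis Voff : {ae mu, forall x, forall j k, j != k -> 0 <= V x j k}.
Hypothesis v0 : {ae mu, forall x, 0 <= v x}.

(** With [r] the negative parts, the sum of the [w j * r j] is pointwise at least [lam] times the
    sum of the [r j ^+ 2], while its integral is at most 0 by [energy_min0]. *)
Lemma system_nonneg (lam : R) (s w f : 'I_m -> E -> R) (ds : 'I_m -> 'I_d -> E -> R) : 0 < lam ->
  (forall j, (Ipow mu 2 (s j) < +oo)%E) -> (forall j k, (Ipow mu 2 (ds j k) < +oo)%E) ->
  (forall j, (Ipow mu 2 (w j) < +oo)%E) -> (forall j k, wpB k (s j) (ds j k)) ->
  (forall j, wdivB (fun h x => \sum_k Q x h k * ds j k x) (w j)) ->
  {ae mu, forall x, forall j, 0 <= f j x} ->
  {ae mu, forall x, forall j, w j x = lam * s j x - f j x - \sum_k V x j k * s k x + v x * s j x} ->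
  forall j, {ae mu, forall x, 0 <= s j x}.
Proof.
move=> lam0 s2 ds2 w2 wp wd f0 eqs.
pose r j x := Num.min (s j x) 0.
have ms j : measurable_fun setT (s j) by have [[]] := wp j (Ordinal d0).
have mw j : measurable_fun setT (w j) by have [_ []] := wd j.
have mr j : measurable_fun setT (r j) by exact: measurable_min0.
have r2 j : (Ipow mu 2 (r j) < +oo)%E by exact: Ipow2_min0.
have i1 j : mu.-integrable setT (EFin \o (fun x => w j x * r j x)) by exact: Ipow2_mul.
have i2 j : mu.-integrable setT (EFin \o (fun x => r j x ^+ 2)) by exact: (Rintegral_sqr_Ipow (mr j) (r2 j)).1.
have neg : \int[mu]_x (\sum_j w j x * r j x) <= 0.
  by rewrite Rintegral_sum// sumr_le0// => j _; exact: energy_min0.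
have pt : {ae mu, forall x, lam * \sum_j r j x ^+ 2 <= \sum_j w j x * r j x}.
  apply: filterS2 (filterI f0 eqs) (filterI Voff v0) => x [fx ex] [Vx vx].
  have r0 j : r j x <= 0 by rewrite /r ge_min lexx orbT.
  have sr j : s j x * r j x = r j x ^+ 2.
    by rewrite /r /Num.min; case: ifPn => // _; rewrite mulr0 expr0n.
  (* On the diagonal [s r = r^2]; off it [r k <= s k], a nonnegative entry keeps the order and
     [r j <= 0] reverses it. So [s] becomes [r] in the coupling term and dissipativity of [V]
     applies to [r]. *)
  have srk j k : (j == k) || (0 <= V x j k) -> V x j k * s k x * r j x <= V x j k * r k x * r j x.
    case/orP => [/eqP <-|Vjk]; first by rewrite -!mulrA sr.
    rewrite ler_wnM2r// ler_wpM2l// /r ge_min lexx//.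
  apply: (@le_trans _ _ (lam * (\sum_j r j x ^+ 2) - \sum_j (\sum_k V x j k * r k x) * r j x)).
    by rewrite lerDl oppr_ge0.
  rewrite mulr_sumr -sumrB; apply: ler_sum => j _; rewrite ex.
  rewrite mulrDl mulrBl mulrBl -[lam * s j x * _]mulrA sr -[v x * _ * _]mulrA sr.
  have h1 : 0 <= v x * r j x ^+ 2 by rewrite mulr_ge0 ?sqr_ge0.
  have h2 : f j x * r j x <= 0 by rewrite mulr_ge0_le0.
  have h3 : (\sum_k V x j k * s k x) * r j x <= (\sum_k V x j k * r k x) * r j x.
    rewrite !mulr_suml; apply: ler_sum => k _; apply: srk.
    by case: eqVneq => //= jk; exact: Vx.
  lra.
have z : \int[mu]_x (\sum_j r j x ^+ 2) = 0.
  apply/le_anti/andP; split; last by apply: Rintegral_ge0 => x _; apply: sumr_ge0 => j _; exact: sqr_ge0.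
  have iS : mu.-integrable setT (EFin \o (fun x => \sum_j r j x ^+ 2)) by exact: integrable_sumr.
  rewrite -(pmulr_rle0 _ lam0) -RintegralZl//; apply: le_trans neg.
  have iW : mu.-integrable setT (EFin \o (fun x => \sum_j w j x * r j x)) by exact: integrable_sumr.
  rewrite -subr_ge0 -RintegralB//; last exact: integrableZlr.
  (* The absolute value turns an integrand nonnegative almost everywhere into one nonnegative
     everywhere. *)
  have ge : {ae mu, forall x, setT x -> \sum_j w j x * r j x - lam * \sum_j r j x ^+ 2 = `|\sum_j w j x * r j x - lam * \sum_j r j x ^+ 2|}.
    by apply: filterS pt => x h _; rewrite ger0_norm// subr_ge0.
  by rewrite (ae_eq_Rintegral_nm ge); exact: Rintegral_ge0.
move=> j; have rj : \int[mu]_x (r j x ^+ 2) = 0.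
  move: z; rewrite Rintegral_sum// => /eqP; rewrite psumr_eq0; last by move=> i _; apply: Rintegral_ge0 => x _; exact: sqr_ge0.
  by move=> /allP/(_ j (mem_index_enum _))/eqP.
have := (Rintegral_sqr_Ipow (mr j) (r2 j)).2; rewrite rj => /esym h.
apply: filterS (Ipow_eq0 (isT : (0 < 2)%N) (mr j) h) => x.
by rewrite /r /Num.min; case: ifPn => [sx e|]; [rewrite e|rewrite -leNgt].
Qed.

End maximum_principle.

(** * Positivity of resolvents and of the semigroups *)

Section nonneg.
Context {R : realType} {d m : nat}.
Local Notation E := 'rV[R]_d.
Local Notation mu := (lebesgue_rV R d).
Local Notation vfun := (vfun R d m).
Local Notation Re := complex.Re.
Local Notation Im := complex.Im.
Implicit Types (u w f g : vfun) (p q : R).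

Lemma wpBZ k (c : R) (s ds s' ds' : E -> R) : (forall x, s' x = c * s x) -> (forall x, ds' x = c * ds x) ->
  wpB k s ds -> wpB k s' ds'.
Proof.
move=> es eds [L1 L2 H]; have sc : smooth (@unit_vec R d) (fun=> c) by exact: smooth_cst.
rewrite (_ : s' = (fun x => c * s x)); last by apply/funext.
rewrite (_ : ds' = (fun x => c * ds x)); last by apply/funext.
split; [exact: L1b_smoothM|exact: L1b_smoothM|] => phi tp.
have i1 := L1b_testM L1 (test_partial k tp); have i2 := L1b_testM L2 tp.
under eq_Rintegral do rewrite -mulrA.
under [in RHS]eq_Rintegral do rewrite -mulrA.
by rewrite !RintegralZl// H// mulrN.
Qed.

Lemma wdivBZ (c : R) (F F' : 'I_d -> E -> R) (g g' : E -> R) : (forall h x, F' h x = c * F h x) ->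
  (forall x, g' x = c * g x) -> wdivB F g -> wdivB F' g'.
Proof.
move=> FF gg [L1 L2 H]; have sc : smooth (@unit_vec R d) (fun=> c) by exact: smooth_cst.
have FE h : F' h = (fun x => c * F h x) by apply/funext => x; exact: FF.
rewrite (_ : g' = (fun x => c * g x)); last by apply/funext.
split; [by move=> h; rewrite FE; exact: L1b_smoothM|exact: L1b_smoothM|] => phi tp.
have i2 := L1b_testM L2 tp.
have i1 : mu.-integrable setT (EFin \o (fun x => \sum_k F k x * partial k phi x)).
  by apply: integrable_sumr => k; apply: L1b_testM => //; exact: test_partial.
transitivity (\int[mu]_x (c * \sum_k F k x * partial k phi x)).
  by apply: eq_Rintegral => x _; rewrite mulr_sumr; apply: eq_bigr => k _; rewrite FF mulrA.
under [in RHS]eq_Rintegral do rewrite -mulrA.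
by rewrite !RintegralZl// H// mulrN.
Qed.

Lemma complex_ge0P (z : R[i]) : reflect (Im z = 0 /\ 0 <= Re z) (0 <= z).
Proof.
by rewrite lecE /=; apply: (iffP andP) => -[/eqP h1 h2]; split => //; apply/eqP.
Qed.

(** The negative part of [f] is dominated by every such [h], hence has p-th power integral 0: a form
    of closedness of the positive cone that suits both halves of the equivalence. *)
Lemma ae_ge0_lim p (f : E -> R) : 0 < p -> lebesgue_measurable_fun f ->
  (forall e : R, 0 < e -> exists h : E -> R, (Ip mu p h <= e%:E)%E /\ {ae mu, forall x, - `|h x| <= f x}) ->
  {ae mu, forall x, 0 <= f x}.
Proof.
move=> p0 [f' mf' ff] H.
have mr : measurable_fun setT (fun x => Num.min (f' x) 0) by exact: measurable_min0.
have z : Ip mu p (fun x => Num.min (f' x) 0%R) = 0%E.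
  apply: tends0_eq0; first exact: Ip_ge0.
  move=> e e0; exists 0%N => _ _; have [h [h1 h2]] := H e e0; apply: le_trans h1.
  apply: ae_ge0_le_integral_nm; try by move=> x _; rewrite lee_fin powR_ge0.
  apply: filterS2 ff h2 => x <- hx _; rewrite lee_fin; apply: ge0_ler_powR; rewrite ?nnegrE ?(ltW p0)//.
  by rewrite /Num.min; case: ifPn => [fx|_]; [rewrite ltr0_norm// lerNl|rewrite normr0].
apply: filterS2 ff (Ip_eq0 p0 mr z) => x ->.
by rewrite /Num.min; case: ifPn => [sx e|]; [rewrite e|rewrite -leNgt].
Qed.

Lemma vnonneg_lim p u : 0 < p -> vmeas u ->
  (forall e : R, 0 < e -> exists g, vnonneg g /\ (LpN p (fun x => (u x - g x)%R) <= e%:E)%E) -> vnonneg u.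
Proof.
move=> p0 mu_ H.
have H' (e : R) : 0 < e -> exists g, vnonneg g /\ (Ip mu p (vn (fun x => u x - g x)%R) <= e%:E)%E.
  move=> e0; have e1 : 0 < e `^ p^-1 by rewrite powR_gt0.
  have [g [g1 g2]] := H _ e1; exists g; split => //.
  by move: g2; rewrite LpN_le ?(ltW e1)// -powRrM mulVf ?gt_eqF// powRr1// ltW.
have re j : {ae mu, forall x, 0 <= re_comp u j x}.
  apply: (ae_ge0_lim p0 (mu_ j).1) => e e0; have [g [g1 g2]] := H' e e0; exists (vn (fun x => u x - g x)); split => //.
  apply: filterS g1 => x /(_ j)/complex_ge0P[_ gj]; rewrite ger0_norm ?Cvec_norm_ge0// lerNl.
  have [h _] := Cvec_norm_comp (u x - g x) j; apply: le_trans h; rewrite !mxE ReB -normrN opprB.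
  by apply: le_trans (ler_norm _); rewrite lerDr.
(* Used with [a = 1] and [a = -1]: nonnegativity of both signs makes the imaginary part vanish. *)
have im0 (a : R) j : `|a| = 1 -> {ae mu, forall x, 0 <= a * im_comp u j x}.
  move=> a1; apply: (ae_ge0_lim p0).
    have [b mb bb] := (mu_ j).2; exists (fun x => a * b x); first exact: measurable_funM.
    by apply: filterS bb => x ->.
  move=> e e0; have [g [g1 g2]] := H' e e0; exists (vn (fun x => u x - g x)); split => //.
  apply: filterS g1 => x /(_ j)/complex_ge0P[gj _]; rewrite ger0_norm ?Cvec_norm_ge0// lerNl.
  have [_ h] := Cvec_norm_comp (u x - g x) j; apply: le_trans h; rewrite !mxE ImB gj subr0.
  by apply: le_trans (ler_norm _) _; rewrite normrN normrM a1 mul1r.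
have ip j := im0 1 j (normr1 _); have im j := im0 (-1) j (normrN1 _).
apply: filterS3 (ae_all_ord re) (ae_all_ord ip) (ae_all_ord im) => x h1 h2 h3 j.
apply/complex_ge0P; split; last exact: h1.
apply/le_anti/andP; split; [move: (h3 j)|move: (h2 j)]; first by rewrite mulN1r oppr_ge0.
by rewrite mul1r.
Qed.

Variables (Q : E -> 'M[R]_d) (V : E -> 'M[R]_m) (v : E -> R).
Hypotheses (d0 : (0 < d)%N) (hQ : hypQ Q) (hV : hypV V) (hv : hypv v).

Lemma hypV_form_le0 x (xi : 'I_m -> R) : \sum_j (\sum_k V x j k * xi k) * xi j <= 0.
Proof.
have [_ [b b0 H] _ _] := hV.
have := H x (\col_k (xi k)%:C%C); set z : 'cV_m := \col_k _ => h.
have -> : \sum_j (\sum_k V x j k * xi k) * xi j = Re (Cvec_dot (map_mx (real_complex R) (V x) *m z) z).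
  have ReS (I : Type) (s : seq I) (F : I -> R) : \sum_(i <- s) (F i)%:C%C = (\sum_(i <- s) F i)%:C%C.
    by rewrite rmorph_sum.
  rewrite /Cvec_dot; under [in RHS]eq_bigr => j _.
    rewrite !mxE; under eq_bigr do rewrite !mxE -rmorphM.
    rewrite ReS conjc_real -rmorphM; over.
  by rewrite ReS.
by apply: le_trans h _; rewrite mulr_le0_ge0 ?(ltW b0)// sqr_ge0.
Qed.

Lemma re_mx_mul u j : re_comp (mx_mul V u) j = (fun x => \sum_k V x j k * re_comp u k x).
Proof.
apply/funext => x; rewrite /re_comp /mx_mul !mxE.
elim: (index_enum _) => [|k s IH]; first by rewrite !big_nil.
by rewrite !big_cons ReD IH mxE ReZ.
Qed.

Lemma im_mx_mul u j : im_comp (mx_mul V u) j = (fun x => \sum_k V x j k * im_comp u k x).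
Proof.
apply/funext => x; rewrite /im_comp /mx_mul !mxE.
elim: (index_enum _) => [|k s IH]; first by rewrite !big_nil.
by rewrite !big_cons ImD IH mxE ImZ.
Qed.

Hypothesis Voff : {ae mu, forall x, forall j k, j != k -> 0 <= V x j k}.

(** Nonnegativity in [R[i]] includes being real. As [Q], [V] and [v] are real, the system splits:
    [system_nonneg] is applied to the real parts with source [h^-1 f], and to plus and minus the
    imaginary parts with source 0. *)
Lemma resolvent_nonneg (h : R) f u : 0 < h -> Lp 2 f -> vnonneg f -> Lp 2 u ->
  Ltilde_op Q V v 2 u (fun x => (h^-1)%:C%C *: (u x - f x)) -> vnonneg u.
Proof.
move=> h0 hf f0 hu Gu; have h1 : 0 < h^-1 by rewrite invr_gt0.
have [u' [Du [D2u [w [D uu gu]]]]] := graph_data hQ Gu.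
have v0 : {ae mu, forall x, 0 <= v x} by case: hv.
have two0 : 0 < 2 :> R by []. have two1 : 1 <= 2 :> R by rewrite ler1n.
have wE : vae_eq (fun x => (h^-1)%:C%C *: (u x - f x) - mx_mul V u' x + fun_mul v u' x) w.
  by apply: filterS gu => x ->; rewrite addrAC addrNK addrK.
have hw : Lp 2 w.
  by apply: Lp_ae wE _; apply: LpD => //; [apply: LpB => //; [apply: LpZ => //; exact: LpB|exact: gd_V D]|exact: gd_v D].
have fin (z : vfun) j : borelv z -> Lp 2 z -> (Ipow mu 2 (re_comp z j) < +oo)%E /\ (Ipow mu 2 (im_comp z j) < +oo)%E.
  move=> bz /(LpP z two0)[_ hz]; have [h2 h3] := Ip_comp z j (ltW two0).
  by rewrite -!Ip2; split; apply: le_lt_trans hz.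
have eqs : {ae mu, forall x, forall j, re_comp w j x = h^-1 * re_comp u' j x - h^-1 * Re (f x j 0) - \sum_k V x j k * re_comp u' k x + v x * re_comp u' j x
   /\ im_comp w j x = h^-1 * im_comp u' j x - 0 - \sum_k V x j k * im_comp u' k x + v x * im_comp u' j x}.
  apply: filterS3 wE uu f0 => x e1 e2 f1 j; have /complex_ge0P[f2 _] := f1 j.
  have r1 := congr1 (fun F => F x) (re_mx_mul u' j); have r2 := congr1 (fun F => F x) (im_mx_mul u' j).
  rewrite -r1 -r2 /re_comp /im_comp -e1 e2 /fun_mul; move: (mx_mul V u' x) => z.
  by rewrite !mxE !ReD !ImD !ReZ !ImZ -!raddfN /= !ReB !ImB f2; split; [congr (_ + _)|congr (_ + _)]; rewrite ?subr0 ?mulrBr//.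
have bu := gd_b D; have bD := gd_b1 D; have bw := gd_bw D.
have re j : {ae mu, forall x, 0 <= re_comp u' j x}.
  apply: (system_nonneg (Q := Q) (V := V) (v := v) (w := re_comp w) (f := fun j x => h^-1 * Re (f x j 0)) (ds := fun j k => re_comp (Du k) j) d0 hQ hypV_form_le0 Voff v0 h1).
  - by move=> i; exact: (fin _ i bu (gd_L D)).1.
  - by move=> i k; exact: (fin _ i (bD k) (gd_L1 D k)).1.
  - by move=> i; exact: (fin _ i bw hw).1.
  - by move=> i k; exact: (gd_wp D k i).1.
  - by move=> i; exact: (gd_wd D i).1.
  - by apply: filterS f0 => x f1 i; have /complex_ge0P[_ f2] := f1 i; rewrite mulr_ge0 ?(ltW h1).
  - by apply: filterS eqs => x e i; exact: (e i).1.
have im j : {ae mu, forall x, 0 <= im_comp u' j x}.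
  apply: (system_nonneg (Q := Q) (V := V) (v := v) (w := im_comp w) (f := fun j x => 0) (ds := fun j k => im_comp (Du k) j) d0 hQ hypV_form_le0 Voff v0 h1).
  - by move=> i; exact: (fin _ i bu (gd_L D)).2.
  - by move=> i k; exact: (fin _ i (bD k) (gd_L1 D k)).2.
  - by move=> i; exact: (fin _ i bw hw).2.
  - by move=> i k; exact: (gd_wp D k i).2.
  - by move=> i; exact: (gd_wd D i).2.
  - exact: aeW.
  - by apply: filterS eqs => x e i; exact: (e i).2.
have im' j : {ae mu, forall x, 0 <= - im_comp u' j x}.
  apply: (system_nonneg (Q := Q) (V := V) (v := v) (s := fun j x => - im_comp u' j x) (w := fun j x => - im_comp w j x) (f := fun j x => 0) (ds := fun j k x => - im_comp (Du k) j x) d0 hQ hypV_form_le0 Voff v0 h1).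
  - by move=> i; rewrite IpowN; exact: (fin _ i bu (gd_L D)).2.
  - by move=> i k; rewrite IpowN; exact: (fin _ i (bD k) (gd_L1 D k)).2.
  - by move=> i; rewrite IpowN; exact: (fin _ i bw hw).2.
  - by move=> i k; apply: (wpBZ (c := -1)) (gd_wp D k i).2 => x; rewrite mulN1r.
  - move=> i; apply: (wdivBZ (c := -1)) (gd_wd D i).2 => [k x|x]; rewrite mulN1r//.
    by rewrite -sumrN; apply: eq_bigr => l _; rewrite mulrN.
  - exact: aeW.
  - apply: filterS eqs => x e i; rewrite (e i).2.
    have -> : \sum_k V x i k * - im_comp u' k x = - \sum_k V x i k * im_comp u' k x.
      by rewrite -sumrN; apply: eq_bigr => l _; rewrite mulrN.
    by ring.
have im0 : {ae mu, forall x, forall j, im_comp u' j x = 0}.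
  apply: filterS2 (ae_all_ord im) (ae_all_ord im') => x a b j.
  by apply/le_anti/andP; split => //; have := b j; rewrite oppr_ge0.
apply: filterS3 uu (ae_all_ord re) im0 => x -> a b j; apply/complex_ge0P; split; [exact: b|exact: a].
Qed.

Variable T : R -> R -> vfun -> vfun.
Hypothesis HT : forall p : R, 1 < p -> [/\ C0_semigroup p (T p), contractive p (T p) &
  is_generator p (T p) (Ltilde_op Q V v p)].

Lemma positive_L2 : positive_semigroup 2 (T 2).
Proof.
move=> t f; have p1 : 1 < 2 :> R by rewrite ltr1n.
have p0 : 0 < 2 :> R by []. have [C0S conS genS] := HT p1.
rewrite le_eqVlt => /predU1P[<-|t0] hf f0.
  by apply: filterS2 (semigroup0 C0S hf) f0 => x ->.
have [J hJ] := J_ex HT p1.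
have it (h : R) n : 0 < h -> Lp 2 (iter n (J h) f) /\ vnonneg (iter n (J h) f).
  move=> h0; elim: n => [//|n [IH1 IH2]]; have [a b] := hJ _ _ h0 IH1; rewrite iterS; split => //.
  exact: resolvent_nonneg IH1 IH2 a b.
apply: (vnonneg_lim p0 (Lp_meas (semigroup_Lp C0S (ltW t0) hf))) => e e0.
have [n0 hn0] := exponential_Lp p1 C0S conS genS hJ t0 e0 hf.
have [_ h2] := hn0 n0 (leqnn _); eexists; split; last exact: h2.
by apply: (it _ n0.+1 _).2; rewrite divr_gt0.
Qed.

(** A nonnegative [f] is the L^p limit of nonnegative truncations lying also in L^2; on these
    consistency applies, and contractivity of [T p] passes to the limit. *)
Lemma positive_Lp p : 1 < p -> positive_semigroup p (T p).
Proof.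
move=> p1 t f t0 hf f0; have [C0S conS genS] := HT p1.
have p0 : 0 < p by exact: lt_trans p1. have p1' : 1 <= p by exact: ltW.
have two1 : 1 < 2 :> R by rewrite ltr1n.
have [f' [bf ff hf']] := Lp_borel hf.
have mf := measurable_vn bf.
have [_ fin] := (LpP f' p0).1 hf'.
(* Truncation in space and in height at once, so that the truncated function is bounded with bounded
   support. *)
pose A (n : nat) : set E := [set x | `|x| < n%:R /\ vn f' x <= n%:R].
have mA n : measurable (A n).
  have -> : A n = kball n%:R `&` (vn f' @^-1` `]-oo, n%:R]%classic).
    by apply/seteqP; split => x /=; rewrite in_itv.
  apply: measurableI; first exact: measurable_kball.
  by rewrite -[X in measurable X]setTI; exact: mf.
pose fn n : vfun := vsc (\1_(A n)) f'.
have bfn n : borelv (fn n) by apply: borelvM => //; exact: measurable_ind.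
have vfn n x : vn (fn n) x = \1_(A n) x * vn f' x by rewrite /vn /fn /vsc Cvec_normZ ger0_norm// indicE ler0n.
have i1 (B : set E) x : 0 <= (\1_B x : R) <= 1 by rewrite indicE; case: (_ \in _); rewrite ?lexx ?ler01.
have fnp n : Lp p (fn n).
  apply/(LpP (fn n) p0); split; first exact: borelv_meas.
  apply: le_lt_trans fin; apply: Ip_le; first exact: ltW.
  move=> x; rewrite vfn normrM ler_piMl// ger0_norm; by case/andP: (i1 (A n) x).
have fn2 n : Lp 2 (fn n).
  have z0 : 0 < 2 :> R by [].
  apply/(LpP (fn n) z0); split; first exact: borelv_meas.
  have mk : measurable_fun setT (\1_(kball n%:R) : E -> R) := measurable_ind_kball _.
  have k2 : (Ip mu 2 (\1_(kball n%:R) : E -> R) < +oo)%E.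
    by rewrite Ip2 Ipow_ind//; [exact: lebesgue_rV_ball_lty|exact: measurable_kball].
  have := Ip_fin_cut z0 (lexx _) mk (measurable_vn (bfn n)) (B := n%:R) (M := n%:R) _ _ k2.
  move=> h; apply: le_lt_trans (h _ _).
  - apply: Ip_le => // x; rewrite vfn !indicE; case: (boolP (x \in A n)) => [|_]; last by rewrite mul0r normr0.
    by rewrite inE => -[h1 h2]; rewrite mul1r mem_set// mulr1.
  - move=> x; rewrite ger0_norm ?Cvec_norm_ge0// vfn indicE.
    case: (boolP (x \in A n)) => [|_]; last by rewrite mul0r ler0n.
    by rewrite inE => -[h1 h2]; rewrite mul1r.
  - move=> x xn; rewrite vfn indicE memNset ?mul0r// => -[h1 _].
    by move: h1; rewrite ltNge xn.
have fn0 n : vnonneg (fn n).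
  apply: filterS2 ff f0 => x e f1 j; rewrite /fn /vsc -e mxE mulr_ge0//.
  by rewrite ler0c; case/andP: (i1 (A n) x).
have lim : tends0 (fun n => LpN p (fun x => f' x - fn n x)).
  apply/tends0_LpN => //.
  have GE n x : vn (fun x => f' x - fn n x) x = (1 - \1_(A n) x) * vn f' x.
    rewrite /vn /fn /vsc.
    rewrite -[X in X - _]scale1r -scalerBl.
    have -> : 1 - (\1_(A n) x)%:C%C = (1 - \1_(A n) x : R)%:C%C by rewrite rmorphB.
    by rewrite Cvec_normZ ger0_norm// subr_ge0; case/andP: (i1 (A n) x).
  have mG n : measurable_fun setT (fun x => (1 - \1_(A n) x) * vn f' x).
    by apply: measurable_funM => //; apply: measurable_funB => //; exact: measurable_ind.
  have mp (g : E -> R) : measurable_fun setT g -> measurable_fun setT (fun x => `|g x| `^ p).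
    by move=> mg; have /measurable_EFinP := measurable_Ip p mg.
  have e1 n : Ip mu p (vn (fun x => f' x - fn n x)) = Ipow mu 1 (fun x => `|(1 - \1_(A n) x) * vn f' x| `^ p - 0).
    by apply: eq_integral => x _; rewrite expr1 subr0 (ger0_norm (powR_ge0 _ _)) GE.
  rewrite (_ : (fun n => _) = (fun n => Ipow mu 1 (fun x => `|(1 - \1_(A n) x) * vn f' x| `^ p - 0))); last by apply/funext => n; exact: e1.
  apply: (@dct_Ipow _ _ _ mu 1 _ (fun=> 0) (fun x => `|vn f' x| `^ p)) => //.
  - by move=> n; apply: mp.
  - exact: mp.
  - by apply: le_lt_trans fin; apply: ge0_le_integral_nm => x _; rewrite ?lee_fin ?expr1 ?(ger0_norm (powR_ge0 _ _))// ?powR_ge0.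
  - move=> n x; rewrite subr0 (ger0_norm (powR_ge0 _ _)); apply: ge0_ler_powR; rewrite ?nnegrE ?(ltW p0)//.
    rewrite normrM ler_piMl// ger0_norm ?subr_ge0 ?lerBlDr ?lerDl; by case/andP: (i1 (A n) x).
  - move=> x; apply: cvg_near_cst.
    pose N := (maxn (Num.truncn `|x|).+1 (Num.truncn (vn f' x)).+1).
    exists N => // n /= Nn; have /andP[n1 n2] : ((Num.truncn `|x|).+1 <= n)%N && ((Num.truncn (vn f' x)).+1 <= n)%N by rewrite -geq_max.
    rewrite indicE mem_set; first by rewrite subrr mul0r normr0 powR0 ?gt_eqF.
    split; first by apply: lt_le_trans (truncnS_gt _) _; rewrite ler_nat.
    by apply/ltW; apply: lt_le_trans (truncnS_gt _) _; rewrite ler_nat.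
apply: (vnonneg_lim p0 (Lp_meas (semigroup_Lp C0S t0 hf))) => e e0.
have [n0 hn0] := lim e e0; have hn := hn0 n0 (leqnn _).
exists (T 2 t (fn n0)); split; first exact: positive_L2.
have c := semigroups_consistent d0 hQ HT p1 two1 t0 (fnp n0) (fn2 n0).
have lin := semigroup_linear C0S (-1)%:C%C t0 (fnp n0) hf.
have hg : Lp p (fun x => (-1)%:C%C *: fn n0 x + f x) by apply: LpD => //; exact: LpZ.
rewrite (@LpN_ae _ _ _ p _ (T p t (fun x => (-1)%:C%C *: fn n0 x + f x))); last first.
  by apply: filterS2 lin c => x -> ->; rewrite scaleN1C addrC.
apply: le_trans (conS _ _ t0 hg) _; apply: le_trans hn; rewrite le_eqVlt; apply/orP; left; apply/eqP.
by apply: LpN_ae; apply: filterS ff => x ->; rewrite scaleN1C addrC.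
Qed.

End nonneg.

(** * Test functions in the domain, and necessity of the sign condition *)

Section test_domain.
Context {R : realType} {d m : nat}.
Local Notation E := 'rV[R]_d.
Local Notation mu := (lebesgue_rV R d).
Local Notation vfun := (vfun R d m).
Local Notation Re := complex.Re.
Local Notation Im := complex.Im.
Implicit Types (u w g : vfun) (p q : R).

Lemma Ip_kball p (M : R) : 0 < p -> (Ip mu p (\1_(kball M)) < +oo)%E.
Proof.
move=> p0; have -> : Ip mu p (\1_(kball M) : E -> R) = Ipow mu 1 (\1_(kball M)).
  apply: eq_integral => x _; rewrite expr1 indicE; case: (_ \in _); rewrite ?normr1 ?powR1// normr0 powR0 ?gt_eqF//.
by rewrite Ipow_ind//; [exact: lebesgue_rV_ball_lty|exact: measurable_kball].
Qed.

Lemma Lp_ae_bdd p u (C M : R) : 0 < p -> vmeas u -> {ae mu, forall x, vn u x <= C * \1_(kball M) x} -> Lp p u.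
Proof.
move=> p0 mu_ H; apply/(LpP u p0); split => //.
have mk : measurable_fun setT (\1_(kball M) : E -> R) := measurable_ind_kball _.
apply: (@le_lt_trans _ _ (Ip mu p (fun x => (C * \1_(kball M) x)%R))); last first.
  have c0 : (0 <= (`|C| `^ p)%:E)%E by rewrite lee_fin powR_ge0.
  by rewrite (IpZ p C mk); exact: (lte_mul_pinfty c0 _ (Ip_kball M p0)).
apply: ae_ge0_le_integral_nm; try by move=> x _; rewrite lee_fin powR_ge0.
apply: filterS H => x hx _; rewrite lee_fin; apply: ge0_ler_powR; rewrite ?nnegrE ?(ltW p0)//.
by rewrite ger0_norm ?Cvec_norm_ge0// (le_trans hx)// ler_norm.
Qed.

Lemma compact_ball (M : R) : compact [set x : E | `|x| <= M].
Proof.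
apply: bounded_closed_compact; last exact: closed_normle.
exists M; split; first exact: num_real.
by move=> y My x /= xM; rewrite (le_trans xM)// ltW.
Qed.

Lemma Lp_loc_bdd p (f phi : E -> R) (z : 'cV[R[i]]_m) : 0 < p -> Linftyloc f -> test_function phi ->
  Lp p (fun x => (f x * phi x)%:C%C *: z).
Proof.
move=> p0 [[b mb fb] Hf] tp; have [M hM] := test_supp tp; have [B B0 hB] := test_bounded tp.
have [C hC] := Hf _ (@compact_ball M).
have bz : borelv (fun _ : E => z) by move=> j; split; exact: measurable_cst.
apply: (@Lp_ae_bdd p _ (`|C| * B * Cvec_norm z) M p0).
  apply: (@vmeas_ae _ _ _ (fun x => (b x * phi x)%:C%C *: z)); first by apply: filterS fb => x ->.
  apply: borelv_meas; apply: (borelvM (a := fun x => b x * phi x)) => //.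
  by apply: measurable_funM => //; exact: test_meas.
apply: filterS hC => x hx; rewrite /vn Cvec_normZ indicE.
case: (boolP (x \in _)) => [|/negP xM].
  rewrite inE /kball /= => xM; rewrite mulr1 ler_wpM2r ?Cvec_norm_ge0// normrM ler_pM//.
  by apply: le_trans (hx (ltW xM)) _; exact: ler_norm.
have -> : phi x = 0.
  by apply: hM; rewrite leNgt; apply/negP => h; apply: xM; rewrite inE.
by rewrite !mulr0 normr0 mul0r.
Qed.

Variables (Q : E -> 'M[R]_d) (V : E -> 'M[R]_m) (v : E -> R).
Hypotheses (hQ : hypQ Q) (hV : hypV V) (hv : hypv v).

(** [V] and [v] are locally bounded and [div (Q grad phi)] is bounded with bounded support, so
    [phi e_j] is in the domain for every [p]. The second-order part stays in component [j]; the last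
    clause lets another component [i] see only [v_ij phi]. *)
Lemma test_domain p (j : 'I_m) (phi : E -> R) : 1 < p -> test_function phi ->
  let u := vsc phi (fun=> delta_mx j 0) in
  exists w, [/\ Lp p u, Lp p (fun x => w x + mx_mul V u x - fun_mul v u x),
    Ltilde_op Q V v p u (fun x => w x + mx_mul V u x - fun_mul v u x) &
    forall i x, i != j -> re_comp w i x = 0].
Proof.
move=> p1 tp u; have p0 : 0 < p by exact: lt_trans p1. have p1' : 1 <= p by exact: ltW.
pose e : 'cV[R[i]]_m := delta_mx j 0.
have be : borelv (fun _ : E => e) by move=> i; split; exact: measurable_cst.
have reE (a : E -> R) i : re_comp (vsc a (fun=> e)) i = (fun x => a x * Re (e i 0)).
  by rewrite /vsc re_compZ.
have imE (a : E -> R) i : im_comp (vsc a (fun=> e)) i = (fun=> 0).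
  by rewrite /vsc im_compZ /im_comp mxE; apply/funext => x; rewrite raddfMn /= mul0rn mulr0.
have [g [C [M [C0 hg]]]] := ell_exists hQ tp.
have hwp h : wpB h (ell Q phi h) (g h) by have [] := hg h.
have gB h x : `|g h x| <= C by have [] := hg h.
have gM h x : M <= `|x| -> g h x = 0 by have [_ _ _ H] := hg h; move=> /H[].
pose G x := \sum_h g h x.
have wdG : wdivB (ell Q phi) G by exact: (wdivB_ell hwp).
have mG : measurable_fun setT G by have [_ []] := wdG.
have tk k := test_partial k tp.
have one : Linftyloc (fun _ : E => (1 : R)).
  by split; [apply: lebesgue_borel; exact: measurable_cst|move=> K _; exists 1; apply: aeW => x _; rewrite normr1].
have Lt (a : E -> R) : test_function a -> Lp p (vsc a (fun=> e)).
  by move=> ta; have := Lp_loc_bdd e p0 one ta; apply: Lp_ae; apply: aeW => x; rewrite mul1r.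
pose w := vsc G (fun=> e).
have wp0 k : wpB k (fun=> 0) (fun _ : E => 0 : R).
  by apply: (wpBZ (c := 0)) (wpB_test k tp) => x; rewrite mul0r.
have W1 i j' : Linftyloc (fun x => V x i j') by have [_ _ H _] := hV; exact: (H i j').1.
have vE x : fun_mul v u x = (v x * phi x)%:C%C *: e by rewrite /fun_mul /u /vsc scalerA -rmorphM.
have VE x : mx_mul V u x = \sum_i (V x i j * phi x)%:C%C *: delta_mx i 0.
  rewrite /mx_mul /u /vsc -scalemxAr; apply/matrixP => a b; rewrite ord1 !mxE summxE (bigD1 j)//= big1 => [|k kj].
    rewrite (bigD1 a)//= big1 => [|k ka]; first by rewrite !mxE !eqxx !mulr1 !addr0 rmorphM mulrC.
    by rewrite !mxE eq_sym (negbTE ka) mulr0.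
  by rewrite !mxE (negbTE kj) mulr0.
have hVu : Lp p (mx_mul V u).
  rewrite (_ : mx_mul V u = (fun x => \sum_i (V x i j * phi x)%:C%C *: delta_mx i 0)); last by apply/funext => x; exact: VE.
  by apply: Lp_sum => // i; exact: Lp_loc_bdd.
have hvu : Lp p (fun_mul v u).
  rewrite (_ : fun_mul v u = (fun x => (v x * phi x)%:C%C *: e)); last by apply/funext => x; exact: vE.
  by apply: Lp_loc_bdd => //; have [[]] := hv.
have hw : Lp p w.
  apply: (@Lp_ae_bdd p _ (d%:R * C * Cvec_norm e) M p0); first by apply: borelv_meas; exact: borelvM.
  apply: aeW => x; rewrite /vn /w /vsc Cvec_normZ indicE.
  case: (boolP (x \in _)) => [_|/negP xM].
    rewrite mulr1 ler_wpM2r ?Cvec_norm_ge0// /G; apply: le_trans (ler_norm_sum _ _ _) _.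
    by apply: le_trans (ler_sum _ (fun h _ => gB h x)) _; rewrite sumr_const card_ord mulr_natl.
  have -> : G x = 0.
    by rewrite /G big1// => h _; apply: gM; rewrite leNgt; apply/negP => h'; apply: xM; rewrite inE.
  by rewrite normr0 mul0r mulr0.
have D : gdata Q V v p u (fun k => vsc (partial k phi) (fun=> e)) (fun h k => vsc (partial h (partial k phi)) (fun=> e)) w.
  split.
  - by apply: borelvM => //; exact: test_meas.
  - by move=> k; apply: borelvM => //; exact: test_meas.
  - by move=> h k; apply: borelvM => //; apply: test_meas; exact: test_partial.
  - exact: borelvM.
  - exact: Lt.
  - by move=> k; exact: Lt.
  - by move=> h k; apply: Lt; exact: test_partial.
  - move=> k i; rewrite !reE !imE; split; last exact: wp0.
    by apply: (wpBZ (c := Re (e i 0))) (wpB_test k tp) => x; rewrite mulrC.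
  - move=> h k i; rewrite !reE !imE; split; last exact: wp0.
    by apply: (wpBZ (c := Re (e i 0))) (wpB_test h (tk k)) => x; rewrite mulrC.
  - move=> i; rewrite !reE !imE; split.
      apply: (wdivBZ (c := Re (e i 0))) wdG => [h x|x]; last by rewrite mulrC.
      by rewrite /ell mulr_sumr; apply: eq_bigr => k _; rewrite reE; ring.
    apply: (wdivBZ (c := 0)) wdG => [h x|x]; rewrite mul0r//.
    by rewrite big1// => k _; rewrite imE mulr0.
  - exact: hVu.
  - exact: hvu.
exists w; split.
- exact: Lt.
- by apply: LpB => //; exact: LpD.
- exact: (graph_intro D (vae_eq_refl _)).
- by move=> i x ij; rewrite reE mxE (negbTE ij) /= mulr0.
Qed.

Lemma positive_offdiag p (S : R -> vfun -> vfun) : 1 < p -> C0_semigroup p S ->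
  is_generator p S (Ltilde_op Q V v p) -> positive_semigroup p S -> offdiag_nonneg (Vtilde V v).
Proof.
move=> p1 C0S genS pos i j ij; have p0 : 0 < p by exact: lt_trans p1.
(* The cut-offs serve as test functions: they are nonnegative, and each point is eventually inside
   the region where they are positive. *)
have key n : {ae mu, forall x, 0 <= V x i j * cutoff n x}.
  have tc := @test_cutoff R d n.
  have [w [hu hg G w0]] := test_domain j p1 tc.
  set u := vsc (cutoff n) (fun=> delta_mx j 0) in hu hg G; set g := fun x => _ in hg G.
  have lim := (genS u g hu hg).1 G.
  have [_ _ W1 _] := hV; have [[[b mb Vb] _] _] := W1 i j.
  apply: (ae_ge0_lim p0).
    exists (fun x => b x * cutoff n x); first by apply: measurable_funM => //; exact: test_meas.
    by apply: filterS Vb => x ->.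
  move=> e e0; have e1 : 0 < e `^ p^-1 by rewrite powR_gt0.
  have F0 (t : R) : (0 <= LpN p (fun x => ((t^-1)%:C%C *: (S t u x - u x) - g x)%R))%E by exact: LpN_ge0.
  have [del del0 hdel] := (cvg_at_right0P F0).1 lim _ e1.
  have t0 : 0 < del / 2 by rewrite divr_gt0.
  have td : 0 < del / 2 < del by rewrite t0 ltr_pdivrMr// ltr_pMr// ltr1n.
  (* A single time [t] per precision [e] is enough: component [i] of the difference quotient is
     nonnegative, so [V_ij] times the cut-off is at least minus the norm of the error [H]. *)
  have {}hdel := hdel _ td; set t := del / 2 in t0 hdel.
  pose H : vfun := fun x => (t^-1)%:C%C *: (S t u x - u x) - g x.
  exists (vn H); split.
    by move: hdel; rewrite LpN_le ?(ltW e1)// -powRrM mulVf ?gt_eqF// powRr1// ltW.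
  have u0 : vnonneg u.
    apply: aeW => x k; rewrite /u /vsc !mxE mulr_ge0// ler0c; exact: mbump_ge0.
  apply: filterS (pos t u (ltW t0) hu u0) => x /(_ i)/complex_ge0P[_ s0].
  rewrite ger0_norm ?Cvec_norm_ge0// lerNl; have [h _] := Cvec_norm_comp (H x) i; apply: le_trans h.
  have -> : Re (H x i 0) = t^-1 * Re (S t u x i 0) - V x i j * cutoff n x.
    have r1 := congr1 (fun F => F x) (re_mx_mul V u i).
    rewrite /H /g; have := w0 i x ij; rewrite /re_comp => w0x.
    rewrite /re_comp in r1; move: (mx_mul V u x) r1 => z r1; rewrite !mxE !ReB ReZ ReB ReD w0x r1 ReZ.
    have u0k k : k != j -> Re (u x k 0) = 0 by move=> kj; rewrite /u /vsc !mxE (negbTE kj) mulr0.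
    rewrite (negbTE ij) /= (bigD1 j)//= big1 => [|k kj]; last by rewrite u0k// mulr0.
    have -> : Re (u x j 0) = cutoff n x by rewrite /u /vsc !mxE !eqxx ReZ /= mulr1.
    by ring.
  by apply: le_trans (ler_norm _); rewrite lerDr mulr_ge0// invr_ge0 ltW.
apply: filterS (ae_foralln key) => x hx; rewrite /Vtilde !mxE (negbTE ij) mulr0n subr0.
have := hx (Num.truncn `|x|); rewrite pmulr_lge0//; apply: mbump_gt0.
by rewrite normrZ gtr0_norm ?invr_gt0// ltr_pdivrMl// mulr1; exact: truncnS_gt.
Qed.

End test_domain.

Theorem proposition4p1 (R : realType) (d m : nat)
    (Q : 'rV[R]_d -> 'M[R]_d) (V : 'rV[R]_d -> 'M[R]_m) (v : 'rV[R]_d -> R)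
    (T : R -> R -> vfun R d m -> vfun R d m) :
  (0 < d)%N -> (0 < m)%N ->
  hypQ Q -> hypV V -> hypv v ->
  (forall p : R, 1 < p ->
    [/\ C0_semigroup p (T p), contractive p (T p) &
        is_generator p (T p) (Ltilde_op Q V v p)]) ->
  (forall p q : R, 1 < p -> 1 < q -> consistent p q (T p) (T q)) /\
  (forall p : R, 1 < p ->
    (positive_semigroup p (T p) <-> offdiag_nonneg (Vtilde V v))).
Proof.
move=> d0 _ hQ hV hv HT; split=> [p q p1 q1|p p1]; first exact: (semigroups_consistent d0 hQ HT p1 q1).
have [C0T _ genT] := HT p p1; split; first by move=> pos; exact: (positive_offdiag hQ hV hv p1 C0T genT pos).
move=> off; apply: (positive_Lp d0 hQ hV hv _ HT p1).
have off' j k : {ae lebesgue_rV R d, forall x, j != k -> 0 <= V x j k}.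
  have [->|jk] := eqVneq j k; first by apply: aeW => x.
  by apply: filterS (off j k jk) => x; rewrite /Vtilde !mxE (negbTE jk) mulr0n subr0.
by apply: filterS (ae_all_ord (fun j => ae_all_ord (off' j))) => x h j k; exact: h.
Qed.
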